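(* Let $K\in\mathcal W_{\mathcal Q}$. There is $b_0=b_0(K)$ such that for every fixed real $b\ge b_0$ and every positive Borel measure $\mu$ on $\mathbb D$: the embedding $\mathrm{id}:Q_K\to L^2(\mu)$ is bounded (that is, there is $C<\infty$ with $\int_{\mathbb D}|f|^2d\mu\le C\|f\|_{Q_K}^2$ for all $f\in Q_K$) if and only if $$\mu(\mathbb D)+D^{(b)}_{K,\mathcal R}(\mu)<\infty .$$
   Context: Notation: $\mathbb D$ is the open unit disc, $\mathbb T=\partial\mathbb D$, $dA=\frac1\pi dx\,dy$, $\varphi_a(z)=\frac{a-z}{1-\bar a z}$ for $a\in\mathbb D$. Class $\mathcal W_{\mathcal Q}$: all non-decreasing, right-continuous $K:[0,\infty)\to[0,\infty)$ such that (K1) $K(0)=0$ and $K(t)>0$ for $t>0$; (K2) $\int_0^1K(\log\frac1r)\,2r\,dr<\infty$; (K3) there is $\sigma>0$ with $\int_0^1\frac{\varphi_K(s)}{s}ds<\infty$ and $\int_1^\infty\frac{\varphi_K(s)}{s^{1+\sigma}}ds<\infty$, where $\varphi_K(s)=\sup_{0<t\le1}\frac{K(st)}{K(t)}$; (K4) there is $C_K\ge1$ with $K(2t)\le C_KK(t)$ for all $t\in[0,1/2]$. Space $Q_K$: analytic $f$ on $\mathbb D$ with $\|f\|_{Q_K}=|f(0)|+\|f\|_{Q_K,*}<\infty$, where $\|f\|_{Q_K,*}^2=\sup_{a\in\mathbb D}\int_{\mathbb D}|f'(z)|^2K(1-|\varphi_a(z)|^2)\,dA(z)$. Carleson boxes: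 for an arc $I\subseteq\mathbb T$, $|I|$ is its normalized arclength ($|\mathbb T|=1$) and $Q_I=\{re^{i\theta}\in\mathbb D:e^{i\theta}\in I,\ 1-|I|\le r<1\}$, $Q_{\mathbb T}=\mathbb D$. Polar dyadic resolution $\mathcal R=\{\mathcal R_N\}_{N\ge0}$: $\mathcal R_N=\{R_{N,j,k}:0\le j,k\le2^N-1\}$, $R_{N,j,k}=\{re^{i\theta}:\frac j{2^N}\le r^2<\frac{j+1}{2^N},\ \frac{2\pi k}{2^N}\le\theta<\frac{2\pi(k+1)}{2^N}\}$. Packets: $dA_b(w)=(b+1)(1-|w|^2)^b\,dA(w)$, $L_b(z,w)=\int_0^z\frac{d\xi}{(1-\xi\bar w)^{b+2}}$ (principal branch), and $\Psi^{(b)}_R(z)=\int_RL_b(z,w)\,dA_b(w)$ for $R\in\mathcal R_N$. Packet matrix: $\Gamma^{(b)}_{\mu,N}(R_1,R_2)=\int_{\mathbb D}\Psi^{(b)}_{R_1}\overline{\Psi^{(b)}_{R_2}}\,d\mu$, $R_1,R_2\in\mathcal R_N$. Diagonal matrices: $A^{(K)}_{I,N}=\operatorname{diag}\bigl(\int_{R\cap Q_I}K(\frac{1-|z|}{|I|})dA(z):R\in\mathcal R_N\bigr)$. Capacity, for finite $\mu$: $$D^{(b)}_{K,\mathcal R}(\mu)=\sup_{N\ge0}\inf\Bigl\{\sum_{m=1}^M\lambda_m: M\in\mathbb N,\ \lambda_m\ge0,\ I_m\subseteq\mathbb T\text{ arcs},\ \Gamma^{(b)}_{\mu,N}\le\sum_{m=1}^M\lambda_mA^{(K)}_{I_m,N}\Bigr\},$$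 where $\le$ between Hermitian matrices means that the difference (right minus left) is positive semidefinite. Since $D^{(b)}_{K,\mathcal R}(\mu)$ is defined only for finite $\mu$, the condition $\mu(\mathbb D)+D^{(b)}_{K,\mathcal R}(\mu)<\infty$ means: $\mu(\mathbb D)<\infty$ and $D^{(b)}_{K,\mathcal R}(\mu)<\infty$. *)

(* Defs.v *)
From HB Require Import structures.
From mathcomp Require Import all_boot all_order all_algebra.
From mathcomp Require Import all_classical all_reals all_analysis.
From mathcomp Require Import complex.

Set Implicit Arguments.
Unset Strict Implicit.
Unset Printing Implicit Defensive.

Import Order.TTheory GRing.Theory Num.Theory.
Import numFieldNormedType.Exports.
Import Normc.

Local Open Scope classical_set_scope.
Local Open Scope ring_scope.
Local Open Scope complex_scope.
Local Open Scope sesquilinear_scope.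

Local Notation Re := complex.Re.
Local Notation Im := complex.Im.

Section Complex.
Variable R : realType.
Implicit Types (z : R[i]) (s : R).

Definition cis (t : R) : R[i] := cos t +i* sin t.

Definition cexp z : R[i] := (expR (Re z))%:C * cis (Im z).

(* The principal argument, in ]-pi, pi] for z != 0. *)
Definition cArg z : R :=
  let t := acos (Re z / normc z) in if Im z < 0 then - t else t.

Definition cLog z : R[i] := ln (normc z) +i* cArg z.

Definition cpow z s : R[i] := cexp (s%:C * cLog z).

Definition holomorphic_on (D : set R[i]) (f : R[i] -> R[i]) : Prop :=
  forall z, D z -> derivable (f : R[i]^o -> R[i]^o) z 1.

Definition cderive (f : R[i] -> R[i]) (z : R[i]) : R[i] :=
  derive1 (f : R[i]^o -> R[i]^o) z.

Definition Cintegral d (T : measurableType d) (m : {measure set T -> \bar R})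
    (D : set T) (f : T -> R[i]) : R[i] :=
  Rintegral m D (fun x => Re (f x)) +i* Rintegral m D (fun x => Im (f x)).

End Complex.

(* The positive semidefinite (Loewner) order on Hermitian matrices. *)
Definition psd (C : numClosedFieldType) n (A : 'M[C]_n) : Prop :=
  A \is hermsymmx /\ forall v : 'rV[C]_n, 0 <= (v *m A *m v ^t* ) 0 0.

Definition loewner_le (C : numClosedFieldType) n (A B : 'M[C]_n) : Prop :=
  psd (B - A).

Section Disc.
Variable R : realType.

(* C carries no sigma-algebra in the library, so measures live on R * R, whose
   product sigma-algebra is the Borel one. *)
Definition plane := (measurableTypeR R * measurableTypeR R)%type.

Definition cpx (p : plane) : R[i] := (p.1 : R) +i* (p.2 : R).

Definition cdisc : set R[i] := [set z | normc z < 1].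

Definition disc : set plane := cpx @^-1` cdisc.

Lemma invpi_ge0 : 0 <= (pi : R)^-1.
Proof. by rewrite invr_ge0 pi_ge0. Qed.

Definition dA : {measure set plane -> \bar R} :=
  mscale (NngNum invpi_ge0)
    (lebesgue_measure \x lebesgue_measure)%E.

Definition mobius (a z : R[i]) : R[i] := (a - z) / (1 - a^* * z).

End Disc.

Section WeightClass.
Variable R : realType.

(* Functions on [0, +oo[ are represented by functions on R of which only the
   values on [0, +oo[ are constrained or used. *)
Definition phiK (K : R -> R) (s : R) : \bar R :=
  ereal_sup [set (K (s * t) / K t)%:E | t in [set t | 0 < t <= 1]].

Record class_WQ (K : R -> R) : Prop := ClassWQ {
  WQ_ge0 : forall t : R, 0 <= t -> 0 <= K t ;
  WQ_nondecreasing : forall s t : R, 0 <= s -> s <= t -> K s <= K t ;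
  WQ_right_continuous : forall t : R, 0 <= t -> K x @[x --> t^'+] --> K t ;
  WQ_at0 : K 0 = 0 ;
  WQ_gt0 : forall t : R, 0 < t -> 0 < K t ;
  WQ_integrable :
    (\int[lebesgue_measure]_(r in `]0%R, 1%R[) (K (ln r^-1) * (2 * r))%:E < +oo)%E ;
  WQ_phi : exists2 sigma : R, 0 < sigma &
    (\int[lebesgue_measure]_(s in `]0%R, 1%R[) (phiK K s * (s^-1)%:E) < +oo)%E /\
    (\int[lebesgue_measure]_(s in `]1%R, +oo[)
        (phiK K s * ((s `^ (1 + sigma))^-1)%:E) < +oo)%E ;
  WQ_doubling : exists2 CK : R, 1 <= CK &
    forall t : R, 0 <= t <= 2^-1 -> K (2 * t) <= CK * K t }.

End WeightClass.

Section QK.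
Variables (R : realType) (K : R -> R).
Implicit Type f : R[i] -> R[i].

Definition QK_seminorm f : \bar R :=
  sqrte (ereal_sup [set (\int[@dA R]_(p in @disc R)
    (normc (cderive f (cpx p)) ^+ 2 * K (1 - normc (mobius a (cpx p)) ^+ 2))%:E)%E
    | a in @cdisc R]).

Definition QK_norm f : \bar R := ((normc (f 0))%:E + QK_seminorm f)%E.

Definition in_QK f : Prop :=
  holomorphic_on (@cdisc R) f /\ (QK_norm f < +oo)%E.

(* A Borel measure on the disc is the restriction to it of a Borel measure on
   the plane: mu is arbitrary and only its trace on the disc is ever used. *)
Definition bounded_embedding (mu : {measure set (plane R) -> \bar R}) : Prop :=
  exists C : R, forall f, in_QK f ->
    (\int[mu]_(p in @disc R) ((normc (f (cpx p)) ^+ 2)%:E)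
       <= C%:E * QK_norm f ^+ 2)%E.

End QK.

Section Arcs.
Variable R : realType.

(* The arc {e^(it) : t between arc_start and arc_end}; the flags are those of
   BSide, so that arcs are nondegenerate and may or may not contain either
   endpoint, and the whole circle is an arc. *)
Record circle_arc := CircleArc {
  arc_start : R ;
  arc_end : R ;
  arc_left : bool ;
  arc_right : bool ;
  arc_lt : arc_start < arc_end ;
  arc_le : arc_end <= arc_start + 2 * pi }.

Definition arc_set (I : circle_arc) : set R[i] :=
  @cis R @` [set` Interval (BSide (arc_left I) (arc_start I))
                           (BSide (arc_right I) (arc_end I))].

Definition arc_len (I : circle_arc) : R := (arc_end I - arc_start I) / (2 * pi).

Definition carleson_box (I : circle_arc) : set (plane R) :=
  [set p | exists r t : R, [/\ cpx p = r%:C * cis t,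
    arc_set I (cis t) & 1 - arc_len I <= r < 1]].

End Arcs.

Section Packets.
Variable R : realType.

Definition cell_index (N : nat) := ('I_(2 ^ N) * 'I_(2 ^ N))%type.

(* R_(N,j,k); distinct indices give distinct cells, so that the matrices below
   may be indexed by the pairs (j, k). *)
Definition cell (N : nat) (jk : cell_index N) : set (plane R) :=
  let j : nat := jk.1 in let k : nat := jk.2 in
  [set p | exists r t : R, [/\ cpx p = r%:C * cis t, 0 <= r,
    j%:R / 2 ^+ N <= r ^+ 2 < j.+1%:R / 2 ^+ N &
    2 * pi * k%:R / 2 ^+ N <= t < 2 * pi * k.+1%:R / 2 ^+ N]].

(* Integration along the segment xi = t z, 0 <= t <= 1. *)
Definition packet_kernel (b : R) (z w : R[i]) : R[i] :=
  Cintegral (@lebesgue_measure R) `[0, 1]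
    (fun t => z / cpow (1 - t%:C * z * w^*) (b + 2)).

Definition packet (b : R) (N : nat) (jk : cell_index N) (z : R[i]) : R[i] :=
  Cintegral (@dA R) (cell jk) (fun p =>
    packet_kernel b z (cpx p) *
      ((b + 1) * (1 - normc (cpx p) ^+ 2) `^ b)%:C).

Definition packet_matrix (b : R) (mu : {measure set (plane R) -> \bar R})
    (N : nat) : 'M[R[i]]_#|{: cell_index N}| :=
  \matrix_(i, j) Cintegral mu (@disc R) (fun p =>
    packet b (enum_val i) (cpx p) * (packet b (enum_val j) (cpx p))^*).

Definition box_matrix (K : R -> R) (I : circle_arc R) (N : nat) :
    'M[R[i]]_#|{: cell_index N}| :=
  diag_mx (\row_i (Rintegral (@dA R) (cell (enum_val i) `&` carleson_box I)
    (fun p => K ((1 - normc (cpx p)) / arc_len I)))%:C).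

Definition capacity_at (K : R -> R) (b : R)
    (mu : {measure set (plane R) -> \bar R}) (N : nat) : \bar R :=
  ereal_inf [set x | exists (M : nat) (lam : 'I_M -> R) (I : 'I_M -> circle_arc R),
    [/\ forall m, 0 <= lam m,
        loewner_le (packet_matrix b mu N)
          (\sum_(m < M) (lam m)%:C *: box_matrix K (I m) N) &
        x = (\sum_(m < M) lam m)%:E]].

(* Only meaningful for finite mu, since Cintegral is a junk value on functions
   that are not integrable. *)
Definition capacity (K : R -> R) (b : R)
    (mu : {measure set (plane R) -> \bar R}) : \bar R :=
  ereal_sup (range (capacity_at K b mu)).

End Packets.

(* Main.v *)
(** With |v_R|^2 summed against A_I, a Schur test based on the Forelli-Rudin
    estimates shows that f = sum_R v_R Psi_R lies in Q_K with
    ||f||^2 <= C sup_I v A_I v*, because the Moebius weights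
    K(1 - |phi_a|^2) are comparable to superpositions of Carleson-box weights.
    A bounded embedding thus gives v Gamma v* <= C sup_I v A_I v*; since Gamma
    is a Gram matrix, the little Grothendieck inequality (random signs) and a
    minimax argument replace the supremum by one combination of the A_I, of
    total mass independent of N.

    Conversely, f - f(0) is a multiple of the integral of L_b(z, w) f'(w) dA_b(w).
    Sampling f' on the cells of a smaller disc gives combinations of packets that
    converge to it pointwise, whose coefficients satisfy
    sup_I v A_I v* <= C ||f||^2 + o(1); the capacity bounds their norms in
    L^2(mu), and Fatou's lemma gives the bound for f - f(0). *)

Require Import Defs.
From HB Require Import structures.
From mathcomp Require Import all_boot all_order all_algebra.
From mathcomp Require Import all_classical all_reals all_analysis.
From mathcomp Require Import measurable_realfun complex ring lra.

Set Implicit Arguments.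
Unset Strict Implicit.
Unset Printing Implicit Defensive.

Import Order.TTheory GRing.Theory Num.Theory.
Import numFieldNormedType.Exports.
Import Normc.

Local Open Scope classical_set_scope.
Local Open Scope ring_scope.
Local Open Scope complex_scope.

Local Notation Re := complex.Re.
Local Notation Im := complex.Im.

(** * Complex numbers and complex derivatives *)

Section ComplexModulus.
Variable R : realType.
Implicit Types (z w u : R[i]) (s t : R).

(** The two integrals in (K3) become two power bounds for [K]: growth of order at most s^sigma under
    dilation, decay of order at least s^delta under contraction, with delta < 1. The first moves
    weights between points of the disc; the second makes the Schur test and the dyadic sum over
    boxes converge. The exponent sigma also fixes [b0]. The obstacle in the forward half is that a
    supremum over arcs is not a quadratic form, so an inequality for single vectors cannot be
    dualised directly. It is first lifted to finite families of vectors at the price of a universal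
    factor; families, measured by their column masses, behave like a convex cone on which separation
    works, and the infinitely many arcs are replaced by a finite net at the price of a factor 2. In
    the converse, boundedness of a packet is immediate for a cell inside a smaller disc; samples
    vanish on the other cells, and a zero coefficient removes whatever entry the packet matrix has
    there. Dyadic radii make the smaller discs unions of cells. Cells overlap at the origin only, a
    null set that is set aside throughout. *)

Lemma normc_sqr z : normc z ^+ 2 = Re z ^+ 2 + Im z ^+ 2.
Proof. by case: z => x y /=; rewrite sqr_sqrtr // addr_ge0 ?sqr_ge0. Qed.

Lemma normc_ge0 z : 0 <= normc z.
Proof. by case: z => x y /=; rewrite sqrtr_ge0. Qed.

Lemma normcD z w : normc (z + w) <= normc z + normc w.
Proof. exact: le_normcD. Qed.

Lemma normcB z w : normc (z - w) <= normc z + normc w.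
Proof. by rewrite (le_trans (normcD _ _)) // normcN. Qed.

Lemma normc_sub z w : normc (z - w) = normc (w - z).
Proof. by rewrite -normcN opprB. Qed.

Lemma ler_normcB z w : normc z - normc w <= normc (z - w).
Proof. by rewrite lerBlDr (le_trans _ (normcD _ _)) // subrK. Qed.

Lemma normcR s : normc s%:C = `|s|.
Proof. by rewrite /= expr0n /= addr0 sqrtr_sqr. Qed.

Lemma normcJ z : normc z^* = normc z.
Proof. by case: z => x y /=; rewrite sqrrN. Qed.

Lemma normcX z n : normc (z ^+ n) = normc z ^+ n.
Proof. by elim: n => [|n IH]; rewrite ?expr0 ?normc1 // !exprS normcM IH. Qed.

Lemma normc_sum I (r : seq I) (P : pred I) (F : I -> R[i]) :
  normc (\sum_(i <- r | P i) F i) <= \sum_(i <- r | P i) normc (F i).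
Proof.
apply: (big_ind2 (fun x y => normc x <= y)) => //; first by rewrite normc0.
by move=> x a y b xa yb; rewrite (le_trans (normcD _ _)) // lerD.
Qed.

Lemma normc_Re z : `|Re z| <= normc z.
Proof.
by rewrite -ler_sqr ?nnegrE ?normc_ge0 // normc_sqr real_normK ?num_real //
  lerDl sqr_ge0.
Qed.

Lemma normc_Im z : `|Im z| <= normc z.
Proof.
by rewrite -ler_sqr ?nnegrE ?normc_ge0 // normc_sqr real_normK ?num_real //
  lerDr sqr_ge0.
Qed.

Lemma normc_leReIm z : normc z <= `|Re z| + `|Im z|.
Proof.
rewrite -ler_sqr ?nnegrE ?addr_ge0 ?normc_ge0 // normc_sqr sqrrD.
by rewrite !real_normK ?num_real // lerD2r lerDl mulrn_wge0 // mulr_ge0.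
Qed.

Lemma normc_mulJ z : (normc z ^+ 2)%:C = z * z^*.
Proof. by rewrite normc_sqr; case: z => x y; apply/eqP; rewrite eq_complex /=;
  apply/andP; split; apply/eqP; ring. Qed.

Lemma cReM z w : Re (z * w) = Re z * Re w - Im z * Im w.
Proof. by case: z w => [x y] [a b]. Qed.

Lemma cImM z w : Im (z * w) = Re z * Im w + Im z * Re w.
Proof. by case: z w => [x y] [a b]. Qed.

Lemma cReD z w : Re (z + w) = Re z + Re w. Proof. by case: z w => [x y] [a b]. Qed.
Lemma cImD z w : Im (z + w) = Im z + Im w. Proof. by case: z w => [x y] [a b]. Qed.
Lemma cReN z : Re (- z) = - Re z. Proof. by case: z. Qed.
Lemma cImN z : Im (- z) = - Im z. Proof. by case: z. Qed.
Lemma cReJ z : Re z^* = Re z. Proof. by case: z. Qed.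
Lemma cImJ z : Im z^* = - Im z. Proof. by case: z. Qed.
Lemma cRe_sum I (r : seq I) (P : pred I) (F : I -> R[i]) :
  Re (\sum_(i <- r | P i) F i) = \sum_(i <- r | P i) Re (F i).
Proof. by elim/big_rec2: _ => // i a b _ <-; rewrite cReD. Qed.
Lemma cIm_sum I (r : seq I) (P : pred I) (F : I -> R[i]) :
  Im (\sum_(i <- r | P i) F i) = \sum_(i <- r | P i) Im (F i).
Proof. by elim/big_rec2: _ => // i a b _ <-; rewrite cImD. Qed.

Lemma eq_cplx z w : Re z = Re w -> Im z = Im w -> z = w.
Proof. by case: z w => [x y] [a b] /= -> ->. Qed.

Lemma normc_cis t : normc (cis t) = 1.
Proof. by rewrite /= cos2Dsin2 sqrtr1. Qed.

Lemma cisD s t : cis (s + t) = cis s * cis t.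
Proof. by apply: eq_cplx; rewrite /= ?sinD ?cosD //; ring. Qed.

Lemma cis0 : cis 0 = 1 :> R[i].
Proof. by rewrite /cis cos0 sin0. Qed.

Lemma cisN t : cis (- t) = (cis t)^*.
Proof. by rewrite /cis cosN sinN. Qed.

Lemma cis_mulN t : cis t * cis (- t) = 1.
Proof. by rewrite -cisD subrr cis0. Qed.

Lemma cis2pi t : cis (t + 2 * pi) = cis t.
Proof. by rewrite /cis mulr_natl cosD2pi sinD2pi. Qed.

Lemma cisX t n : cis t ^+ n = cis (n%:R * t).
Proof.
elim: n => [|n IH]; first by rewrite mul0r cis0.
by rewrite exprS IH -cisD -[in RHS]natr1 mulrDl mul1r addrC.
Qed.

Lemma cis_neq0 t : cis t != 0.
Proof.
by apply/eqP => c0; move: (normc_cis t); rewrite c0 normc0 => /eqP; rewrite eq_sym oner_eq0.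
Qed.

Lemma cisV t : (cis t)^-1 = cis (- t).
Proof. by apply: (mulfI (cis_neq0 t)); rewrite divff ?cis_neq0 // cis_mulN. Qed.

Lemma normc_cpow z s : z != 0 -> normc (cpow z s) = normc z `^ s.
Proof.
move=> z0; rewrite /cpow /cexp normcM normc_cis mulr1 normcR ger0_norm ?expR_ge0 //.
have nz : 0 < normc z.
  by rewrite lt_neqAle normc_ge0 andbT eq_sym; apply: contra z0 => /eqP /eq0_normc ->.
by rewrite /powR gt_eqF // cReM /= mul0r subr0.
Qed.

Lemma normc_gt0 z : (0 < normc z) = (z != 0).
Proof.
rewrite lt_neqAle normc_ge0 andbT eq_sym; congr negb; apply/eqP/eqP.
  exact: eq0_normc.
by move=> ->; rewrite normc0.
Qed.

Lemma invcE z : z^-1 = ((normc z ^+ 2)^-1)%:C * z^*.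
Proof.
have [->|z0] := eqVneq z 0; first by rewrite invr0 normc0 expr0n invr0 rmorph0 mul0r.
apply: (mulfI z0); rewrite divff // mulrCA -normc_mulJ -rmorphM /= mulVf //.
by rewrite expf_neq0 // gt_eqF // normc_gt0.
Qed.

Lemma normc_div z w : normc (z / w) = normc z / normc w.
Proof. by rewrite normcM normcV. Qed.

End ComplexModulus.

Section ComplexDerivative.
Variable R : realType.
Implicit Types (f g : R[i] -> R[i]) (z d : R[i]).

(** Differentiability with an error bound instead of a quotient: remainders of power series and
    increments along curves fit it directly. The two lemmas after it make it equivalent to
    [derivable]. *)
Definition cdiff f z d := forall e : R, 0 < e -> exists2 r : R, 0 < r &
  forall h, normc h < r -> normc (f (z + h) - f z - d * h) <= e * normc h.

Lemma lt_normC (z : R[i]) (e : R) : (`|z| < e%:C) = (normc z < e).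
Proof. by rewrite normc_def ltcR; case: z. Qed.

Lemma cdiff_derivable f z d : cdiff f z d ->
  derivable (f : R[i]^o -> R[i]^o) z 1 /\ cderive f z = d.
Proof.
move=> fd.
have H : (fun h : (R[i] : numFieldType) => h^-1 *: ((f : R[i]^o -> R[i]^o) (h + z) - f z)) @ (0 : (R[i] : numFieldType))^' --> (d : R[i]^o).
  apply/cvgrPdist_le => /= e e0.
  have [eR e0'] : exists2 eR : R, 0 < eR & e = eR%:C.
    by exists (Re e); [move: e0; rewrite ltcE /= => /andP[]|
      case: e e0 => a b; rewrite ltcE /= => /andP[/eqP -> _]].
  move=> ->; have [r r0 H] := fd eR e0'.
  exists r%:C => /=; first by rewrite ltcR.
  move=> h /=; rewrite sub0r normrN lt_normC => hr h0.
  have nh : 0 < normc h by rewrite normc_gt0.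
  have -> : d - h^-1 *: ((f : R[i]^o -> R[i]^o) (h + z) - f z) =
     - (h^-1 * (f (z + h) - f z - d * h)) :> R[i].
    by rewrite /GRing.scale /= [h + z]addrC; field.
  rewrite normrN normrM normfV.
  have nE (x : R[i]) : `|x| = (normc x)%:C by rewrite normc_def; case: x.
  rewrite !nE -rmorphV ?unitfE ?gt_eqF //= -rmorphM /= lecR.
  by rewrite ler_pdivrMl // [_ * eR]mulrC; exact: H.
split; first by apply/cvg_ex; exists d; under eq_fun do rewrite scaler1.
rewrite /cderive derive1E; rewrite /derive.
have -> : (fun h : (R[i] : numFieldType) => h^-1 *: (((f : R[i]^o -> R[i]^o) \o shift (z : R[i]^o)) (h *: (1 : R[i]^o)) - (f : R[i]^o -> R[i]^o) z)) =
  (fun h : (R[i] : numFieldType) => h^-1 *: ((f : R[i]^o -> R[i]^o) (h + z) - f z)).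
  by apply/funext => h /=; rewrite scaler1.
exact: (cvg_lim (@norm_hausdorff _ _) H).
Qed.

Lemma derivable_cdiff f z : derivable (f : R[i]^o -> R[i]^o) z 1 ->
  cdiff f z (cderive f z).
Proof.
move=> fz e e0.
have : (fun h : (R[i] : numFieldType) => h^-1 *: ((f : R[i]^o -> R[i]^o) (h *: 1 + z) - f z)) @ (0 : (R[i] : numFieldType))^' -->
    (cderive f z : R[i]^o).
  by rewrite /cderive derive1E; exact: fz.
move/cvgrPdist_le => /(_ e%:C); rewrite /= ltcR => /(_ e0) [r /= r0 H].
exists (Re r); first by move: r0; rewrite ltcE /= => /andP[].
move=> h hr.
have rE : r = (Re r)%:C by case: r r0 {H hr} => a b; rewrite ltcE /= => /andP[/eqP -> _].
have [->|h0] := eqVneq h 0; first by rewrite addr0 mulr0 !subrr normc0 mulr0.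
have nE (x : R[i]) : `|x| = (normc x)%:C by rewrite normc_def; case: x.
move: (H h); rewrite /= sub0r normrN rE lt_normC => /(_ hr h0).
have -> : cderive f z - h^-1 *: ((f : R[i]^o -> R[i]^o) (h *: 1 + z) - f z) =
     - (h^-1 * (f (z + h) - f z - cderive f z * h)) :> R[i].
  by rewrite /GRing.scale /= mulr1 [h + z]addrC; field.
have nh : 0 < normc h by rewrite normc_gt0.
rewrite normrN normrM normfV !nE -rmorphV ?unitfE ?gt_eqF //= -rmorphM /= lecR.
by rewrite ler_pdivrMl // [_ * e]mulrC.
Qed.

End ComplexDerivative.

(** * Minimax and the little Grothendieck inequality *)

Section Alternative.
Variables (R : realType) (X : Type) (add : X -> X -> X) (scl : R -> X -> X).

(** [X] carries no laws: it will be the finite families of vectors, added by concatenation and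
    scaled by square roots, on which sums of quadratic forms are additive and homogeneous. *)
Definition cone_functional (L : X -> R) :=
  (forall x y, L (add x y) = L x + L y) /\ (forall c x, 0 < c -> L (scl c x) = c * L x).

Lemma cone_functional_sum m (L : nat -> X -> R) (lam : nat -> R) :
  (forall i, cone_functional (L i)) -> cone_functional (fun x => \sum_(i < m) lam i * L i x).
Proof.
move=> hL; split=> [x y|c x c0].
  by rewrite -big_split; apply: eq_bigr => i _; rewrite (hL i).1 mulrDr.
by rewrite mulr_sumr; apply: eq_bigr => i _; rewrite (hL i).2 // mulrCA.
Qed.

(* Finite-dimensional minimax, by induction on the number of functionals: the
   last multiplier is the infimum of - l x / L x over the x with L x > 0. *)
Lemma cone_alternative m (L : nat -> X -> R) (P : X -> Prop) :
  (forall i, cone_functional (L i)) ->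
  (forall x y, P x -> P y -> P (add x y)) -> (forall c x, 0 < c -> P x -> P (scl c x)) ->
  (forall x, P x -> exists2 i, (i < m)%N & L i x <= 0) ->
  (forall x, ~ P x) \/ exists lam : nat -> R, [/\ forall i, 0 <= lam i,
    0 < \sum_(i < m) lam i & forall x, P x -> \sum_(i < m) lam i * L i x <= 0].
Proof.
move=> hL; elim: m P => [|m IH] P PD PZ PL.
  by left=> x Px; have [] := PL x Px.
(* Where [L m] is nonpositive it serves by itself. On [P'] it cannot, so one of the first [m]
   functionals does, and the induction hypothesis applies to [P']. *)
pose P' x := P x /\ 0 < L m x.
have P'D x y : P' x -> P' y -> P' (add x y).
  by move=> [Px Lx] [Py Ly]; split; [exact: PD|rewrite (hL m).1 addr_gt0].
have P'Z c x : 0 < c -> P' x -> P' (scl c x).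
  by move=> c0 [Px Lx]; split; [exact: PZ|rewrite (hL m).2 // mulr_gt0].
have P'L x : P' x -> exists2 i, (i < m)%N & L i x <= 0.
  move=> [Px]; have [k] := PL x Px; rewrite ltnS leq_eqVlt => /orP[/eqP -> Li Lm|im Li _]; last by exists k.
  by move: (lt_le_trans Lm Li); rewrite ltxx.
have [P'0|[lam [lam0 lamS lamP]]] := IH P' P'D P'Z P'L.
  right; exists (fun i => (i == m)%:R); split=> [i||x Px].
  - by rewrite ler0n.
  - by rewrite big_ord_recr /= eqxx big1 ?add0r // => i _; rewrite ltn_eqF.
  - rewrite big_ord_recr /= eqxx mul1r big1 ?add0r => [|i _]; last by rewrite ltn_eqF ?mul0r.
    by rewrite leNgt; apply/negP => Lm; exact: (P'0 x).
have [P'0|/existsNP[x1 /contrapT P'x1]] := pselect (forall x, ~ P' x).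
  right; exists (fun i => (i == m)%:R); split=> [i||x Px].
  - by rewrite ler0n.
  - by rewrite big_ord_recr /= eqxx big1 ?add0r // => i _; rewrite ltn_eqF.
  - rewrite big_ord_recr /= eqxx mul1r big1 ?add0r => [|i _]; last by rewrite ltn_eqF ?mul0r.
    by rewrite leNgt; apply/negP => Lm; exact: (P'0 x).
pose l x := \sum_(i < m) lam i * L i x.
have hl : cone_functional l by exact: cone_functional_sum.
pose S := [set - l x / L m x | x in P'].
have Snz : S !=set0 by exists (- l x1 / L m x1), x1.
have Slb : has_lbound S.
  by exists 0 => _ [x P'x <-]; rewrite divr_ge0 ?oppr_ge0 ?lamP // ltW // P'x.2.
pose beta := inf S.
have beta0 : 0 <= beta.
  apply: lb_le_inf => // _ [x P'x <-].
  by rewrite divr_ge0 ?oppr_ge0 ?lamP // ltW // P'x.2.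
right; exists (fun i => if i == m then beta else lam i); split=> [i||x Px].
- by case: ifP.
- rewrite big_ord_recr /= eqxx ltr_pwDl // (eq_bigr (fun i : 'I_m => lam i)) // => i _.
  by rewrite ltn_eqF.
rewrite big_ord_recr /= eqxx (_ : \sum_(i < m) _ = l x); last first.
  by apply: eq_bigr => i _; rewrite ltn_eqF.
(* Mix [x] and [y] with coefficients that nearly cancel [L m]: the mixture stays in [P'], so [l] is
   nonpositive on it, and a small [t] leaves the cross inequality up to [e]. *)
have key y : P' y -> l x * L m y <= l y * L m x \/ 0 < L m x.
  move=> P'y; have [Lx|Lx] := ltP 0 (L m x); [by right|left].
  apply/ler_addgt0Pl => e e0.
  pose t := e / (1 - l y).
  have ly0 : 0 < 1 - l y by rewrite subr_gt0 (le_lt_trans (lamP _ P'y)).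
  have t0 : 0 < t by rewrite divr_gt0.
  pose z := add (scl (L m y) x) (scl (- L m x + t) y).
  have c0 : 0 < - L m x + t by rewrite ltr_wpDl // oppr_ge0.
  have P'z : P' z.
    split; first by apply: PD; apply: PZ => //; [exact: P'y.2|exact: P'y.1].
    rewrite /z (hL m).1 !(hL m).2 ?P'y.2 //.
    have -> : L m y * L m x + (- L m x + t) * L m y = t * L m y by ring.
    by rewrite mulr_gt0 // P'y.2.
  have := lamP _ P'z; rewrite -/(l z) /z hl.1 !hl.2 ?P'y.2 // => H.
  have te : - (t * l y) <= e.
    rewrite /t mulrAC -mulNr -mulrN ler_pdivrMr // ler_wpM2l ?(ltW e0) //.
    by lra.
  rewrite mulrC; lra.
have bx y : P' y -> beta <= - l y / L m y.
  by move=> P'y; apply: ge_inf => //; exists y.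
have [Lx|Lx] := ltP 0 (L m x).
  have := bx x (conj Px Lx); rewrite ler_pdivlMr // => Hb; lra.
have [Lx0|Lx0] := eqVneq (L m x) 0.
  have [|] := key _ P'x1; last by rewrite Lx0 ltxx.
  rewrite Lx0 !mulr0 addr0 => H.
  by rewrite -(pmulr_lle0 _ P'x1.2).
have Lxn : L m x < 0 by rewrite lt_neqAle Lx0.
suff : l x / - L m x <= beta.
  by rewrite ler_pdivrMr ?oppr_gt0 // mulrN => H; lra.
apply: lb_le_inf => // _ [y P'y <-].
have [H|] := key y P'y; last by rewrite ltNge Lx.
rewrite ler_pdivrMr ?oppr_gt0 // (_ : _ * - L m x = l y * L m x / L m y); last by ring.
by rewrite ler_pdivlMr ?P'y.2.
Qed.

End Alternative.

Section LittleGrothendieck.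
Variables (R : realType) (n : nat).
Implicit Types (u v w : 'rV[R[i]]_n) (l : seq 'rV[R[i]]_n) (x : 'I_n -> R).

(** All 2^|l| signed sums, with multiplicity, so that a normalised sum over this list is an
    expectation over independent random signs. *)
Fixpoint sign_sums l : seq 'rV[R[i]]_n :=
  if l is v :: l' then [seq w + v | w <- sign_sums l'] ++ [seq w - v | w <- sign_sums l']
  else [:: 0].

Lemma size_sign_sums l : size (sign_sums l) = (2 ^ size l)%N.
Proof. by elim: l => //= v l IH; rewrite size_cat !size_map IH expnS mul2n addnn. Qed.

Lemma sum_sign_sums l (F : 'rV[R[i]]_n -> R) v :
  \sum_(w <- sign_sums (v :: l)) F w = \sum_(w <- sign_sums l) (F (w + v) + F (w - v)).
Proof. by rewrite /= big_cat !big_map big_split. Qed.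

Lemma sum_const_sign_sums l (c : R) : \sum_(w <- sign_sums l) c = 2 ^+ size l * c.
Proof.
rewrite big_const_seq count_predT size_sign_sums iter_addr addr0 -[LHS]mulr_natl natrX.
by [].
Qed.

Definition sqmass l i : R := \sum_(v <- l) normc (v 0 i) ^+ 2.

Lemma sqmass_ge0 l i : 0 <= sqmass l i.
Proof. by apply: sumr_ge0 => v _; rewrite sqr_ge0. Qed.

Lemma second_moment_sign l i : \sum_(w <- sign_sums l) normc (w 0 i) ^+ 2 = 2 ^+ size l * sqmass l i.
Proof.
rewrite /sqmass; elim: l => [|v l IH].
  by rewrite /= big_seq1 big_nil mxE normc0 expr0n mulr0.
rewrite sum_sign_sums (eq_bigr (fun w => 2 * normc (w 0 i) ^+ 2 + 2 * normc (v 0 i) ^+ 2)).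
  by rewrite big_split /= -mulr_sumr IH sum_const_sign_sums big_cons /= [2 ^+ (size l).+1]exprS; ring.
by move=> w _; rewrite !mxE !normc_sqr !cReD !cImD !cReN !cImN; ring.
Qed.

(** Khintchine's inequality for the fourth moment, by adding one sign at a time. The mixed term is
    bounded by Cauchy-Schwarz, which produces the 12, and 3 is the constant that the induction then
    preserves. *)
Lemma fourth_moment_sign l i :
  \sum_(w <- sign_sums l) normc (w 0 i) ^+ 4 <= 3 * 2 ^+ size l * sqmass l i ^+ 2.
Proof.
elim: l => [|v l IH].
  by rewrite /= big_seq1 mxE normc0 expr0n /sqmass big_nil expr0n mulr0.
rewrite sum_sign_sums; apply: (@le_trans _ _ (\sum_(w <- sign_sums l)
   (2 * normc (w 0 i) ^+ 4 + 12 * normc (v 0 i) ^+ 2 * normc (w 0 i) ^+ 2 + 2 * normc (v 0 i) ^+ 4))).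
  apply: ler_sum => w _; rewrite !mxE.
  have e4 (z : R[i]) : normc z ^+ 4 = (Re z ^+ 2 + Im z ^+ 2) ^+ 2 by rewrite -normc_sqr -exprM.
  rewrite !e4 !normc_sqr !cReD !cImD !cReN !cImN.
  set a := Re (w 0 i); set b := Im (w 0 i); set c := Re (v 0 i); set d := Im (v 0 i).
  have := sqr_ge0 (a * d - b * c); nra.
rewrite !big_split /= sum_const_sign_sums -!mulr_sumr second_moment_sign.
rewrite /sqmass big_cons -/(sqmass l i) /= [2 ^+ (size l).+1]exprS.
set X := sqmass l i; set t := normc (v 0 i) ^+ 2; set p := 2 ^+ size l.
have -> : normc (v 0 i) ^+ 4 = t ^+ 2 by rewrite -exprM.
have p0 : 0 <= p by rewrite exprn_ge0.
have t0 : 0 <= t by rewrite sqr_ge0.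
apply: (@le_trans _ _ (2 * (3 * p * X ^+ 2) + 12 * t * (p * X) + p * (2 * t ^+ 2))).
  by rewrite !lerD2r ler_wpM2l.
have := mulr_ge0 p0 (sqr_ge0 t); nra.
Qed.

Variable q : 'rV[R[i]]_n -> R.
Hypothesis q_ge0 : forall v, 0 <= q v.
Hypothesis q_par : forall u v, q (u + v) + q (u - v) = 2 * q u + 2 * q v.
Hypothesis q_hom : forall (c : R) v, q (c%:C *: v) = c ^+ 2 * q v.
Variable Lam : R.
Hypothesis q_bnd : forall v, q v <= Lam * \sum_i normc (v 0 i) ^+ 2.

Lemma sum_q_sign_sums l : \sum_(w <- sign_sums l) q w = 2 ^+ size l * \sum_(v <- l) q v.
Proof.
elim: l => [|v l IH].
  rewrite /= big_seq1 big_nil mulr0 -(scale0r (0 : 'rV[R[i]]_n)) -[0 : R[i]]/(0%:C).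
  by rewrite q_hom expr0n mul0r.
rewrite sum_sign_sums (eq_bigr _ (fun w _ => q_par w v)) big_split /= -mulr_sumr IH.
by rewrite sum_const_sign_sums big_cons exprS; ring.
Qed.

Definition truncv x w : 'rV[R[i]]_n :=
  \row_i (if normc (w 0 i) ^+ 2 <= 16 * x i then w 0 i else 0).

Let adm x l := forall i, sqmass l i <= x i.

(* Splitting each random sign sum at height 4 sqrt x: the tails have small
   second moment by the fourth-moment bound, hence are absorbed by the
   supremum B itself. *)
Lemma little_grothendieck x s l : (forall i, 0 <= x i) ->
  (forall u, (forall i, normc (u 0 i) ^+ 2 <= x i) -> q u <= s) ->
  adm x l -> \sum_(v <- l) q v <= 64 * s.
Proof.
move=> x0 hs al.
pose S := [set \sum_(v <- l) q v | l in adm x].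
(* Finiteness of the supremum, which makes it legitimate to absorb it later, is what [q_bnd] is
   for. *)
have ubS : has_ubound S.
  exists (`|Lam| * \sum_i x i) => _ [l' al' <-].
  apply: (@le_trans _ _ (\sum_(v <- l') `|Lam| * \sum_i normc (v 0 i) ^+ 2)).
    apply: ler_sum => v _; rewrite (le_trans (q_bnd v)) //.
    by rewrite ler_wpM2r ?ler_norm // sumr_ge0 // => i _; rewrite sqr_ge0.
  rewrite -mulr_sumr ler_wpM2l // exchange_big /=.
  by apply: ler_sum => i _; exact: al'.
have S0 : S !=set0 by exists (\sum_(v <- l) q v), l.
pose B := sup S.
have hB l' : adm x l' -> \sum_(v <- l') q v <= B.
  by move=> al'; apply: ub_le_sup => //; exists l'.
have hBc c l' : 0 < c -> (forall i, sqmass l' i <= c * x i) -> \sum_(v <- l') q v <= c * B.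
  move=> c0 al'; pose t := (Num.sqrt c)^-1.
  have tE : t ^+ 2 = c^-1 by rewrite /t exprVn sqr_sqrtr ?ltW.
  have := hB [seq t%:C *: v | v <- l'] _; rewrite big_map.
  rewrite (eq_bigr _ (fun v _ => q_hom t v)) -mulr_sumr tE mulrC ler_pdivrMr // mulrC; apply.
  move=> i; rewrite /sqmass big_map (eq_bigr (fun v : 'rV_n => c^-1 * normc (v 0 i) ^+ 2)).
    by rewrite -mulr_sumr mulrC ler_pdivrMr // mulrC; exact: al'.
  by move=> v _; rewrite mxE normcM normcR exprMn real_normK ?num_real // tE.
(* The loop closes because 6/16 < 1: it gives B <= 51.2 s, which 64 rounds up. *)
have step l' : adm x l' -> \sum_(v <- l') q v <= 32 * s + 6 / 16 * B.
  move=> al'; have p0 : 0 < (2 : R) ^+ size l' by rewrite exprn_gt0.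
  rewrite -(ler_pM2l p0) -sum_q_sign_sums.
  pose rest w := w - truncv x w.
  (* A quarter of a truncated vector satisfies the constraint of [hs], hence the factor 16 = 4^2. *)
  have tr_le w : q (truncv x w) <= 16 * s.
    have := hs ((4^-1)%:C *: truncv x w) _; rewrite q_hom => H.
    have : 4^-1 ^+ 2 * q (truncv x w) <= s.
      apply: H => i; rewrite !mxE normcM normcR exprMn real_normK ?num_real //.
      case: ifP => [|_]; last by rewrite normc0 expr0n mulr0.
      by move=> h; rewrite exprVn mulrC ler_pdivrMr // mulrC; apply: le_trans h _; lra.
    lra.
  have q2 w : q w <= 32 * s + 2 * q (rest w).
    have := q_par (truncv x w) (rest w).
    have -> : truncv x w + rest w = w by rewrite /rest addrC subrK.
    have := q_ge0 (truncv x w - rest w).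
    have := tr_le w; lra.
  apply: le_trans (ler_sum _ (fun w _ => q2 w)) _.
  rewrite big_split /= sum_const_sign_sums -mulr_sumr mulrDr lerD2l.
  (* On the tail, where |w_i|^2 > 16 x_i, one has |w_i|^2 <= |w_i|^4 / (16 x_i). With the fourth
     moment, the tails of all the sign sums form a family of column mass at most 3/16 2^|l'| x, to
     which the definition of [B] applies after rescaling. *)
  have := hBc (3 / 16 * 2 ^+ size l') [seq rest w | w <- sign_sums l'] _ _.
  rewrite big_map => /(_ _ _)/(ler_wpM2l (ler0n R 2)) H.
  apply: (le_trans (H _ _)); [by rewrite mulr_gt0| |by rewrite le_eqVlt; apply/orP; left; apply/eqP; ring].
  move=> i; rewrite /sqmass big_map.
  (* The quotient bound divides by x_i. Where x_i = 0 the whole column of the family vanishes, and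
     so does that of every sign sum. *)
  have [xi0|xi0] := eqVneq (x i) 0.
    have m0 : sqmass l' i = 0 by apply: le_anti; rewrite sqmass_ge0 -xi0 al'.
    apply: (@le_trans _ _ (\sum_(w <- sign_sums l') normc (w 0 i) ^+ 2)); last first.
      by rewrite second_moment_sign m0 xi0 !mulr0.
    apply: ler_sum => w _.
    rewrite !mxE xi0 mulr0; case: ifP => _; last by rewrite subr0.
    by rewrite subrr normc0 expr0n sqr_ge0.
  have xi : 0 < x i by rewrite lt_neqAle eq_sym xi0 x0.
  apply: (@le_trans _ _ (\sum_(w <- sign_sums l') (16 * x i)^-1 * normc (w 0 i) ^+ 4)).
    apply: ler_sum => w _; rewrite !mxE; case: ifPn => [_|].
      by rewrite subrr normc0 expr0n mulr_ge0 ?invr_ge0 ?mulr_ge0 ?exprn_ge0 ?normc_ge0 ?x0.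
    rewrite -ltNge subr0 => h; rewrite mulrC ler_pdivlMr ?mulr_gt0 //.
    rewrite [normc _ ^+ 4](_ : _ = normc (w 0 i) ^+ 2 * normc (w 0 i) ^+ 2); last by rewrite -exprD.
    by rewrite ler_wpM2l ?sqr_ge0 // ltW.
  rewrite -mulr_sumr mulrC ler_pdivrMr ?mulr_gt0 //.
  apply: le_trans (fourth_moment_sign _ _) _.
  have -> : 3 / 16 * 2 ^+ size l' * x i * (16 * x i) = 3 * 2 ^+ size l' * x i ^+ 2 by field.
  by rewrite ler_wpM2l ?mulr_ge0 ?(ltW p0) // ler_sqr ?nnegrE ?x0 ?sqmass_ge0 ?al'.
have s0 : 0 <= s.
  by apply: le_trans (q_ge0 0) _; apply: hs => i; rewrite mxE normc0 expr0n x0.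
have : B <= 32 * s + 6 / 16 * B.
  by apply: ge_sup => // _ [l' al' <-]; exact: step.
have := hB _ al; lra.
Qed.

End LittleGrothendieck.

(** * The weight *)

Section IntegralMonotone.
Variables (d : measure_display) (T : measurableType d) (R : realType).
Variable mu : {measure set T -> \bar R}.

(* No measurability is needed, the integral of a nonnegative function being the
   supremum of the integrals of the simple functions below it. *)
Lemma ge0_le_integral_set (A B : set T) (f g : T -> \bar R) :
  (forall x, A x -> 0 <= f x)%E -> (forall x, B x -> 0 <= g x)%E -> A `<=` B ->
  (forall x, A x -> f x <= g x)%E ->
  (\int[mu]_(x in A) f x <= \int[mu]_(x in B) g x)%E.
Proof.
move=> f0 g0 AB fg; rewrite integral_mkcond [leRHS]integral_mkcond.
have fA x : (0 <= (f \_ A) x)%E by rewrite patchE; case: ifPn => // /set_mem /f0.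
have gB x : (0 <= (g \_ B) x)%E by rewrite patchE; case: ifPn => // /set_mem /g0.
rewrite !ge0_integralTE //; apply: le_ereal_sup => _ [h hf <-]; exists h => // x.
apply: le_trans (hf x) _; rewrite !patchE; case: ifPn => [/set_mem Ax|_].
  by rewrite mem_set ?fg //; exact: AB.
by case: ifPn => // /set_mem /g0.
Qed.

Lemma ge0_le_integral' (A : set T) (f g : T -> \bar R) :
  (forall x, A x -> 0 <= f x)%E -> (forall x, A x -> f x <= g x)%E ->
  (\int[mu]_(x in A) f x <= \int[mu]_(x in A) g x)%E.
Proof.
by move=> f0 fg; apply: ge0_le_integral_set => // x Ax; exact: le_trans (f0 x Ax) (fg x Ax).
Qed.

End IntegralMonotone.

Section Weight.
Variables (R : realType) (K : R -> R).
Hypothesis hK : class_WQ K.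

(** Since [K] is nondecreasing, a quotient K(s t) / K(t) persists on the window ]s, 2s[; the part of
    the integral of (K3) at infinity over that window alone already bounds it by a multiple of
    s^sigma. *)
Lemma WQ_upper : exists sigma C : R, [/\ 0 < sigma, 1 <= C &
  forall s t, 1 <= s -> 0 < t -> t <= 1 -> K (s * t) <= C * s `^ sigma * K t].
Proof.
have [sigma sigma0 [_ ]] := WQ_phi hK.
set J := (X in (X < +oo)%E) => Jfin.
have phi_ge0 s : (0 <= s)%R -> (0 <= phiK K s)%E.
  move=> s0; apply: (@le_trans _ _ (K (s * 1) / K 1)%:E).
    by rewrite lee_fin divr_ge0 ?(WQ_ge0 hK) ?mulr_ge0.
  by apply: ereal_sup_ubound; exists 1 => //=; rewrite ltr01 lexx.
have J0 : (0 <= J)%E.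
  apply: integral_ge0 => s /=; rewrite in_itv /= andbT => s1.
  by rewrite mule_ge0 ?phi_ge0 ?lee_fin ?invr_ge0 ?powR_ge0 //; lra.
pose C := 1 + fine J * 2 `^ (1 + sigma).
have C1 : 1 <= C by rewrite lerDl mulr_ge0 ?fine_ge0 ?powR_ge0.
exists sigma, C; split=> // s t s1 t0 t1.
have s0 : 0 < s by lra.
have Kt : 0 < K t by exact: WQ_gt0 hK _ t0.
rewrite -ler_pdivrMr //.
set y := K (s * t) / K t.
have y0 : 0 <= y by rewrite divr_ge0 ?(ltW Kt) // (WQ_ge0 hK) // mulr_ge0 // ltW.
have H : ((y * ((2 * s) `^ (1 + sigma))^-1 * s)%:E <= J)%E.
  apply: (@le_trans _ _ (\int[lebesgue_measure]_(u in `]s, (2 * s)%R[)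
      (cst (y * ((2 * s) `^ (1 + sigma))^-1)%:E u))%E).
    rewrite integral_cst //= lebesgue_measure_itv /= lte_fin ifT; last by lra.
    rewrite -EFinD -EFinM lee_fin (_ : 2 * s - s = s) //; lra.
  apply: ge0_le_integral_set => [u _|u|u|u] /=.
  - by rewrite lee_fin mulr_ge0 ?invr_ge0 ?powR_ge0.
  - rewrite in_itv /= andbT => u1.
    by rewrite mule_ge0 ?phi_ge0 ?lee_fin ?invr_ge0 ?powR_ge0 //; lra.
  - by rewrite !in_itv /= andbT => /andP[su _]; lra.
  - rewrite in_itv /= => /andP[su us]; rewrite EFinM.
    apply: lee_pmul; rewrite ?lee_fin ?invr_ge0 ?powR_ge0 //.
      apply: (@le_trans _ _ (K (u * t) / K t)%:E).
        rewrite lee_fin ler_pM2r ?invr_gt0 //.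
        by apply: (WQ_nondecreasing hK); rewrite ?mulr_ge0 ?ler_pM2r //; lra.
      by apply: ereal_sup_ubound; exists t => //=; rewrite t0 t1.
    by rewrite lef_pV2 ?posrE ?powR_gt0 ?ge0_ler_powR ?nnegrE //; lra.
have Jf : J \is a fin_num by rewrite ge0_fin_numE.
rewrite -(fineK Jf) lee_fin in H.
have p2 : 0 < (2 * s) `^ (1 + sigma) by rewrite powR_gt0; lra.
have : y * s <= fine J * (2 * s) `^ (1 + sigma).
  by rewrite -ler_pdivrMr //; apply: le_trans H; rewrite mulrAC.
rewrite powRM ?(ltW s0) //.
rewrite [s `^ (1 + _)]powRD; last by rewrite (gt_eqF s0) implybT.
rewrite powRr1 ?(ltW s0) // => H2.
have : y <= fine J * 2 `^ (1 + sigma) * s `^ sigma.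
  by rewrite -(ler_pM2r s0); apply: le_trans H2 _; rewrite le_eqVlt; apply/orP; left; apply/eqP; ring.
move=> /le_trans; apply; rewrite ler_wpM2r ?powR_ge0 // /C; lra.
Qed.

(** Otherwise [phiK] would be at least 1/2 near 0, and the integral of phiK(s) / s there would
    diverge logarithmically. *)
Lemma WQ_small_dilation : exists s0 : R, [/\ 0 < s0, s0 < 2^-1 &
  forall t, 0 < t -> t <= 1 -> K (s0 * t) <= 2^-1 * K t].
Proof.
apply: contrapT => H0.
have H s : 0 < s -> s < 2^-1 -> (2^-1%:E <= phiK K s)%E.
  move=> s0 s12; apply: contrapT => /negP; rewrite -ltNge => Hs; apply: H0.
  exists s; split=> // t t0 t1; rewrite -ler_pdivrMr ?(WQ_gt0 hK) //.
  rewrite -lee_fin; apply: le_trans (ltW Hs).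
  by apply: ereal_sup_ubound; exists t => //=; rewrite t0 t1.
have [_ _ [Jfin _]] := WQ_phi hK.
have phi_ge0 s : (0 <= s)%R -> (0 <= phiK K s)%E.
  move=> s0; apply: (@le_trans _ _ (K (s * 1) / K 1)%:E).
    by rewrite lee_fin divr_ge0 ?(WQ_ge0 hK) ?mulr_ge0.
  by apply: ereal_sup_ubound; exists 1 => //=; rewrite ltr01 lexx.
move: Jfin; set J := (X in (X < +oo)%E) => Jfin.
have J0 : (0 <= J)%E.
  apply: integral_ge0 => s /=; rewrite in_itv /= => /andP[s0 s1].
  by rewrite mule_ge0 ?phi_ge0 ?lee_fin ?invr_ge0 //; lra.
have Jf : J \is a fin_num by rewrite ge0_fin_numE.
pose M := fine J; have M0 : 0 <= M by rewrite fine_ge0.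
(* Chosen so that half of the logarithmic length of [eta, 1/3] is M + 1/2, more than the integral
   [M]; the end 1/3 stays below 1/2, where [H] applies. *)
pose eta := 3^-1 * expR (- (2 * M + 1)).
have eta0 : 0 < eta by rewrite mulr_gt0 ?expR_gt0 //; lra.
have eta3 : eta < 3^-1.
  by rewrite gtr_pMr ?invr_gt0 ?ltr0n // -[ltRHS]expR0 ltr_expR; lra.
have : ((2^-1 * (ln 3^-1 - ln eta))%:E <= J)%E.
  rewrite EFinM EFinB.
  rewrite -(@continuous_FTC2 R (fun x => x^-1) (@ln R) eta 3^-1) //; last 3 first.
  - apply: continuous_in_subspaceT => x; rewrite inE /= in_itv /= => /andP[x1 _].
    by apply: inv_continuous; rewrite gt_eqF //; lra.
  - split=> [x|//|//].
    + rewrite in_itv /= => /andP[x1 _]; apply: ex_derive; apply: is_derive1_ln; lra.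
    + by apply: cvg_at_right_filter; apply: continuous_ln.
    + by apply: cvg_at_left_filter; apply: continuous_ln; rewrite invr_gt0.
  - move=> x; rewrite in_itv /= => /andP[x1 _]; rewrite derive1E; apply: derive_val.
    by apply: is_derive1_ln; lra.
  rewrite -ge0_integralZl_EFin //=; last 2 first.
  - by move=> x; rewrite in_itv /= => /andP[x1 _]; rewrite lee_fin invr_ge0; lra.
  - apply/measurable_EFinP; apply: subspace_continuous_measurable_fun => //.
    apply: continuous_in_subspaceT => x; rewrite inE /= in_itv /= => /andP[x1 _].
    by apply: inv_continuous; rewrite gt_eqF //; lra.
  apply: ge0_le_integral_set => [u|u|u|u] /=.
  - by rewrite in_itv /= => /andP[x1 _]; rewrite mule_ge0 // lee_fin invr_ge0; lra.
  - by rewrite in_itv /= => /andP[u0 u1]; rewrite mule_ge0 ?phi_ge0 ?lee_fin ?invr_ge0 //; lra.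
  - by rewrite !in_itv /= => /andP[u0 u1]; lra.
  - rewrite in_itv /= => /andP[u0 u1]; apply: lee_wpmul2r; first by rewrite lee_fin invr_ge0; lra.
    by apply: H; lra.
rewrite -(fineK Jf) -/M lee_fin /eta lnM ?posrE ?expR_gt0 ?invr_gt0 // expRK.
lra.
Qed.

(** Iterating the dilation that halves [K] gives decay of order delta, where s0^delta = 1/2; s0 <
    1/2 forces delta < 1. The range of s goes up to 4 because 2 (1 - |a|^2) / |1 - conj a w| can
    reach it; above 1, [WQ_upper] at s = 4 is enough. *)
Lemma WQ_lower : exists dlt C : R, [/\ 0 < dlt, dlt < 1, 1 <= C &
  forall s t, 0 <= s -> s <= 4 -> 0 < t -> t <= 1 -> K (s * t) <= C * s `^ dlt * K t].
Proof.
have [sigma [C [sigma0 C1 HC]]] := WQ_upper.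
have [s0 [s00 s02 Hs]] := WQ_small_dilation.
pose dlt := ln 2 / - ln s0.
have ln2 : 0 < ln (2 : R) by rewrite ln_gt0 ?ltr1n.
have lns : ln 2 < - ln s0.
  by rewrite -lnV ?posrE // ltr_ln ?posrE ?invr_gt0 // -[ltLHS]invrK ltf_pV2 ?posrE ?invr_gt0.
have dlt0 : 0 < dlt by rewrite divr_gt0 //; lra.
have dlt1 : dlt < 1 by rewrite ltr_pdivrMr; lra.
have s0d : s0 `^ dlt = 2^-1.
  rewrite /powR gt_eqF // (_ : dlt * ln s0 = - ln 2); last first.
    by rewrite /dlt; field; rewrite lt_eqF //; lra.
  by rewrite -lnV ?posrE // lnK ?posrE ?invr_gt0.
have iter n t : 0 < t -> t <= 1 -> K (s0 ^+ n * t) <= 2^-1 ^+ n * K t.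
  elim: n => [|n IH] t0 t1; first by rewrite !expr0 !mul1r.
  rewrite exprS -mulrA; apply: le_trans (Hs _ _ _) _.
  - by rewrite mulr_gt0 ?exprn_gt0.
  - by rewrite mulr_ile1 ?exprn_ge0 ?exprn_ile1 ?(ltW s00) ?(ltW t0) //; lra.
  - by rewrite exprS -mulrA ler_wpM2l ?IH // invr_ge0.
pose C' := 2 + C * 4 `^ sigma.
have C4 : 0 <= C * 4 `^ sigma by rewrite mulr_ge0 ?powR_ge0 //; lra.
exists dlt, C'; split=> //; first by rewrite /C'; lra.
move=> s t; rewrite le_eqVlt => /predU1P[<- _ t0 _|s_gt0 s4 t0 t1].
  by rewrite mul0r (WQ_at0 hK) !mulr_ge0 ?powR_ge0 ?(WQ_ge0 hK) ?(ltW t0) // /C'; lra.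
have Kt : 0 < K t by exact: WQ_gt0 hK _ t0.
have [s1|s1] := leP s 1; last first.
  apply: (@le_trans _ _ (K (4 * t))).
    by apply: (WQ_nondecreasing hK); rewrite ?mulr_ge0 ?ler_pM2r //; lra.
  apply: le_trans (HC 4 t _ t0 t1) _; first by lra.
  rewrite ler_pM2r //; apply: (@le_trans _ _ (C' * 1)); first by rewrite /C'; lra.
  rewrite ler_wpM2l //; first by rewrite /C'; lra.
  by rewrite -[leLHS](powRr0 s) ler_powR ?ltW.
(* The least such n places s between s0^(n+1) and s0^n; the mismatch between 2^-n and 2^-(n+1) is
   the 2 in [C']. *)
have ex_n : exists n, s0 ^+ n.+1 < s.
  have s01 : `|s0| < 1 by rewrite gtr0_norm //; lra.
  have /cvgrPdist_lt /(_ s s_gt0)[N _ HN] := cvg_expr s01.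
  exists N; have := HN N.+1 (leqnSn N); rewrite /= sub0r normrN gtr0_norm ?exprn_gt0 //.
have [n Hn Hmin] := ex_minnP ex_n.
have sn : s <= s0 ^+ n.
  case: n Hn Hmin => [|n] Hn Hmin; first by rewrite expr0.
  by rewrite leNgt; apply/negP => /Hmin; rewrite ltnn.
apply: (@le_trans _ _ (K (s0 ^+ n * t))).
  by apply: (WQ_nondecreasing hK); rewrite ?mulr_ge0 ?ler_pM2r //; lra.
apply: le_trans (iter n t t0 t1) _; rewrite ler_pM2r //.
have h : 2^-1 ^+ n.+1 <= s `^ dlt.
  rewrite -s0d -powR_mulrn ?powR_ge0 // -powRrM mulrC powRrM powR_mulrn ?(ltW s00) //.
  by rewrite ge0_ler_powR ?nnegrE ?exprn_ge0 ?(ltW s00) ?(ltW dlt0) ?(ltW s_gt0) ?ltW.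
apply: (@le_trans _ _ (2 * s `^ dlt)).
  by rewrite exprS in h; lra.
rewrite ler_wpM2r ?powR_ge0 // /C'; lra.
Qed.

End Weight.

(** * Rotations and radial integrals *)

Section LineChange.
Variable R : realType.
Local Notation mu := (@lebesgue_measure R).
Implicit Types (f : R -> \bar R) (a c : R).

Lemma ge0_integral_lebesgue_shift f a : measurable_fun [set: R] f -> (forall x, 0 <= f x)%E ->
  (\int[mu]_x f (x + a)%R = \int[mu]_x f x)%E.
Proof.
move=> mf f0.
have mphi : measurable_fun [set: measurableTypeR R] ((fun x : R => x + a) : measurableTypeR R -> measurableTypeR R) by exact: measurable_funD.
rewrite -(@ge0_integral_pushforward _ _ _ _ _ _ mphi mu setT f) //.
apply: eq_measure_integral => A mA _; apply/esym/lebesgue_measure_unique => // _ [[u v]] _ <-.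
transitivity (mu `](u - a)%R, (v - a)%R]); last first.
  by congr (mu _); apply/seteqP; split=> x /=; rewrite !in_itv /= ltrBlDr lerBrDr.
rewrite !lebesgue_measure_itv /= !lte_fin ltrD2r; case: ifP => // _.
by rewrite -!EFinD; congr (_%:E); ring.
Qed.

Lemma ge0_integral_lebesgue_opp f : measurable_fun [set: R] f -> (forall x, 0 <= f x)%E ->
  (\int[mu]_x f (- x)%R = \int[mu]_x f x)%E.
Proof.
move=> mf f0.
have mphi : measurable_fun [set: measurableTypeR R] ((fun x : R => - x) : measurableTypeR R -> measurableTypeR R) by exact: oppr_measurable.
rewrite -(@ge0_integral_pushforward _ _ _ _ _ _ mphi mu setT f) //.
by apply: eq_measure_integral => A mA _; exact: lebesgue_measureN.
Qed.

Lemma ge0_integral_lebesgue_scale f c : 0 < c -> measurable_fun [set: R] f -> (forall x, 0 <= f x)%E ->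
  (c%:E * \int[mu]_x f (c * x)%R = \int[mu]_x f x)%E.
Proof.
move=> c0 mf f0.
have mphi : measurable_fun [set: measurableTypeR R] ((fun x : R => c * x) : measurableTypeR R -> measurableTypeR R) by exact: mulrl_measurable.
rewrite -[X in (_ * X)%E](@ge0_integral_pushforward _ _ _ _ _ _ mphi mu setT f) //.
rewrite -[c]/(NngNum (ltW c0))%:num -ge0_integral_mscale //.
apply: eq_measure_integral => A mA _; apply/esym/lebesgue_measure_unique => // _ [[u v]] _ <-.
transitivity (c%:E * mu `](u / c)%R, (v / c)%R])%E; last first.
  congr (_ * mu _)%E; apply/seteqP; split=> x /=;
    by rewrite !in_itv /= ler_pdivlMr // ltr_pdivrMr // mulrC.
rewrite !lebesgue_measure_itv /= !lte_fin ltr_pM2r ?invr_gt0 //; case: ifP => [_|_]; last by rewrite mule0.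
by rewrite -!EFinD -EFinM; congr (_%:E); field; rewrite gt_eqF.
Qed.

End LineChange.

Section PlaneChange.
Variable R : realType.
Local Notation mu := (@lebesgue_measure R).
Local Notation mu2 := ((@lebesgue_measure R \x @lebesgue_measure R)%E).
Implicit Types (F : plane R -> \bar R) (t c : R).

Lemma ge0_integral_shear1 F t : measurable_fun [set: plane R] F -> (forall p, 0 <= F p)%E ->
  (\int[mu2]_p F ((p.1 + t * p.2)%R, p.2) = \int[mu2]_p F p)%E.
Proof.
move=> mF F0.
have mG : measurable_fun [set: plane R] (fun p : plane R => F ((p.1 + t * p.2)%R, p.2)).
  apply: measurableT_comp => //; apply: measurable_fun_pair => //.
  by apply: measurable_funD => //; apply: measurable_funM.
rewrite (fubini_tonelli2 _ mG (fun p => F0 _)) (fubini_tonelli2 _ mF F0); apply: eq_integral => y _; rewrite /fubini_G /=.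
rewrite (@ge0_integral_lebesgue_shift R (fun x => F (x, y)) (t * y)) //.
by apply: measurableT_comp => //; exact: pair2_measurable.
Qed.

Lemma ge0_integral_shear2 F t : measurable_fun [set: plane R] F -> (forall p, 0 <= F p)%E ->
  (\int[mu2]_p F (p.1, (p.2 + t * p.1)%R) = \int[mu2]_p F p)%E.
Proof.
move=> mF F0.
have mG : measurable_fun [set: plane R] (fun p : plane R => F (p.1, (p.2 + t * p.1)%R)).
  apply: measurableT_comp => //; apply: measurable_fun_pair => //.
  by apply: measurable_funD => //; apply: measurable_funM.
rewrite (fubini_tonelli1 _ mG (fun p => F0 _)) (fubini_tonelli1 _ mF F0); apply: eq_integral => x _; rewrite /fubini_F /=.
rewrite (@ge0_integral_lebesgue_shift R (fun y => F (x, y)) (t * x)) //.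
by apply: measurableT_comp => //; exact: pair1_measurable.
Qed.

Lemma ge0_integral_scale2 F c : 0 < c -> measurable_fun [set: plane R] F -> (forall p, 0 <= F p)%E ->
  ((c ^+ 2)%:E * \int[mu2]_p F ((c * p.1)%R, (c * p.2)%R) = \int[mu2]_p F p)%E.
Proof.
move=> c0 mF F0.
have mG : measurable_fun [set: plane R] (fun p : plane R => F ((c * p.1)%R, (c * p.2)%R)).
  by apply: measurableT_comp => //; apply: measurable_fun_pair => //; apply: measurable_funM.
have mH : measurable_fun [set: plane R] (fun p : plane R => F ((c * p.1)%R, p.2)).
  by apply: measurableT_comp => //; apply: measurable_fun_pair => //; apply: measurable_funM.
transitivity (c%:E * \int[mu2]_p F ((c * p.1)%R, p.2))%E.
  rewrite expr2 EFinM -muleA; congr (_ * _)%E.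
  rewrite !fubini_tonelli1 // -ge0_integralZl_EFin //; last 3 first.
  - by move=> x _; apply: integral_ge0.
  - exact: measurable_fun_fubini_tonelli_F.
  - exact: ltW.
  apply: eq_integral => x _; rewrite /fubini_F /=.
  rewrite (@ge0_integral_lebesgue_scale R (fun y => F (c * x, y)) c) //.
  by apply: measurableT_comp => //; exact: pair1_measurable.
rewrite !fubini_tonelli2 // -ge0_integralZl_EFin //; last 3 first.
- by move=> x _; apply: integral_ge0.
- exact: measurable_fun_fubini_tonelli_G.
- exact: ltW.
apply: eq_integral => y _; rewrite /fubini_G /=.
rewrite (@ge0_integral_lebesgue_scale R (fun x => F (x, y)) c) //.
by apply: measurableT_comp => //; exact: pair2_measurable.
Qed.

Definition rot t (p : plane R) : plane R :=
  (cos t * p.1 - sin t * p.2, sin t * p.1 + cos t * p.2).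

Lemma cpx_rot t p : cpx (rot t p) = cis t * cpx p.
Proof. by rewrite /cpx /rot /cis; apply/eqP; rewrite eq_complex /= [sin t * p.1 + _]addrC !eqxx. Qed.

Lemma measurable_rot t : measurable_fun [set: plane R] (rot t).
Proof.
apply: measurable_fun_pair.
  by apply: measurable_funB; apply: measurable_funM.
by apply: measurable_funD; apply: measurable_funM.
Qed.

(* A rotation is a product of three shears, except for the half turn. *)
Lemma ge0_integral_rot F t : 1 + cos t != 0 -> measurable_fun [set: plane R] F ->
  (forall p, 0 <= F p)%E -> (\int[mu2]_p F (rot t p) = \int[mu2]_p F p)%E.
Proof.
(* [tau] is minus the tangent of t/2: the two outer shears have coefficient [tau] and the middle one
   sin t. *)
move=> ct mF F0; set tau := - (sin t / (1 + cos t)).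
have taus : tau * sin t = cos t - 1.
  have s2 : sin t * sin t = 1 - cos t ^+ 2 by rewrite -expr2 sin2cos2.
  apply: (mulIf ct); rewrite (_ : tau * _ * _ = - (sin t * sin t)); last by rewrite /tau; field.
  by rewrite s2; ring.
have tauc : tau * (1 + cos t) = - sin t by rewrite /tau mulNr divfK.
pose F1 (p : plane R) := F ((p.1 + tau * p.2)%R, p.2).
pose F2 (p : plane R) := F1 (p.1, (p.2 + sin t * p.1)%R).
have mF1 : measurable_fun [set: plane R] F1.
  apply: measurableT_comp => //; apply: measurable_fun_pair => //.
  by apply: measurable_funD => //; apply: measurable_funM.
have mF2 : measurable_fun [set: plane R] F2.
  apply: measurableT_comp => //; apply: measurable_fun_pair => //.
  by apply: measurable_funD => //; apply: measurable_funM.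
rewrite -(ge0_integral_shear1 tau mF F0) -/F1 -(ge0_integral_shear2 (sin t) mF1); last by move=> p; exact: F0.
rewrite -[RHS](ge0_integral_shear1 tau mF2); last by move=> p; exact: F0.
apply: eq_integral => -[x y] _; rewrite /F2 /F1 /rot /=; congr (F (_, _)).
- have -> : x + tau * y + tau * (y + sin t * (x + tau * y)) =
    x + tau * sin t * x + (tau + tau + tau * sin t * tau) * y by ring.
  rewrite taus; have -> : tau + tau + (cos t - 1) * tau = tau * (1 + cos t) by ring.
  by rewrite tauc; ring.
- have -> : y + sin t * (x + tau * y) = sin t * x + (1 + tau * sin t) * y by ring.
  by rewrite taus; ring.
Qed.

Lemma ge0_integral_dA (D : set (plane R)) F : measurable D -> measurable_fun D F ->
  (forall p, D p -> 0 <= F p)%E ->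
  (\int[@dA R]_(p in D) F p = (pi^-1)%:E * \int[mu2]_(p in D) F p)%E.
Proof. by move=> mD mF F0; rewrite /dA ge0_integral_mscale. Qed.

End PlaneChange.

Lemma ge0_integral_setU_le d (T : measurableType d) (R : realType)
    (m : {measure set T -> \bar R}) (A B : set T) (f : T -> \bar R) :
  measurable A -> measurable B -> measurable_fun [set: T] f -> (forall x, 0 <= f x)%E ->
  (\int[m]_(x in A `|` B) f x <= \int[m]_(x in A) f x + \int[m]_(x in B) f x)%E.
Proof.
move=> mA mB mf f0.
have -> : A `|` B = A `|` (B `\` A).
  apply/seteqP; split=> x [Ax|Bx]; try by left.
    by have [Ax|Ax] := pselect (A x); [left|right].
  by right; case: Bx.
rewrite ge0_integral_setU //.
- by rewrite leeD2l //; apply: ge0_le_integral_set => // x [].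
- exact: measurableD.
- exact: measurable_funTS.
- by apply/disj_setPS => x [Ax [_ ]].
Qed.

(** * One-dimensional integral estimates *)

Section RealCalculus.
Variable R : realType.
Local Notation mu := (@lebesgue_measure R).

Lemma integral_powR (q a b : R) : q + 1 != 0 -> 0 < a -> a < b ->
  (\int[mu]_(x in `[a, b]) (x `^ q)%:E = ((b `^ (q + 1) - a `^ (q + 1)) / (q + 1))%:E)%E.
Proof.
move=> q1 a0 ab.
have cpow' (r x : R) : 0 < x -> {for x, continuous (fun x => x `^ r)}.
  by move=> x0; apply: differentiable_continuous; apply/derivable1_diffP;
    apply: derivable_powR; rewrite in_itv /= x0.
have dF (x : R) : 0 < x -> is_derive x 1 (fun x : R => (q + 1)^-1 * x `^ (q + 1)) (x `^ q).
  move=> x0; have d := @is_derive1_powR R (q + 1) x x0.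
  apply: is_derive_eq; rewrite /GRing.scale /=.
  by rewrite addrK mulrA mulVf // mul1r.
rewrite (@continuous_FTC2 R (fun x => x `^ q) (fun x => (q + 1)^-1 * x `^ (q + 1)) a b) //.
- by rewrite -EFinB -mulrBr mulrC.
- apply: continuous_in_subspaceT => x; rewrite inE /= in_itv /= => /andP[ax _].
  by apply: cpow'; exact: lt_le_trans ax.
- split=> [x|//|//].
  + rewrite in_itv /= => /andP[ax _]; apply: ex_derive; apply: dF; exact: lt_trans ax.
  + apply: cvg_at_right_filter; apply: cvgM; [exact: cvg_cst|exact: cpow'].
  + apply: cvg_at_left_filter; apply: cvgM; [exact: cvg_cst|by apply: cpow'; exact: lt_trans ab].
- move=> x; rewrite in_itv /= => /andP[ax _]; rewrite derive1E; apply: derive_val.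
  by apply: dF; exact: lt_trans ax.
Qed.

Lemma measurable_powRfun (q : R) : measurable_fun [set: R] (fun x : R => x `^ q).
Proof. exact: measurable_powR. Qed.

Lemma integral_shift_powR_le (p S B : R) : 1 < p -> 0 < S ->
  (\int[mu]_(x in `[0%R, B]) ((S + x) `^ (- p))%:E <= (S `^ (1 - p) / (p - 1))%:E)%E.
Proof.
move=> p1 S0.
have [B0|B0] := leP B 0.
  apply: (@le_trans _ _ 0%E); last by rewrite lee_fin divr_ge0 ?powR_ge0 //; lra.
  rewrite (@integral_Sset1 R _ _ 0) // => x /=; rewrite in_itv /= => /andP[x0 xB].
  by apply: le_anti; rewrite x0 (le_trans xB).
have -> : (\int[mu]_(x in `[0%R, B]) ((S + x) `^ (- p))%:E =
    \int[mu]_(x in `[S, (S + B)%R]) (x `^ (- p))%:E)%E.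
  rewrite integral_mkcond [RHS]integral_mkcond.
  rewrite -[RHS](@ge0_integral_lebesgue_shift R _ S).
  - apply: eq_integral => x _; rewrite !patchE; congr (if _ then _ else _); last by rewrite addrC.
    apply/idP/idP; rewrite !inE /= !in_itv /= => /andP[h1 h2]; apply/andP; split; lra.
  - apply/(measurable_restrictT _ _).1 => //; apply/measurable_EFinP.
    by apply: measurable_funTS; exact: measurable_powRfun.
  - by move=> x; rewrite patchE; case: ifP => // _; rewrite lee_fin powR_ge0.
rewrite integral_powR ?ltrDl //; last by apply/eqP; lra.
rewrite lee_fin (_ : - p + 1 = - (p - 1)); last by ring.
rewrite invrN mulrN -mulNr opprB ler_pM2r ?invr_gt0; last by lra.
by rewrite (_ : 1 - p = - (p - 1)) ?lerBlDr ?lerDl ?powR_ge0 //; ring.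
Qed.

Lemma integral_abs_shift_powR_le (p S B : R) : 1 < p -> 0 < S ->
  (\int[mu]_(x in `[(- B)%R, B]) ((S + `|x|) `^ (- p))%:E <= (2 * (S `^ (1 - p) / (p - 1)))%:E)%E.
Proof.
move=> p1 S0.
pose g (x : R) := ((fun x => ((S + x) `^ (- p))%:E) \_ `[0%R, B]) x.
have mg : measurable_fun [set: R] g.
  apply/(measurable_restrictT _ _).1 => //; apply/measurable_EFinP; apply: measurable_funTS.
  by apply: (measurableT_comp (measurable_powRfun (- p))); exact: measurable_funD.
have g0 x : (0 <= g x)%E by rewrite /g patchE; case: ifP => // _; rewrite lee_fin powR_ge0.
have Ig : (\int[mu]_x g x <= (S `^ (1 - p) / (p - 1))%:E)%E.
  by rewrite /g -integral_mkcond; exact: integral_shift_powR_le.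
apply: (@le_trans _ _ (\int[mu]_x (g x + g (- x)%R))%E).
  apply: ge0_le_integral_set => // [x _|x _|x /=].
  - by rewrite lee_fin powR_ge0.
  - by rewrite adde_ge0.
  - rewrite in_itv /= => /andP[x1 x2]; have [x0|x0] := leP 0 x.
      rewrite ger0_norm // -[leLHS]adde0 leeD //.
      by rewrite /g patchE ifT // inE /= in_itv /= x0.
    rewrite ltr0_norm // -[leLHS]add0e leeD //.
    by rewrite /g patchE ifT // inE /= in_itv /=; apply/andP; split; lra.
rewrite ge0_integralD //; last by apply: measurableT_comp => //; exact: oppr_measurable.
by rewrite ge0_integral_lebesgue_opp // mulr_natl mulr2n EFinD leeD.
Qed.

(** Split at [eps]: below it the second factor is of the order of its value at 0, above it the
    integrand is at most x^-(1+c). The two halves contribute (1 + e)^-1 and c^-1. *)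
Lemma integral_powR_mix_le (e c eps : R) : - 1 < e -> 0 < c -> 0 < eps -> eps <= 1 ->
  (\int[mu]_(x in `]0%R, 1%R]) (x `^ e * (eps + x) `^ (- (1 + e + c)))%:E
    <= (((1 + e)^-1 + c^-1) * eps `^ (- c))%:E)%E.
Proof.
move=> e1 c0 eps0 eps1; pose f (x : R) := (x `^ e * (eps + x) `^ (- (1 + e + c)))%:E.
rewrite -/f.
(* Powers are integrated from a positive left end, so ]0, 1] is exhausted from the right; the index
   n + 2 keeps the left end strictly below the splitting point [eps]. *)
pose F n := `[(n.+2%:R^-1 * eps)%R, 1%R]%classic : set R.
have f0 x : (0 <= f x)%E by rewrite lee_fin mulr_ge0 ?powR_ge0.
have mf : measurable_fun [set: R] f.
  apply/measurable_EFinP; apply: measurable_funM; first exact: measurable_powRfun.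
  by apply: (measurableT_comp (measurable_powRfun _)); exact: measurable_funD.
have UF : `]0%R, 1%R]%classic = \bigcup_n F n.
  apply/seteqP; split=> x /=.
    rewrite in_itv /= => /andP[x0 x1].
    have [n Hn] : exists n : nat, eps / x < n.+2%:R.
      have /archi_boundP H : 0 <= eps / x by rewrite divr_ge0 // ltW.
      by exists (Num.bound (eps / x)); apply: lt_le_trans H _; rewrite ler_nat ltnW.
    exists n => //; rewrite /F /= in_itv /= x1 andbT mulrC ler_pdivrMr // mulrC.
    by rewrite -ler_pdivrMr // ltW.
  move=> [n _]; rewrite /F /= in_itv /= => /andP[h h1].
  by rewrite in_itv /= h1 andbT (lt_le_trans _ h) // mulr_gt0.
have ndF : nondecreasing_seq F.
  move=> m n mn; apply/subsetPset => x; rewrite /F /= !in_itv /= => /andP[h ->]; rewrite andbT.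
  by apply: le_trans h; rewrite ler_pM2r // lef_pV2 ?posrE // ler_nat !ltnS.
rewrite UF.
have H := @ge0_nondecreasing_set_cvg_integral _ (measurableTypeR R) R F f mu ndF (fun _ => measurable_itv _)
  (fun _ => measurable_funTS mf) (fun _ x _ => f0 x).
rewrite -(cvg_lim _ H) //; apply: lime_le; first by apply/cvg_ex; exists (\int[mu]_(x in \bigcup_i F i) f x)%E.
apply: nearW => n; set eta := n.+2%:R^-1 * eps.
have eta0 : 0 < eta by rewrite mulr_gt0.
have etaeps : eta < eps by rewrite gtr_pMl // invf_lt1 // ltr1n.
have qe : (1 : R) + e + c > 0 by lra.
have A : (\int[mu]_(x in `[eta, eps]) f x <= ((1 + e)^-1 * eps `^ (- c))%:E)%E.
  apply: (@le_trans _ _ (\int[mu]_(x in `[eta, eps]) ((eps `^ (- (1 + e + c)))%:E * (x `^ e)%:E))%E).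
    apply: ge0_le_integral' => // x /=; rewrite in_itv /= => /andP[x0 x1].
    rewrite -EFinM lee_fin mulrC ler_wpM2r ?powR_ge0 // !powRN lef_pV2 ?posrE ?powR_gt0 //; last by lra.
    by apply: ge0_ler_powR; rewrite ?nnegrE //; lra.
  rewrite ge0_integralZl_EFin ?powR_ge0 //; last 2 first.
  - by move=> x _; rewrite lee_fin powR_ge0.
  - by apply/measurable_EFinP; apply: measurable_funTS; exact: measurable_powRfun.
  rewrite integral_powR //; last by apply/eqP; lra.
  rewrite -EFinM lee_fin mulrA (addrC e) [leRHS]mulrC ler_pM2r ?invr_gt0; last by lra.
  apply: (@le_trans _ _ (eps `^ (- (1 + e + c)) * eps `^ (1 + e))).
    by rewrite ler_wpM2l ?powR_ge0 // gerBl powR_ge0.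
  by rewrite -powRD ?(gt_eqF eps0) ?implybT // (_ : - (1 + e + c) + (1 + e) = - c) //; ring.
have B : (\int[mu]_(x in `[eps, 1%R]) f x <= (c^-1 * eps `^ (- c))%:E)%E.
  move: eps1; rewrite le_eqVlt => /predU1P[->|eps1].
    rewrite set_itv1 integral_set1 lee_fin mulr_ge0 ?powR_ge0 // invr_ge0 ltW //.
  apply: (@le_trans _ _ (\int[mu]_(x in `[eps, 1%R]) (x `^ (- (1 + c)))%:E)%E).
    apply: ge0_le_integral' => // x /=; rewrite in_itv /= => /andP[x0 x1].
    have xx : 0 < x by lra.
    rewrite lee_fin (_ : - (1 + c) = e + - (1 + e + c)); last by ring.
    rewrite [X in _ <= X]powRD; last by rewrite (gt_eqF xx) implybT.
    rewrite ler_wpM2l ?powR_ge0 // !powRN lef_pV2 ?posrE ?powR_gt0 //; last by lra.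
    by apply: ge0_ler_powR; rewrite ?nnegrE //; lra.
  rewrite integral_powR //; last by apply/eqP; lra.
  rewrite lee_fin (_ : - (1 + c) + 1 = - c); last by ring.
  rewrite powR1 invrN mulrN -mulNr opprB mulrC ler_pM2l ?invr_gt0 //.
  by rewrite lerBlDr lerDl.
apply: (@le_trans _ _ (\int[mu]_(x in `[eta, eps] `|` `[eps, 1%R]) f x)%E).
  apply: ge0_le_integral_set => // x /=; rewrite !in_itv /= => /andP[h1 h2].
  by have [h|h] := leP x eps; [left|right]; apply/andP; split=> //; exact: ltW.
rewrite mulrDl EFinD; apply: le_trans (leeD A B).
exact: ge0_integral_setU_le.
Qed.

(** A crude form of Jordan's inequality: up to pi/4 the mean value theorem with cos >= 1/2 gives
    u/2, and beyond it monotonicity keeps sin u above pi/8 >= u/4. *)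
Lemma sin_ge_quarter (u : R) : 0 <= u -> u <= pi / 2 -> u / 4 <= sin u.
Proof.
move=> u0 u2.
have c4 : 2^-1 <= cos (pi / 4 : R).
  have : cos (pi / 4 + pi / 4 : R) = 0 by rewrite -[RHS]cos_pihalf; congr cos; field.
  rewrite cosD -!expr2 sin2cos2 => h.
  have : 0 <= cos (pi / 4 : R) by apply: cos_ge0_pihalf; apply/andP; split; have := pi_gt0 R; lra.
  nra.
have pi4 : (pi : R) <= 4 by have := pihalf_lt2 R; lra.
have mono (v : R) : 0 <= v -> v <= pi / 4 -> v / 2 <= sin v.
  move=> v0 v4; have [->|vn0] := eqVneq v 0; first by rewrite sin0 mul0r.
  have vgt : 0 < v by rewrite lt_neqAle eq_sym vn0.
  have [x xv ] := @MVT R sin cos 0 v vgt (fun x _ => is_derive_sin x)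
    (continuous_subspaceT (fun x => @continuous_sin R x)).
  rewrite sin0 !subr0 => ->.
  move: xv; rewrite in_itv /= => /andP[x0 xv].
  have : cos (pi / 4) <= cos x.
    by apply: ltW; rewrite ltr_cos ?in_itv /=; [lra|apply/andP; split; lra|apply/andP; split; lra].
  nra.
have [u4|u4] := leP u (pi / 4); first by have := mono _ u0 u4; lra.
have m4 : pi / 4 / 2 <= sin (pi / 4 : R) by apply: mono => //; have := pi_gt0 R; lra.
have : sin (pi / 4) <= sin u.
  by apply: ltW; rewrite ltr_sin ?in_itv //=; apply/andP; split; lra.
lra.
Qed.

End RealCalculus.

(** * Power series *)

Section ComplexSeries.
Variable R : realType.
Implicit Types (u : nat -> R[i]) (a : nat -> R[i]) (z w h S : R[i]).

Definition cseries u S := forall e : R, 0 < e -> exists N0, forall N, (N0 <= N)%N ->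
  normc (S - \sum_(n < N) u n) <= e.

Lemma cseries_unique u S T : cseries u S -> cseries u T -> S = T.
Proof.
move=> hS hT; apply/eqP; rewrite -subr_eq0; apply/eqP; apply: eq0_normc.
apply/eqP; rewrite eq_le normc_ge0 andbT; apply/ler_addgt0Pl => e e0; rewrite addr0.
have e2 : 0 < e / 2 by lra.
have [N1 H1] := hS _ e2; have [N2 H2] := hT _ e2.
have -> : S - T = (S - \sum_(n < maxn N1 N2) u n) - (T - \sum_(n < maxn N1 N2) u n) by ring.
apply: le_trans (normcB _ _) _.
by have := H1 _ (leq_maxl N1 N2); have := H2 _ (leq_maxr N1 N2); lra.
Qed.

Lemma cvg_expr_small (q C e : R) : 0 <= q -> q < 1 -> 0 < e ->
  exists N0, forall N, (N0 <= N)%N -> C * q ^+ N <= e.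
Proof.
move=> q0 q1 e0; have nq : `|q| < 1 by rewrite ger0_norm.
have C1 : 0 < `|C| + 1 by rewrite ltr_wpDl.
have /cvgrPdist_lt /(_ (e / (`|C| + 1)) (divr_gt0 e0 C1)) [N _ HN] := cvg_expr nq.
exists N => n Nn; have := HN n Nn; rewrite /= sub0r normrN ger0_norm ?exprn_ge0 // => H.
apply: (@le_trans _ _ ((`|C| + 1) * q ^+ n)).
  by rewrite ler_wpM2r ?exprn_ge0 // (le_trans (ler_norm _)) // lerDl.
by rewrite mulrC -ler_pdivlMr // ltW.
Qed.

Lemma geometric_sum_le (q : R) m n : 0 <= q -> q < 1 -> \sum_(m <= k < n) q ^+ k <= q ^+ m / (1 - q).
Proof.
move=> q0 q1; have q1' : 0 < 1 - q by lra.
rewrite ler_pdivlMr //.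
have [nm|mn] := leqP n m; first by rewrite big_geq // mul0r exprn_ge0.
suff -> : (\sum_(m <= k < n) q ^+ k) * (1 - q) = q ^+ m - q ^+ n by rewrite gerBl exprn_ge0.
elim: n mn => // n IH; rewrite ltnS leq_eqVlt => /predU1P[<-|mn].
  by rewrite big_nat1 exprS; ring.
by rewrite big_nat_recr /= 1?ltnW // mulrDl IH // exprS; ring.
Qed.

Lemma cseries_geometric u (C q : R) : 0 <= C -> 0 <= q -> q < 1 ->
  (forall n, normc (u n) <= C * q ^+ n) ->
  exists S, forall N, normc (S - \sum_(n < N) u n) <= C * q ^+ N / (1 - q).
Proof.
move=> C0 q0 q1 hu; have q1' : 0 < 1 - q by lra.
have cv (f : nat -> R) : (forall n, `|f n| <= normc (u n)) -> cvgn (series f).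
  move=> hf; apply: normed_cvg.
  apply: (@series_le_cvg _ _ (geometric C q)) => [n|n|n|] //=.
  - by rewrite mulr_ge0 ?exprn_ge0.
  - exact: le_trans (hf n) (hu n).
  - by apply: is_cvg_geometric_series; rewrite ger0_norm.
have cR := cv (fun n => Re (u n)) (fun n => normc_Re _).
have cI := cv (fun n => Im (u n)) (fun n => normc_Im _).
exists (limn (series (fun n => Re (u n))) +i* limn (series (fun n => Im (u n)))) => N.
set S := (X in normc (X - _)).
apply/ler_addgt0Pl => e e0.
have e2 : 0 < e / 2 by lra.
have /cvgrPdist_le /(_ _ e2) [N1 _ H1] := cR.
have /cvgrPdist_le /(_ _ e2) [N2 _ H2] := cI.
pose M := maxn N (maxn N1 N2).
have h1 := H1 M (leq_trans (leq_maxl N1 N2) (leq_maxr _ _)).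
have h2 := H2 M (leq_trans (leq_maxr N1 N2) (leq_maxr _ _)).
have -> : S - \sum_(n < N) u n = (S - \sum_(n < M) u n) + \sum_(N <= n < M) u n.
  rewrite -!(big_mkord xpredT).
  by rewrite (big_cat_nat (leq0n N) (leq_maxl N (maxn N1 N2))) /=; ring.
apply: le_trans (normcD _ _) _; apply: lerD.
  apply: le_trans (normc_leReIm _) _.
  rewrite cReD cImD cReN cImN cRe_sum cIm_sum.
  by move: h1 h2; rewrite /= /series /= !big_mkord; lra.
apply: le_trans (normc_sum _ _ _) _.
apply: (@le_trans _ _ (\sum_(N <= n < M) C * q ^+ n)); first by apply: ler_sum => n _.
by rewrite -mulr_sumr -mulrA ler_wpM2l // geometric_sum_le.
Qed.

Lemma cseries_of_bound u S (C q : R) : 0 <= q -> q < 1 ->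
  (forall N, normc (S - \sum_(n < N) u n) <= C * q ^+ N) -> cseries u S.
Proof.
move=> q0 q1 H e e0; have [N0 HN] := cvg_expr_small C q0 q1 e0.
by exists N0 => N /HN; exact: le_trans.
Qed.

(** Equivalent to a radius of convergence at least 1. *)
Definition subexp a := forall x : R, 0 < x -> x < 1 -> exists C : R, forall n, normc (a n) * x ^+ n <= C.

(** The sum is selected by its uniqueness, with value 0 for a divergent series, so that the term
    carries no convergence proof. *)
Definition psum a z : R[i] := xget 0 [set S | cseries (fun n => a n * z ^+ n) S].

Lemma psum_unique a z S : cseries (fun n => a n * z ^+ n) S -> psum a z = S.
Proof.
move=> hS; rewrite /psum; case: xgetP => [T _ hT|/(_ S)] //.
by apply: cseries_unique hT hS.
Qed.

(** Abel's lemma: boundedness of the terms at the radius x midway between r and 1 gives the ratio q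
    = r/x. The constant is divided by 1 - q so that one [C] serves both terms and tails. *)
Lemma psum_unif a (r : R) : subexp a -> 0 <= r -> r < 1 -> exists C q : R,
  [/\ 0 <= C, 0 <= q, q < 1,
    forall z n, normc z <= r -> normc (a n * z ^+ n) <= C * q ^+ n &
    forall z N, normc z <= r -> normc (psum a z - \sum_(n < N) a n * z ^+ n) <= C * q ^+ N].
Proof.
move=> ha r0 r1; pose x := (1 + r) / 2.
have x0 : 0 < x by rewrite /x; lra.
have [C HC] := ha x x0 ltac:(rewrite /x; lra).
have C0 : 0 <= C.
  by apply: le_trans (HC 0%N); rewrite mulr_ge0 ?normc_ge0 ?exprn_ge0 // ltW.
pose q := r / x.
have q0 : 0 <= q by rewrite divr_ge0 // ltW.
have q1 : q < 1 by rewrite ltr_pdivrMr // /x; lra.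
have q1' : 0 < 1 - q by lra.
have hb z n : normc z <= r -> normc (a n * z ^+ n) <= C * q ^+ n.
  move=> zr; rewrite normcM normcX expr_div_n mulrA ler_pdivlMr ?exprn_gt0 //.
  rewrite mulrAC; apply: ler_pM; rewrite ?mulr_ge0 ?exprn_ge0 ?normc_ge0 ?(ltW x0) //.
  by rewrite lerXn2r // nnegrE normc_ge0.
have C1 : C <= C / (1 - q).
  by rewrite ler_pdivlMr // ler_piMr // gerBl.
exists (C / (1 - q)), q; split=> // [|z n zr|z N zr].
- by rewrite divr_ge0 // ltW.
- by apply: le_trans (hb _ _ zr) _; rewrite ler_wpM2r ?exprn_ge0.
have [S HS] := cseries_geometric C0 q0 q1 (fun n => hb z n zr).
have HS' M : normc (S - \sum_(n < M) a n * z ^+ n) <= C / (1 - q) * q ^+ M by rewrite mulrAC.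
by rewrite (psum_unique (cseries_of_bound q0 q1 HS')).
Qed.

Lemma psum_cseries a z : subexp a -> normc z < 1 -> cseries (fun n => a n * z ^+ n) (psum a z).
Proof.
move=> ha z1; have [C [q [C0 q0 q1 _ H]]] := psum_unif ha (normc_ge0 z) z1.
by apply: (cseries_of_bound q0 q1) => N; exact: H.
Qed.

(** Each of the n terms of 1 + q + ... + q^(n-1) is at least q^n, and the sum is at most 1 / (1 -
    q). *)
Lemma natr_expr_le (q : R) n : 0 <= q -> q < 1 -> n%:R * q ^+ n <= (1 - q)^-1.
Proof.
move=> q0 q1; have q1' : 0 < 1 - q by lra.
rewrite -[leRHS]mul1r ler_pdivlMr //.
apply: (@le_trans _ _ (1 - q ^+ n)); last by rewrite gerBl exprn_ge0.
elim: n => [|n IH]; first by rewrite mul0r mul0r expr0 subrr.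
have p0 : 0 <= q ^+ n by rewrite exprn_ge0.
have p1 : q ^+ n <= 1 by rewrite exprn_ile1 // ltW.
rewrite -natr1 exprS.
have -> : (n%:R + 1) * (q * q ^+ n) * (1 - q) = q * (n%:R * q ^+ n * (1 - q)) + q * q ^+ n * (1 - q) by ring.
apply: (@le_trans _ _ (q * (1 - q ^+ n) + q * q ^+ n * (1 - q))).
  by rewrite lerD2r ler_wpM2l.
have h : 0 <= 1 - q * q ^+ n by rewrite subr_ge0 mulr_ile1 ?(ltW q1).
have := mulr_ge0 (ltW q1') h; nra.
Qed.

Definition pderiv a n : R[i] := n.+1%:R * a n.+1.

Lemma normc_nat n : normc (n%:R : R[i]) = n%:R.
Proof.
have -> : (n%:R : R[i]) = (n%:R)%:C by rewrite rmorph_nat.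
by rewrite normcR ger0_norm.
Qed.

Lemma subexp_mulnat a : subexp a -> subexp (fun n => n%:R * a n).
Proof.
move=> ha x x0 x1; pose y := (1 + x) / 2.
have y0 : 0 < y by rewrite /y; lra.
have [C HC] := ha y y0 ltac:(rewrite /y; lra).
have C0 : 0 <= C.
  by apply: le_trans (HC 0%N); rewrite mulr_ge0 ?normc_ge0 ?exprn_ge0 // ltW.
have q0 : 0 <= x / y by rewrite divr_ge0 // ltW.
have q1 : x / y < 1 by rewrite ltr_pdivrMr // /y; lra.
exists (C * (1 - x / y)^-1) => n; rewrite normcM normc_nat.
have -> : x ^+ n = y ^+ n * (x / y) ^+ n by rewrite -exprMn mulrC divfK ?gt_eqF.
rewrite (_ : _ * _ = (normc (a n) * y ^+ n) * (n%:R * (x / y) ^+ n)); last by ring.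
apply: ler_pM => //; last exact: natr_expr_le.
- by rewrite mulr_ge0 ?normc_ge0 ?exprn_ge0 // ltW.
- by rewrite mulr_ge0 ?exprn_ge0.
Qed.

Lemma subexp_shift a : subexp a -> subexp (fun n => a n.+1).
Proof.
move=> ha x x0 x1; have [C HC] := ha x x0 x1; exists (C / x) => n.
by rewrite ler_pdivlMr // -mulrA -exprSr.
Qed.

Lemma subexp_pderiv a : subexp a -> subexp (pderiv a).
Proof. by move=> /subexp_mulnat /subexp_shift. Qed.

(** The remainders satisfy D_(n+1) = (z + h) D_n + n z^(n-1) h^2. The factor r^n is kept apart so
    that the bound can be summed against the coefficients of a series. *)
Lemma expr_taylor_le z h (r : R) n : 0 < r -> normc z <= r -> normc (z + h) <= r ->
  normc ((z + h) ^+ n - z ^+ n - n%:R * z ^+ n.-1 * h) <= n%:R ^+ 2 * r ^+ n * (normc h ^+ 2 / r ^+ 2).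
Proof.
move=> r0 zr zhr; elim: n => [|n IH].
  by rewrite !expr0 subrr !mul0r subr0 normc0 expr0n /= !mul0r.
set D := (X in normc X <= _) in IH.
have -> : (z + h) ^+ n.+1 - z ^+ n.+1 - n.+1%:R * z ^+ n.+1.-1 * h =
   (z + h) * D + n%:R * z ^+ n.-1 * h ^+ 2.
  rewrite /D; case: n {IH D} => [|n] /=; first by rewrite !expr0 !expr1; ring.
  by rewrite -[n.+2%:R]natr1 !exprS; ring.
set k := normc h ^+ 2 / r ^+ 2 in IH *.
have k0 : 0 <= k by rewrite divr_ge0 ?sqr_ge0.
apply: le_trans (normcD _ _) _.
have A : normc ((z + h) * D) <= r * (n%:R ^+ 2 * r ^+ n * k).
  by rewrite normcM ler_pM ?normc_ge0.
have B : normc (n%:R * z ^+ n.-1 * h ^+ 2) <= n%:R * r ^+ n.+1 * k.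
  rewrite !normcM normc_nat !normcX /k.
  case: n {IH D A} => [|n]; first by rewrite !mul0r.
  have -> : n.+1%:R * r ^+ n.+2 * (normc h ^+ 2 / r ^+ 2) = n.+1%:R * (r ^+ n * normc h ^+ 2).
    by rewrite [r ^+ n.+2]exprS [r ^+ n.+1]exprS; field; rewrite gt_eqF.
  rewrite -mulrA ler_wpM2l //=.
  by rewrite ler_wpM2r ?sqr_ge0 // lerXn2r // nnegrE ?normc_ge0 // ltW.
apply: le_trans (lerD A B) _.
have -> : r * (n%:R ^+ 2 * r ^+ n * k) + n%:R * r ^+ n.+1 * k = (n%:R ^+ 2 + n%:R) * (r ^+ n.+1 * k).
  by rewrite [r ^+ n.+1]exprS; ring.
rewrite -[leRHS]mulrA; apply: ler_wpM2r; first by rewrite mulr_ge0 ?exprn_ge0 ?(ltW r0).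
rewrite -[n.+1%:R]natr1 sqrrD.
have : (0 : R) <= n%:R by []. 
by rewrite mulr1 expr1n; lra.
Qed.

(** Termwise differentiation with a quadratic error: the Taylor remainders of the monomials sum
    against n^2 |a_n| r^n, which is still geometric because [subexp] survives multiplication by
    n. *)
Lemma psum_cdiff a z : subexp a -> normc z < 1 -> cdiff (psum a) z (psum (pderiv a) z).
Proof.
move=> ha z1; pose r := (1 + normc z) / 2.
have nz := normc_ge0 z.
have r0 : 0 < r by rewrite /r; lra.
have r1 : r < 1 by rewrite /r; lra.
have [C [q [C0 q0 q1 Hn _]]] := psum_unif (subexp_mulnat (subexp_mulnat ha)) (ltW r0) r1.
have q1' : 0 < 1 - q by lra.
pose B := C / (1 - q) / r ^+ 2.
have B0 : 0 <= B by rewrite !divr_ge0 ?sqr_ge0 // ltW.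
have key h : normc (z + h) <= r ->
    normc (psum a (z + h) - psum a z - psum (pderiv a) z * h) <= B * normc h ^+ 2.
  move=> zhr; have zh1 : normc (z + h) < 1 by lra.
  apply/ler_addgt0Pl => e e0.
  have nh := normc_ge0 h.
  (* The allowance [e] is shared between three truncation errors, the last of which is multiplied by
     h. *)
  have e3 : 0 < e / (3 * (1 + normc h)) by rewrite divr_gt0 // mulr_gt0 //; lra.
  have [N1 H1] := psum_cseries ha zh1 e3.
  have [N2 H2] := psum_cseries ha z1 e3.
  have [N3 H3] := psum_cseries (subexp_pderiv ha) z1 e3.
  pose N := maxn N1 (maxn N2 N3).
  have {}H1 := H1 N.+1 (leqW (leq_maxl _ _)).
  have {}H2 := H2 N.+1 (leqW (leq_trans (leq_maxl _ _) (leq_maxr _ _))).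
  have {}H3 := H3 N (leq_trans (leq_maxr _ _) (leq_maxr _ _)).
  set P1 := \sum_(n < N.+1) _ in H1; set P2 := \sum_(n < N.+1) _ in H2.
  set P3 := \sum_(n < N) _ in H3.
  have -> : psum a (z + h) - psum a z - psum (pderiv a) z * h =
     (psum a (z + h) - P1) - (psum a z - P2) - (psum (pderiv a) z - P3) * h + (P1 - P2 - P3 * h).
    by move: (psum _ _) (psum a z) (psum _ z) P1 P2 P3 {H1 H2 H3} => *; ring.
  have PP : P1 - P2 - P3 * h = \sum_(n < N.+1) a n * ((z + h) ^+ n - z ^+ n - n%:R * z ^+ n.-1 * h).
    have -> : P3 * h = \sum_(n < N.+1) a n * (n%:R * z ^+ n.-1 * h).
      rewrite big_ord_recl /= !mul0r mulr0 add0r /P3 mulr_suml; apply: eq_bigr => n _.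
      by rewrite /pderiv /bump /= add1n; ring.
    by rewrite -!sumrB; apply: eq_bigr => n _; ring.
  have PB : normc (P1 - P2 - P3 * h) <= B * normc h ^+ 2.
    rewrite PP; apply: le_trans (normc_sum _ _ _) _.
    apply: (@le_trans _ _ (\sum_(n < N.+1) (C * q ^+ n) * (normc h ^+ 2 / r ^+ 2))).
      apply: ler_sum => n _; rewrite normcM.
      apply: (@le_trans _ _ (normc (a n) * (n%:R ^+ 2 * r ^+ n * (normc h ^+ 2 / r ^+ 2)))).
        by rewrite ler_wpM2l ?normc_ge0 // expr_taylor_le // /r; lra.
      rewrite (_ : normc (a n) * _ = normc (n%:R * (n%:R * a n) * (r%:C) ^+ n) * (normc h ^+ 2 / r ^+ 2)); last first.
        by rewrite !normcM normcX normcR ger0_norm ?(ltW r0) // normc_nat; ring.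
      rewrite ler_wpM2r ?divr_ge0 ?sqr_ge0 //; apply: Hn.
      by rewrite normcR ger0_norm // ltW.
    rewrite -mulr_suml -mulr_sumr /B.
    rewrite -(big_mkord xpredT (fun n => q ^+ n)).
    have G := geometric_sum_le 0 N.+1 q0 q1; rewrite expr0 div1r in G.
    rewrite (_ : C / (1 - q) / r ^+ 2 * normc h ^+ 2 = C * (1 - q)^-1 * (normc h ^+ 2 / r ^+ 2)); last by ring.
    by rewrite ler_wpM2r ?divr_ge0 ?sqr_ge0 // ler_wpM2l.
  apply: le_trans (normcD _ _) _; apply: lerD => //.
  apply: le_trans (normcB _ _) _; rewrite normcM.
  have := normcB (psum a (z + h) - P1) (psum a z - P2).
  have H3' : normc (psum (pderiv a) z - P3) * normc h <= e / (3 * (1 + normc h)) * normc h by rewrite ler_wpM2r.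
  have : e / (3 * (1 + normc h)) * (3 * (1 + normc h)) = e by rewrite divfK // gt_eqF // mulr_gt0 //; lra.
  set g := e / _ in e3 H1 H2 H3' *. 
  by move: H1 H2 H3'; nra.
move=> e e0; exists (Num.min ((1 - normc z) / 2) (e / (B + 1))).
  by rewrite lt_min; apply/andP; split; rewrite divr_gt0 //; lra.
move=> h; rewrite lt_min => /andP[h1 h2].
have nh := normc_ge0 h.
apply: le_trans (key h _) _; first by apply: le_trans (normcD _ _) _; rewrite /r; lra.
rewrite expr2 mulrA ler_wpM2r //.
rewrite ltr_pdivlMr in h2; last by lra.
nra.
Qed.

End ComplexSeries.

(** * Area measure in the variable |z|^2 *)

Section RadialPart.
Variable R : realType.
Local Notation mu := (@lebesgue_measure R).
Local Notation mu2 := ((@lebesgue_measure R \x @lebesgue_measure R)%E).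
Implicit Types (F : plane R -> \bar R) (t c : R).

Definition nsq (p : plane R) : R := p.1 ^+ 2 + p.2 ^+ 2.

Lemma nsqE p : nsq p = normc (cpx p) ^+ 2.
Proof. by rewrite normc_sqr. Qed.

Lemma nsq_ge0 p : 0 <= nsq p.
Proof. by rewrite addr_ge0 ?sqr_ge0. Qed.

Lemma measurable_nsq : measurable_fun [set: plane R] nsq.
Proof. by apply: measurable_funD; apply: measurable_funX. Qed.

Lemma disc_nsq : @disc R = [set p | nsq p < 1].
Proof.
apply/seteqP; split=> p; rewrite /disc /cdisc /= nsqE => h.
  by rewrite -(expr1n R 2) ltr_sqr ?nnegrE ?normc_ge0.
by rewrite -ltr_sqr ?nnegrE ?normc_ge0 // expr1n.
Qed.

Lemma measurable_nsq_set (A : set R) : measurable A -> measurable (nsq @^-1` A).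
Proof. by move=> mA; rewrite -[X in measurable X]setTI; exact: measurable_nsq. Qed.

Lemma measurable_disc : measurable (@disc R).
Proof.
rewrite disc_nsq (_ : [set p | _] = nsq @^-1` `]-oo, 1%R[); first exact: measurable_nsq_set.
by apply/seteqP; split=> p /=; rewrite in_itv.
Qed.

Lemma ge0_integral_dA_rot F t : 1 + cos t != 0 -> measurable_fun [set: plane R] F ->
  (forall p, 0 <= F p)%E -> (\int[@dA R]_p F (rot t p) = \int[@dA R]_p F p)%E.
Proof.
move=> ct mF F0; rewrite !ge0_integral_dA // ?ge0_integral_rot //.
by apply: measurableT_comp => //; exact: measurable_rot.
Qed.

Definition kappa : R := fine (@dA R (nsq @^-1` `]-oo, 1%R])).

Let sq_meas (a : R) : measurable ([set p : plane R | `|p.1| <= a /\ `|p.2| <= a]).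
Proof.
have -> : [set p : plane R | `|p.1| <= a /\ `|p.2| <= a] = `[(- a)%R, a]%classic `*` `[(- a)%R, a]%classic.
  by apply/seteqP; split=> p /=; rewrite !in_itv /= !ler_norml.
exact: measurableX.
Qed.

Let dA_sq (a : R) : 0 < a -> @dA R [set p : plane R | `|p.1| <= a /\ `|p.2| <= a] = (pi^-1 * (2 * a) ^+ 2)%:E.
Proof.
move=> a0.
have -> : [set p : plane R | `|p.1| <= a /\ `|p.2| <= a] = `[(- a)%R, a]%classic `*` `[(- a)%R, a]%classic.
  by apply/seteqP; split=> p /=; rewrite !in_itv /= !ler_norml.
have L : mu `[(- a)%R, a]%classic = (2 * a)%:E.
  rewrite lebesgue_measure_itv /= lte_fin ifT; last by lra.
  by rewrite -EFinD; congr (_%:E); ring.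
transitivity ((pi^-1)%:E * mu2 (`[(- a)%R, a]%classic `*` `[(- a)%R, a]%classic))%E; first by [].
rewrite product_measure1E; [|exact: measurable_itv|exact: measurable_itv].
transitivity ((pi^-1)%:E * ((2 * a)%:E * (2 * a)%:E))%E; first by rewrite -L.
by rewrite -!EFinM.
Qed.

Let dA_unit_fin : (@dA R (nsq @^-1` `]-oo, 1%R]) < +oo)%E.
Proof.
apply: (@le_lt_trans _ _ (@dA R [set p : plane R | `|p.1| <= 1 /\ `|p.2| <= 1])).
  apply: le_measure; rewrite ?inE //; first exact: measurable_nsq_set.
  move=> p; rewrite /= in_itv /= /nsq => h.
  have h1 := sqr_ge0 p.1; have h2 := sqr_ge0 p.2.
  by split; rewrite -ler_sqr ?nnegrE // real_normK ?num_real // expr1n; lra.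
by rewrite dA_sq // ltry.
Qed.

Lemma kappa_gt0 : 0 < kappa.
Proof.
have h : ((pi^-1 * (2 * 2^-1) ^+ 2)%:E <= @dA R (nsq @^-1` `]-oo, 1%R]))%E.
  rewrite -dA_sq ?invr_gt0 //; apply: le_measure; rewrite ?inE //; first exact: measurable_nsq_set.
  move=> p [/= h1 h2]; rewrite /= in_itv /= /nsq.
  rewrite -(real_normK (num_real p.1)) -(real_normK (num_real p.2)).
  have := normr_ge0 p.1; have := normr_ge0 p.2; nra.
have f : @dA R (nsq @^-1` `]-oo, 1%R]) \is a fin_num by rewrite ge0_fin_numE.
rewrite -(fineK f) lee_fin divff ?pnatr_eq0 // expr1n mulr1 in h.
by apply: lt_le_trans h; rewrite invr_gt0 pi_gt0.
Qed.

(** Dilation by sqrt t: the measure of a disc is proportional to the square of its radius, and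
    [kappa] is the factor. *)
Let dA_le (t : R) : 0 < t -> @dA R (nsq @^-1` `]-oo, t]) = (kappa * t)%:E.
Proof.
move=> t0; have st : 0 < Num.sqrt t by rewrite sqrtr_gt0.
have f : @dA R (nsq @^-1` `]-oo, 1%R]) \is a fin_num by rewrite ge0_fin_numE.
have ind (A : set (plane R)) : measurable A -> @dA R A = (\int[@dA R]_p (\1_A p)%:E)%E.
  by move=> mA; rewrite integral_indic // setIT.
have mI (A : set (plane R)) : measurable A -> measurable_fun [set: plane R] (fun p => (\1_A p)%:E : \bar R).
  by move=> mA; apply/measurable_EFinP; exact: measurable_indic.
have mt := measurable_nsq_set (measurable_itv `]-oo, t]).
have m1 := measurable_nsq_set (measurable_itv `]-oo, 1%R]).
rewrite EFinM /kappa fineK // !ind // !ge0_integral_dA //; try exact: mI.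
rewrite -muleA; congr (_ * _)%E.
rewrite -(ge0_integral_scale2 st) //; last exact: mI.
rewrite sqr_sqrtr ?(ltW t0) // muleC; congr (_ * _)%E.
apply: eq_integral => p _; congr (_%:E); rewrite !indicE; congr (nat_of_bool _)%:R.
apply/idP/idP; rewrite !inE /= !in_itv /= /nsq !exprMn sqr_sqrtr ?(ltW t0) // -mulrDr.
  by rewrite ger_pMr.
by rewrite ger_pMr.
Qed.

Let dA_le0 (t : R) : t <= 0 -> @dA R (nsq @^-1` `]-oo, t]) = 0%E.
Proof.
move=> t0; apply/eqP; rewrite eq_le measure_ge0 andbT; apply/lee_addgt0Pr => e e0; rewrite add0e.
have k0 := kappa_gt0.
have ek : 0 < e / kappa by rewrite divr_gt0.
apply: (@le_trans _ _ (@dA R (nsq @^-1` `]-oo, (e / kappa)%R]))).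
  apply: le_measure; rewrite ?inE //; try exact: measurable_nsq_set.
  by move=> p /=; rewrite !in_itv /= => h; lra.
by rewrite dA_le // mulrC divfK // gt_eqF.
Qed.

Let dA_leE (t : R) : @dA R (nsq @^-1` `]-oo, t]) = (kappa * Num.max t 0)%:E.
Proof.
have [t0|t0] := ltP 0 t; first by rewrite dA_le.
by rewrite dA_le0 // mulr0.
Qed.

Let dA_ocitv (a b : R) : a <= b ->
  @dA R (nsq @^-1` `]a, b]) = (kappa * (Num.max b 0 - Num.max a 0))%:E.
Proof.
move=> ab.
have -> : nsq @^-1` `]a, b] = (nsq @^-1` `]-oo, b]) `\` (nsq @^-1` `]-oo, a]).
  apply/seteqP; split=> p /=; rewrite !in_itv /=.
    by move=> /andP[h1 h2]; split=> //; rewrite leNgt h1.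
  by move=> [h1 /negP]; rewrite -ltNge h1 andbT.
have mb := measurable_nsq_set (measurable_itv `]-oo, b]).
have ma := measurable_nsq_set (measurable_itv `]-oo, a]).
have hfin : (@dA R (nsq @^-1` `]-oo, b]) < +oo)%E by rewrite dA_leE ltry.
have e : nsq @^-1` `]-oo, b] `&` nsq @^-1` `]-oo, a] = nsq @^-1` `]-oo, a].
  by rewrite -preimage_setI; congr (_ @^-1` _); apply/seteqP; split=> t /=; rewrite !in_itv /=; [case|move=> h; split=> //; lra].
transitivity (@dA R (nsq @^-1` `]-oo, b]) - @dA R (nsq @^-1` `]-oo, b] `&` nsq @^-1` `]-oo, a]))%E.
  exact: measureD mb ma hfin.
by rewrite e !dA_leE -EFinB -mulrBr.
Qed.

(* The image of dA under the squared modulus is kappa times Lebesgue measure on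
   the half-line; kappa is 1, but its value never matters. *)
Lemma ge0_integral_radial (h : R -> \bar R) : measurable_fun [set: R] h ->
  (forall t : R, (0 <= t)%R -> (0 <= h t)%E) ->
  (\int[@dA R]_(p in @disc R) h (nsq p) = kappa%:E * \int[mu]_(t in `[0%R, 1%R[) h t)%E.
Proof.
move=> mh h0; have k0 := kappa_gt0.
have mn : measurable_fun [set: plane R] (nsq : plane R -> measurableTypeR R) by exact: measurable_nsq.
have dE : @disc R = nsq @^-1` (`[0%R, 1%R[%classic : set (measurableTypeR R)).
  by rewrite disc_nsq; apply/seteqP; split=> p /=; rewrite in_itv /= nsq_ge0.
rewrite dE -(@ge0_integral_pushforward _ _ _ _ _ _ mn (@dA R) _ h) //; last 2 first.
- exact: measurable_funTS.
- by move=> t; rewrite inE /= in_itv /= => /andP[t0 _]; exact: h0.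
rewrite -[kappa]/(NngNum (ltW k0))%:num -ge0_integral_mscale //; last 2 first.
- exact: measurable_funTS.
- by move=> t /=; rewrite in_itv /= => /andP[t0 _]; exact: h0.
have mneg : measurable (`]-oo, 0%R]%classic : set (measurableTypeR R)) by exact: measurable_itv.
have k1 : 0 <= kappa^-1 by rewrite invr_ge0 ltW.
pose m1 : {measure set (measurableTypeR R) -> \bar R} :=
  measure_function_pushforward__canonical__measure_function_Measure (@dA R) mn.
pose m2 : {measure set (measurableTypeR R) -> \bar R} := mscale (NngNum (ltW k0)) (mrestr mu mneg).
(* Uniqueness of Lebesgue measure speaks of the whole line. The push-forward vanishes on the
   negative half-line, so it is completed there by [kappa] times Lebesgue measure, and the sum is
   divided by [kappa]. *)
pose m3 : {measure set (measurableTypeR R) -> \bar R} := mscale (NngNum k1) (measure_add m1 m2).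
have m3E A : m3 A = ((kappa^-1)%:E * (@dA R (nsq @^-1` A) + kappa%:E * mu (A `&` `]-oo, 0%R])))%E.
  transitivity ((kappa^-1)%:E * (measure_add m1 m2) A)%E; first by [].
  by rewrite measure_addE.
have H A : measurable A -> mu A = m3 A.
  move=> mA; apply: lebesgue_measure_unique => // X [[a b]] _ <-; rewrite m3E /=.
  have [ab|ab] := leP a b; last first.
    rewrite set_itv_ge; last by rewrite bnd_simp -leNgt ltW.
    by rewrite set0I preimage_set0 !measure0 mule0 add0e mule0.
  rewrite dA_ocitv //.
  have -> : mu (`]a, b]%classic `&` `]-oo, 0%R]) = (Num.min b 0 - Num.min a 0)%:E.
    rewrite (_ : _ `&` _ = `]a, (Num.min b 0)]%classic); last first.
      by apply/seteqP; split=> t /=; rewrite !in_itv /= le_min;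
        [move=> [/andP[-> ->] ->]|move=> /and3P[-> -> ->]].
    rewrite lebesgue_measure_itv /= lte_fin lt_min.
    have [a0|a0] := ltP a 0; last by rewrite andbF (min_r (le_trans a0 ab)) subrr.
    rewrite andbT; move: a0; move: ab; rewrite le_eqVlt => /predU1P[->|->] a0; last by rewrite -EFinB.
    by rewrite ltxx min_l ?subrr // ltW.
  transitivity ((kappa^-1 * (kappa * (Num.max b 0 - Num.max a 0) +
     kappa * (Num.min b 0 - Num.min a 0)))%:E); last by [].
  rewrite lebesgue_measure_itv /= lte_fin.
  rewrite (_ : (if _ then _ else _) = (b - a)%:E); last first.
    by case: ifPn => //; rewrite -leNgt => ba; rewrite (_ : b = a) ?subrr //; lra.
  congr (_%:E); rewrite -[in RHS]mulrDr mulKf ?gt_eqF //.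
  by have [b0|b0] := leP b 0; have [a0|a0] := leP a 0; lra.
apply: eq_measure_integral => A mA A01.
transitivity (@dA R (nsq @^-1` A)); first by [].
transitivity (kappa%:E * mu A)%E; last by [].
rewrite (H A mA) m3E muleA -EFinM divff ?gt_eqF // mul1e.
rewrite [X in (_ + X)%E](_ : _ = 0%E) ?adde0 //.
rewrite [mu _](_ : _ = 0%E) ?mule0 //.
apply/eqP; rewrite eq_le measure_ge0 andbT -(lebesgue_measure_set1 (0 : R)).
apply: le_measure; rewrite ?inE //; first exact: measurableI.
move=> t [/A01 /=]; rewrite !in_itv /= => /andP[t0 _] t0'.
by apply: le_anti; rewrite t0 t0'.
Qed.

End RadialPart.

(** * Complex integrals *)

Section ComplexMeasurable.
Context d (T : measurableType d) (R : realType).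
Variable D : set T.
Implicit Types (f g : T -> R[i]).

Definition cmeas f := measurable_fun D (fun x => Re (f x)) /\ measurable_fun D (fun x => Im (f x)).

Lemma cmeas_cst (c : R[i]) : cmeas (fun=> c).
Proof. by split; exact: measurable_cst. Qed.

Lemma cmeasD f g : cmeas f -> cmeas g -> cmeas (fun x => f x + g x).
Proof.
move=> [f1 f2] [g1 g2]; split; under eq_fun do rewrite ?cReD ?cImD; exact: measurable_funD.
Qed.

Lemma cmeasN f : cmeas f -> cmeas (fun x => - f x).
Proof.
by move=> [f1 f2]; split; under eq_fun do rewrite ?cReN ?cImN; exact: measurableT_comp.
Qed.

Lemma cmeasB f g : cmeas f -> cmeas g -> cmeas (fun x => f x - g x).
Proof. by move=> hf hg; apply: cmeasD => //; exact: cmeasN. Qed.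

Lemma cmeasM f g : cmeas f -> cmeas g -> cmeas (fun x => f x * g x).
Proof.
move=> [f1 f2] [g1 g2]; split; under eq_fun do rewrite ?cReM ?cImM.
  by apply: measurable_funB; apply: measurable_funM.
by apply: measurable_funD; apply: measurable_funM.
Qed.

Lemma cmeasJ f : cmeas f -> cmeas (fun x => (f x)^*).
Proof.
move=> [f1 f2]; split; first by under eq_fun do rewrite cReJ.
by under eq_fun do rewrite cImJ; exact: measurableT_comp.
Qed.

Lemma cmeasX f n : cmeas f -> cmeas (fun x => f x ^+ n).
Proof.
move=> hf; elim: n => [|n IH].
  by under eq_fun do rewrite expr0; exact: cmeas_cst.
by under eq_fun do rewrite exprS; exact: cmeasM.
Qed.

Lemma cmeas_sum I (r : seq I) (P : pred I) (f : I -> T -> R[i]) :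
  (forall i, cmeas (f i)) -> cmeas (fun x => \sum_(i <- r | P i) f i x).
Proof.
move=> hf; elim: r => [|j r IH].
  by under eq_fun do rewrite big_nil; exact: cmeas_cst.
under eq_fun do rewrite big_cons; case: (P j) => //.
exact: cmeasD.
Qed.

Lemma cmeasR (h : T -> R) : measurable_fun D h -> cmeas (fun x => (h x)%:C).
Proof. by move=> hh; split=> //; exact: measurable_cst. Qed.

Lemma measurable_normc f : cmeas f -> measurable_fun D (fun x => normc (f x)).
Proof.
move=> [f1 f2].
have -> : (fun x => normc (f x)) = (fun x => Num.sqrt (Re (f x) ^+ 2 + Im (f x) ^+ 2)).
  by apply/funext => x; case: (f x).
apply: (measurableT_comp (f := @Num.sqrt R)); last first.
  by apply: measurable_funD; apply: measurable_funX.
apply: continuous_measurable_fun; exact: sqrt_continuous.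
Qed.

Lemma eq_cmeas f g : (forall x, D x -> f x = g x) -> cmeas f -> cmeas g.
Proof.
move=> fg [f1 f2]; split; [apply: eq_measurable_fun f1|apply: eq_measurable_fun f2];
  by move=> x /set_mem /fg ->.
Qed.

Lemma cmeas_cvg (f : nat -> T -> R[i]) g : (forall n, cmeas (f n)) ->
  (forall x, D x -> forall e : R, 0 < e -> exists N0, forall N, (N0 <= N)%N -> normc (g x - f N x) <= e) ->
  cmeas g.
Proof.
move=> hf hg; split.
  apply: (measurable_fun_cvg (fun n => (hf n).1)) => x Dx; apply/cvgrPdist_le => e e0.
  have [N0 HN] := hg x Dx e e0; exists N0 => // N /= /HN; apply: le_trans.
  by rewrite -cReN -cReD normc_Re.
apply: (measurable_fun_cvg (fun n => (hf n).2)) => x Dx; apply/cvgrPdist_le => e e0.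
have [N0 HN] := hg x Dx e e0; exists N0 => // N /= /HN; apply: le_trans.
by rewrite -cImN -cImD normc_Im.
Qed.

End ComplexMeasurable.

Section ComplexIntegral.
Context d (T : measurableType d) (R : realType).
Variables (m : {measure set T -> \bar R}) (D : set T).
Hypothesis mD : measurable D.
Implicit Types (f g : T -> R[i]) (c : R[i]).

Definition cintble f := m.-integrable D (fun x => (Re (f x))%:E) /\ m.-integrable D (fun x => (Im (f x))%:E).

Lemma cintble_cmeas f : cintble f -> cmeas D f.
Proof.
by move=> [/measurable_int/measurable_EFinP f1 /measurable_int/measurable_EFinP f2].
Qed.

Lemma cintbleD f g : cintble f -> cintble g -> cintble (fun x => f x + g x).
Proof.
move=> [f1 f2] [g1 g2]; split.
  by under eq_fun do rewrite cReD EFinD; exact: integrableD.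
by under eq_fun do rewrite cImD EFinD; exact: integrableD.
Qed.

Lemma cintbleZ c f : cintble f -> cintble (fun x => c * f x).
Proof.
move=> [f1 f2]; split.
  under eq_fun do rewrite cReM EFinB !EFinM; apply: integrableB => //; exact: integrableZl.
by under eq_fun do rewrite cImM EFinD !EFinM; apply: integrableD => //; exact: integrableZl.
Qed.

Lemma cintble0 : cintble (fun=> 0).
Proof. by split; exact: integrable0. Qed.

Lemma cintble_sum I (r : seq I) (P : pred I) (f : I -> T -> R[i]) :
  (forall i, P i -> cintble (f i)) -> cintble (fun x => \sum_(i <- r | P i) f i x).
Proof.
move=> hf; elim: r => [|j r IH].
  by under eq_fun do rewrite big_nil; exact: cintble0.
under eq_fun do rewrite big_cons; case Pj: (P j) => //.
by apply: cintbleD => //; exact: hf.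
Qed.

Lemma eq_cintble f g : (forall x, D x -> f x = g x) -> cintble f -> cintble g.
Proof.
move=> fg [f1 f2]; split; [apply: eq_integrable f1|apply: eq_integrable f2] => //;
  by move=> x /set_mem /fg ->.
Qed.

Lemma eq_Cintegral f g : (forall x, D x -> f x = g x) -> Cintegral m D f = Cintegral m D g.
Proof.
by move=> fg; rewrite /Cintegral; congr (_ +i* _); apply: eq_Rintegral => x /set_mem /fg ->.
Qed.

Lemma CintegralD f g : cintble f -> cintble g ->
  Cintegral m D (fun x => f x + g x) = Cintegral m D f + Cintegral m D g.
Proof.
move=> [f1 f2] [g1 g2]; apply: eq_cplx; rewrite ?cReD ?cImD /= -RintegralD //.
  by apply: eq_Rintegral => x _; rewrite cReD.
by apply: eq_Rintegral => x _; rewrite cImD.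
Qed.

Lemma CintegralZ c f : cintble f -> Cintegral m D (fun x => c * f x) = c * Cintegral m D f.
Proof.
move=> [f1 f2]; apply: eq_cplx; rewrite ?cReM ?cImM /= -!RintegralZl //.
  rewrite -RintegralB //; last 2 first.
  - exact: (integrableZl mD (Re c) f1).
  - exact: (integrableZl mD (Im c) f2).
  by apply: eq_Rintegral => x _; rewrite cReM.
rewrite -RintegralD //; last 2 first.
- exact: (integrableZl mD (Re c) f2).
- exact: (integrableZl mD (Im c) f1).
by apply: eq_Rintegral => x _; rewrite cImM.
Qed.

Lemma Cintegral0 : Cintegral m D (fun=> 0 : R[i]) = 0.
Proof. by apply: eq_cplx; rewrite /= /Rintegral integral0. Qed.

Lemma Cintegral_sum I (r : seq I) (P : pred I) (f : I -> T -> R[i]) :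
  (forall i, P i -> cintble (f i)) ->
  Cintegral m D (fun x => \sum_(i <- r | P i) f i x) = \sum_(i <- r | P i) Cintegral m D (f i).
Proof.
move=> hf; elim: r => [|j r IH].
  by rewrite big_nil -[RHS]Cintegral0; apply: eq_Cintegral => x _; rewrite big_nil.
rewrite big_cons; case Pj: (P j); last first.
  by rewrite -IH; apply: eq_Cintegral => x _; rewrite big_cons Pj.
rewrite -IH -CintegralD; [|exact: hf|exact: cintble_sum].
by apply: eq_Cintegral => x _; rewrite big_cons Pj.
Qed.

Lemma CintegralN f : cintble f -> Cintegral m D (fun x => - f x) = - Cintegral m D f.
Proof.
by move=> hf; rewrite -mulN1r -CintegralZ //; apply: eq_Cintegral => x _; rewrite mulN1r.
Qed.

Lemma cintbleN f : cintble f -> cintble (fun x => - f x).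
Proof. by move=> hf; apply: eq_cintble (cintbleZ (-1) hf) => x _; rewrite mulN1r. Qed.

Lemma CintegralB f g : cintble f -> cintble g ->
  Cintegral m D (fun x => f x - g x) = Cintegral m D f - Cintegral m D g.
Proof. by move=> hf hg; rewrite CintegralD ?CintegralN //; exact: cintbleN. Qed.

Lemma cintbleB f g : cintble f -> cintble g -> cintble (fun x => f x - g x).
Proof. by move=> hf hg; apply: cintbleD => //; exact: cintbleN. Qed.

Lemma CintegralJ f : cintble f -> Cintegral m D (fun x => (f x)^*) = (Cintegral m D f)^*.
Proof.
move=> [f1 f2]; apply: eq_cplx; rewrite ?cReJ ?cImJ /=.
  by apply: eq_Rintegral => x _; rewrite cReJ.
rewrite -mulN1r -RintegralZl //; apply: eq_Rintegral => x _; rewrite cImJ mulN1r //.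
Qed.

Lemma cintbleP f : cmeas D f -> (\int[m]_(x in D) (normc (f x))%:E < +oo)%E -> cintble f.
Proof.
move=> [f1 f2] hfin; split; apply/integrableP; split; try exact/measurable_EFinP.
  apply: le_lt_trans hfin; apply: ge0_le_integral' => // x _.
  by rewrite lee_fin normc_Re.
apply: le_lt_trans hfin; apply: ge0_le_integral' => // x _.
by rewrite lee_fin normc_Im.
Qed.

Lemma cintble_normc f : cintble f -> m.-integrable D (fun x => (normc (f x))%:E).
Proof.
move=> hf; have [f1 f2] := hf.
apply: (@le_integrable _ _ _ _ _ mD _ (fun x => `|(Re (f x))%:E| + `|(Im (f x))%:E|)%E).
- by apply/measurable_EFinP; apply: measurable_normc; exact: cintble_cmeas.
- move=> x _; rewrite -!EFinD /= lee_fin ger0_norm ?normc_ge0 // ger0_norm ?addr_ge0 //.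
  exact: normc_leReIm.
- by apply: integrableD => //; exact: integrable_abse.
Qed.

(** A unimodular factor [u] turns the integral onto the positive axis, where it is the integral of a
    real part. *)
Lemma normc_Cintegral_le f : cintble f ->
  ((normc (Cintegral m D f))%:E <= \int[m]_(x in D) (normc (f x))%:E)%E.
Proof.
move=> hf; set S := Cintegral m D f.
have [S0|S0] := eqVneq S 0.
  by rewrite S0 normc0; apply: integral_ge0 => x _; rewrite lee_fin normc_ge0.
have nS : 0 < normc S by rewrite normc_gt0.
pose u := S^* / (normc S)%:C.
have nu : normc u = 1.
  by rewrite /u normc_div normcJ normcR ger0_norm ?normc_ge0 // divff // gt_eqF.
have uS : u * S = (normc S)%:C.
  rewrite /u mulrAC [S^* * S]mulrC -normc_mulJ -rmorphV ?unitfE ?gt_eqF //= -rmorphM /=.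
  by rewrite expr2 mulfK ?gt_eqF.
have := cintbleZ u hf => hu.
have -> : normc S = \int[m]_(x in D) (Re (u * f x)).
  by have := congr1 (@complex.Re R) uS; rewrite /S -CintegralZ //= => <-.
rewrite /Rintegral fineK; last by apply: integrable_fin_num => //; exact: hu.1.
apply: le_integral => //; first exact: hu.1.
  exact: cintble_normc.
move=> x _; rewrite lee_fin (le_trans (ler_norm _)) // (le_trans (normc_Re _)) //.
by rewrite normcM nu mul1r.
Qed.

Lemma cintble_bounded f (M : R) : cmeas D f -> (m D < +oo)%E ->
  (forall x, D x -> normc (f x) <= M) -> cintble f.
Proof.
move=> mf mDf fM; apply: cintbleP => //.
apply: (@le_lt_trans _ _ (\int[m]_(x in D) (cst (`|M|%:E) x))%E).
  apply: ge0_le_integral' => x Dx; first by rewrite lee_fin normc_ge0.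
  by rewrite lee_fin (le_trans (fM x Dx)) // ler_norm.
by rewrite integral_cst // lte_mul_pinfty // lee_fin.
Qed.

Lemma normc_Cintegral_bound f (M : R) : cmeas D f -> (m D < +oo)%E ->
  (forall x, D x -> normc (f x) <= M) -> 0 <= M ->
  normc (Cintegral m D f) <= M * fine (m D).
Proof.
move=> mf mDf fM M0; have hf := cintble_bounded mf mDf fM.
have fD : m D \is a fin_num by rewrite ge0_fin_numE.
rewrite -lee_fin EFinM fineK //; apply: le_trans (normc_Cintegral_le hf) _.
apply: (@le_trans _ _ (\int[m]_(x in D) (cst (M%:E) x))%E); last by rewrite integral_cst.
apply: ge0_le_integral' => x Dx; first by rewrite lee_fin normc_ge0.
by rewrite lee_fin fM.
Qed.

End ComplexIntegral.

(** * Forelli-Rudin estimates *)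

Section SigmaFiniteMeasureOf.
Context d (T : measurableType d) (R : realType) (m : {measure set T -> \bar R}).

(** A copy of [m] that carries the proof in its type, so that instance resolution finds
    sigma-finiteness when Fubini's theorem is applied to a measure such as [dA]. *)
Definition sigma_finite_of (_ : sigma_finite [set: T] m) : set T -> \bar R := m.

Variable h : sigma_finite [set: T] m.

HB.instance Definition _ := isMeasure.Build _ _ _ (sigma_finite_of h)
  (measure0 m) (measure_ge0 m) (@measure_semi_sigma_additive _ _ _ m).

HB.instance Definition _ := Measure_isSigmaFinite.Build _ _ _ (sigma_finite_of h) h.

End SigmaFiniteMeasureOf.

Section Tonelli.
Context d1 d2 (T1 : measurableType d1) (T2 : measurableType d2) (R : realType).
Variables (m1 : {measure set T1 -> \bar R}) (m2 : {measure set T2 -> \bar R}).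
Hypotheses (h1 : sigma_finite [set: T1] m1) (h2 : sigma_finite [set: T2] m2).
Variable f : T1 * T2 -> \bar R.
Hypotheses (mf : measurable_fun [set: T1 * T2] f) (f0 : forall x, (0 <= f x)%E).

Lemma ge0_tonelli :
  (\int[m1]_x \int[m2]_y f (x, y) = \int[m2]_y \int[m1]_x f (x, y))%E.
Proof.
exact: (fubini_tonelli (m1 := sigma_finite_of h1) (m2 := sigma_finite_of h2) f mf f0).
Qed.

Lemma measurable_fun_tonelli : measurable_fun [set: T1] (fun x => \int[m2]_y f (x, y))%E.
Proof. exact: (measurable_fun_fubini_tonelli_F (m2 := sigma_finite_of h2) f mf f0). Qed.

End Tonelli.

Lemma ge0_integral_flip (R : realType) (h : R -> \bar R) :
  measurable_fun [set: R] h -> (forall x : R, (0 <= h x)%E) ->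
  (\int[@lebesgue_measure R]_(t in `[0%R, 1%R[) h (1 - t)%R =
   \int[@lebesgue_measure R]_(x in `]0%R, 1%R]) h x)%E.
Proof.
move=> mh h0; pose k x : \bar R := if (0 < x <= 1)%R then h x else 0%E.
have e1 : (\int[@lebesgue_measure R]_(x in `]0%R, 1%R]) h x = \int[@lebesgue_measure R]_x k x)%E.
  rewrite integral_mkcond; apply: eq_integral => x _; rewrite patchE /k.
  have -> : (x \in `]0%R, 1%R]%classic) = (0 < x <= 1)%R by apply/idP/idP; rewrite inE /= in_itv.
  by case: ifP.
have e2 : (\int[@lebesgue_measure R]_(t in `[0%R, 1%R[) h (1 - t)%R = \int[@lebesgue_measure R]_x k (- x + 1)%R)%E.
  rewrite integral_mkcond; apply: eq_integral => x _; rewrite patchE /k [1 - x]addrC.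
  have -> : (x \in `[0%R, 1%R[%classic) = (0 < - x + 1 <= 1)%R.
    by apply/idP/idP; rewrite inE /= in_itv /= => /andP[h1 h2]; apply/andP; split; lra.
  by case: ifP.
have mk : measurable_fun [set: R] k.
  apply: measurable_fun_ifT => //.
  rewrite (_ : (fun x : R => _) = (fun x : R => (0 < x) && (x <= 1))%R) //.
  by apply: measurable_and; [exact: measurable_fun_ltr|exact: measurable_fun_ler].
have k0 x : (0 <= k x)%E by rewrite /k; case: ifP.
have mk1 : measurable_fun [set: R] (fun x : R => k (x + 1)%R).
  by apply: (measurableT_comp mk); exact: measurable_funD.
rewrite e1 e2 -(ge0_integral_lebesgue_shift 1 mk k0).
exact: (ge0_integral_lebesgue_opp mk1 (fun x => k0 (x + 1)%R)).
Qed.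

Section ForelliRudin.
Variable R : realType.
Local Notation mu := (@lebesgue_measure R).
Local Notation mu2 := ((@lebesgue_measure R \x @lebesgue_measure R)%E).
Implicit Types (z y : R[i]).

Lemma cArg_polar z : `|cArg z| <= pi /\ z = (normc z)%:C * cis (cArg z).
Proof.
have nz0 := normc_ge0 z.
have cz : -1 <= Re z / normc z <= 1.
  have [->|z0] := eqVneq (normc z) 0; first by rewrite invr0 mulr0 lerN10 ler01.
  have nz : 0 < normc z by rewrite lt_neqAle eq_sym z0.
  have := normc_Re z; rewrite ler_norml => /andP[h1 h2].
  by rewrite ler_pdivrMr // ler_pdivlMr // mulN1r mul1r h1 h2.
have [/andP[a0 api] ca] := acos_def cz; rewrite /cArg; set al := acos _ in a0 api ca *.
split; first by case: ifP => _; rewrite ?normrN ger0_norm.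
have [z0|z0] := eqVneq z 0; first by rewrite {1}z0 z0 normc0 mul0r.
have nz : 0 < normc z by rewrite normc_gt0.
have s2 : sin al ^+ 2 = (Im z / normc z) ^+ 2.
  rewrite sin2cos2 ca -[1](divff (x := normc z ^+ 2)) ?expf_neq0 ?gt_eqF //.
  by rewrite !expr_div_n -mulrBl {1}normc_sqr; congr (_ / _); ring.
have sal : 0 <= sin al by rewrite sin_ge0_pi // a0.
have [I0|I0] := leP 0 (Im z).
  apply: eq_cplx; rewrite ?cReM ?cImM /= ?mul0r ?subr0 ?addr0.
    by rewrite ca mulrC divfK ?gt_eqF.
  have -> : sin al = Im z / normc z.
    by apply/eqP; rewrite -(@eqrXn2 _ 2) ?divr_ge0 ?normc_ge0 // s2.
  by rewrite mulrC divfK ?gt_eqF.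
apply: eq_cplx; rewrite ?cReM ?cImM /= ?mul0r ?subr0 ?addr0.
  by rewrite cosN ca mulrC divfK ?gt_eqF.
have -> : sin (- al) = Im z / normc z.
  rewrite sinN; apply: oppr_inj; rewrite opprK.
  by apply/eqP; rewrite -(@eqrXn2 _ 2) ?sqrrN ?s2 // -mulNr divr_ge0 ?normc_ge0 // oppr_ge0 ltW.
by rewrite mulrC divfK ?gt_eqF.
Qed.

Lemma polar_form z : exists alpha : R, `|alpha| <= pi /\ z = (normc z)%:C * cis alpha.
Proof. by exists (cArg z); exact: cArg_polar. Qed.

Lemma normc_1Bcis_ge (x : R) : `|x| <= pi -> `|x| / 4 <= normc (1 - cis x).
Proof.
move=> xpi.
have h : normc (1 - cis x) ^+ 2 = 4 * sin (x / 2) ^+ 2.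
  rewrite normc_sqr !cReD !cImD !cReN !cImN /= sub0r sqrrN.
  have -> : (1 - cos x) ^+ 2 + sin x ^+ 2 = 2 - 2 * cos x + (cos x ^+ 2 + sin x ^+ 2 - 1) by ring.
  rewrite cos2Dsin2 subrr addr0 {1}(_ : x = x / 2 + x / 2); last by field.
  by rewrite cosD sin2cos2 -!expr2 sin2cos2; ring.
have s : `|x| / 2 / 4 <= `|sin (x / 2)|.
  have [x0|x0] := leP 0 x.
    rewrite ger0_norm in xpi *; rewrite // ger0_norm; last first.
      by apply: sin_ge0_pi; apply/andP; split; have := pi_gt0 R; lra.
    by apply: sin_ge_quarter; lra.
  rewrite ltr0_norm // in xpi *.
  rewrite -normrN -sinN ger0_norm; last first.
    by apply: sin_ge0_pi; apply/andP; split; have := pi_gt0 R; lra.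
  by rewrite -mulNr; apply: sin_ge_quarter; lra.
rewrite -ler_sqr ?nnegrE ?normc_ge0 ?divr_ge0 // h -(real_normK (num_real (sin _))).
have := normr_ge0 x; nra.
Qed.

(** The radial distance 1 - r and the chord |1 - e^(ix)| are each controlled by |1 - r e^(ix)|, the
    chord with a factor 2 and the arc by 4 chords; 16 absorbs the sum. *)
Lemma normc_1Bmulcis_ge (r x : R) : 0 <= r -> r <= 1 -> `|x| <= pi ->
  ((1 - r) + `|x|) / 16 <= normc (1 - r%:C * cis x).
Proof.
move=> r0 r1 xpi.
have h1 : 1 - r <= normc (1 - r%:C * cis x).
  have := ler_normcB 1 (r%:C * cis x).
  by rewrite normc1 normcM normc_cis mulr1 normcR ger0_norm.
have h2 : normc (1 - cis x) <= 2 * normc (1 - r%:C * cis x).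
  have -> : 1 - cis x = (1 - r%:C * cis x) - (1 - r)%:C * cis x.
    by rewrite rmorphB /=; ring.
  apply: le_trans (normcB _ _) _.
  by rewrite [normc (_%:C * _)]normcM normc_cis mulr1 normcR ger0_norm ?subr_ge0 //; lra.
have := normc_1Bcis_ge xpi; have := normr_ge0 x; lra.
Qed.

Lemma measurable_normc1B_cis y : measurable_fun [set: R] (fun th : R => normc (1 - y * cis (- th))).
Proof.
apply: measurable_normc; apply: cmeasB; first exact: cmeas_cst.
apply: cmeasM; first exact: cmeas_cst.
by split; apply: (measurableT_comp (f := _ : R -> R)); [|exact: oppr_measurable| |exact: oppr_measurable];
  apply: continuous_measurable_fun; [exact: continuous_cos|exact: continuous_sin].
Qed.

(** After rotating y to the positive axis the integrand is at most a constant times (1 - |y| +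
    |x|)^-p, whose integral over the line is explicit. *)
Lemma angular_integral_le (p : R) : 1 < p -> exists2 C : R, 0 <= C & forall y, normc y < 1 ->
  (\int[mu]_(th in `](- pi)%R, pi[) (normc (1 - y * cis (- th)) `^ (- p))%:E
     <= (C * (1 - normc y) `^ (1 - p))%:E)%E.
Proof.
move=> p1; exists (16 `^ p * 3 * (2 / (p - 1))).
  by rewrite !mulr_ge0 ?powR_ge0 ?invr_ge0 //; lra.
move=> y y1; have [alpha [al ya]] := polar_form y.
set S := 1 - normc y; have S0 : 0 < S by rewrite subr_gt0.
have ny := normc_ge0 y.
have pip := pi_gt0 R.
pose g (x : R) := ((fun x : R => ((S + `|x|) `^ (- p))%:E) \_ `[(- (5 * pi))%R, (5 * pi)%R]) x.
have mg : measurable_fun [set: R] g.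
  apply/(measurable_restrictT _ _).1 => //; apply/measurable_EFinP; apply: measurable_funTS.
  apply: (measurableT_comp (@measurable_powR R (- p))).
  by apply: measurable_funD => //; exact: normr_measurable.
have g0 x : (0 <= g x)%E by rewrite /g patchE; case: ifP => // _; rewrite lee_fin powR_ge0.
have Ig : (\int[mu]_x g x <= (2 * (S `^ (1 - p) / (p - 1)))%:E)%E.
  by rewrite /g -integral_mkcond; exact: integral_abs_shift_powR_le.
pose G (t c x : R) := g (x + c)%R.
have mG (c : R) : measurable_fun [set: R] (fun x => g (x + c)%R).
  by apply: measurableT_comp => //; exact: measurable_funD.
(* The angle x - alpha lies between -2 pi and 2 pi, so one of these three translates brings it into
   [-pi, pi]. Adding the three majorants covers all cases in one integral. *)
pose c0 := - alpha; pose c1 := - alpha + 2 * pi; pose c2 := - alpha - 2 * pi.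
have mS : measurable_fun [set: R] (fun x => (g (x + c1)%R + g (x + c2)%R)%E) := emeasurable_funD (mG c1) (mG c2).
apply: (@le_trans _ _ (\int[mu]_x ((16 `^ p)%:E * (g (x + c0)%R + (g (x + c1)%R + g (x + c2)%R))))%E).
  apply: ge0_le_integral_set => // [x _|x _|x /=].
  - by rewrite lee_fin powR_ge0.
  - by rewrite mule_ge0 ?lee_fin ?powR_ge0 // !adde_ge0.
  - rewrite in_itv /= => /andP[x1 x2].
    have key (c : R) : `|x + c| <= pi -> cis (alpha - x) = cis (- (x + c)) ->
        ((normc (1 - y * cis (- x)) `^ (- p))%:E <= (16 `^ p)%:E * g (x + c)%R)%E.
      move=> xc cE.
      have -> : 1 - y * cis (- x) = 1 - (normc y)%:C * cis (- (x + c)).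
        by rewrite {1}ya -mulrA -cisD cE.
      have h := normc_1Bmulcis_ge ny (ltW y1) (_ : `|- (x + c)| <= pi); rewrite normrN in h.
      have {}h := h xc; rewrite -/S in h.
      rewrite /g patchE ifT; last first.
        by rewrite inE /= in_itv /= -ler_norml; apply: le_trans xc _; lra.
      rewrite -EFinM lee_fin.
      have e16 : 16 `^ p * (S + `|x + c|) `^ (- p) = ((S + `|x + c|) / 16) `^ (- p).
        rewrite powRM ?invr_ge0 //; last by rewrite addr_ge0 // ltW.
        by rewrite -powR_inv1 // -powRrM mulN1r opprK mulrC.
      have pos : 0 < (S + `|x + c|) / 16 by rewrite divr_gt0 // ltr_pwDl.
      rewrite e16 !powRN lef_pV2 ?posrE ?powR_gt0 //; last exact: lt_le_trans h.
      by apply: ge0_ler_powR; rewrite ?nnegrE ?normc_ge0 ?(ltW pos) //; lra.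
    have P16 : (0 <= (16 `^ p)%:E :> \bar R)%E by rewrite lee_fin powR_ge0.
    move: al; rewrite ler_norml => /andP[al1 al2].
    have [h1|h1] := leP (x - alpha) (- pi).
      apply: le_trans (key c1 _ _) _.
      + by rewrite /c1 ler_norml; apply/andP; split; lra.
      + by rewrite -(cis2pi (- (x + c1))); congr cis; rewrite /c1; ring.
      + by apply: lee_wpmul2l => //; rewrite [leRHS]addeCA leeDl ?adde_ge0.
    have [h2|h2] := leP (x - alpha) pi.
      apply: le_trans (key c0 _ _) _.
      + by rewrite /c0 ler_norml; apply/andP; split; lra.
      + by congr cis; rewrite /c0; ring.
      + by apply: lee_wpmul2l => //; rewrite leeDl ?adde_ge0.
    apply: le_trans (key c2 _ _) _.
    + by rewrite /c2 ler_norml; apply/andP; split; lra.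
    + by rewrite -(cis2pi (alpha - x)); congr cis; rewrite /c2; ring.
    + by apply: lee_wpmul2l => //; rewrite addeA leeDr ?adde_ge0.
rewrite ge0_integralZl_EFin ?powR_ge0 //; last 2 first.
- by move=> x _; rewrite !adde_ge0.
- exact: emeasurable_funD (mG c0) mS.
have I3 : (\int[mu]_x (g (x + c0)%R + (g (x + c1)%R + g (x + c2)%R)) =
    \int[mu]_x g x + (\int[mu]_x g x + \int[mu]_x g x))%E.
  transitivity (\int[mu]_x g (x + c0)%R + (\int[mu]_x g (x + c1)%R + \int[mu]_x g (x + c2)%R))%E.
    rewrite (@ge0_integralD _ (measurableTypeR R) R mu setT measurableT
      (fun x : R => g (x + c0)%R) (fun x : R => (g (x + c1)%R + g (x + c2)%R)%E)
      (fun x _ => g0 (x + c0)) (mG c0) (fun x _ => adde_ge0 (g0 (x + c1)) (g0 (x + c2))) mS).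
    rewrite (@ge0_integralD _ (measurableTypeR R) R mu setT measurableT
      (fun x : R => g (x + c1)%R) (fun x : R => g (x + c2)%R)
      (fun x _ => g0 (x + c1)) (mG c1) (fun x _ => g0 (x + c2)) (mG c2)).
    by [].
  by rewrite !ge0_integral_lebesgue_shift.
apply: (@le_trans _ _ ((16 `^ p)%:E * (\int[mu]_x g x + (\int[mu]_x g x + \int[mu]_x g x)))%E).
  by rewrite -I3.
rewrite -!mulrA EFinM; apply: lee_wpmul2l; first by rewrite lee_fin powR_ge0.
apply: le_trans (leeD Ig (leeD Ig Ig)) _.
by rewrite -!EFinD lee_fin /S le_eqVlt; apply/orP; left; apply/eqP; ring.
Qed.

Lemma cmeas_cpx (D : set (plane R)) : cmeas D (@cpx R).
Proof. by split; apply: measurable_funTS; [exact: measurable_fst|exact: measurable_snd]. Qed.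

Lemma nsq_rot t (p : plane R) : nsq (rot t p) = nsq p.
Proof. by rewrite !nsqE cpx_rot normcM normc_cis mul1r. Qed.

Lemma measurable_rot_pair : measurable_fun [set: plane R * measurableTypeR R]
  (fun q : plane R * measurableTypeR R => rot q.2 q.1).
Proof.
have m1 : measurable_fun [set: plane R * measurableTypeR R] (fun q : plane R * measurableTypeR R => q.1.1).
  exact: (measurableT_comp (@measurable_fst _ _ _ _) (@measurable_fst _ _ _ _)).
have m2 : measurable_fun [set: plane R * measurableTypeR R] (fun q : plane R * measurableTypeR R => q.1.2).
  exact: (measurableT_comp (@measurable_snd _ _ _ _) (@measurable_fst _ _ _ _)).
have mc : measurable_fun [set: plane R * measurableTypeR R] (fun q : plane R * measurableTypeR R => cos q.2).
  apply: (measurableT_comp (f := @cos R)) => //.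
  by apply: continuous_measurable_fun; exact: continuous_cos.
have ms : measurable_fun [set: plane R * measurableTypeR R] (fun q : plane R * measurableTypeR R => sin q.2).
  apply: (measurableT_comp (f := @sin R)) => //.
  by apply: continuous_measurable_fun; exact: continuous_sin.
apply: measurable_fun_pair.
  by apply: measurable_funB; exact: measurable_funM.
by apply: measurable_funD; exact: measurable_funM.
Qed.

Lemma cos_gtN1 (t : R) : - pi < t -> t < pi -> 1 + cos t != 0.
Proof.
move=> t1 t2; have pip := pi_gt0 R.
have : cos pi < cos `|t|.
  have tp : `|t| < pi by rewrite ltr_norml t1 t2.
  have i1 : pi \in `[0, (pi : R)] by rewrite in_itv /= lexx ltW.
  have i2 : `|t| \in `[0, (pi : R)] by rewrite in_itv /= normr_ge0 ltW.
  by rewrite ltr_cos.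
rewrite cospi; have -> : cos `|t| = cos t.
  by case: (leP 0 t) => h; [rewrite ger0_norm|rewrite ltr0_norm // cosN].
by move=> h; apply/eqP; lra.
Qed.

Lemma dA_sigma_finite : sigma_finite [set: plane R] (@dA R).
Proof.
exists (fun n => `[(- n%:R)%R, n%:R]%classic `*` `[(- n%:R)%R, n%:R]%classic).
  apply/seteqP; split=> // -[x y] _; exists (maxn (Num.bound `|x|) (Num.bound `|y|)) => //=.
  rewrite !in_itv /= -!ler_norml; split.
    by apply: le_trans (ltW (archi_boundP (normr_ge0 x))) _; rewrite ler_nat leq_maxl.
  by apply: le_trans (ltW (archi_boundP (normr_ge0 y))) _; rewrite ler_nat leq_maxr.
move=> n; split; first by apply: measurableX; exact: measurable_itv.
set I := `[(- n%:R)%R, n%:R]%classic.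
have L : (mu I < +oo)%E.
  by rewrite lebesgue_measure_itv /=; case: ifP; rewrite ?ltry // -EFinD ltry.
suff H : (mu2 (I `*` I) < +oo)%E.
  by apply: (lte_mul_pinfty _ _ H); rewrite ?lee_fin ?invr_ge0 ?pi_ge0.
rewrite product_measure1E; [|exact: measurable_itv|exact: measurable_itv].
by apply: lte_mul_pinfty => //; rewrite ge0_fin_numE.
Qed.

(** Rotation invariance averaged over the angle plays the role of polar coordinates. The interval is
    open, which leaves out the half turn, where the product of shears breaks down. *)
Lemma ge0_integral_dA_average (F : plane R -> \bar R) : measurable_fun [set: plane R] F ->
  (forall p, 0 <= F p)%E ->
  ((2 * pi)%:E * \int[@dA R]_p F p =
   \int[@dA R]_p \int[mu]_(th in `](- pi)%R, pi[) F (rot th p))%E.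
Proof.
move=> mF F0; have pip := pi_gt0 R.
pose B : set (plane R * measurableTypeR R) := snd @^-1` `](- pi)%R, pi[%classic.
have mB : measurable B.
  by rewrite -[B]setTI; apply: (@measurable_snd _ _ (plane R) (measurableTypeR R)) => //; exact: measurable_itv.
pose H := (fun q : plane R * measurableTypeR R => F (rot q.2 q.1)) \_ B.
have mH : measurable_fun [set: plane R * measurableTypeR R] H.
  apply/(measurable_restrictT _ _).1 => //; apply: measurable_funTS.
  by apply: (measurableT_comp mF); exact: measurable_rot_pair.
have H0 q : (0 <= H q)%E by rewrite /H patchE; case: ifP.
have HE p : (\int[mu]_(th in `](- pi)%R, pi[) F (rot th p) = \int[mu]_th H (p, th))%E.
  rewrite integral_mkcond; apply: eq_integral => th _; rewrite /H !patchE /=.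
  by congr (if _ then _ else _); apply/idP/idP; rewrite !inE.
under [RHS]eq_integral do rewrite HE.
rewrite (ge0_tonelli dA_sigma_finite (sigma_finiteT mu) mH H0).
transitivity (\int[mu]_(th in `](- pi)%R, pi[) (cst (\int[@dA R]_p F p) th))%E.
  rewrite integral_cst //= lebesgue_measure_itv /= lte_fin ifT; last by lra.
  by rewrite -EFinD muleC; congr (_ * (_%:E))%E; ring.
transitivity (\int[mu]_y \int[@dA R]_x H (x, y))%E; last by [].
rewrite integral_mkcond; apply: eq_integral => th _; rewrite patchE /=.
case: ifPn => [|hth].
  rewrite inE /= in_itv /= => /andP[t1 t2].
  rewrite -(ge0_integral_dA_rot (cos_gtN1 t1 t2) mF F0); apply: eq_integral => p _.
  by rewrite /H patchE ifT // inE /B /= in_itv /= t1 t2.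
rewrite integral0_eq // => p _; rewrite /H patchE ifF //.
by apply/negbTE; apply: contra hth; rewrite !inE.
Qed.

(** Averaging over rotations first replaces the kernel by a power of 1 - |z||p|, of exponent lower
    by 1; what remains depends on |p|^2 only and is the mixed power integral with eps = 1 -
    |z|^2. *)
Lemma forelli_rudin (e c : R) : -1 < e -> 0 < c -> exists2 C : R, 0 <= C & forall z, normc z < 1 ->
  (\int[@dA R]_(p in @disc R) ((1 - nsq p) `^ e * normc (1 - z * (cpx p)^*) `^ (- (2 + e + c)))%:E
    <= (C * (1 - normc z ^+ 2) `^ (- c))%:E)%E.
Proof.
move=> e1 c0; set q := 2 + e + c; have q1 : 1 < q by rewrite /q; lra.
have [C1 C10 HC1] := angular_integral_le q1.
have k0 := @kappa_gt0 R; have pip := pi_gt0 R.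
pose B := (1 + e)^-1 + c^-1.
have B0 : 0 <= B by rewrite addr_ge0 ?invr_ge0 //; lra.
exists ((2 * pi)^-1 * (C1 * 4 `^ (q - 1) * (kappa R * B))).
  apply: mulr_ge0; first by rewrite invr_ge0 mulr_ge0 // ltW.
  apply: mulr_ge0; first by rewrite mulr_ge0 ?powR_ge0.
  by rewrite mulr_ge0 // ltW.
move=> z z1; set eps := 1 - normc z ^+ 2.
have nz := normc_ge0 z.
have eps0 : 0 < eps by rewrite subr_gt0 expr_lt1.
have eps1 : eps <= 1 by rewrite gerBl sqr_ge0.
pose f (p : plane R) : R := (1 - nsq p) `^ e * normc (1 - z * (cpx p)^*) `^ (- q).
pose F := (EFin \o f) \_ (@disc R).
have mF : measurable_fun [set: plane R] F.
  apply: (measurable_restrictT _ (@measurable_disc R)).1; apply/measurable_EFinP; apply: measurable_funTS.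
  apply: measurable_funM.
    apply: (measurableT_comp (@measurable_powR R e)).
    by apply: measurable_funB => //; exact: measurable_nsq.
  apply: (measurableT_comp (@measurable_powR R (- q))).
  apply: measurable_normc; apply: cmeasB; first exact: cmeas_cst.
  by apply: cmeasM; [exact: cmeas_cst|apply: cmeasJ; exact: cmeas_cpx].
have F0 p : (0 <= F p)%E by rewrite /F patchE; case: ifP => // _; rewrite lee_fin mulr_ge0 ?powR_ge0.
rewrite integral_mkcond -/F.
have avg := ge0_integral_dA_average mF F0.
have -> : (\int[@dA R]_p F p = ((2 * pi)^-1)%:E * ((2 * pi)%:E * \int[@dA R]_p F p))%E.
  by rewrite muleA -EFinM mulVf ?mul1e // gt_eqF // mulr_gt0.
rewrite avg -[X in (_ <= X%:E)%E]mulrA EFinM; apply: lee_wpmul2l.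
  by rewrite lee_fin invr_ge0 mulr_ge0 // ltW.
pose h (t : R) := ((1 - t) `^ e * (eps + (1 - t)) `^ (- (1 + e + c)))%:E.
have h0 t : (0 <= h t)%E by rewrite lee_fin mulr_ge0 ?powR_ge0.
have mh : measurable_fun [set: R] h.
  apply/measurable_EFinP; apply: measurable_funM.
    by apply: (measurableT_comp (@measurable_powR R e)); exact: measurable_funB.
  apply: (measurableT_comp (@measurable_powR R _)); apply: measurable_funD => //.
  exact: measurable_funB.
apply: (@le_trans _ _ (\int[@dA R]_(p in @disc R) ((C1 * 4 `^ (q - 1))%:E * h (nsq p)))%E).
  rewrite [leRHS]integral_mkcond; apply: ge0_le_integral' => p _; first by apply: integral_ge0.
  rewrite patchE; case: ifPn => [|hp].
    rewrite inE => hp; have {}hp : nsq p < 1 by move: hp; rewrite disc_nsq.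
    have p0 := nsq_ge0 p.
    have np : normc (cpx p) < 1.
      by rewrite -(@ltr_pXn2r _ 2) ?nnegrE ?normc_ge0 // expr1n -nsqE.
    pose y := z * (cpx p)^*.
    have ny : normc y = normc z * normc (cpx p) by rewrite normcM normcJ.
    have y1 : normc y < 1.
      by rewrite ny (le_lt_trans _ z1) // ler_piMr // ltW.
    apply: (@le_trans _ _ (\int[mu]_(th in `](- pi)%R, pi[) (((1 - nsq p) `^ e)%:E * (normc (1 - y * cis (- th)) `^ (- q))%:E))%E).
      apply: ge0_le_integral' => // th _; rewrite /F patchE; case: ifP => _; last first.
        by rewrite -EFinM lee_fin mulr_ge0 ?powR_ge0.
      by rewrite /= /f nsq_rot cpx_rot -EFinM /y cisN rmorphM /= [z * (_ * _)]mulrCA [_ * (cis th)^*]mulrC.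
    rewrite ge0_integralZl_EFin ?powR_ge0 //; last 2 first.
    - by move=> th _; rewrite lee_fin powR_ge0.
    - apply/measurable_EFinP; apply: measurable_funTS.
      apply: (measurableT_comp (@measurable_powR R (- q))); exact: measurable_normc1B_cis.
    apply: le_trans (lee_wpmul2l _ (HC1 y y1)) _; first by rewrite lee_fin powR_ge0.
    rewrite /h -!EFinM lee_fin mulrCA -[leRHS]mulrA ler_wpM2l //.
    rewrite [leRHS]mulrCA; apply: ler_wpM2l; rewrite ?powR_ge0 //.
    have D0 : 0 < eps + (1 - nsq p) by rewrite addr_gt0 // subr_gt0.
    (* Each of 1 - |z|^2 and 1 - |p|^2 is at most 2 (1 - |z||p|), since both moduli are below 1. *)
    have D1 : (eps + (1 - nsq p)) / 4 <= 1 - normc y.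
      rewrite ny /eps nsqE; have := normc_ge0 (cpx p); nra.
    have -> : - (1 + e + c) = 1 - q by rewrite /q; ring.
    have -> : 4 `^ (q - 1) * (eps + (1 - nsq p)) `^ (1 - q) = ((eps + (1 - nsq p)) / 4) `^ (1 - q).
      rewrite powRM ?(ltW D0) ?invr_ge0 // mulrC; congr (_ * _).
      by rewrite -powR_inv1 // -powRrM mulN1r opprB.
    rewrite (_ : 1 - q = - (q - 1)); last by ring.
    rewrite !powRN lef_pV2 ?posrE ?powR_gt0 ?divr_gt0 // ?subr_gt0 //.
    by apply: ge0_ler_powR; rewrite ?nnegrE ?divr_ge0 ?(ltW D0) ?subr_ge0 ?(ltW y1) //; lra.
  rewrite integral0_eq // => th _; rewrite /F patchE ifF //; apply/negbTE.
  by apply: contra hp; rewrite !inE !disc_nsq /= nsq_rot.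
rewrite ge0_integralZl_EFin ?mulr_ge0 ?powR_ge0 //; last 2 first.
- exact: measurable_disc.
- by apply: measurable_funTS; apply: (measurableT_comp mh); exact: measurable_nsq.
rewrite ge0_integral_radial //.
have -> : (\int[mu]_(t in `[0%R, 1%R[) h t = \int[mu]_(x in `]0%R, 1%R]) (x `^ e * (eps + x) `^ (- (1 + e + c)))%:E)%E.
  apply: (@ge0_integral_flip R (fun x => (x `^ e * (eps + x) `^ (- (1 + e + c)))%:E)).
    apply/measurable_EFinP; apply: measurable_funM; first exact: measurable_powR.
    by apply: (measurableT_comp (@measurable_powR R _)); exact: measurable_funD.
  by move=> x; rewrite lee_fin mulr_ge0 ?powR_ge0.
have I := integral_powR_mix_le e1 c0 eps0 eps1.
apply: le_trans (lee_wpmul2l _ (lee_wpmul2l _ I)) _.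
- by rewrite lee_fin mulr_ge0 ?powR_ge0.
- by rewrite lee_fin ltW.
by rewrite -!EFinM lee_fin -!mulrA.
Qed.

End ForelliRudin.

(** * The Schur test *)

Lemma powRDp (R : realType) (x r s : R) : 0 < x -> x `^ (r + s) = x `^ r * x `^ s.
Proof. by move=> x0; rewrite powRD // (gt_eqF x0) implybT. Qed.

Section DiscGeometry.
Variable R : realType.
Implicit Types (a z w : R[i]).

Lemma normc1B_conj z w : normc (1 - z * w^*) = normc (1 - w * z^*).
Proof.
rewrite -normcJ; congr normc; apply: eq_cplx; rewrite ?cReJ ?cImJ ?cReD ?cImD ?cReN ?cImN ?cReM ?cImM ?cReJ ?cImJ /=; ring.
Qed.

Lemma disc_identity a z : normc (1 - a^* * z) ^+ 2 - normc (a - z) ^+ 2 =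
  (1 - normc a ^+ 2) * (1 - normc z ^+ 2).
Proof.
rewrite !normc_sqr ?cReD ?cImD ?cReN ?cImN ?cReM ?cImM ?cReJ ?cImJ /=; ring.
Qed.

Lemma normc1B_ge a z : normc a <= 1 -> normc z <= 1 ->
  1 - normc a <= normc (1 - a^* * z) /\ 1 - normc z <= normc (1 - a^* * z).
Proof.
move=> a1 z1; have na := normc_ge0 a; have nz := normc_ge0 z.
have := ler_normcB 1 (a^* * z); rewrite normc1 normcM normcJ => h.
by split; apply: le_trans h; nra.
Qed.

Lemma normc1B_gt0 a z : normc a < 1 -> normc z <= 1 -> 0 < normc (1 - a^* * z).
Proof.
by move=> a1 z1; have [h _] := normc1B_ge (ltW a1) z1; apply: lt_le_trans h; rewrite subr_gt0.
Qed.

Lemma onem_sqr_le z : normc z <= 1 -> 1 - normc z ^+ 2 <= 2 * (1 - normc z).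
Proof. have nz := normc_ge0 z; nra. Qed.

Lemma onem_sqr_gt0 z : normc z < 1 -> 0 < 1 - normc z ^+ 2.
Proof. by move=> z1; rewrite subr_gt0 expr_lt1 ?normc_ge0. Qed.

Lemma mobius_onem a z : normc a < 1 -> normc z < 1 ->
  1 - normc (mobius a z) ^+ 2 = (1 - normc a ^+ 2) * (1 - normc z ^+ 2) / normc (1 - a^* * z) ^+ 2.
Proof.
move=> a1 z1; have d0 := normc1B_gt0 a1 (ltW z1).
rewrite -disc_identity /mobius normc_div expr_div_n mulrBl divff //.
by rewrite expf_neq0 // gt_eqF.
Qed.

(** The correction conj a (z - w) is at most |z - w|, and |z - w| <= |1 - z conj w| because the
    pseudohyperbolic distance is at most 1 ([disc_identity]). *)
Lemma normc1B_triangle a z w : normc a < 1 -> normc z < 1 -> normc w < 1 ->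
  normc (1 - a^* * w) <= normc (1 - a^* * z) + normc (1 - z * w^*).
Proof.
move=> a1 z1 w1.
have -> : 1 - a^* * w = (1 - a^* * z) + a^* * (z - w) by ring.
apply: le_trans (normcD _ _) _; rewrite lerD2l normcM normcJ.
have h : normc (z - w) <= normc (1 - z * w^*).
  rewrite -ler_sqr ?nnegrE ?normc_ge0 // normc1B_conj [w * _]mulrC -subr_ge0 disc_identity.
  by rewrite mulr_ge0 // ltW // onem_sqr_gt0.
by apply: le_trans h; rewrite ler_piMl ?normc_ge0 // ltW.
Qed.

End DiscGeometry.

Section IntegralCauchySchwarz.
Context d (T : measurableType d) (R : realType) (m : {measure set T -> \bar R}).
Variable D : set T.
Hypothesis mD : measurable D.

(** Integrate 2 sqrt(c) k <= tau u + v / tau and choose [tau] afterwards. In the Schur test, u holds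
    the test function and v the input, while the weight c at the outer point is a constant. *)
Lemma integral_cauchy_schwarz (k u v : T -> R) (c U : R) :
  measurable_fun D u -> measurable_fun D v ->
  (forall x, D x -> 0 <= k x) -> (forall x, D x -> 0 <= u x) -> (forall x, D x -> 0 <= v x) ->
  0 <= c -> 0 < U ->
  (forall x, D x -> c * k x ^+ 2 <= u x * v x) ->
  (\int[m]_(x in D) (u x)%:E <= U%:E)%E ->
  (c%:E * (\int[m]_(x in D) (k x)%:E) ^+ 2 <= U%:E * \int[m]_(x in D) (v x)%:E)%E.
Proof.
move=> mu mv k0 u0 v0 c0 U0 hk hU.
have Iv0 : (0 <= \int[m]_(x in D) (v x)%:E)%E by apply: integral_ge0 => x /v0; rewrite lee_fin.
have Ik0 : (0 <= \int[m]_(x in D) (k x)%:E)%E by apply: integral_ge0 => x /k0; rewrite lee_fin.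
have Iu0 : (0 <= \int[m]_(x in D) (u x)%:E)%E by apply: integral_ge0 => x /u0; rewrite lee_fin.
move: c0; rewrite le_eqVlt => /predU1P[<-|c0].
  by rewrite mul0e mule_ge0 // lee_fin ltW.
have [Ivoo|Ivfin] := eqVneq (\int[m]_(x in D) (v x)%:E)%E +oo%E.
  by rewrite Ivoo gt0_muley ?lte_fin // leey.
have vf : (\int[m]_(x in D) (v x)%:E)%E \is a fin_num by rewrite ge0_fin_numE // ltey.
have uf : (\int[m]_(x in D) (u x)%:E)%E \is a fin_num by rewrite ge0_fin_numE // (le_lt_trans hU) // ltry.
set V := fine (\int[m]_(x in D) (v x)%:E)%E.
have V0 : 0 <= V by exact: fine_ge0.
pose sc := Num.sqrt c; have sc0 : 0 < sc by rewrite sqrtr_gt0.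
have scE : sc ^+ 2 = c by rewrite sqr_sqrtr // ltW.
have key (tau : R) : 0 < tau ->
    ((2 * sc)%:E * \int[m]_(x in D) (k x)%:E <= (tau * U + tau^-1 * V)%:E)%E.
  move=> t0; have ti : 0 < tau^-1 by rewrite invr_gt0.
  have sck : (\int[m]_(x in D) (k x)%:E <= ((2 * sc)^-1)%:E * \int[m]_(x in D) ((tau * u x + tau^-1 * v x)%:E))%E.
    rewrite -ge0_integralZl_EFin //; last 3 first.
    - by move=> x Dx; rewrite lee_fin addr_ge0 // mulr_ge0 ?u0 ?v0 // ltW.
    - by apply/measurable_EFinP; apply: measurable_funD; apply: measurable_funM => //; exact: measurable_cst.
    - by rewrite invr_ge0 mulr_ge0 // ltW.
    apply: ge0_le_integral' => x Dx; first by rewrite lee_fin k0.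
    rewrite -EFinM lee_fin [leRHS]mulrC ler_pdivlMr ?mulr_gt0 //.
    have hx : (sc * k x) ^+ 2 <= (tau * u x) * (tau^-1 * v x).
      by rewrite exprMn scE mulrACA mulfV ?gt_eqF // mul1r hk.
    have A0 : 0 <= tau * u x by rewrite mulr_ge0 ?u0 // ltW.
    have B0 : 0 <= tau^-1 * v x by rewrite mulr_ge0 ?v0 // ltW.
    have : (2 * (sc * k x)) ^+ 2 <= (tau * u x + tau^-1 * v x) ^+ 2.
      have := sqr_ge0 (tau * u x - tau^-1 * v x); nra.
    have P0 : 0 <= 2 * (sc * k x) by rewrite mulr_ge0 // mulr_ge0 ?k0 // ltW.
    by rewrite ler_sqr ?nnegrE ?addr_ge0 // => hh; lra.
  apply: le_trans (lee_wpmul2l _ sck) _; first by rewrite lee_fin mulr_ge0 // ltW.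
  rewrite muleA -EFinM divff ?mul1e; last by rewrite mulf_neq0 // gt_eqF.
  under eq_integral do rewrite EFinD !EFinM.
  rewrite ge0_integralD //; last 4 first.
  - by move=> x Dx; rewrite -EFinM lee_fin mulr_ge0 ?u0 // ltW.
  - by apply: measurable_funeM; exact/measurable_EFinP.
  - by move=> x Dx; rewrite -EFinM lee_fin mulr_ge0 ?v0 // ltW.
  - by apply: measurable_funeM; exact/measurable_EFinP.
  rewrite !ge0_integralZl_EFin //; try exact/measurable_EFinP; try exact: ltW.
  rewrite EFinD !EFinM /V fineK //; apply: leeD => //.
  by apply: lee_wpmul2l => //; rewrite lee_fin ltW.
have kf : (\int[m]_(x in D) (k x)%:E)%E \is a fin_num.
  rewrite ge0_fin_numE //; have := key 1 ltr01.
  rewrite muleC -lee_pdivlMr ?mulr_gt0 // -EFinM; move/le_lt_trans; apply; exact: ltry.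
set S := fine (\int[m]_(x in D) (k x)%:E)%E.
have S0 : 0 <= S by exact: fine_ge0.
rewrite -(fineK kf) -(fineK vf) -/S -/V -EFin_expe -!EFinM lee_fin.
have keyR tau : 0 < tau -> 2 * sc * S <= tau * U + tau^-1 * V.
  by move=> t0; have := key tau t0; rewrite -(fineK kf) -EFinM lee_fin.
have [S00|Sn] := eqVneq S 0; first by rewrite S00 expr0n mulr0 mulr_ge0 // ltW.
have Sp : 0 < S by rewrite lt_neqAle eq_sym Sn.
have tp : 0 < sc * S / U by rewrite divr_gt0 // mulr_gt0.
have := keyR _ tp; rewrite divfK ?gt_eqF // invf_div => h.
have h2 : sc * S <= U / (sc * S) * V by lra.
have : (sc * S) * (sc * S) <= U * V.
  by move: h2; rewrite mulrAC ler_pdivlMr ?mulr_gt0.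
by rewrite -expr2 exprMn scE.
Qed.

End IntegralCauchySchwarz.

Section SchurTest.
Variables (R : realType) (K : R -> R).
Hypothesis hK : class_WQ K.
Variables (sigma C1 delta C2 : R).
Hypotheses (sigma0 : 0 < sigma) (C11 : 1 <= C1).
Hypothesis KU : forall s t : R, 1 <= s -> 0 < t -> t <= 1 -> K (s * t) <= C1 * s `^ sigma * K t.
Hypotheses (delta0 : 0 < delta) (delta1 : delta < 1) (C21 : 1 <= C2).
Hypothesis KL : forall s t : R, 0 <= s -> s <= 4 -> 0 < t -> t <= 1 -> K (s * t) <= C2 * s `^ delta * K t.
Implicit Types (a z w : R[i]).

(** A majorant of the Moebius weight. There 1 - |phi_a(w)|^2 is the product of 2 (1 - |a|^2) / |1 -
    conj a w|, which leaves [K] as a power of order delta, and of the argument kept here; the 2 puts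
    that argument in ]0, 1], where the power bounds for [K] hold. *)
Definition wt a w : R :=
  ((1 - normc a ^+ 2) / normc (1 - a^* * w)) `^ delta * K ((1 - normc w ^+ 2) / (2 * normc (1 - a^* * w))).

Lemma wt_arg_gt0 a w : normc a < 1 -> normc w < 1 -> 0 < (1 - normc w ^+ 2) / (2 * normc (1 - a^* * w)).
Proof.
move=> a1 w1; have d0 := normc1B_gt0 a1 (ltW w1).
by rewrite divr_gt0 ?onem_sqr_gt0 // mulr_gt0.
Qed.

Lemma wt_arg_le1 a w : normc a < 1 -> normc w < 1 -> (1 - normc w ^+ 2) / (2 * normc (1 - a^* * w)) <= 1.
Proof.
move=> a1 w1; have d0 := normc1B_gt0 a1 (ltW w1).
rewrite ler_pdivrMr ?mulr_gt0 // mul1r; apply: le_trans (onem_sqr_le (ltW w1)) _.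
by rewrite ler_pM2l //; have [] := normc1B_ge (ltW a1) (ltW w1).
Qed.

Lemma wt_ge0 a w : normc a < 1 -> normc w < 1 -> 0 <= wt a w.
Proof.
by move=> a1 w1; rewrite mulr_ge0 ?powR_ge0 // (WQ_ge0 hK) // ltW // wt_arg_gt0.
Qed.

Lemma K_mobius_le a z : normc a < 1 -> normc z < 1 ->
  K (1 - normc (mobius a z) ^+ 2) <= C2 * 2 `^ delta * wt a z.
Proof.
move=> a1 z1; have d0 := normc1B_gt0 a1 (ltW z1).
rewrite mobius_onem // /wt; set d := normc _ in d0 *.
pose s := 2 * ((1 - normc a ^+ 2) / d); pose t := (1 - normc z ^+ 2) / (2 * d).
have -> : (1 - normc a ^+ 2) * (1 - normc z ^+ 2) / d ^+ 2 = s * t.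
  by rewrite /s /t; field; rewrite gt_eqF.
have ad0 : 0 <= (1 - normc a ^+ 2) / d by rewrite divr_ge0 // ltW // onem_sqr_gt0.
have s0 : 0 <= s by rewrite mulr_ge0.
have s4 : s <= 4.
  suff : (1 - normc a ^+ 2) / d <= 2 by rewrite /s; lra.
  rewrite ler_pdivrMr //; apply: le_trans (onem_sqr_le (ltW a1)) _.
  by rewrite ler_pM2l //; have [] := normc1B_ge (ltW a1) (ltW z1).
apply: le_trans (KL s0 s4 (wt_arg_gt0 a1 z1) (wt_arg_le1 a1 z1)) _.
by rewrite /s powRM // -!mulrA.
Qed.

(** Slow variation, uniform in a. The triangle inequality for |1 - conj a w| bounds the change of
    both factors by the distance |1 - z conj w| relative to 1 - |z|^2 or 1 - |w|^2; delta and sigma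
    become the powers that the Forelli-Rudin estimates must absorb. *)
Lemma wt_ratio a z w : normc a < 1 -> normc z < 1 -> normc w < 1 ->
  wt a z <= C1 * (4 * normc (1 - z * w^*) / (1 - normc z ^+ 2)) `^ delta
     * (4 * normc (1 - z * w^*) / (1 - normc w ^+ 2)) `^ sigma * wt a w.
Proof.
move=> a1 z1 w1; have dz0 := normc1B_gt0 a1 (ltW z1); have dw0 := normc1B_gt0 a1 (ltW w1).
have tri := normc1B_triangle a1 z1 w1; have tri2 := normc1B_triangle a1 w1 z1.
have zw2 : normc (1 - w * z^*) = normc (1 - z * w^*) by rewrite normc1B_conj.
have wz1 := normc1B_ge (ltW w1) (ltW z1).
have az1 := normc1B_ge (ltW a1) (ltW z1).
have aw1 := normc1B_ge (ltW a1) (ltW w1).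
have zwE : normc (1 - w^* * z) = normc (1 - z * w^*) by rewrite mulrC.
rewrite zwE in wz1; rewrite zw2 in tri2; rewrite /wt.
move: dz0 dw0 tri tri2 wz1 az1 aw1 (wt_arg_gt0 a1 w1) (wt_arg_le1 a1 w1) (wt_arg_gt0 a1 z1).
set dz := normc (1 - a^* * z); set dw := normc (1 - a^* * w); set D := normc (1 - z * w^*).
move=> dz0 dw0 tri tri2 [Dw Dz] [dza dzz] [dwa dww] tw0 tw1 tz0.
have sz0 := onem_sqr_gt0 z1; have sw0 := onem_sqr_gt0 w1; have sa0 := onem_sqr_gt0 a1.
have sz2 := onem_sqr_le (ltW z1); have sw2 := onem_sqr_le (ltW w1).
have D0 : 0 < D by apply: lt_le_trans Dw; rewrite subr_gt0.
have r1 : dw / dz <= 4 * D / (1 - normc z ^+ 2).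
  rewrite ler_pdivrMr // mulrAC ler_pdivlMr //; nra.
have rw : 1 <= 4 * D / (1 - normc w ^+ 2) by rewrite ler_pdivlMr // mul1r; lra.
have hr : K ((1 - normc z ^+ 2) / (2 * dz)) <= C1 * (4 * D / (1 - normc w ^+ 2)) `^ sigma * K ((1 - normc w ^+ 2) / (2 * dw)).
  apply: le_trans (KU rw tw0 tw1); apply: (WQ_nondecreasing hK); first exact: ltW.
  have -> : 4 * D / (1 - normc w ^+ 2) * ((1 - normc w ^+ 2) / (2 * dw)) = 4 * D / (2 * dw).
    by field; rewrite !gt_eqF.
  rewrite ler_pdivrMr ?mulr_gt0 // mulrAC ler_pdivlMr ?mulr_gt0 //; nra.
have hl : ((1 - normc a ^+ 2) / dz) `^ delta <= (4 * D / (1 - normc z ^+ 2)) `^ delta * ((1 - normc a ^+ 2) / dw) `^ delta.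
  rewrite -powRM ?divr_ge0 ?mulr_ge0 ?(ltW D0) ?(ltW sz0) ?(ltW dw0) ?(ltW sa0) //.
  apply: ge0_ler_powR; rewrite ?nnegrE ?(ltW delta0) ?mulr_ge0 ?divr_ge0 ?invr_ge0 ?mulr_ge0 ?(ltW D0) ?(ltW sz0) ?(ltW dw0) ?(ltW dz0) ?(ltW sa0) //.
  have -> : (1 - normc a ^+ 2) / dz = dw / dz * ((1 - normc a ^+ 2) / dw) by field; rewrite !gt_eqF.
  by apply: ler_wpM2r => //; rewrite divr_ge0 // ltW.
apply: le_trans (ler_pM (powR_ge0 _ _) (WQ_ge0 hK (ltW tz0)) hl hr) _.
by rewrite le_eqVlt; apply/orP; left; apply/eqP; ring.
Qed.

(** The class constrains [K] on [0, +oo[ only; freezing it at K(0) on negative arguments makes it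
    monotone on the whole line. *)
Lemma measurable_WQ : measurable_fun [set: R] (fun x => K (Num.max x 0)).
Proof.
apply: nondecreasing_measurable => // x y xy.
apply: (WQ_nondecreasing hK); first by rewrite le_max lexx orbT.
by rewrite ge_max !le_max xy lexx !orbT.
Qed.

Lemma measurable_normc1B a (D : set (plane R)) : measurable_fun D (fun p => normc (1 - a * cpx p)).
Proof.
apply: measurable_normc; apply: cmeasB; first exact: cmeas_cst.
by apply: cmeasM; [exact: cmeas_cst|exact: cmeas_cpx].
Qed.

Lemma measurable_inv_ge0 (D : set (plane R)) (f : plane R -> R) : (forall x, 0 <= f x) ->
  measurable_fun D f -> measurable_fun D (fun x => (f x)^-1).
Proof.
move=> f0 mf; rewrite (_ : (fun x => _) = (fun x => f x `^ (-1))).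
  by apply: (measurableT_comp (@measurable_powR R (-1))).
by apply/funext => x; rewrite powR_inv1.
Qed.

Lemma measurable_wt a (D : set (plane R)) : normc a < 1 -> D `<=` @disc R ->
  measurable D -> measurable_fun D (fun p => wt a (cpx p)).
Proof.
move=> a1 Dd mD.
have md : measurable_fun D (fun p => (normc (1 - a^* * cpx p))^-1).
  by apply: measurable_inv_ge0; [move=> x; exact: normc_ge0|exact: measurable_normc1B].
apply: measurable_funM.
  apply: (measurableT_comp (@measurable_powR R delta)).
  by apply: measurable_funM.
pose g (p : plane R) := K (Num.max ((1 - nsq p) * (2^-1 * (normc (1 - a^* * cpx p))^-1)) 0).
apply: (@eq_measurable_fun _ _ _ _ D g).
  move=> p; rewrite inE => /Dd Dp; rewrite /g nsqE -invfM; congr K.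
  by apply/max_idPl; apply/ltW/wt_arg_gt0.
apply: (measurableT_comp measurable_WQ); apply: measurable_funM.
  by apply: measurable_funB => //; apply: measurable_funTS; exact: measurable_nsq.
exact: measurable_funM.
Qed.

Lemma sqr_wt_ge0 (x : R) a w : normc a < 1 -> normc w < 1 -> 0 <= x ^+ 2 * wt a w.
Proof. by move=> a1 w1; apply: mulr_ge0; [exact: sqr_ge0|exact: wt_ge0]. Qed.

Local Ltac factors_ge0 := repeat first [assumption | exact: powR_ge0 | by apply: sqr_wt_ge0 | apply: mulr_ge0].

Lemma measurable_normc1B_pair :
  measurable_fun [set: plane R * plane R] (fun q => normc (1 - cpx q.1 * (cpx q.2)^*)).
Proof.
have h1 : cmeas [set: plane R * plane R] (fun q => cpx q.1).
  by split; [exact: (measurableT_comp measurable_fst measurable_fst)|exact: (measurableT_comp measurable_snd measurable_fst)].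
have h2 : cmeas [set: plane R * plane R] (fun q => cpx q.2).
  by split; [exact: (measurableT_comp measurable_fst measurable_snd)|exact: (measurableT_comp measurable_snd measurable_snd)].
by apply: measurable_normc; apply: cmeasB; [exact: cmeas_cst|apply: cmeasM => //; exact: cmeasJ].
Qed.

Lemma measurable_onem_powR (D : set (plane R)) e : measurable_fun D (fun p => (1 - nsq p) `^ e).
Proof.
apply: (measurableT_comp (@measurable_powR R e)); apply: measurable_funB => //.
by apply: measurable_funTS; exact: measurable_nsq.
Qed.

Lemma measurable_kernel_snd z (D : set (plane R)) e :
  measurable_fun D (fun p => normc (1 - z * (cpx p)^*) `^ e).
Proof.
apply: (measurableT_comp (@measurable_powR R e)); apply: measurable_normc.
apply: cmeasB; first exact: cmeas_cst.
by apply: cmeasM; [exact: cmeas_cst|apply: cmeasJ; exact: cmeas_cpx].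
Qed.

Definition bergman_abs (b : R) (h : plane R -> R) z : \bar R :=
  (\int[@dA R]_(p in @disc R) (h p * (1 - nsq p) `^ b * normc (1 - z * (cpx p)^*) `^ (- (b + 2)))%:E)%E.

(** Cauchy-Schwarz with the test function (1 - |w|^2)^(-1/2), after [wt_ratio] has moved the weight
    from z to w. The first factor is a Forelli-Rudin integral whose exponent (1 - delta) / 2 is
    positive because delta < 1. *)
Lemma schur_pointwise (b : R) : sigma + 1 <= b -> exists2 A : R, 0 <= A &
  forall (a z : R[i]) (h : plane R -> R), normc a < 1 -> normc z < 1 -> measurable_fun [set: plane R] h -> (forall p, 0 <= h p) ->
  ((wt a z)%:E * bergman_abs b h z ^+ 2 <= A%:E * \int[@dA R]_(w in @disc R)
    ((1 - normc z ^+ 2) `^ (- (1 + delta) / 2) * normc (1 - z * (cpx w)^*) `^ (- (b + 2 - (delta + sigma) / 2)) *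
      (h w ^+ 2 * wt a (cpx w) * (1 - nsq w) `^ (b - sigma / 2 + 2^-1)))%:E)%E.
Proof.
move=> hb.
have s0 := sigma0; have dl0 := delta0; have dl1 := delta1.
have e1 : -1 < b - sigma / 2 - 2^-1 by lra.
have c1 : 0 < (1 - delta) / 2 by lra.
have [A1 A10 FR1] := forelli_rudin e1 c1.
pose M := C1 * 4 `^ delta * 4 `^ sigma.
have M0 : 0 <= M by rewrite !mulr_ge0 ?powR_ge0 // (le_trans _ C11).
exists ((A1 + 1) * M); first by rewrite mulr_ge0 // addr_ge0.
move=> a z h a1 z1 mh h0.
set X := 1 - normc z ^+ 2; have X0 : 0 < X by exact: onem_sqr_gt0.
pose q := b + 2 - (delta + sigma) / 2.
(* [H] is the kernel times the square root of the weight ratio, so that wt(a,z) k^2 <= M H^2 h^2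
   wt(a,w); [u] and [v] then share this product with opposite powers of 1 - |w|^2. *)
pose H (w : plane R) := X `^ (- delta / 2) * (1 - nsq w) `^ (b - sigma / 2) * normc (1 - z * (cpx w)^*) `^ (- q).
have Dd (w : plane R) : @disc R w -> normc (cpx w) < 1 by [].
have Y0 (w : plane R) : @disc R w -> 0 < 1 - nsq w by move=> dw; rewrite nsqE; apply: onem_sqr_gt0; exact: Dd.
have mdisc := @measurable_disc R.
have mH : measurable_fun (@disc R) H.
  apply: measurable_funM; last exact: measurable_kernel_snd.
  by apply: measurable_funM => //; exact: measurable_onem_powR.
have H0 (w : plane R) : 0 <= H w by rewrite !mulr_ge0 ?powR_ge0.
pose u (w : plane R) := H w * (1 - nsq w) `^ (- 2^-1).
pose v (w : plane R) := M * H w * (h w ^+ 2 * wt a (cpx w)) * (1 - nsq w) `^ 2^-1.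
have mhd : measurable_fun (@disc R) h by exact: measurable_funTS.
have mu : measurable_fun (@disc R) u by apply: measurable_funM => //; exact: measurable_onem_powR.
have mv : measurable_fun (@disc R) v.
  apply: measurable_funM; last exact: measurable_onem_powR.
  apply: measurable_funM; first exact: measurable_funM.
  by apply: measurable_funM; [exact: measurable_funX|exact: measurable_wt].
pose k (w : plane R) := h w * (1 - nsq w) `^ b * normc (1 - z * (cpx w)^*) `^ (- (b + 2)).
have U0 : 0 < (A1 + 1) * X `^ (- 2^-1) by rewrite mulr_gt0 ?powR_gt0 // ltr_wpDl.
have := @integral_cauchy_schwarz _ _ R (@dA R) _ mdisc k u v (wt a z) _ mu mv _ _ _ (wt_ge0 a1 z1) U0.
move=> CS; apply: le_trans (CS _ _ _ _ _) _.
- by move=> w _; rewrite !mulr_ge0 ?powR_ge0.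
- by move=> w _; rewrite mulr_ge0 ?powR_ge0.
- move=> w dw; have w1 := Dd w dw.
  exact: mulr_ge0 (mulr_ge0 (mulr_ge0 M0 (H0 w)) (sqr_wt_ge0 _ a1 w1)) (powR_ge0 _ _).
- move=> w dw; have yw := Y0 w dw; have D0 : 0 < normc (1 - z * (cpx w)^*).
    by have := normc1B_gt0 (Dd w dw) (ltW z1); rewrite mulrC.
  have := wt_ratio a1 z1 (Dd w dw).
  rewrite -nsqE -/X /k /u /v /H; move: yw D0; set Y := 1 - nsq w; set D := normc _ => yw D0 hr.
  rewrite !powRM ?mulr_ge0 ?invr_ge0 ?(ltW X0) ?(ltW yw) ?(ltW D0) // in hr.
  have i0 : 0 <= (h w * Y `^ b * D `^ (- (b + 2))) ^+ 2 by exact: sqr_ge0.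
  apply: le_trans (ler_wpM2r i0 hr) _.
  rewrite -[X^-1]powR_inv1 ?(ltW X0) // -[Y^-1]powR_inv1 ?(ltW yw) // -!powRrM !mulN1r.
  rewrite le_eqVlt; apply/orP; left; apply/eqP.
  rewrite /M !expr2.
  have pX : X `^ (- delta) = X `^ (- delta / 2) * X `^ (- delta / 2).
    by rewrite -powRDp //; congr (_ `^ _); field.
  have pY : Y `^ (- sigma) * (Y `^ b * Y `^ b) = Y `^ (b - sigma / 2) * Y `^ (b - sigma / 2).
    by rewrite -!powRDp //; congr (_ `^ _); field.
  have pY2 : Y `^ (- 2^-1) * Y `^ (2^-1) = 1.
    by rewrite -powRDp // addNr powRr0.
  have pD : D `^ delta * D `^ sigma * (D `^ (- (b + 2)) * D `^ (- (b + 2))) = D `^ (- q) * D `^ (- q).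
    by rewrite -!powRDp //; congr (_ `^ _); rewrite /q; field.
  rewrite pX.
  transitivity (C1 * 4 `^ delta * 4 `^ sigma * (X `^ (- delta / 2) * X `^ (- delta / 2)) * (Y `^ (b - sigma / 2) * Y `^ (b - sigma / 2)) * (D `^ (- q) * D `^ (- q)) * (h w * h w) * wt a (cpx w)).
    by rewrite -pY -pD; ring.
  transitivity (C1 * 4 `^ delta * 4 `^ sigma * (X `^ (- delta / 2) * X `^ (- delta / 2)) * (Y `^ (b - sigma / 2) * Y `^ (b - sigma / 2)) * (D `^ (- q) * D `^ (- q)) * (h w * h w) * wt a (cpx w) * (Y `^ (- 2^-1) * Y `^ (2^-1))).
    by rewrite pY2 mulr1.
  ring.
- have -> : (\int[@dA R]_(x in @disc R) (u x)%:E = (X `^ (- delta / 2))%:E * \int[@dA R]_(p in @disc R) ((1 - nsq p) `^ (b - sigma / 2 - 2^-1) * normc (1 - z * (cpx p)^*) `^ (- q))%:E)%E.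
    rewrite -ge0_integralZl_EFin ?powR_ge0 //.
    + apply: eq_integral => w; rewrite inE => dw; rewrite -EFinM /u /H; congr EFin.
      rewrite -mulrA [_ `^ (- q) * _]mulrC mulrA -[_ * _ * (1 - nsq w) `^ (- 2^-1)]mulrA -powRDp ?Y0 //.
      by rewrite mulrA.
    + by move=> w dw; rewrite lee_fin mulr_ge0 ?powR_ge0.
    + apply/measurable_EFinP; apply: measurable_funM; first exact: measurable_onem_powR.
      exact: measurable_kernel_snd.
  have FR := FR1 z z1; rewrite (_ : 2 + _ + _ = q) in FR; last by rewrite /q; field.
  apply: le_trans (lee_wpmul2l _ FR) _; first by rewrite lee_fin powR_ge0.
  rewrite -EFinM lee_fin -/X mulrCA -powRDp //.
  rewrite (_ : - delta / 2 + - ((1 - delta) / 2) = - 2^-1); last by field.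
  by apply: ler_wpM2r; rewrite ?powR_ge0 // lerDl.
rewrite [((A1 + 1) * X `^ _)%:E]EFinM [((A1 + 1) * M)%:E]EFinM -!muleA.
apply: lee_wpmul2l; first by rewrite lee_fin addr_ge0.
rewrite -!ge0_integralZl_EFin ?powR_ge0 //.
- apply: ge0_le_integral' => w dw.
    have w1 := Dd w dw; rewrite -EFinM lee_fin; apply: mulr_ge0 (powR_ge0 _ _) _.
    exact: mulr_ge0 (mulr_ge0 (mulr_ge0 M0 (H0 w)) (sqr_wt_ge0 _ a1 w1)) (powR_ge0 _ _).
  have yw := Y0 w dw.
  rewrite -!EFinM lee_fin /v /H -/q le_eqVlt; apply/orP; left; apply/eqP.
  have -> : X `^ (- (1 + delta) / 2) = X `^ (- 2^-1) * X `^ (- delta / 2).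
    by rewrite -powRDp //; congr (_ `^ _); field.
  rewrite [(1 - nsq w) `^ (b - sigma / 2 + 2^-1)]powRDp //; ring.
- move=> w dw; rewrite lee_fin; have w1 := Dd w dw; factors_ge0.
- apply/measurable_EFinP; apply: measurable_funM.
    by apply: measurable_funM => //; exact: measurable_kernel_snd.
  apply: measurable_funM; last exact: measurable_onem_powR.
  by apply: measurable_funM; [exact: measurable_funX|exact: measurable_wt].
- move=> w dw; have w1 := Dd w dw; rewrite lee_fin.
  exact: mulr_ge0 (mulr_ge0 (mulr_ge0 M0 (H0 w)) (sqr_wt_ge0 _ a1 w1)) (powR_ge0 _ _).
- exact/measurable_EFinP.
Qed.

(** Integrating the pointwise bound in z by Tonelli gives a second Forelli-Rudin integral, with
    exponent -(1 + delta) / 2 > -1; its value cancels exactly the power of 1 - |w|^2 left by the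
    first. All constants are free of a. *)
Lemma schur_bound (b : R) : sigma + 1 <= b -> exists2 C : R, 0 <= C &
  forall (a : R[i]) (h : plane R -> R), normc a < 1 -> measurable_fun [set: plane R] h -> (forall p, 0 <= h p) ->
  (\int[@dA R]_(z in @disc R) ((wt a (cpx z))%:E * bergman_abs b h (cpx z) ^+ 2) <=
    C%:E * \int[@dA R]_(w in @disc R) (h w ^+ 2 * wt a (cpx w))%:E)%E.
Proof.
move=> hb; have [A1 A10 SP] := schur_pointwise hb.
have s0 := sigma0; have dl0 := delta0; have dl1 := delta1.
have e2 : -1 < - (1 + delta) / 2 by lra.
have c2 : 0 < b - sigma / 2 + 2^-1 by lra.
have [A2 A20 FR2] := forelli_rudin e2 c2.
exists (A1 * A2); first exact: mulr_ge0.
move=> a h a1 mh h0.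
have mdisc := @measurable_disc R.
pose q := b + 2 - (delta + sigma) / 2.
pose fA (z : plane R) := if nsq z < 1 then (1 - nsq z) `^ (- (1 + delta) / 2) else 0.
pose fB (w : plane R) := if nsq w < 1 then h w ^+ 2 * wt a (cpx w) * (1 - nsq w) `^ (b - sigma / 2 + 2^-1) else 0.
pose F (x : plane R * plane R) : \bar R := (fA x.1 * normc (1 - cpx x.1 * (cpx x.2)^*) `^ (- q) * fB x.2)%:E.
have inD (p : plane R) : (p \in @disc R) = (nsq p < 1) by apply/idP/idP; rewrite ?inE disc_nsq.
have mA : measurable_fun [set: plane R] fA.
  rewrite (_ : fA = (fun z : plane R => (1 - nsq z) `^ (- (1 + delta) / 2)) \_ (@disc R)).
    by apply/(measurable_restrictT _ _).1 => //; exact: measurable_onem_powR.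
  by apply/funext => p; rewrite patchE inD.
have mB : measurable_fun [set: plane R] fB.
  rewrite (_ : fB = (fun w : plane R => h w ^+ 2 * wt a (cpx w) * (1 - nsq w) `^ (b - sigma / 2 + 2^-1)) \_ (@disc R)).
    apply/(measurable_restrictT _ _).1 => //; apply: measurable_funM; last exact: measurable_onem_powR.
    by apply: measurable_funM; [apply: measurable_funX; exact: measurable_funTS|exact: measurable_wt].
  by apply/funext => p; rewrite patchE inD.
have A0 p : 0 <= fA p by rewrite /fA; case: ifP => // _; rewrite powR_ge0.
have B0 p : 0 <= fB p.
  rewrite /fB; case: ifP => // hp; have p1 : normc (cpx p) < 1 by move: hp; rewrite -inD inE.
  factors_ge0.
have mF : measurable_fun [set: plane R * plane R] F.
  apply/measurable_EFinP; apply: measurable_funM; last exact: (measurableT_comp mB).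
  apply: measurable_funM; first exact: (measurableT_comp mA).
  by apply: (measurableT_comp (@measurable_powR R _)); exact: measurable_normc1B_pair.
have F0 x : (0 <= F x)%E by rewrite lee_fin !mulr_ge0 ?powR_ge0.
apply: (@le_trans _ _ (A1%:E * \int[@dA R]_z \int[@dA R]_w F (z, w))%E).
  rewrite -ge0_integralZl_EFin //; last 2 first.
  - by move=> z _; apply: integral_ge0.
  - exact: (measurable_fun_tonelli (@dA_sigma_finite R) mF F0).
  apply: ge0_le_integral_set => [z dz||//|z dz].
  - by rewrite mule_ge0 ?lee_fin ?wt_ge0 // expe_ge0 //; apply: integral_ge0 => w dw; rewrite lee_fin !mulr_ge0 ?powR_ge0.
  - by move=> z _; rewrite mule_ge0 // ?lee_fin // integral_ge0.
  apply: le_trans (SP a (cpx z) h a1 dz mh h0) _; apply: lee_wpmul2l; first by rewrite lee_fin.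
  have dz' : nsq z < 1 by rewrite -inD inE.
  apply: ge0_le_integral_set => // w dw.
    rewrite lee_fin; have w1 : normc (cpx w) < 1 := dw; factors_ge0.
  have dw' : nsq w < 1 by rewrite -inD inE.
  by rewrite /F /= /fA /fB dz' dw' -nsqE.
rewrite (ge0_tonelli (@dA_sigma_finite R) (@dA_sigma_finite R) mF F0).
rewrite EFinM -muleA; apply: lee_wpmul2l; first by rewrite lee_fin.
rewrite -ge0_integralZl_EFin //; last 2 first.
- by move=> w dw; rewrite lee_fin mulr_ge0 ?sqr_ge0 // wt_ge0.
- by apply/measurable_EFinP; apply: measurable_funM; [apply: measurable_funX; exact: measurable_funTS|exact: measurable_wt].
rewrite [leRHS]integral_mkcond; apply: ge0_le_integral' => w _; first exact: integral_ge0.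
rewrite patchE inD; case: ifP => dw; last first.
  by rewrite integral0_eq // => z _; rewrite /F /= /fB dw mulr0.
have w1 : normc (cpx w) < 1 by move: dw; rewrite -inD inE.
have FRw := FR2 (cpx w) w1; rewrite (_ : 2 + _ + _ = q) in FRw; last by rewrite /q; field.
apply: (@le_trans _ _ ((fB w)%:E * \int[@dA R]_(p in @disc R)
        ((1 - nsq p) `^ (- (1 + delta) / 2) * normc (1 - cpx w * (cpx p)^*) `^ (- q))%:E)%E).
  rewrite -ge0_integralZl_EFin //; last 2 first.
  - by move=> z dz; rewrite lee_fin mulr_ge0 ?powR_ge0.
  - by apply/measurable_EFinP; apply: measurable_funM; [exact: measurable_onem_powR|exact: measurable_kernel_snd].
  rewrite [leRHS]integral_mkcond; apply: ge0_le_integral' => z _; first exact: F0.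
  rewrite patchE inD (_ : F (z, w) = (fA z * normc (1 - cpx z * (cpx w)^*) `^ (- q) * fB w)%:E) // /fA.
  case: ifP => dz; last by rewrite !mul0r.
  by rewrite -EFinM lee_fin normc1B_conj mulrC.
apply: le_trans (lee_wpmul2l _ FRw) _; first by rewrite lee_fin.
rewrite -!EFinM lee_fin /fB dw -nsqE.
have Yp : 0 < 1 - nsq w by rewrite subr_gt0.
have PP : (1 - nsq w) `^ (b - sigma / 2 + 2^-1) * (1 - nsq w) `^ (- (b - sigma / 2 + 2^-1)) = 1.
  by rewrite -powRDp // subrr powRr0.
move: PP; move: (_ `^ _) (_ `^ _) (h w ^+ 2 * wt a (cpx w)) => P P' g PP.
by rewrite le_eqVlt; apply/orP; left; apply/eqP; rewrite -[RHS]mulr1 -PP; ring.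
Qed.

End SchurTest.

(** * Cells and Carleson boxes *)

Section Sectors.
Variable R : realType.
Implicit Types (p : plane R) (s t : R) (J : interval R).

Lemma normr_sin_le t : `|sin t| <= `|t|.
Proof.
wlog t0 : t / 0 <= t => [H|].
  have [|t0] := leP 0 t; first exact: H.
  by rewrite -normrN -sinN -[leRHS]normrN H // oppr_ge0 ltW.
have cs : {within `[0, t], continuous (@sin R)} by apply: continuous_subspaceT => x; exact: continuous_sin.
have [c _] := MVT_segment t0 (fun x _ => is_derive_sin x) cs.
by rewrite sin0 !subr0 => ->; rewrite normrM ler_piMl // ler_norml cos_geN1 cos_le1.
Qed.

Lemma normc_1Bcis_sqr t : normc (1 - cis t) ^+ 2 = 4 * sin (t / 2) ^+ 2.
Proof.
rewrite normc_sqr !cReD !cImD !cReN !cImN /= sub0r sqrrN.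
have -> : (1 - cos t) ^+ 2 + sin t ^+ 2 = 2 - 2 * cos t + (cos t ^+ 2 + sin t ^+ 2 - 1) by ring.
rewrite cos2Dsin2 subrr addr0 {1}(_ : t = t / 2 + t / 2); last by field.
by rewrite cosD sin2cos2 -!expr2 sin2cos2; ring.
Qed.

Lemma normc_1Bcis_le t : normc (1 - cis t) <= `|t|.
Proof.
rewrite -ler_sqr ?nnegrE ?normc_ge0 // normc_1Bcis_sqr -[_ ^+ 2]real_normK ?num_real //.
have := normr_sin_le (t / 2); rewrite normrM (ger0_norm (_ : 0 <= 2^-1)) // => h.
have := normr_ge0 (sin (t / 2)); nra.
Qed.

Lemma cis_eq1 t : 0 <= t -> t < 2 * pi -> cis t = 1 -> t = 0.
Proof.
rewrite le_eqVlt => /predU1P[<- //|t0] t1 c1.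
have s0 : 0 < sin (t / 2) by apply: sin_gt0_pi; apply/andP; split; lra.
have := normc_1Bcis_sqr t; rewrite c1 subrr normc0 expr0n /= => /esym/eqP.
by rewrite mulf_eq0 expf_eq0 /= (gt_eqF s0) pnatr_eq0.
Qed.

Lemma cis_shift t (k : int) : cis (t + 2 * pi * k%:~R) = cis t.
Proof.
have pos (n : nat) (u : R) : cis (u + 2 * pi * n%:R) = cis u.
  elim: n u => [|n IH] u; first by rewrite mulr0 addr0.
  by rewrite -[n.+1]addn1 natrD mulrDr mulr1 addrA cis2pi IH.
case: k => n; first exact: pos.
by rewrite NegzE mulrNz -(pos n.+1) mulrN subrK.
Qed.

Lemma cis_inj s t : cis s = cis t -> exists k : int, s = t + 2 * pi * k%:~R.
Proof.
move=> e; have p0 : 0 < 2 * pi :> R by rewrite mulr_gt0 // pi_gt0.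
pose k := Num.floor ((s - t) / (2 * pi)); exists k.
have /andP[k1 k2] := Num.Theory.floor_itv ((s - t) / (2 * pi)).
apply/eqP; rewrite addrC -subr_eq -subr_eq0; apply/eqP.
apply: cis_eq1.
- by move: k1; rewrite ler_pdivlMr // subr_ge0 mulrC.
- move: k2; rewrite -/k ltr_pdivrMr // intrD mulrDl mul1r => k2.
  by rewrite ltrBlDl mulrC.
- have -> : s - t - 2 * pi * k%:~R = s - t + 2 * pi * (- k)%:~R by rewrite mulrNz mulrN.
  by rewrite cis_shift cisD e -cisD subrr cis0.
Qed.

Definition sector J : set (plane R) :=
  [set p | exists t, [set` J] t /\ cpx p = (normc (cpx p))%:C * cis t].

Lemma measurable_cArg : measurable_fun [set: plane R] (fun p => cArg (cpx p)).
Proof.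
(* Clamping to [-1, 1] makes arccosine monotone on the whole line, hence measurable, without
   changing it on the quotients met here. *)
pose c (p : plane R) := acos (Num.min 1 (Num.max (-1) (p.1 * (normc (cpx p))^-1))).
have mc : measurable_fun [set: plane R] c.
  pose ac (x : R) := acos (Num.min 1 (Num.max (-1) x)).
  have mac : measurable_fun [set: R] ac.
    apply: nonincreasing_measurable => // x y xy; rewrite /ac.
    set u := Num.min 1 (Num.max (-1) x); set v := Num.min 1 (Num.max (-1) y).
    have uv : u <= v.
      rewrite /u /v le_min !ge_min lexx /= ge_max !le_max lexx /=.
      by rewrite xy !orbT.
    have ui : -1 <= u <= 1 by rewrite /u le_min ge_min lexx le_max lexx /= andbT; lra.
    have vi : -1 <= v <= 1 by rewrite /v le_min ge_min lexx le_max lexx /= andbT; lra.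
    rewrite leNgt; apply/negP => lt; move: uv; rewrite leNgt => /negP; apply.
    rewrite -(acosK (_ : v \in _)) ?in_itv //= -(acosK (_ : u \in _)) ?in_itv //=.
    by rewrite ltr_cos // in_itv /= ?acos_ge0 ?acos_lepi.
  apply: (measurableT_comp mac); apply: measurable_funM; first exact: measurable_fst.
  apply: measurable_inv_ge0; first by move=> x; exact: normc_ge0.
  by apply: measurable_normc; exact: cmeas_cpx.
rewrite (_ : (fun p => _) = (fun p : plane R => if p.2 < 0 then - c p else c p)).
  apply: measurable_fun_ifT => //.
  - by apply: measurable_fun_ltr => //; exact: measurable_snd.
  - exact: (measurableT_comp (@measurable_funN _ _ R [set: R] id (@measurable_id _ _ _)) mc).
apply/funext => p; rewrite /cArg /=.
have -> : c p = acos (p.1 / normc (cpx p)) => //.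
have cz : -1 <= p.1 / normc (cpx p) <= 1.
  have [z0|z0] := eqVneq (normc (cpx p)) 0; first by rewrite z0 invr0 mulr0 lerN10 ler01.
  have nz : 0 < normc (cpx p) by rewrite lt_neqAle eq_sym z0 normc_ge0.
  have := normc_Re (cpx p); rewrite ler_norml => /andP[h1 h2].
  by rewrite ler_pdivrMr // ler_pdivlMr // mulN1r mul1r h1 h2.
by case/andP: cz => c1 c2; rewrite /c (max_idPr c1) (min_idPr c2).
Qed.

(** The origin has every angle; any other point has its principal argument up to multiples of 2 pi.
    A sector is thereby a countable union of measurable sets. *)
Lemma sectorE J p : sector J p <-> (cpx p = 0 /\ [set` J] !=set0) \/
  (exists k : int, [set` J] (cArg (cpx p) + 2 * pi * k%:~R)).
Proof.
have [_ hp] := cArg_polar (cpx p).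
split=> [[t [Jt pt]]|[[p0 [t Jt]]|[k Jk]]].
- have [p0|p0] := eqVneq (cpx p) 0; first by left; split=> //; exists t.
  right; have : (normc (cpx p))%:C * cis t = (normc (cpx p))%:C * cis (cArg (cpx p)) by rewrite -pt -hp.
  have n0 : (normc (cpx p))%:C != 0 by rewrite -normc_gt0 normcR ger0_norm ?normc_ge0 // normc_gt0.
  by move/(mulfI n0)/cis_inj => [k kE]; exists k; rewrite -kE.
- by exists t; split=> //; rewrite p0 normc0 mul0r.
- by exists (cArg (cpx p) + 2 * pi * k%:~R); split=> //; rewrite cis_shift.
Qed.

Lemma measurable_sector J : measurable (sector J).
Proof.
pose f (k : int) (p : plane R) := cArg (cpx p) + 2 * pi * k%:~R.
pose Z : set (plane R) := [set p | nsq p = 0 /\ [set` J] !=set0].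
have -> : sector J = Z `|` \bigcup_k (f k @^-1` [set` J]).
  apply/seteqP; split=> p.
    move/sectorE => [[p0 J0]|[k Jk]]; [left; split=> //|by right; exists k].
    by rewrite nsqE p0 normc0 expr0n.
  case=> [[p0 J0]|[k _ Jk]]; apply/sectorE; [left; split=> //|by right; exists k].
  by apply/eq0_normc/eqP; rewrite -sqrf_eq0 -nsqE p0.
apply: measurableU.
  have [J0|J0] := pselect ([set` J] !=set0).
    rewrite (_ : Z = @nsq R @^-1` [set 0]); first exact: measurable_nsq_set.
    by apply/seteqP; split=> p /=; [case|].
  by rewrite (_ : Z = set0) //; apply/seteqP; split=> p // -[].
rewrite (_ : \bigcup_k _ = \bigcup_(n in [set: nat]) (if unpickle n is Some k then f k @^-1` [set` J] else set0)).
  apply: bigcup_measurable => // n _; case: (unpickle n) => // k.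
  rewrite -[X in measurable X]setTI.
  by apply: (measurable_funD measurable_cArg (measurable_cst (2 * pi * k%:~R))).
apply/seteqP; split=> [p [k _ fk]|p [n _]].
  by exists (pickle k); [exact: I|rewrite pickleK].
by case: (unpickle n) => // k fk; exists k.
Qed.

End Sectors.

Section CellsAndBoxes.
Variable R : realType.
Implicit Types (p : plane R) (s t : R) (N : nat).

Definition cell_arc N (k : nat) : interval R := `[2 * pi * k%:R / 2 ^+ N, 2 * pi * k.+1%:R / 2 ^+ N[.

Lemma cellE N (jk : cell_index N) : @cell R N jk =
  [set p | (jk.1 : nat)%:R / 2 ^+ N <= nsq p < (jk.1 : nat).+1%:R / 2 ^+ N] `&` sector (cell_arc N jk.2).
Proof.
apply/seteqP; split=> p.
  move=> [r [t [pE r0 rr tt]]].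
  have nr : normc (cpx p) = r by rewrite pE normcM normc_cis mulr1 normcR ger0_norm.
  by split; rewrite /= ?nsqE ?nr //; exists t; split; rewrite ?nr //= in_itv.
move=> [/= rr [t [/= tt pE]]]; exists (normc (cpx p)), t; split=> //.
- exact: normc_ge0.
- by rewrite -nsqE.
Qed.

Lemma measurable_cell N (jk : cell_index N) : measurable (@cell R N jk).
Proof.
rewrite cellE; apply: measurableI; last exact: measurable_sector.
rewrite (_ : [set p | _] = @nsq R @^-1` `[(jk.1 : nat)%:R / 2 ^+ N, (jk.1 : nat).+1%:R / 2 ^+ N[).
  by apply: measurable_nsq_set.
by apply/seteqP; split=> p /=; rewrite in_itv.
Qed.

Lemma cell_disc N (jk : cell_index N) : cell jk `<=` @disc R.
Proof.
rewrite cellE => p [/= /andP[_ h] _]; rewrite disc_nsq /=; apply: (lt_le_trans h).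
by rewrite ler_pdivrMr ?exprn_gt0 // mul1r -natrX ler_nat.
Qed.

Lemma angle_mod t : exists s (k : int), 0 <= s < 2 * pi /\ s = t + 2 * pi * k%:~R.
Proof.
have p0 : 0 < 2 * pi :> R by rewrite mulr_gt0 // pi_gt0.
pose k := Num.floor (t / (2 * pi)); exists (t - 2 * pi * k%:~R), (- k).
have /andP[k1 k2] := Num.Theory.floor_itv (t / (2 * pi)).
split; last by rewrite mulrNz mulrN.
move: k1 k2; rewrite ler_pdivlMr // ltr_pdivrMr // intrD -/k.
move: p0 (k%:~R : R) => p0 x; move: p0; move: (2 * pi) => P P0 k1 k2.
by apply/andP; split; lra.
Qed.

Lemma cell_cover p N : @disc R p -> exists jk : cell_index N, cell jk p.
Proof.
rewrite disc_nsq => /= p1; have p0 := nsq_ge0 p.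
have N0 : 0 < 2 ^+ N :> R by rewrite exprn_gt0.
have pp0 : 0 < 2 * pi :> R by rewrite mulr_gt0 // pi_gt0.
have [_ pE] := cArg_polar (cpx p).
have [t [k [/andP[t0 t1] tE]]] := angle_mod (cArg (cpx p)).
have idx (x : R) : 0 <= x -> x < 1 -> exists j : 'I_(2 ^ N), (j : nat)%:R / 2 ^+ N <= x < (j : nat).+1%:R / 2 ^+ N.
  move=> x0 x1; have xN : 0 <= x * 2 ^+ N by rewrite mulr_ge0 // ltW.
  have /andP[h1 h2] := Num.Theory.truncn_itv xN.
  have jN : (Num.truncn (x * 2 ^+ N) < 2 ^ N)%N.
    rewrite -(ltr_nat R) natrX; apply: (le_lt_trans h1).
    by rewrite gtr_pMl.
  by exists (Ordinal jN); rewrite /= ler_pdivrMr // ltr_pdivlMr // h1 h2.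
have [j hj] := idx _ p0 p1.
have [|| k' /andP[hk1 hk2]] := idx (t / (2 * pi)).
- by rewrite divr_ge0 // ltW.
- by rewrite ltr_pdivrMr // mul1r.
exists (j, k'); rewrite cellE; split=> //=.
exists t; split; last by rewrite tE cis_shift.
rewrite /= in_itv /=; apply/andP; split.
  move: hk1; rewrite ler_pdivlMr // => hk1; apply: le_trans hk1.
  by rewrite le_eqVlt; apply/orP; left; apply/eqP; ring.
move: hk2; rewrite ltr_pdivrMr // => hk2; apply: (lt_le_trans hk2).
by rewrite le_eqVlt; apply/orP; left; apply/eqP; ring.
Qed.

(** The origin is excluded because every cell with radial index 0 contains it. Elsewhere |p|^2 fixes
    the first index, and the angle in [0, 2 pi[ the second. *)
Lemma cell_uniq p N (i j : cell_index N) : cpx p != 0 -> cell i p -> cell j p -> i = j.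
Proof.
move=> p0; rewrite !cellE => -[/= r1 [t [/= t1 e1]]] [/= r2 [s [/= s1 e2]]].
have N0 : 0 < 2 ^+ N :> R by rewrite exprn_gt0.
have pp0 : 0 < 2 * pi :> R by rewrite mulr_gt0 // pi_gt0.
have natE (a b : nat) (x : R) : a%:R <= x -> x < a.+1%:R -> b%:R <= x -> x < b.+1%:R -> a = b.
  move=> h1 h2 h3 h4; apply/eqP; rewrite eqn_leq -ltnS -(ltr_nat R) (le_lt_trans h1 h4) /=.
  by rewrite -ltnS -(ltr_nat R) (le_lt_trans h3 h2).
have e12 : i.1 = j.1.
  apply: val_inj; apply: (natE _ _ (nsq p * 2 ^+ N)).
  - by case/andP: r1; rewrite ler_pdivrMr.
  - by case/andP: r1; rewrite ltr_pdivlMr.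
  - by case/andP: r2; rewrite ler_pdivrMr.
  - by case/andP: r2; rewrite ltr_pdivlMr.
have arc0 (k : 'I_(2 ^ N)) u : u \in cell_arc N k -> [/\ 0 <= u, u < 2 * pi, (k : nat)%:R <= u * 2 ^+ N / (2 * pi) & u * 2 ^+ N / (2 * pi) < (k : nat).+1%:R].
  rewrite in_itv /= => /andP[h1 h2]; split.
  - by apply: le_trans h1; rewrite divr_ge0 ?mulr_ge0 ?(ltW N0) ?pi_ge0.
  - apply: (lt_le_trans h2); rewrite ler_pdivrMr // ler_pM2l // -natrX ler_nat; exact: ltn_ord.
  - by rewrite ler_pdivlMr // mulrC -ler_pdivrMr.
  - by rewrite ltr_pdivrMr // [ltRHS]mulrC -ltr_pdivlMr.
have [ta tb tc td] := arc0 _ _ t1; have [sa sb sc sd] := arc0 _ _ s1.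
have ts : t = s.
  have n0 : (normc (cpx p))%:C != 0 by rewrite -normc_gt0 normcR ger0_norm ?normc_ge0 // normc_gt0.
  have ce : cis t = cis s by apply: (mulfI n0); rewrite -e1 -e2.
  wlog st : t s ta tb sa sb ce {t1 e1 s1 e2 tc td sc sd} / s <= t => [H|].
    by have [/H|/ltW/H] := leP s t; [apply|move=> h; rewrite h].
  apply/eqP; rewrite -subr_eq0; apply/eqP; apply: cis_eq1; rewrite ?subr_ge0 //.
    by lra.
  by rewrite cisD ce -cisD subrr cis0.
have e22 : i.2 = j.2 by apply: val_inj; apply: (natE _ _ (t * 2 ^+ N / (2 * pi))) => //; rewrite ts.
by move: e12 e22; case: (i) => ? ?; case: (j) => ? ? /= -> ->.
Qed.

Implicit Type I : circle_arc R.

Definition arc_itv I : interval R :=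
  Interval (BSide (arc_left I) (arc_start I)) (BSide (arc_right I) (arc_end I)).

Lemma arc_len_gt0 I : 0 < arc_len I.
Proof. by rewrite divr_gt0 ?mulr_gt0 ?pi_gt0 // subr_gt0 arc_lt. Qed.

Lemma arc_len_le1 I : arc_len I <= 1.
Proof.
rewrite ler_pdivrMr ?mulr_gt0 ?pi_gt0 // mul1r lerBlDl; exact: arc_le.
Qed.

Lemma carleson_boxE I : carleson_box I =
  [set p | 1 - arc_len I <= normc (cpx p) < 1] `&` sector (arc_itv I).
Proof.
apply/seteqP; split=> p.
  move=> [r [t [pE [s Is st] rr]]].
  have r0 : 0 <= r by case/andP: rr => h _; apply: le_trans h; rewrite subr_ge0 arc_len_le1.
  have nr : normc (cpx p) = r by rewrite pE normcM normc_cis mulr1 normcR ger0_norm.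
  split; first by rewrite /mkset nr.
  by exists s; split=> //; rewrite nr st.
move=> [/= rr [t [Jt pE]]]; exists (normc (cpx p)), t; split=> //.
by exists t.
Qed.

Lemma measurable_carleson_box I : measurable (carleson_box I).
Proof.
rewrite carleson_boxE; apply: measurableI; last exact: measurable_sector.
rewrite (_ : [set p | _] = setT `&` (fun p => normc (cpx p)) @^-1` `[1 - arc_len I, 1[).
  by apply: (measurable_normc (@cmeas_cpx R setT)).
by rewrite setTI; apply/seteqP; split=> p /=; rewrite in_itv.
Qed.

Lemma carleson_box_disc I : carleson_box I `<=` @disc R.
Proof. by rewrite carleson_boxE => p [/= /andP[_ h] _]. Qed.

End CellsAndBoxes.

(** * Comparison of Moebius weights with Carleson-box weights *)

Section BoxBounds.
Variables (R : realType) (K : R -> R).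
Hypothesis hK : class_WQ K.
Variables (sigma C1 delta C2 : R).
Hypotheses (sigma0 : 0 < sigma) (C11 : 1 <= C1).
Hypothesis KU : forall s t : R, 1 <= s -> 0 < t -> t <= 1 -> K (s * t) <= C1 * s `^ sigma * K t.
Hypotheses (delta0 : 0 < delta).
Implicit Types (a : R[i]) (p : plane R).

Lemma centered_arc (t0 l : R) : 0 < l -> l <= 1 ->
  exists I : circle_arc R, arc_len I = l /\ (forall p x, `|x| <= pi * l ->
     1 - l <= normc (cpx p) < 1 -> cpx p = (normc (cpx p))%:C * cis (t0 + x) -> carleson_box I p).
Proof.
move=> l0 l1; have p0 := pi_gt0 R.
have h1 : t0 - pi * l < t0 + pi * l.
  by have : 0 < pi * l by [exact: mulr_gt0]; lra.
have h2 : t0 + pi * l <= t0 - pi * l + 2 * pi.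
  by have : pi * l <= pi by [rewrite ler_piMr // ltW]; lra.
have lenE : arc_len (@CircleArc R _ _ true false h1 h2) = l.
  rewrite /arc_len /= (_ : _ - _ = l * (2 * pi)); last by ring.
  by rewrite mulfK // mulf_neq0 // gt_eqF.
exists (@CircleArc R _ _ true false h1 h2); split.
  exact: lenE.
move=> p x xl rr pE; rewrite carleson_boxE; split.
  by rewrite /mkset lenE.
exists (t0 + x); split=> //.
by rewrite /arc_itv /= in_itv /=; move: xl; rewrite ler_norml => /andP[h3 h4]; apply/andP; split; lra.
Qed.

(* The caps [|1 - conj a w| <= 2^n (1 - |a|)] lie in Carleson boxes of
   comparable size. *)
Lemma cap_in_box a (r : R) : normc a < 1 -> 1 - normc a <= r ->
  exists I : circle_arc R, [/\ arc_len I = Num.min 1 (8 * r) &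
    forall p, @disc R p -> normc (1 - a^* * cpx p) <= r -> carleson_box I p].
Proof.
move=> a1 ar; have r0 : 0 < r by apply: lt_le_trans ar; rewrite subr_gt0.
have l0 : 0 < Num.min 1 (8 * r) by rewrite lt_min ltr01 mulr_gt0.
have l1 : Num.min 1 (8 * r) <= 1 by rewrite ge_min lexx.
have [I [lenI boxI]] := centered_arc (cArg a) l0 l1.
exists I; split=> // p dp dr.
have p1 : normc (cpx p) < 1 by [].
have [_ aE] := cArg_polar a.
have [xpi xE] := cArg_polar (cpx p * cis (- cArg a)).
set x := cArg (cpx p * _) in xpi xE.
have nE : normc (cpx p * cis (- cArg a)) = normc (cpx p) by rewrite normcM normc_cis mulr1.
rewrite nE in xE.
have pE : cpx p = (normc (cpx p))%:C * cis (cArg a + x).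
  by rewrite -[LHS]mulr1 -(cis_mulN (- cArg a)) mulrA xE opprK -mulrA -cisD [x + _]addrC.
have pp0 := pi_gt0 R; have pp2 := @pihalf_ge1 R.
apply: (boxI p x) => //; last first.
  rewrite p1 andbT lerBlDl -lerBlDr; case: (leP 1 (8 * r)) => h.
    by rewrite lerBlDr lerDl normc_ge0.
  have [_ h1] := normc1B_ge (ltW a1) (ltW p1).
  by lra.
case: (leP 1 (8 * r)) => h; first by rewrite mulr1.
have dE : 1 - a^* * cpx p = 1 - (normc a * normc (cpx p))%:C * cis x.
  congr (_ - _); have cR (y : R) : (y%:C)^* = y%:C by rewrite /= oppr0.
  have aJ : a^* = (normc a)%:C * cis (- cArg a) by rewrite {1}aE rmorphM cisN; congr (_ * _); exact: cR.
  transitivity ((normc a)%:C * cis (- cArg a) * cpx p); first by congr (_ * _).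
  rewrite {1}pE rmorphM cisD; set u := cis (- _); set v := cis (cArg a).
  have uv : u * v = 1 by rewrite mulrC; exact: cis_mulN.
  transitivity ((normc a)%:C * (normc (cpx p))%:C * cis x * (u * v)); last by rewrite uv mulr1.
  rewrite mulrACA -!mulrA; congr (_ * (_ * _)); rewrite mulrCA [RHS]mulrC -!mulrA mulrCA; congr (_ * _); exact: mulrC.
have na := normc_ge0 a; have np := normc_ge0 (cpx p).
have rho0 : 0 <= normc a * normc (cpx p) by exact: mulr_ge0.
have rho1 : normc a * normc (cpx p) <= 1 by nra.
have := normc_1Bmulcis_ge rho0 rho1 xpi; rewrite -dE => h1.
have := normr_ge0 x; nra.
Qed.

(** On the shell where |1 - conj a w| is about 2^n (1 - |a|), the first factor of [wt] is of order
    2^(-n delta) and the argument of [K] is comparable to the one of a box of size 2^n (1 - |a|).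
    The term of that n alone dominates. *)
Lemma wt_box_bound : exists2 C : R, 0 <= C & forall a, normc a < 1 ->
  exists (I : nat -> circle_arc R) (n : nat), forall p, @disc R p ->
    wt K delta a (cpx p) <= C * \sum_(i < n) (2 `^ (- delta)) ^+ i *
      (\1_(carleson_box (I i)) p * K ((1 - normc (cpx p)) / arc_len (I i))).
Proof.
exists (4 `^ delta * (C1 * 16 `^ sigma)).
  by rewrite !mulr_ge0 ?powR_ge0 // (le_trans _ C11).
move=> a a1.
pose r (n : nat) := 2 ^+ n * (1 - normc a).
have a0 : 0 < 1 - normc a by rewrite subr_gt0.
have ar n : 1 - normc a <= r n by rewrite ler_peMl ?(ltW a0) // exprn_ege1 // ler1n.
have [I hI] : {I : nat -> circle_arc R & forall n, arc_len (I n) = Num.min 1 (8 * r n) /\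
    forall p, @disc R p -> normc (1 - a^* * cpx p) <= r n -> carleson_box (I n) p}.
  have H n := cid (cap_in_box a1 (ar n)).
  by exists (fun n => projT1 (H n)) => n; case: (projT2 (H n)).
(* |1 - conj a w| is at most 2, so the caps up to index m exhaust the disc and a finite sum is
   enough. *)
have [m hm] : exists m, 2 <= r m.
  pose m := (Num.truncn (2 / (1 - normc a))).+1; exists m.
  have /andP[_ h] := Num.Theory.truncn_itv (divr_ge0 (ler0n _ 2) (ltW a0)).
  rewrite -ler_pdivrMr //; apply: ltW; apply: (lt_trans h); rewrite -/m.
  by rewrite -natrX ltr_nat ltn_expl.
exists I, m.+1 => p dp.
have p1 : normc (cpx p) < 1 by [].
have [da dpp] := normc1B_ge (ltW a1) (ltW p1).
have d0 := normc1B_gt0 a1 (ltW p1).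
set d := normc (1 - a^* * cpx p) in da dpp d0.
have d2 : d <= r m.
  apply: le_trans hm; apply: le_trans (normcB _ _) _.
  rewrite normc1 normcM normcJ; have := normc_ge0 a; have := normc_ge0 (cpx p); nra.
(* The smallest cap containing p. Minimality gives the lower bound r(n) / 2 <= d, and for n = 0 the
   bound d >= 1 - |a| replaces it. *)
pose n := ex_minn (ex_intro (fun n => d <= r n) m d2).
have [nP nmin nm] : [/\ d <= r n, forall k, d <= r k -> (n <= k)%N & (n <= m)%N].
  by rewrite /n; case: ex_minnP => k hk hmin; split=> //; exact: hmin.
have r2 : r n / 2 <= d.
  case E : n => [|k].
    by apply: le_trans da; rewrite /r expr0 mul1r; lra.
  have : ~~ (d <= r k) by apply/negP => /nmin; rewrite E ltnn.
  by rewrite -ltNge /r exprS => /ltW h; lra.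
have rn0 : 0 < r n by apply: lt_le_trans (ar n).
have [lenI boxI] := hI n.
have l0 := arc_len_gt0 (I n); have l1 := arc_len_le1 (I n).
have box := boxI p dp nP.
have np0 : 0 < 1 - normc (cpx p) by rewrite subr_gt0.
have tI0 : 0 < (1 - normc (cpx p)) / arc_len (I n) by rewrite divr_gt0.
have tI1 : (1 - normc (cpx p)) / arc_len (I n) <= 1.
  rewrite ler_pdivrMr // mul1r.
  by move: box; rewrite carleson_boxE => -[/= /andP[h _] _]; lra.
rewrite (bigD1 (Ordinal (nm : (n < m.+1)%N))) //= mulrDr.
apply: ler_wpDr.
  apply: mulr_ge0; first by rewrite !mulr_ge0 ?powR_ge0 // (le_trans _ C11).
  apply: sumr_ge0 => i _; apply: mulr_ge0; first by rewrite exprn_ge0 // powR_ge0.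
  rewrite indicE mulr_ge0 ?ler0n // (WQ_ge0 hK) // divr_ge0 ?(ltW np0) //.
  exact: ltW (arc_len_gt0 _).
rewrite indicE mem_set // mul1r /wt -/d.
set tI := _ / arc_len _ in tI0 tI1 *.
have e1 : ((1 - normc a ^+ 2) / d) `^ delta <= 4 `^ delta * (2 `^ (- delta)) ^+ n.
  rewrite -powR_mulrn ?powR_ge0 // -powRrM.
  have -> : 2 `^ (- delta * n%:R) = (2 ^- n) `^ delta :> R.
    by rewrite -exprVn -powR_mulrn ?invr_ge0 // -powRrM -powR_inv1 // -powRrM; congr (_ `^ _); ring.
  rewrite -powRM ?invr_ge0 ?exprn_ge0 //.
  apply: ge0_ler_powR; rewrite ?nnegrE ?(ltW delta0) ?divr_ge0 ?(ltW d0) ?(ltW (onem_sqr_gt0 a1)) ?invr_ge0 ?exprn_ge0 //.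
  rewrite ler_pdivrMr //; apply: le_trans (onem_sqr_le (ltW a1)) _.
  have -> : 2 * (1 - normc a) = 4 / 2 ^+ n * (r n / 2).
    by rewrite /r; field; rewrite gt_eqF // exprn_gt0.
  by apply: ler_wpM2l => //; rewrite divr_ge0 // exprn_ge0.
have e2 : K ((1 - normc (cpx p) ^+ 2) / (2 * d)) <= C1 * 16 `^ sigma * K tI.
  have h16 : (1 : R) <= 16 by rewrite ler1n.
  apply: le_trans (KU h16 tI0 tI1); apply: (WQ_nondecreasing hK).
    by rewrite ltW // wt_arg_gt0.
  rewrite /tI ler_pdivrMr ?mulr_gt0 //; apply: le_trans (onem_sqr_le (ltW p1)) _.
  have h : arc_len (I n) <= 16 * d.
    by rewrite lenI ge_min; apply/orP; right; lra.
  have -> : 16 * ((1 - normc (cpx p)) / arc_len (I n)) * (2 * d) = 2 * (1 - normc (cpx p)) * (16 * d / arc_len (I n)).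
    by move: (arc_len _)^-1 => z; ring.
  by rewrite ler_peMr ?mulr_ge0 ?(ltW np0) // ler_pdivlMr // mul1r.
have Kt0 : 0 <= K ((1 - normc (cpx p) ^+ 2) / (2 * d)) by rewrite (WQ_ge0 hK) // ltW // wt_arg_gt0.
apply: le_trans (ler_pM (powR_ge0 _ _) Kt0 e1 e2) _.
by rewrite le_eqVlt; apply/orP; left; apply/eqP; ring.
Qed.

(** The point a lies below the midpoint of the arc at height |I|, and is 0 for the full circle. The
    radial defect costs at most 2 |I| and the half-arc pi |I| <= 4 |I|, hence 6. *)
Lemma box_in_cap (I : circle_arc R) : exists a : R[i], [/\ normc a = 1 - arc_len I &
  forall p, carleson_box I p -> normc (1 - a^* * cpx p) <= 6 * arc_len I].
Proof.
have l0 := arc_len_gt0 I; have l1 := arc_len_le1 I.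
have r0 : 0 <= 1 - arc_len I by rewrite subr_ge0.
pose t0 := (arc_start I + arc_end I) / 2.
exists ((1 - arc_len I)%:C * cis t0); split.
  by rewrite normcM normc_cis mulr1 normcR ger0_norm.
move=> p; rewrite carleson_boxE => -[/andP[pl p1] [t [Jt pE]]].
have pp0 := pi_gt0 R; have pp4 : pi <= 4 :> R by have := @pihalf_lt2 R; lra.
have lE : arc_end I - arc_start I = 2 * pi * arc_len I by rewrite /arc_len mulrC divfK // mulf_neq0 // gt_eqF.
have tl : `|t - t0| <= pi * arc_len I.
  have {Jt} : arc_start I <= t <= arc_end I.
    by move: Jt; rewrite /arc_itv; case: (arc_left I) (arc_right I) => -[]; rewrite /= in_itv /= => /andP[h1 h2]; rewrite ?h1 ?h2 ?(ltW h1) ?(ltW h2).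
  by move=> /andP[h1 h2]; rewrite ler_norml /t0; apply/andP; split; lra.
set x := t - t0 in tl; set r := normc (cpx p) in pl p1 pE.
have r'0 : 0 <= r by exact: normc_ge0.
have -> : 1 - ((1 - arc_len I)%:C * cis t0)^* * cpx p = (1 - (1 - arc_len I) * r)%:C + ((1 - arc_len I) * r)%:C * (1 - cis x).
  have aJ : ((1 - arc_len I)%:C * cis t0)^* = (1 - arc_len I)%:C * cis (- t0).
    by rewrite rmorphM cisN; congr (_ * _); rewrite /= oppr0.
  transitivity (1 - (1 - arc_len I)%:C * cis (- t0) * cpx p); first by congr (_ - _ * _).
  have e : (1 - (1 - arc_len I) * r)%:C = 1 - (1 - arc_len I)%:C * r%:C by rewrite rmorphB rmorphM.
  rewrite pE /x cisD e rmorphM; ring.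
apply: le_trans (normcD _ _) _; rewrite [normc (_ * _)]normcM !normcR !ger0_norm ?mulr_ge0 ?subr_ge0 //; last by nra.
have h := normc_1Bcis_le x; have h0 := normc_ge0 (1 - cis x).
have : (1 - arc_len I) * r * normc (1 - cis x) <= 1 * `|x|.
  by apply: ler_pM => //; nra.
nra.
Qed.

(** The converse comparison. Over the box |1 - conj a p|^2 <= 36 |I|^2, hence 1 - |phi_a(p)|^2 is at
    least (1 - |p|) / (36 |I|), and [K] pays 36^sigma for the dilation. *)
Lemma box_weight_le : exists2 C : R, 0 <= C & forall I : circle_arc R, exists a : R[i], normc a < 1 /\
  forall p, carleson_box I p ->
    K ((1 - normc (cpx p)) / arc_len I) <= C * K (1 - normc (mobius a (cpx p)) ^+ 2).
Proof.
exists (C1 * 36 `^ sigma); first by rewrite mulr_ge0 ?powR_ge0 // (le_trans _ C11).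
move=> I; have [a [aE ha]] := box_in_cap I.
have l0 := arc_len_gt0 I; have l1 := arc_len_le1 I.
have a1 : normc a < 1 by rewrite aE; lra.
exists a; split=> // p bp; have dp := carleson_box_disc bp.
have p1 : normc (cpx p) < 1 by [].
have hd := ha p bp; have d0 := normc1B_gt0 a1 (ltW p1).
have np := normc_ge0 (cpx p).
have m0 := onem_sqr_gt0 a1; have q0 := onem_sqr_gt0 p1.
have h36 : (1 : R) <= 36 by rewrite ler1n.
have pl : 1 - arc_len I <= normc (cpx p) by move: bp; rewrite carleson_boxE => -[/andP[]].
set s := (1 - normc (cpx p)) / (36 * arc_len I).
have s0 : 0 < s by rewrite divr_gt0 ?subr_gt0 // mulr_gt0.
have s1 : s <= 1.
  have l36 : 0 < 36 * arc_len I by rewrite mulr_gt0.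
  by rewrite /s ler_pdivrMr // mul1r; lra.
have -> : (1 - normc (cpx p)) / arc_len I = 36 * s by rewrite /s; field; rewrite gt_eqF.
apply: le_trans (KU h36 s0 s1) _; apply: ler_wpM2l.
  by rewrite mulr_ge0 ?powR_ge0 // (le_trans _ C11).
apply: (WQ_nondecreasing hK); first exact: ltW.
rewrite mobius_onem // ler_pdivlMr ?exprn_gt0 //.
have dd : normc (1 - a^* * cpx p) ^+ 2 <= 36 * arc_len I * arc_len I.
  have := normc_ge0 (1 - a^* * cpx p); nra.
apply: le_trans (ler_wpM2l (ltW s0) dd) _.
have -> : s * (36 * arc_len I * arc_len I) = (1 - normc (cpx p)) * arc_len I.
  by rewrite /s; field; rewrite gt_eqF.
rewrite aE; move: (normc (cpx p)) (arc_len I) l0 l1 np p1 {m0 q0 s0 s1 hd d0 dd pl s} => r l l0 l1 r0 r1.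
have h0 : 0 <= (1 - r) * l by rewrite mulr_ge0 ?subr_ge0 // ltW.
have -> : (1 - (1 - l) ^+ 2) * (1 - r ^+ 2) = (1 - r) * l * ((2 - l) * (1 + r)) by ring.
by rewrite ler_peMr //; nra.
Qed.

Definition boxval (I : circle_arc R) N (jk : cell_index N) : R :=
  Rintegral (@dA R) (cell jk `&` carleson_box I) (fun p => K ((1 - normc (cpx p)) / arc_len I)).

Lemma box_arg I p : carleson_box I p -> 0 < (1 - normc (cpx p)) / arc_len I <= 1.
Proof.
move=> bp; have l0 := arc_len_gt0 I.
move: bp; rewrite carleson_boxE => -[/andP[h1 h2] _].
by apply/andP; split; [rewrite divr_gt0 ?subr_gt0|rewrite ler_pdivrMr // mul1r; lra].
Qed.

Lemma dA_disc_fin : (@dA R (@disc R) < +oo)%E.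
Proof.
have := @ge0_integral_radial R (cst 1%E) (measurable_cst _) (fun _ _ => lee01).
rewrite integral_cst ?mul1e; last exact: measurable_disc.
have -> : (\int[@lebesgue_measure R]_(t in `[0%R, 1%R[) cst 1 t = 1)%E.
  rewrite integral_cst // mul1e.
  transitivity (@lebesgue_measure R `[0%R, 1%R[); first by [].
  by rewrite lebesgue_measure_itv /= lte_fin ltr01 oppr0 adde0.
move=> ->.
by rewrite -EFinM ltry.
Qed.

Lemma measurable_box_weight I (D : set (plane R)) : measurable D -> D `<=` carleson_box I ->
  measurable_fun D (fun p => K ((1 - normc (cpx p)) / arc_len I)).
Proof.
move=> mD Db.
apply: (eq_measurable_fun (fun p => K (Num.max ((1 - normc (cpx p)) / arc_len I) 0))).
  move=> p; rewrite inE => /Db /box_arg /andP[h _]; congr K; apply/max_idPl; exact: ltW.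
apply: (measurableT_comp (measurable_WQ hK)); apply: measurable_funM => //.
apply: measurable_funB => //; apply: measurable_normc; exact: cmeas_cpx.
Qed.

Lemma boxvalE I N (jk : cell_index N) :
  (boxval I jk)%:E = (\int[@dA R]_(p in cell jk `&` carleson_box I) (K ((1 - normc (cpx p)) / arc_len I))%:E)%E.
Proof.
rewrite /boxval /Rintegral fineK // ge0_fin_numE; last first.
  apply: integral_ge0 => p [_ /box_arg /andP[h _]]; rewrite lee_fin (WQ_ge0 hK) //; exact: ltW.
have mD : measurable (cell jk `&` carleson_box I).
  by apply: measurableI; [exact: measurable_cell|exact: measurable_carleson_box].
apply: (@le_lt_trans _ _ (\int[@dA R]_(p in @disc R) (K 1)%:E)%E).
  apply: ge0_le_integral_set.
  - by move=> p [_ /box_arg /andP[h _]]; rewrite lee_fin (WQ_ge0 hK) //; exact: ltW.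
  - by move=> p _; rewrite lee_fin (WQ_ge0 hK).
  - by move=> p [/cell_disc].
  - by move=> p [_ /box_arg /andP[h1 h2]]; rewrite lee_fin (WQ_nondecreasing hK) //; exact: ltW.
rewrite integral_cst; last exact: measurable_disc.
have := dA_disc_fin; rewrite -ge0_fin_numE // => /fineK <-; rewrite -EFinM; exact: ltry.
Qed.

Lemma boxval_ge0 I N (jk : cell_index N) : 0 <= boxval I jk.
Proof.
rewrite /boxval /Rintegral fine_ge0 // integral_ge0 // => p [_ /box_arg /andP[h _]].
by rewrite lee_fin (WQ_ge0 hK) //; exact: ltW.
Qed.

(** Each box of [wt_box_bound] contributes at most s, and the boxes are weighted by powers of
    2^-delta < 1, so the total is a geometric sum independent of a and N. *)
Lemma wt_cells_bound : delta < 1 -> exists2 C : R, 0 <= C & forall a N (x : cell_index N -> R) (s : R),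
  normc a < 1 -> (forall i, 0 <= x i) ->
  (forall I, \sum_i x i * boxval I i <= s) ->
  (\int[@dA R]_(p in @disc R) ((\sum_i x i * \1_(cell i) p) * wt K delta a (cpx p))%:E <= (C * s)%:E)%E.
Proof.
move=> delta1; have dl0 := delta0; have [C C0 HC] := wt_box_bound.
pose q : R := 2 `^ (- delta).
have q0 : 0 <= q by exact: powR_ge0.
have q1 : q < 1.
  rewrite /q powRN invf_lt1 ?powR_gt0 // -[ltLHS](_ : 1 `^ delta = 1); last by rewrite powR1.
  by apply: gt0_ltr_powR; rewrite ?nnegrE // ltr1n.
exists (C / (1 - q)); first by rewrite divr_ge0 // subr_ge0 ltW.
move=> a N x s a1 x0 hs.
have [I [n HI]] := HC a a1.
have mdisc := @measurable_disc R.
have mI i k : measurable (cell (N := N) k `&` carleson_box (I i)).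
  by apply: measurableI; [exact: measurable_cell|exact: measurable_carleson_box].
pose G (i : 'I_n) (k : cell_index N) (p : plane R) : \bar R :=
  ((C * q ^+ i * x k) * (\1_(cell k `&` carleson_box (I i)) p * K ((1 - normc (cpx p)) / arc_len (I i))))%:E.
have Gint i k : (\int[@dA R]_(p in @disc R) G i k p = (C * q ^+ i * x k * boxval (I i) k)%:E)%E.
  rewrite EFinM boxvalE /G; under eq_integral do rewrite EFinM.
  rewrite ge0_integralZl_EFin ?mulr_ge0 ?exprn_ge0 //; last 2 first.
  - move=> p dp; rewrite lee_fin mulr_ge0 ?indicE ?ler0n // (WQ_ge0 hK) // divr_ge0 ?(ltW (arc_len_gt0 _)) //.
    by rewrite subr_ge0 ltW.
  - apply/measurable_EFinP; rewrite (_ : (fun p => _) = (fun p => K ((1 - normc (cpx p)) / arc_len (I i))) \_ (cell k `&` carleson_box (I i))).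
      apply: measurable_funTS; apply/(measurable_restrictT _ _).1 => //.
      by apply: measurable_box_weight => // p [].
    by apply/funext => p; rewrite patchE indicE; case: ifP; rewrite ?mul1r ?mul0r.
  congr (_ * _)%E; rewrite integral_mkcond [RHS]integral_mkcond.
  apply: eq_integral => p _; rewrite !patchE indicE.
  have [bp|bp] := boolP (p \in cell k `&` carleson_box (I i)).
    by rewrite mul1r mem_set //; move: bp; rewrite inE => -[/cell_disc].
  by rewrite mul0r; case: ifP.
have G0 i k p : @disc R p -> (0 <= G i k p)%E.
  move=> dp; rewrite lee_fin !mulr_ge0 ?exprn_ge0 ?indicE ?ler0n // (WQ_ge0 hK) // divr_ge0 ?(ltW (arc_len_gt0 _)) //.
  by rewrite subr_ge0 ltW.
have mG i k : measurable_fun (@disc R) (G i k).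
  apply/measurable_EFinP; apply: measurable_funM => //.
  rewrite (_ : (fun p => _) = (fun p => K ((1 - normc (cpx p)) / arc_len (I i))) \_ (cell k `&` carleson_box (I i))).
    apply: measurable_funTS; apply/(measurable_restrictT _ _).1 => //.
    by apply: measurable_box_weight => // p [].
  by apply/funext => p; rewrite patchE indicE; case: ifP; rewrite ?mul1r ?mul0r.
apply: (@le_trans _ _ (\int[@dA R]_(p in @disc R) (\sum_(i < n) \sum_(k : cell_index N) G i k p))%E).
  apply: ge0_le_integral' => p dp.
    rewrite lee_fin mulr_ge0 ?wt_ge0 // sumr_ge0 // => k _.
    by rewrite mulr_ge0 // indicE ler0n.
  have S0 : 0 <= \sum_i x i * \1_(cell i) p.
    by apply: sumr_ge0 => k _; rewrite mulr_ge0 // indicE ler0n.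
  rewrite (_ : (\sum_(i < n) \sum_k G i k p)%E = ((\sum_i x i * \1_(cell i) p) * (C * \sum_(i < n) q ^+ i *
       (\1_(carleson_box (I i)) p * K ((1 - normc (cpx p)) / arc_len (I i)))))%:E).
    by rewrite lee_fin ler_wpM2l // HI.
  rewrite mulr_sumr mulr_sumr -sumEFin; apply: eq_bigr => i _.
  rewrite mulr_suml -sumEFin; apply: eq_bigr => k _; congr EFin.
  by rewrite indicI /=; ring.
rewrite ge0_integral_sum //; last 2 first.
- by move=> i; exact: emeasurable_sum.
- by move=> i p dp; apply: sume_ge0 => k _; exact: G0.
have s0 : 0 <= s.
  by apply: le_trans (hs (I 0%N)); apply: sumr_ge0 => k _; rewrite mulr_ge0 // boxval_ge0.
apply: (@le_trans _ _ (\sum_(i < n) (C * q ^+ i * s)%:E)%E).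
  apply: lee_sum => i _; rewrite ge0_integral_sum //; last by move=> k p; exact: G0.
  under eq_bigr do rewrite Gint.
  rewrite sumEFin lee_fin; under eq_bigr do rewrite -mulrA.
  by rewrite -mulr_sumr ler_wpM2l ?mulr_ge0 ?exprn_ge0.
rewrite sumEFin lee_fin -mulr_suml -mulr_sumr ler_wpM2r //; apply: ler_wpM2l => //.
by have := geometric_sum_le 0 n q0 q1; rewrite expr0 div1r big_mkord.
Qed.

End BoxBounds.

Section Origin.
Variable R : realType.

Lemma dA_origin : @dA R [set p | nsq p = 0] = 0%E.
Proof.
have -> : [set p : plane R | nsq p = 0] = [set 0 : R] `*` [set 0 : R].
  apply/seteqP; split=> -[x y]; rewrite /nsq /=.
    by move/eqP; rewrite paddr_eq0 ?sqr_ge0 // !sqrf_eq0 => /andP[/eqP -> /eqP ->].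
  by move=> [/= -> ->]; rewrite expr0n addr0.
rewrite /dA /= /mscale /=.
have -> : ((@lebesgue_measure R \x @lebesgue_measure R)%E ([set 0 : R] `*` [set 0 : R])) = 0%E.
  transitivity (@lebesgue_measure R [set 0%R : R] * @lebesgue_measure R [set 0%R : R])%E; first exact: product_measure1E.
  by rewrite lebesgue_measure_set1 mul0e.
by rewrite mule0.
Qed.

(** Pointwise bounds for sums over cells hold where a single cell contains the point; this discards
    the origin before such comparisons. *)
Lemma ge0_integral_off_origin (F : plane R -> \bar R) : measurable_fun (@disc R) F ->
  (forall p, @disc R p -> 0 <= F p)%E ->
  (\int[@dA R]_(p in @disc R) F p = \int[@dA R]_(p in @disc R) (if nsq p == 0%R then 0%E else F p))%E.
Proof.
move=> mF F0.
have mN : measurable [set p : plane R | nsq p = 0].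
  rewrite (_ : [set p | _] = @nsq R @^-1` [set 0]); first exact: measurable_nsq_set.
  by apply/seteqP; split.
rewrite (ge0_negligible_integral mN (@measurable_disc R) mF F0 dA_origin).
rewrite integral_mkcond [RHS]integral_mkcond; apply: eq_integral => p _; rewrite !patchE.
case: eqP => p0.
  by rewrite if_same ifF //; apply/negbTE/negP; rewrite inE => -[].
suff -> : (p \in @disc R `\` [set p | nsq p = 0]) = (p \in @disc R) by [].
by apply/idP/idP; rewrite !inE; [case|].
Qed.

End Origin.

(** * The binomial series *)

Section PsumAlgebra.
Variable R : realType.
Implicit Types (a : nat -> R[i]) (z w : R[i]).

Lemma eq_psum a1 a2 z : (forall n, a1 n = a2 n) -> psum a1 z = psum a2 z.
Proof. by move=> e; congr psum; apply/funext. Qed.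

Lemma psumD a1 a2 z : subexp a1 -> subexp a2 -> normc z < 1 ->
  psum (fun n => a1 n + a2 n) z = psum a1 z + psum a2 z.
Proof.
move=> h1 h2 z1; apply: psum_unique => e e0.
have e2 : 0 < e / 2 by rewrite divr_gt0.
have [N1 H1] := psum_cseries h1 z1 e2; have [N2 H2] := psum_cseries h2 z1 e2.
exists (maxn N1 N2) => N; rewrite geq_max => /andP[n1 n2].
under eq_bigr do rewrite mulrDl.
rewrite big_split /= opprD addrACA; apply: le_trans (normcD _ _) _.
by have := H1 N n1; have := H2 N n2; lra.
Qed.

Lemma psumZ a c z : subexp a -> normc z < 1 -> psum (fun n => c * a n) z = c * psum a z.
Proof.
move=> h z1; apply: psum_unique => e e0.
have c0 := normc_ge0 c; have c1 : 0 < normc c + 1 by lra.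
have e2 : 0 < e / (normc c + 1) by rewrite divr_gt0.
have [N0 H] := psum_cseries h z1 e2; exists N0 => N /H hN.
under eq_bigr do rewrite -mulrA.
rewrite -mulr_sumr -mulrBr normcM; apply: le_trans (ler_wpM2l c0 hN) _.
by rewrite mulrCA ler_piMr ?(ltW e0) // ler_pdivrMr // mul1r; lra.
Qed.

Lemma psum0 z : psum (fun=> 0 : R[i]) z = 0.
Proof.
apply: psum_unique => e e0; exists 0%N => N _.
by under eq_bigr do rewrite mul0r; rewrite sumr_const mul0rn subrr normc0 ltW.
Qed.

Lemma subexp_cst (C : R) a : (forall n, normc (a n) <= C) -> subexp a.
Proof.
move=> h x x0 x1; exists C => n; apply: le_trans (h n).
by rewrite ler_piMr ?normc_ge0 // exprn_ile1 // ltW.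
Qed.

Lemma subexpD a1 a2 : subexp a1 -> subexp a2 -> subexp (fun n => a1 n + a2 n).
Proof.
move=> h1 h2 x x0 x1; have [C1 H1] := h1 x x0 x1; have [C2 H2] := h2 x x0 x1.
exists (C1 + C2) => n; apply: le_trans (lerD (H1 n) (H2 n)).
by rewrite -mulrDl ler_wpM2r ?exprn_ge0 ?(ltW x0) // normcD.
Qed.

Lemma subexpM a u (M : R) : (forall n, normc (u n) <= M) -> subexp a -> subexp (fun n => a n * u n : R[i]).
Proof.
move=> hu h x x0 x1; have [C H] := h x x0 x1; exists (C * M) => n.
rewrite normcM mulrAC; apply: ler_pM => //; rewrite ?normc_ge0 //.
by rewrite mulr_ge0 ?normc_ge0 ?exprn_ge0 // ltW.
Qed.

Lemma subexpZ a c : subexp a -> subexp (fun n => c * a n).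
Proof.
move=> h; under [X in subexp X]eq_fun do rewrite mulrC.
by apply: (subexpM (u := fun=> c)) h => n; exact: lexx.
Qed.

Definition pshift a n : R[i] := if n is m.+1 then a m else 0.

Lemma subexp_pshift a : subexp a -> subexp (pshift a).
Proof.
move=> h x x0 x1; have [C H] := h x x0 x1; exists (C + 0) => -[|n].
  rewrite addr0 (_ : pshift a 0 = 0) // normc0 mul0r; apply: le_trans (H 0%N).
  by rewrite mulr_ge0 ?normc_ge0 ?exprn_ge0 // ltW.
rewrite addr0 /=; apply: le_trans (H n); rewrite exprS mulrCA ler_piMl ?(ltW x1) //.
by rewrite mulr_ge0 ?normc_ge0 ?exprn_ge0 // ltW.
Qed.

Lemma psum_pshift a z : subexp a -> normc z < 1 -> psum (pshift a) z = z * psum a z.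
Proof.
move=> h z1; apply: psum_unique => e e0.
have [N0 H] := psum_cseries h z1 e0; exists N0.+1 => -[//|N]; rewrite ltnS => /H hN.
rewrite big_ord_recl /= mul0r add0r.
under eq_bigr do rewrite /bump /= add1n exprS mulrCA.
rewrite -mulr_sumr -mulrBr normcM; apply: le_trans hN.
by rewrite ler_piMl ?normc_ge0 // ltW.
Qed.

Lemma psum_at0 a : psum a 0 = a 0%N.
Proof.
apply: psum_unique => e e0; exists 1%N => -[//|N] _.
rewrite big_ord_recl /= expr0 mulr1 big1 ?addr0 ?subrr ?normc0 ?ltW //.
by move=> i _; rewrite expr0n /= mulr0.
Qed.

Lemma subexp_sum I (r : seq I) (v : I -> R[i]) (a : I -> nat -> R[i]) : (forall i, subexp (a i)) ->
  subexp (fun n => \sum_(i <- r) v i * a i n).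
Proof.
move=> h; elim: r => [|i r IH].
  by under [X in subexp X]eq_fun do rewrite big_nil; apply: (subexp_cst (C := 0)) => n; rewrite normc0.
under [X in subexp X]eq_fun do rewrite big_cons.
by apply: subexpD => //; exact: subexpZ.
Qed.

Lemma psum_sum I (r : seq I) (v : I -> R[i]) (a : I -> nat -> R[i]) z : (forall i, subexp (a i)) -> normc z < 1 ->
  psum (fun n => \sum_(i <- r) v i * a i n) z = \sum_(i <- r) v i * psum (a i) z.
Proof.
move=> h z1; elim: r => [|i r IH].
  by under eq_psum do rewrite big_nil; rewrite psum0 big_nil.
under eq_psum do rewrite big_cons.
rewrite psumD //; [by rewrite psumZ // IH big_cons|exact: subexpZ|exact: subexp_sum].
Qed.

End PsumAlgebra.

Section RealVariableDerivative.
Variable R : realType.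
Implicit Types (f g : R -> R[i]) (t : R) (d : R[i]).

Definition rdiff f t d := is_derive t 1 (fun x => Re (f x)) (Re d) /\ is_derive t 1 (fun x => Im (f x)) (Im d).

Lemma rdiffM f g t d e : rdiff f t d -> rdiff g t e -> rdiff (fun x => f x * g x) t (d * g t + f t * e).
Proof.
move=> [f1 f2] [g1 g2]; split.
  under eq_fun do rewrite cReM.
  by apply: is_derive_eq; rewrite cReD !cReM /GRing.scale /=; ring.
under eq_fun do rewrite cImM.
by apply: is_derive_eq; rewrite cImD !cImM /GRing.scale /=; ring.
Qed.

Lemma is_derive_eps (h : R -> R) t (d : R) :
  (forall e, 0 < e -> exists2 r, 0 < r & forall x, `|x| < r -> `|h (t + x) - h t - d * x| <= e * `|x|) ->
  is_derive t 1 h d.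
Proof.
move=> H.
have C : (fun x : R => x^-1 *: (h (x *: 1 + t) - h t)) @ 0^' --> d.
  apply/cvgrPdist_le => /= e e0; have [r r0 Hr] := H e e0.
  exists r => //= x /=; rewrite sub0r normrN => xr x0.
  have -> : d - x^-1 *: (h (x *: 1 + t) - h t) = - (x^-1 * (h (t + x) - h t - d * x)).
    by rewrite /GRing.scale /= mulr1 [x + t]addrC; field.
  rewrite normrN normrM normfV ler_pdivrMl ?normr_gt0 // [_ * e]mulrC; exact: Hr.
apply: DeriveDef; first by apply/cvg_ex; exists d.
by rewrite /derive; apply/cvg_lim.
Qed.

Lemma rdiff_psum a u t : subexp a -> normc u < 1 -> 0 <= t <= 1 ->
  rdiff (fun x => psum a (x%:C * u)) t (u * psum (pderiv a) (t%:C * u)).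
Proof.
move=> ha u1 /andP[t0 t1].
have tu : normc (t%:C * u) < 1.
  by rewrite normcM normcR ger0_norm // (le_lt_trans _ u1) // ler_piMl ?normc_ge0 //.
have H := psum_cdiff ha tu.
have key (e : R) : 0 < e -> exists2 r, 0 < r & forall x : R, `|x| < r ->
    normc (psum a ((t + x)%:C * u) - psum a (t%:C * u) - (u * psum (pderiv a) (t%:C * u)) * x%:C) <= e * `|x|.
  move=> e0; have [r r0 Hr] := H e e0; exists r => // x xr.
  have nx : normc (x%:C * u) <= `|x| by rewrite normcM normcR ler_piMr // ltW.
  have := Hr (x%:C * u) (le_lt_trans nx xr).
  rewrite -mulrDl -rmorphD /= => h.
  rewrite (_ : u * _ * _ = psum (pderiv a) (t%:C * u) * (x%:C * u)); last first.
    by move: (psum (pderiv a) _) => y; ring.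
  by apply: le_trans h _; rewrite ler_wpM2l // ltW.
split; apply: is_derive_eps => e e0; have [r r0 Hr] := key e e0; exists r => // x xr.
  apply: le_trans (Hr x xr); apply: le_trans _ (normc_Re _).
  by rewrite !cReD !cReN [Re (_ * x%:C)]cReM /= mulr0 subr0.
apply: le_trans (Hr x xr); apply: le_trans _ (normc_Im _).
by rewrite !cImD !cImN [Im (_ * x%:C)]cImM /= mulr0 add0r.
Qed.

Lemma rdiff_cst01 f : (forall t, 0 <= t <= 1 -> rdiff f t 0) -> f 1 = f 0.
Proof.
move=> H.
have key (h : R -> R) : (forall t, 0 <= t <= 1 -> is_derive t 1 h 0) -> h 1 = h 0.
  move=> Hh; have c : {within `[0, 1], continuous h}.
    apply: derivable_within_continuous => x; rewrite in_itv /= => /Hh [] //.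
  have [|x _ e] := MVT_segment ler01 _ c (df := fun=> 0).
    by move=> x; rewrite in_itv /= => /andP[x0 x1]; apply: Hh; rewrite !ltW.
  by apply/eqP; rewrite -subr_eq0 e mul0r.
apply: eq_cplx; apply: (key (fun x => _ (f x))) => t /H [] //.
Qed.

End RealVariableDerivative.

Section BinomialSeries.
Variables (R : realType) (beta : R).
Hypothesis beta0 : 0 <= beta.

(** The Taylor coefficients of (1 - z)^-beta. *)
Fixpoint binc (n : nat) : R := if n is m.+1 then binc m * (m%:R + beta) / m.+1%:R else 1.

Definition bincC n : R[i] := (binc n)%:C.

Lemma binc_ge0 n : 0 <= binc n.
Proof.
by elim: n => [|n IH] //=; rewrite divr_ge0 // mulr_ge0 // addr_ge0.
Qed.

Lemma subexp_bincC : subexp bincC.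
Proof.
move=> x x0 x1.
(* From this index on, consecutive terms have ratio (n + beta) x / (n + 1) <= 1, so the maximum is
   reached among the first terms, whose sum is [M]. *)
have [N HN] : exists N : nat, beta * x <= N%:R * (1 - x).
  pose N := (Num.truncn (beta * x / (1 - x))).+1; exists N.
  have x10 : 0 < 1 - x by rewrite subr_gt0.
  have /andP[_ h] := Num.Theory.truncn_itv (divr_ge0 (mulr_ge0 beta0 (ltW x0)) (ltW x10)).
  by rewrite -ler_pdivrMr // ltW.
pose M := \sum_(i < N.+1) binc i * x ^+ i.
have le_M i : (i <= N)%N -> binc i * x ^+ i <= M.
  move=> iN; rewrite /M (bigD1 (Ordinal (iN : (i < N.+1)%N))) //= lerDl.
  by apply: sumr_ge0 => k _; rewrite mulr_ge0 ?binc_ge0 // exprn_ge0 // ltW.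
exists M => n; rewrite normcR ger0_norm ?binc_ge0 //.
elim: n => [|n IH]; first exact: le_M.
have [nN|Nn] := leqP n.+1 N; first exact: le_M.
apply: le_trans IH; rewrite exprS /=.
have -> : binc n * (n%:R + beta) / n.+1%:R * (x * x ^+ n) = (binc n * x ^+ n) * ((n%:R + beta) * x / n.+1%:R).
  by ring.
rewrite ler_piMr ?mulr_ge0 ?binc_ge0 ?exprn_ge0 ?(ltW x0) // ler_pdivrMr // mul1r.
have h : (N%:R : R) <= n.+1%:R by rewrite ler_nat ltnW.
have h2 : N%:R * (1 - x) <= n.+1%:R * (1 - x) by rewrite ler_wpM2r // subr_ge0 ltW.
by move: h2; rewrite -natr1; lra.
Qed.

Lemma psum_binc_ode z : normc z < 1 -> (1 - z) * psum (pderiv bincC) z = beta%:C * psum bincC z.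
Proof.
move=> z1; have h := subexp_bincC; have hd := subexp_pderiv h.
rewrite mulrBl mul1r -psum_pshift // -psumZ //.
apply/eqP; rewrite subr_eq -psumD //; [|exact: subexpZ|exact: subexp_pshift].
apply/eqP; apply: eq_psum => n; rewrite /pderiv /bincC /=.
have n0 : (n.+1%:R : R) != 0 by rewrite pnatr_eq0.
have nE k : (k%:R : R[i]) = (k%:R)%:C by rewrite rmorph_nat.
rewrite nE -rmorphM /= [n.+1%:R * _]mulrC divfK //.
case: n {n0} => [|m] /=; first by rewrite !mul1r addr0 add0r mulr1.
rewrite -/(binc m.+1) nE -!rmorphM -rmorphD; congr (_%:C).
by move: (binc m.+1) => y; ring.
Qed.

Lemma cArg_atan (z : R[i]) : 0 < Re z -> cArg z = atan (Im z / Re z).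
Proof.
move=> x0; have [api zE] := cArg_polar z.
have z0 : 0 < normc z by rewrite normc_gt0; apply/eqP => z0; rewrite z0 ltxx in x0.
have ct : cos (atan (Im z / Re z)) = Re z / normc z.
  rewrite cos_atan; have -> : 1 + (Im z / Re z) ^+ 2 = (normc z / Re z) ^+ 2.
    by rewrite !expr_div_n normc_sqr; field; rewrite gt_eqF.
  by rewrite sqrtr_sqr ger0_norm ?divr_ge0 ?(ltW z0) ?(ltW x0) // invf_div.
have cp : 0 < cos (atan (Im z / Re z)) by rewrite ct divr_gt0.
have st : sin (atan (Im z / Re z)) = Im z / normc z.
  have := atanK (Im z / Re z); rewrite /tan => /(congr1 (fun x => x * cos (atan (Im z / Re z)))).
  by rewrite divfK ?gt_eqF // => ->; rewrite ct; field; rewrite !gt_eqF.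
have zE2 : z = (normc z)%:C * cis (atan (Im z / Re z)).
  by apply: eq_cplx; rewrite ?cReM ?cImM /= ?mul0r ?subr0 ?addr0 ?ct ?st mulrC divfK ?gt_eqF.
have nz : (normc z)%:C != 0 by rewrite -normc_gt0 normcR ger0_norm // ltW.
have : cis (cArg z) = cis (atan (Im z / Re z)).
  by apply: (mulfI nz); rewrite -zE -zE2.
move/cis_inj => [k kE].
have := atan_gtNpi2 (Im z / Re z); have := atan_ltpi2 (Im z / Re z) => h1 h2.
have p0 := pi_gt0 R.
move: api; rewrite kE ler_norml => /andP[h3 h4].
have k1 : (k%:~R : R) < 1 by rewrite -(@ltr_pM2l _ (2 * pi)) ?mulr_gt0 //; lra.
have k2 : -1 < (k%:~R : R) by rewrite -(@ltr_pM2l _ (2 * pi)) ?mulr_gt0 //; lra.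
have -> : k = 0.
  have k1' : (k < 1)%R by rewrite -(ltr_int R).
  have k2' : (-1 < k)%R by rewrite -(ltr_int R) mulrNz.
  by apply/eqP; rewrite eq_le -ltzD1 add0r k1' /= -ltzD1 -ltrBlDr sub0r.
by rewrite mulr0 addr0.
Qed.

(** Along the segment 1 - s u keeps a positive real part: its argument is an arctangent and its
    modulus the exponential of half a logarithm, both differentiable in the real variable. *)
Lemma rdiff_cpow (u : R[i]) t : normc u < 1 -> 0 <= t <= 1 ->
  rdiff (fun x => cpow (1 - x%:C * u) beta) t
    (- beta%:C * u / (1 - t%:C * u) * cpow (1 - t%:C * u) beta).
Proof.
move=> u1 /andP[t0 t1].
pose X s := 1 - s * Re u; pose Y s := - (s * Im u).
have ReX s : Re (1 - s%:C * u) = X s by rewrite cReD cReN cReM /= mul0r subr0.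
have ImY s : Im (1 - s%:C * u) = Y s by rewrite cImD cImN cImM /= mul0r addr0 add0r.
have Xt : 0 < X t.
  rewrite /X subr_gt0; apply: le_lt_trans u1; apply: le_trans (normc_Re u).
  by apply: le_trans (ler_norm _) _; rewrite normrM ger0_norm // ler_piMl.
pose N s := X s ^+ 2 + Y s ^+ 2.
have Nt : 0 < N t by rewrite ltr_pwDl ?exprn_gt0 ?sqr_ge0.
have nE s : normc (1 - s%:C * u) ^+ 2 = N s by rewrite normc_sqr ReX ImY.
pose ph s := beta * atan (Y s / X s).
pose G s := expR (beta * (ln (N s) / 2)).
have cpE s : 0 < X s -> cpow (1 - s%:C * u) beta = (G s)%:C * cis (ph s).
  move=> Xs; have Ns : 0 < N s by rewrite ltr_pwDl ?exprn_gt0 ?sqr_ge0.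
  have n0 : 0 < normc (1 - s%:C * u).
    by rewrite lt_neqAle normc_ge0 andbT eq_sym -sqrf_eq0 nE gt_eqF.
  rewrite /cpow /cexp cReM cImM /= !mul0r subr0 addr0 cArg_atan ?ReX // ImY /G /ph -nE.
  have -> : ln (normc (1 - s%:C * u) ^+ 2) / 2 = ln (normc (1 - s%:C * u)).
    by rewrite lnXn // mulr2n; move: (ln _) => l; field.
  by [].
have dX : is_derive t 1 X (- Re u).
  by apply: is_derive_eq; rewrite /GRing.scale /=; ring.
have dY : is_derive t 1 Y (- Im u).
  by apply: is_derive_eq; rewrite /GRing.scale /=; ring.
have dN : is_derive t 1 N (- (2 * (X t * Re u + Y t * Im u))).
  by apply: is_derive_eq; rewrite /GRing.scale /= ?expr1; ring.
have dL : is_derive t 1 (fun s => ln (N s)) ((N t)^-1 * - (2 * (X t * Re u + Y t * Im u))).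
  exact: (@is_derive1_comp _ (@ln R) N _ _ _ (is_derive1_ln Nt) dN).
have dG : is_derive t 1 G (- beta * (X t * Re u + Y t * Im u) / N t * G t).
  have dl : is_derive t 1 (fun s => beta * (ln (N s) / 2)) (- beta * (X t * Re u + Y t * Im u) / N t).
    by apply: is_derive_eq; rewrite /GRing.scale /=; field; rewrite gt_eqF.
  have := @is_derive1_comp _ (@expR R) (fun s => beta * (ln (N s) / 2)) t _ _ (is_derive_expR _) dl.
  by rewrite mulrC.
have dP : is_derive t 1 ph (beta * (Y t * Re u - X t * Im u) / N t).
  have dq : is_derive t 1 (fun s => Y s / X s) ((Y t * Re u - X t * Im u) / X t ^+ 2).
    have dV : is_derive t 1 (fun s => (X s)^-1) (- X t ^- 2 *: - Re u).
      by apply: is_deriveV => //; rewrite gt_eqF.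
    by apply: is_derive_eq; rewrite /GRing.scale /=; field; rewrite gt_eqF.
  have da := @is_derive1_comp _ (@atan R) (fun s => Y s / X s) t _ _ (is_derive1_atan _) dq.
  have da' : is_derive t 1 (fun s => atan (Y s / X s)) ((Y t * Re u - X t * Im u) / N t).
    apply: is_derive_eq; rewrite /N expr_div_n; field; rewrite gt_eqF //=.
    by rewrite -/(N t) gt_eqF.
  by apply: is_derive_eq; rewrite /GRing.scale /=; ring.
have near_X : \forall s \near t, 0 < X s.
  have cX : {for t, continuous X} by apply: differentiable_continuous; apply/derivable1_diffP; case: dX.
  by move/cvgrPdist_lt: cX => /(_ _ Xt); apply: filterS => s; rewrite ltr_distlC subrr => /andP[].
have dc : is_derive t 1 (fun s => cos (ph s)) (- sin (ph t) * (beta * (Y t * Re u - X t * Im u) / N t)).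
  exact: (@is_derive1_comp _ (@cos R) ph t _ _ (is_derive_cos _) dP).
have ds : is_derive t 1 (fun s => sin (ph s)) (cos (ph t) * (beta * (Y t * Re u - X t * Im u) / N t)).
  exact: (@is_derive1_comp _ (@sin R) ph t _ _ (is_derive_sin _) dP).
set q := - beta%:C * u / (1 - t%:C * u).
have qRe : Re q = - beta * (X t * Re u + Y t * Im u) / N t.
  rewrite /q invcE nE cReM cReM cImM ?cReN ?cImN ?cReM ?cImM cReJ cImJ ReX ImY /=; ring.
have qIm : Im q = beta * (Y t * Re u - X t * Im u) / N t.
  rewrite /q invcE nE cImM cReM cImM ?cReN ?cImN ?cReM ?cImM cReJ cImJ ReX ImY /=; ring.
split.
  apply: (@near_eq_is_derive _ _ _ (fun s => G s * cos (ph s))) => //.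
    by near=> s; rewrite cpE ?cReM /= ?mul0r ?subr0 //; near: s.
  apply: is_derive_eq; rewrite cpE // cReM qRe qIm cReM cImM /= /GRing.scale /=; ring.
apply: (@near_eq_is_derive _ _ _ (fun s => G s * sin (ph s))) => //.
  by near=> s; rewrite cpE ?cImM /= ?mul0r ?addr0 //; near: s.
apply: is_derive_eq; rewrite cpE // cImM qRe qIm cReM cImM /= /GRing.scale /=; ring.
Unshelve. all: by end_near.
Qed.

(** Along the segment from 0 to u, the product of the series with the principal power has derivative
    0 by the differential equation, so it keeps its value 1 at 0. *)
Lemma psum_binc u : normc u < 1 -> psum bincC u = (cpow (1 - u) beta)^-1.
Proof.
move=> u1.
have ne1 t : 0 <= t <= 1 -> 1 - t%:C * u != 0.
  move=> /andP[t0 t1]; rewrite -normc_gt0; apply: lt_le_trans (ler_normcB _ _).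
  rewrite normc1 subr_gt0 normcM normcR ger0_norm // (le_lt_trans _ u1) // ler_piMl ?normc_ge0 //.
have H : psum bincC (1%:C * u) * cpow (1 - 1%:C * u) beta = psum bincC (0%:C * u) * cpow (1 - 0%:C * u) beta.
  apply: (rdiff_cst01 (f := fun t => psum bincC (t%:C * u) * cpow (1 - t%:C * u) beta)) => t t01.
  have tu : normc (t%:C * u) < 1.
    by case/andP: t01 => t0 t1; rewrite normcM normcR ger0_norm // (le_lt_trans _ u1) // ler_piMl ?normc_ge0.
  have := rdiffM (rdiff_psum subexp_bincC u1 t01) (rdiff_cpow u1 t01).
  have ode := psum_binc_ode tu; have n0 := ne1 t t01.
  suff -> : u * psum (pderiv bincC) (t%:C * u) * cpow (1 - t%:C * u) beta +
     psum bincC (t%:C * u) * (- beta%:C * u / (1 - t%:C * u) * cpow (1 - t%:C * u) beta) = 0 by [].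
  have -> : psum (pderiv bincC) (t%:C * u) = beta%:C * psum bincC (t%:C * u) / (1 - t%:C * u).
    by rewrite -ode mulrAC divff // mul1r.
  by move: (psum _ _) (cpow _ _) (_^-1) => x y v; ring.
move: H; rewrite rmorph1 rmorph0 mul1r mul0r subr0 psum_at0.
have -> : cpow 1 beta = 1 :> R[i].
  rewrite /cpow /cexp cReM cImM /= mul0r subr0 mul0r addr0 -/(normc 1) expr1n expr0n addr0 sqrtr1 ln1 mulr0 expR0.
  by rewrite cArg_atan /= ?ltr01 // mul0r atan0 mulr0 cis0 mul1r.
rewrite mulr1 => e; have n0 : cpow (1 - u) beta != 0.
  by apply/eqP => c0; move: e; rewrite c0 mulr0 => /eqP; rewrite eq_sym oner_eq0.
by apply: (mulIf n0); rewrite e mulVf.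
Qed.

End BinomialSeries.

(** * Packets *)

Section CintegralPsum.
Context d (T : measurableType d) (R : realType) (m : {measure set T -> \bar R}).
Variables (D : set T) (g nu : T -> R[i]) (M : R) (a : nat -> R[i]) (z : R[i]).
Hypotheses (mD : measurable D) (finD : (m D < +oo)%E).
Hypotheses (mg : cmeas D g) (g1 : forall x, D x -> normc (g x) <= 1).
Hypotheses (mnu : cmeas D nu) (nuM : forall x, D x -> normc (nu x) <= M).
Hypotheses (ha : subexp a) (z1 : normc z < 1).

Let zg x : D x -> normc (z * g x) <= normc z.
Proof. by move=> Dx; rewrite normcM ler_piMr ?normc_ge0 // g1. Qed.

Lemma cmeas_psum : cmeas D (fun x => psum a (z * g x)).
Proof.
have [C [q [C0 q0 q1 _ H]]] := psum_unif ha (normc_ge0 z) z1.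
apply: (@cmeas_cvg _ _ _ _ (fun N x => \sum_(n < N) a n * (z * g x) ^+ n)).
  move=> N; apply: cmeas_sum => i; apply: cmeasM; first exact: cmeas_cst.
  by apply: cmeasX; apply: cmeasM => //; exact: cmeas_cst.
move=> x Dx e e0; have [N0 HN] := cvg_expr_small C q0 q1 e0.
by exists N0 => N /HN; apply: le_trans; apply: H; exact: zg.
Qed.

Lemma moment_bound n : normc (Cintegral m D (fun x => g x ^+ n * nu x)) <= Num.max M 0 * fine (m D).
Proof.
apply: normc_Cintegral_bound => //; last by rewrite le_max lexx orbT.
  by apply: cmeasM => //; exact: cmeasX.
move=> x Dx; rewrite normcM normcX le_max; apply/orP; left.
rewrite -[leRHS]mul1r; apply: ler_pM; rewrite ?exprn_ge0 ?normc_ge0 ?nuM //.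
by rewrite exprn_ile1 ?normc_ge0 ?g1.
Qed.

Lemma subexp_moment : subexp (fun n => a n * Cintegral m D (fun x => g x ^+ n * nu x)).
Proof. exact: subexpM moment_bound ha. Qed.

Lemma cintble_psum : cintble m D (fun x => psum a (z * g x) * nu x).
Proof.
have [C [q [C0 q0 q1 _ H]]] := psum_unif ha (normc_ge0 z) z1.
apply: (@cintble_bounded _ _ _ _ _ mD _ (C * Num.max M 0)) => //.
  by apply: cmeasM => //; exact: cmeas_psum.
move=> x Dx; rewrite normcM; apply: ler_pM; rewrite ?normc_ge0 //.
  by have := H _ 0%N (zg Dx); rewrite big_ord0 subr0 expr0 mulr1.
by rewrite le_max nuM.
Qed.

(** Since |g| <= 1, the tails of the series are geometric uniformly over [D], and sum and integral
    may be exchanged on a set of finite measure. *)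
Lemma Cintegral_psum : Cintegral m D (fun x => psum a (z * g x) * nu x) =
  psum (fun n => a n * Cintegral m D (fun x => g x ^+ n * nu x)) z.
Proof.
have [C [q [C0 q0 q1 _ H]]] := psum_unif ha (normc_ge0 z) z1.
symmetry; apply: psum_unique.
have mgn n : cmeas D (fun x => g x ^+ n * nu x) by apply: cmeasM => //; exact: cmeasX.
have ign n : cintble m D (fun x => g x ^+ n * nu x).
  apply: (@cintble_bounded _ _ _ _ _ mD _ (Num.max M 0)) => // x Dx.
  rewrite normcM normcX -[leRHS]mul1r; apply: ler_pM; rewrite ?exprn_ge0 ?normc_ge0 //.
    by rewrite exprn_ile1 ?normc_ge0 ?g1.
  by rewrite le_max nuM.
apply: (@cseries_of_bound _ _ _ (C * Num.max M 0 * fine (m D)) q) => // N.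
rewrite (_ : \sum_(n < N) _ = Cintegral m D (fun x => \sum_(n < N) (a n * z ^+ n) * (g x ^+ n * nu x))); last first.
  rewrite Cintegral_sum // => [|i _]; last exact: cintbleZ.
  by apply: eq_bigr => i _; rewrite CintegralZ // mulrAC.
rewrite -CintegralB //; last 2 first.
- exact: cintble_psum.
- by apply: cintble_sum => // i _; exact: cintbleZ.
rewrite (_ : _ * q ^+ N = C * q ^+ N * Num.max M 0 * fine (m D)); last by ring.
apply: normc_Cintegral_bound => //.
- apply: cmeasB; first by apply: cmeasM => //; exact: cmeas_psum.
  by apply: cmeas_sum => i; apply: cmeasM => //; exact: cmeas_cst.
- move=> x Dx.
  have -> : psum a (z * g x) * nu x - \sum_(n < N) a n * z ^+ n * (g x ^+ n * nu x) =
      (psum a (z * g x) - \sum_(n < N) a n * (z * g x) ^+ n) * nu x.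
    rewrite mulrBl mulr_suml; congr (_ - _); apply: eq_bigr => i _.
    by rewrite exprMn !mulrA.
  rewrite normcM; apply: ler_pM; rewrite ?normc_ge0 //; first exact/H/zg.
  by rewrite le_max nuM.
- by rewrite !mulr_ge0 ?exprn_ge0 // le_max lexx orbT.
Qed.

End CintegralPsum.

Section PacketSeries.
Variables (R : realType) (b : R).
Hypothesis b0 : 0 <= b.
Implicit Types (z w : R[i]).

Let beta0 : 0 <= b + 2. Proof. by rewrite addr_ge0. Qed.

(** Taylor coefficients in u of the integral of (1 - t u)^-(b+2) over t in [0, 1]; with u = z conj
    w, multiplying that function by z gives the packet kernel. *)
Definition ecoef n : R[i] := bincC (b + 2) n / n.+1%:R.

Lemma subexp_ecoef : subexp ecoef.
Proof.
apply: (subexpM (u := fun n => n.+1%:R^-1) (M := 1)); last exact: subexp_bincC.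
by move=> n; rewrite normcV normc_nat invf_le1 // ler1n.
Qed.

Lemma Cintegral_monomial01 (z : R[i]) n :
  Cintegral (@lebesgue_measure R) `[0, 1] (fun t => (t%:C) ^+ n * z) = z / n.+1%:R.
Proof.
have n0 : (n.+1%:R : R) != 0 by rewrite pnatr_eq0.
pose F (t : R) := t ^+ n.+1 / n.+1%:R.
have dF (t : R) : is_derive t 1 F (t ^+ n).
  rewrite (_ : F = (fun t => n.+1%:R^-1 * t ^+ n.+1)); last by apply/funext => x; rewrite mulrC.
  have d1 : is_derive t 1 (fun x : R => x ^+ n.+1) (n.+1%:R * t ^+ n).
    by apply: DeriveDef; [exact: exprn_derivable|rewrite exp_derive /GRing.scale /= mulr1].
  have := @is_deriveZ R R _ _ (n.+1%:R^-1) t 1 _ d1.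
  by rewrite /GRing.scale /= mulrA mulVf // mul1r.
have cF : continuous F.
  by move=> t; apply: differentiable_continuous; apply/derivable1_diffP; case: (dF t).
have I : (\int[@lebesgue_measure R]_(t in `[0%R, 1%R]) (t ^+ n)%:E = (n.+1%:R^-1)%:E)%E.
  have := @continuous_FTC2 R (fun t => t ^+ n) F 0 1 ltr01.
  rewrite /F expr1n expr0n /= mul0r mul1r sube0 => ->//.
  - by apply: continuous_subspaceT => t; exact: exprn_continuous.
  - split=> [t _||]; first by case: (dF t).
      by apply: cvg_at_right_filter; exact: cF.
    by apply: cvg_at_left_filter; exact: cF.
  - by move=> t _; rewrite derive1E; case: (dF t).
have IR : Rintegral (@lebesgue_measure R) `[0, 1] (fun t => t ^+ n) = n.+1%:R^-1 by rewrite /Rintegral I.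
have mI : @measurable _ (measurableTypeR R) `[0, 1] by exact: measurable_itv.
have fI : (@lebesgue_measure R `[0%R, 1%R] < +oo)%E.
  by rewrite lebesgue_measure_itv /= lte_fin ltr01 ltry.
have ci : cintble (@lebesgue_measure R) `[0, 1] (fun t : R => (t%:C) ^+ n).
  apply: (@cintble_bounded _ _ _ _ _ mI _ 1) => //; first by apply: cmeasX; exact: cmeasR.
  move=> t /=; rewrite in_itv /= => /andP[t0 t1].
  by rewrite normcX normcR ger0_norm // exprn_ile1.
transitivity (Cintegral (@lebesgue_measure R) `[0, 1] (fun t : R => z * (t%:C) ^+ n)).
  by apply: eq_Cintegral => t _; rewrite mulrC.
rewrite CintegralZ //; congr (z * _).
transitivity (Cintegral (@lebesgue_measure R) `[0, 1] (fun t : R => (t ^+ n)%:C)).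
  by apply: eq_Cintegral => t _; rewrite rmorphXn.
have -> : (n.+1%:R : R[i]) = (n.+1%:R)%:C by rewrite rmorph_nat.
rewrite -fmorphV; apply: eq_cplx; rewrite /Cintegral /=; first exact: IR.
by rewrite /Rintegral integral0.
Qed.

Lemma packet_kernel_psum z w : normc z < 1 -> normc w <= 1 ->
  packet_kernel b z w = z * psum ecoef (z * w^*).
Proof.
move=> z1 w1; have zw : normc (z * w^*) < 1.
  by rewrite normcM normcJ (le_lt_trans _ z1) // ler_piMr ?normc_ge0.
rewrite /packet_kernel.
have I1 : (@lebesgue_measure R `[0%R, 1%R] < +oo)%E.
  by rewrite lebesgue_measure_itv /= lte_fin ltr01 ltry.
have m1 : @cmeas _ (measurableTypeR R) R `[0, 1] (fun t : R => t%:C).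
  exact: cmeasR.
transitivity (Cintegral (@lebesgue_measure R) `[0, 1] (fun t : R => psum (bincC (b + 2)) (z * w^* * t%:C) * z)).
  apply: eq_Cintegral => t /=; rewrite in_itv /= => /andP[t0 t1]; rewrite psum_binc //; last first.
    rewrite normcM normcR ger0_norm // (le_lt_trans _ zw) // ler_piMr ?normc_ge0 //.
  have -> : t%:C * z * w^* = z * w^* * t%:C by rewrite -mulrA mulrC.
  exact: mulrC.
rewrite (@Cintegral_psum _ _ _ _ _ _ _ (normc z)) //; last 2 first.
- by move=> t h; rewrite normcR; move: h; rewrite /= in_itv /= => /andP[t0 t1]; rewrite ger0_norm.
- exact: subexp_bincC.
rewrite -psumZ //; last exact: subexp_ecoef.
apply: eq_psum => n; rewrite Cintegral_monomial01 /ecoef mulrCA; ring.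
Qed.

Variables (D : set (plane R)) (G : plane R -> R[i]) (M : R).
Hypotheses (mD : measurable D) (Dd : D `<=` @disc R).
Hypotheses (mG : cmeas D G) (GM : forall p, D p -> normc (G p) <= M).

Definition moment n : R[i] := Cintegral (@dA R) D (fun p => (cpx p)^* ^+ n * G p).

Let finD : (@dA R D < +oo)%E.
Proof.
apply: le_lt_trans (dA_disc_fin R); apply: le_measure => //; rewrite inE //.
exact: measurable_disc.
Qed.

Let mg : cmeas D (fun p => (cpx p)^*).
Proof. by apply: cmeasJ; exact: cmeas_cpx. Qed.

Let g1 p : D p -> normc (cpx p)^* <= 1.
Proof. by move=> /Dd dp; rewrite normcJ ltW. Qed.

Lemma subexp_ecoef_moment : subexp (fun n => ecoef n * moment n).
Proof. exact: (subexp_moment mD finD mg g1 mG GM subexp_ecoef). Qed.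

Lemma Cintegral_packet_kernel z : normc z < 1 ->
  Cintegral (@dA R) D (fun p => packet_kernel b z (cpx p) * G p) =
  psum (pshift (fun n => ecoef n * moment n)) z.
Proof.
move=> z1; rewrite psum_pshift //; last exact: subexp_ecoef_moment.
rewrite (@eq_Cintegral _ _ _ _ _ _ (fun p => z * (psum ecoef (z * (cpx p)^*) * G p))); last first.
  by move=> p /Dd dp; rewrite packet_kernel_psum ?mulrA // ltW.
rewrite CintegralZ //; last exact: (cintble_psum mD finD mg g1 mG GM subexp_ecoef z1).
by rewrite (Cintegral_psum mD finD mg g1 mG GM subexp_ecoef z1).
Qed.

Lemma pderiv_packet n : pderiv (pshift (fun n => ecoef n * moment n)) n = bincC (b + 2) n * moment n.
Proof.
by rewrite /pderiv /= /ecoef mulrA; congr (_ * _); rewrite mulrC divfK // pnatr_eq0.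
Qed.

Lemma psum_pderiv_packet z : normc z < 1 ->
  psum (pderiv (pshift (fun n => ecoef n * moment n))) z =
  Cintegral (@dA R) D (fun p => (cpow (1 - z * (cpx p)^*) (b + 2))^-1 * G p).
Proof.
move=> z1; under eq_psum do rewrite pderiv_packet.
rewrite -(Cintegral_psum mD finD mg g1 mG GM (subexp_bincC beta0) z1).
apply: eq_Cintegral => p /Dd dp; rewrite psum_binc // normcM normcJ.
by rewrite (le_lt_trans _ z1) // ler_piMr ?normc_ge0 // ltW.
Qed.

Lemma normc_psum_pderiv_packet z : normc z < 1 ->
  ((normc (psum (pderiv (pshift (fun n => ecoef n * moment n))) z))%:E <=
   \int[@dA R]_(p in D) (normc (1 - z * (cpx p)^*) `^ (- (b + 2)) * normc (G p))%:E)%E.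
Proof.
move=> z1; rewrite psum_pderiv_packet //.
apply: le_trans (normc_Cintegral_le mD _) _.
  apply: eq_cintble (cintble_psum mD finD mg g1 mG GM (subexp_bincC beta0) z1) => // p /Dd dp.
  rewrite psum_binc // normcM normcJ.
  by rewrite (le_lt_trans _ z1) // ler_piMr ?normc_ge0 // ltW.
apply: ge0_le_integral' => p /Dd dp; first by rewrite lee_fin normc_ge0.
rewrite lee_fin normcM normcV normc_cpow ?powRN // -normc_gt0.
by have := normc1B_gt0 dp (ltW z1); rewrite mulrC.
Qed.

End PacketSeries.

Section PacketCombination.
Variables (R : realType) (b : R).
Hypothesis b0 : 0 <= b.
Variable N : nat.
Implicit Types (jk : cell_index N) (v : cell_index N -> R[i]) (z : R[i]) (p : plane R).

Definition bweight p : R := (b + 1) * (1 - normc (cpx p) ^+ 2) `^ b.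

Lemma bweight_ge0 p : 0 <= bweight p.
Proof. by rewrite mulr_ge0 ?powR_ge0 // addr_ge0. Qed.

Lemma bweight_le p : @disc R p -> bweight p <= b + 1.
Proof.
move=> dp; rewrite ler_piMr ?addr_ge0 //.
have h := onem_sqr_gt0 (dp : normc (cpx p) < 1).
rewrite -[leRHS](_ : 1 `^ b = 1); last by rewrite powR1.
by apply: ge0_ler_powR; rewrite ?nnegrE ?(ltW h) // gerBl sqr_ge0.
Qed.

Lemma measurable_bweight (D : set (plane R)) : measurable_fun D bweight.
Proof.
apply: measurable_funM => //; apply: (measurableT_comp (@measurable_powR R b)).
apply: measurable_funB => //; apply: measurable_funX.
by apply: measurable_normc; exact: cmeas_cpx.
Qed.

Definition packet_coef jk : nat -> R[i] :=
  pshift (fun n => ecoef b n * moment (cell jk) (fun p => (bweight p)%:C) n).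

Let mw jk : cmeas (cell jk) (fun p => (bweight p)%:C).
Proof. by apply: cmeasR; exact: measurable_bweight. Qed.

Let wM jk p : cell jk p -> normc (bweight p)%:C <= b + 1.
Proof. by move=> /cell_disc dp; rewrite normcR ger0_norm ?bweight_ge0 ?bweight_le. Qed.

Lemma subexp_packet_coef jk : subexp (packet_coef jk).
Proof.
apply: subexp_pshift.
exact: (subexp_ecoef_moment b0 (measurable_cell jk) (@cell_disc R N jk) (@mw jk) (@wM jk)).
Qed.

Lemma packet_psum jk z : normc z < 1 -> packet b jk z = psum (packet_coef jk) z.
Proof.
move=> z1.
exact: (Cintegral_packet_kernel b0 (measurable_cell jk) (@cell_disc R N jk) (@mw jk) (@wM jk) z1).
Qed.

Definition comb_coef v n : R[i] := \sum_jk v jk * packet_coef jk n.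

Lemma subexp_comb v : subexp (comb_coef v).
Proof. by apply: subexp_sum => jk; exact: subexp_packet_coef. Qed.

Lemma comb_psum v z : normc z < 1 -> psum (comb_coef v) z = \sum_jk v jk * packet b jk z.
Proof.
move=> z1; rewrite psum_sum //; last by move=> jk; exact: subexp_packet_coef.
by apply: eq_bigr => jk _; rewrite packet_psum.
Qed.

Lemma comb_at0 v : psum (comb_coef v) 0 = 0.
Proof. by rewrite psum_at0 /comb_coef big1 // => jk _; rewrite mulr0. Qed.

Lemma comb_pderiv v n : pderiv (comb_coef v) n = \sum_jk v jk * pderiv (packet_coef jk) n.
Proof. by rewrite /pderiv /comb_coef mulr_sumr; apply: eq_bigr => jk _; rewrite mulrCA. Qed.

(** The modulus of the function constant on cells. It is set to 0 at the origin, which lies in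
    several cells, so that its square is bounded cell by cell everywhere. *)
Definition step v p : R := if nsq p == 0 then 0 else \sum_jk normc (v jk) * \1_(cell jk) p.

Lemma step_ge0 v p : 0 <= step v p.
Proof.
rewrite /step; case: ifP => // _; apply: sumr_ge0 => jk _.
by rewrite mulr_ge0 ?normc_ge0 // indicE ler0n.
Qed.

Lemma measurable_cellsum (x : cell_index N -> R) (D : set (plane R)) :
  measurable_fun D (fun p => \sum_jk x jk * \1_(cell jk) p).
Proof.
apply: measurable_sum => jk; apply: measurable_funM => //.
by apply: measurable_funTS; apply: measurable_indic; exact: measurable_cell.
Qed.

Lemma measurable_step v : measurable_fun [set: plane R] (step v).
Proof.
apply: measurable_fun_ifT => //; last exact: measurable_cellsum.
by apply: measurable_fun_eqr => //; exact: measurable_nsq.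
Qed.

Lemma step_sqr_le v p : step v p ^+ 2 <= \sum_jk normc (v jk) ^+ 2 * \1_(cell jk) p.
Proof.
rewrite /step; case: ifPn => [_|p0].
  by rewrite expr0n; apply: sumr_ge0 => jk _; rewrite mulr_ge0 ?sqr_ge0 // indicE ler0n.
have cp0 : cpx p != 0 by apply: contra p0 => /eqP c0; rewrite nsqE c0 normc0 expr0n.
have [[i ip]|no] := pselect (exists i : cell_index N, cell i p); last first.
  rewrite big1 ?expr0n; first by apply: sumr_ge0 => jk _; rewrite mulr_ge0 ?sqr_ge0 // indicE ler0n.
  move=> jk _; rewrite indicE memNset ?mulr0 // => h; apply: no; by exists jk.
have off jk : jk != i -> \1_(cell jk) p = 0 :> R.
  move=> ji; rewrite indicE memNset // => h; move: ji; rewrite (cell_uniq cp0 h ip) eqxx //.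
rewrite (bigD1 i) //= [leRHS](bigD1 i) //= big1; last by move=> jk /off ->; rewrite mulr0.
rewrite [X in _ <= _ + X]big1; last by move=> jk /off ->; rewrite mulr0.
by rewrite !addr0 indicE mem_set // !mulr1.
Qed.

(** Differentiating the packet kernel in z undoes the primitive and leaves the Bergman kernel, whose
    modulus is integrated against [step v]. *)
Lemma normc_comb_deriv v z : normc z < 1 ->
  ((normc (psum (pderiv (comb_coef v)) z))%:E <= (b + 1)%:E * bergman_abs b (step v) z)%E.
Proof.
move=> z1.
pose k p := normc (1 - z * (cpx p)^*) `^ (- (b + 2)) * bweight p.
have k0 p : 0 <= k p by rewrite mulr_ge0 ?powR_ge0 ?bweight_ge0.
have mk (D : set (plane R)) : measurable_fun D k.
  by apply: measurable_funM; [exact: measurable_kernel_snd|exact: measurable_bweight].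
have -> : psum (pderiv (comb_coef v)) z = \sum_jk v jk * psum (pderiv (packet_coef jk)) z.
  under eq_psum do rewrite comb_pderiv.
  by rewrite psum_sum // => jk; apply: subexp_pderiv; exact: subexp_packet_coef.
apply: (@le_trans _ _ (\sum_jk (normc (v jk))%:E * \int[@dA R]_(p in cell jk) (k p)%:E)%E).
  apply: (@le_trans _ _ (\sum_jk (normc (v jk))%:E * (normc (psum (pderiv (packet_coef jk)) z))%:E)%E).
    rewrite (eq_bigr (fun jk => (normc (v jk * psum (pderiv (packet_coef jk)) z))%:E)); last first.
      by move=> jk _; rewrite normcM EFinM.
    by rewrite sumEFin lee_fin normc_sum.
  apply: lee_sum => jk _; apply: lee_wpmul2l; first by rewrite lee_fin normc_ge0.
  apply: le_trans (normc_psum_pderiv_packet b0 (measurable_cell jk) (@cell_disc R N jk) (@mw jk) (@wM jk) z1) _.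
  apply: ge0_le_integral' => p _; first by rewrite lee_fin mulr_ge0 ?powR_ge0 ?normc_ge0.
  by rewrite normcR ger0_norm ?bweight_ge0.
pose F p := ((\sum_jk normc (v jk) * \1_(cell jk) p) * k p)%:E.
have E1 : (\sum_jk (normc (v jk))%:E * \int[@dA R]_(p in cell jk) (k p)%:E = \int[@dA R]_(p in @disc R) F p)%E.
  transitivity (\int[@dA R]_(p in @disc R) \sum_jk ((normc (v jk) * (\1_(cell jk) p * k p))%:E))%E.
    rewrite ge0_integral_sum //; last 3 first.
    - exact: measurable_disc.
    - move=> jk; apply/measurable_EFinP; apply: measurable_funM => //; apply: measurable_funM => //.
      by apply: measurable_funTS; apply: measurable_indic; exact: measurable_cell.
    - by move=> jk p _; rewrite lee_fin mulr_ge0 ?normc_ge0 // mulr_ge0 // indicE ler0n.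
    apply: eq_bigr => jk _; under [RHS]eq_integral do rewrite EFinM.
    rewrite ge0_integralZl_EFin ?normc_ge0 //; last 3 first.
    - exact: measurable_disc.
    - by move=> p _; rewrite lee_fin mulr_ge0 // indicE ler0n.
    - apply/measurable_EFinP; apply: measurable_funM => //.
      by apply: measurable_funTS; apply: measurable_indic; exact: measurable_cell.
    congr (_ * _)%E; rewrite [LHS]integral_mkcond [RHS]integral_mkcond.
    apply: eq_integral => p _; rewrite !patchE indicE.
    have [jp|jp] := boolP (p \in cell jk); last by rewrite mul0r; case: ifP.
    by rewrite mul1r mem_set //; move: jp; rewrite inE => /cell_disc.
  apply: eq_integral => p _; rewrite sumEFin /F mulr_suml; congr EFin.
  by apply: eq_bigr => jk _; rewrite mulrA.
rewrite E1 ge0_integral_off_origin; last 2 first.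
- by apply/measurable_EFinP; apply: measurable_funM => //; exact: measurable_cellsum.
- move=> p _; rewrite lee_fin mulr_ge0 //; apply: sumr_ge0 => jk _.
  by rewrite mulr_ge0 ?normc_ge0 // indicE ler0n.
rewrite /bergman_abs -ge0_integralZl_EFin; last 4 first.
- exact: measurable_disc.
- by move=> p _; rewrite lee_fin !mulr_ge0 ?powR_ge0 ?step_ge0.
- apply/measurable_EFinP; apply: measurable_funM; last exact: measurable_kernel_snd.
  by apply: measurable_funM; [apply: measurable_funTS; exact: measurable_step|exact: measurable_onem_powR].
- by rewrite addr_ge0.
apply: ge0_le_integral' => p _.
  case: ifP => // _; rewrite lee_fin mulr_ge0 //; apply: sumr_ge0 => jk _.
  by rewrite mulr_ge0 ?normc_ge0 // indicE ler0n.
rewrite /step; case: ifP => p0; first by rewrite !mul0r mule0.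
rewrite -EFinM lee_fin /k /bweight -nsqE le_eqVlt; apply/orP; left; apply/eqP; ring.
Qed.

End PacketCombination.

Section FullCircle.
Variable R : realType.

Lemma full_circle_lt : - pi < pi :> R.
Proof. by have := pi_gt0 R; lra. Qed.

Lemma full_circle_le : pi <= - pi + 2 * pi :> R.
Proof. by lra. Qed.

(** Its box is the whole disc, which makes it the reference arc of the duality argument. *)
Definition full_circle : circle_arc R := CircleArc true false full_circle_lt full_circle_le.

Lemma full_circle_len : arc_len full_circle = 1.
Proof.
have := pi_gt0 R => p0; rewrite /arc_len (_ : _ - _ = 2 * pi); last by rewrite /=; ring.
by rewrite divff // mulf_neq0 // gt_eqF.
Qed.

Lemma full_circle_box : carleson_box full_circle = @disc R.
Proof.
apply/seteqP; split; first exact: carleson_box_disc.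
move=> p dp; rewrite carleson_boxE; split.
  by rewrite /mkset full_circle_len subrr normc_ge0.
have [h hp] := cArg_polar (cpx p); exists (cArg (cpx p)); split=> //.
by rewrite /arc_itv /= in_itv /= -ler_norml.
Qed.

End FullCircle.

(** * Packet combinations belong to Q_K *)

Section PacketsInQK.
Variables (R : realType) (K : R -> R).
Hypothesis hK : class_WQ K.
Variables (sigma C1 delta C2 : R).
Hypotheses (sigma0 : 0 < sigma) (C11 : 1 <= C1).
Hypothesis KU : forall s t : R, 1 <= s -> 0 < t -> t <= 1 -> K (s * t) <= C1 * s `^ sigma * K t.
Hypotheses (delta0 : 0 < delta) (delta1 : delta < 1) (C21 : 1 <= C2).
Hypothesis KL : forall s t : R, 0 <= s -> s <= 4 -> 0 < t -> t <= 1 -> K (s * t) <= C2 * s `^ delta * K t.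

Lemma psum_holomorphic (a : nat -> R[i]) : subexp a -> holomorphic_on (@cdisc R) (psum a).
Proof. by move=> ha z z1; have [] := cdiff_derivable (psum_cdiff ha z1). Qed.

Lemma cderive_psum (a : nat -> R[i]) z : subexp a -> normc z < 1 -> cderive (psum a) z = psum (pderiv a) z.
Proof. by move=> ha z1; have [] := cdiff_derivable (psum_cdiff ha z1). Qed.

Lemma QK_seminorm_sqr_le (f : R[i] -> R[i]) (s : R) : 0 <= s ->
  (forall a, normc a < 1 -> (\int[@dA R]_(p in @disc R)
    (normc (cderive f (cpx p)) ^+ 2 * K (1 - normc (mobius a (cpx p)) ^+ 2))%:E <= s%:E)%E) ->
  (QK_seminorm K f ^+ 2 <= s%:E)%E.
Proof.
move=> s0 H; rewrite /QK_seminorm; set S := ereal_sup _.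
have S0 : (0 <= S)%E.
  have h0 : @cdisc R 0 by rewrite /cdisc /mkset normc0 ltr01.
  apply: le_trans (ereal_sup_ubound (ex_intro2 _ _ (0 : R[i]) h0 erefl)).
  apply: integral_ge0 => p dp; rewrite lee_fin mulr_ge0 ?sqr_ge0 // (WQ_ge0 hK) //.
  rewrite mobius_onem ?normc0 ?ltr01 // divr_ge0 ?sqr_ge0 // mulr_ge0 ?(ltW (onem_sqr_gt0 (dp : normc (cpx p) < 1))) //.
  by rewrite expr0n subr0.
rewrite sqr_sqrte //; apply: ge_ereal_sup => _ [a a1 <-]; exact: H.
Qed.

(** For each a: the Moebius weight is replaced by [wt], the derivative by the Bergman operator on
    [step v], the Schur test returns to [step v], and boxes control what is left. No constant
    depends on a or N, so the supremum over a is harmless. *)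
Lemma packets_in_QK (b : R) : sigma + 1 <= b -> exists2 C : R, 0 <= C &
  forall N (v : cell_index N -> R[i]) (s : R),
  (forall I, \sum_i normc (v i) ^+ 2 * boxval K I i <= s) ->
  in_QK K (psum (comb_coef b v)) /\ (QK_norm K (psum (comb_coef b v)) ^+ 2 <= (C * s)%:E)%E.
Proof.
move=> hb; have s0 := sigma0.
have b0 : 0 <= b by lra.
have [Cs Cs0 HS] := schur_bound hK sigma0 C11 KU delta0 delta1 hb.
have [Cc Cc0 HC] := wt_cells_bound hK C11 KU delta0 delta1.
have Ck0 : 0 <= C2 * 2 `^ delta by rewrite mulr_ge0 ?powR_ge0 // (le_trans _ C21).
(* The losses of [K_mobius_le] and [normc_comb_deriv] are folded into the input h = k [step v] of
   the Schur test. *)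
pose k := Num.sqrt (C2 * 2 `^ delta) * (b + 1).
have k0 : 0 <= k by rewrite mulr_ge0 ?sqrtr_ge0 // addr_ge0.
have kk : k ^+ 2 = C2 * 2 `^ delta * (b + 1) ^+ 2 by rewrite exprMn sqr_sqrtr.
pose C := Cs * (Cc * k ^+ 2).
have C0 : 0 <= C by exact: mulr_ge0 Cs0 (mulr_ge0 Cc0 (sqr_ge0 _)).
exists C => // N v s hs.
have sp := subexp_comb b0 v.
have s00 : 0 <= s.
  apply: le_trans (hs (full_circle R)); apply: sumr_ge0 => i _; rewrite mulr_ge0 ?sqr_ge0 //; exact: boxval_ge0.
have main : (QK_seminorm K (psum (comb_coef b v)) ^+ 2 <= (C * s)%:E)%E.
  apply: QK_seminorm_sqr_le => [|a a1]; first exact: mulr_ge0.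
  have mdisc := @measurable_disc R.
  pose h p := k * step v p.
  have h0 p : 0 <= h p by rewrite mulr_ge0 ?step_ge0.
  have mh : measurable_fun [set: plane R] h by apply: measurable_funM => //; exact: measurable_step.
  have hE z : bergman_abs b h z = (k%:E * bergman_abs b (step v) z)%E.
    rewrite /bergman_abs -ge0_integralZl_EFin //.
    - by apply: eq_integral => p _; rewrite -EFinM /h -!mulrA.
    - by move=> p _; rewrite lee_fin !mulr_ge0 ?powR_ge0 ?step_ge0.
    - apply/measurable_EFinP; apply: measurable_funM; last exact: measurable_kernel_snd.
      by apply: measurable_funM; [apply: measurable_funTS; exact: measurable_step|exact: measurable_onem_powR].
  apply: (@le_trans _ _ (\int[@dA R]_(z in @disc R)
     ((wt K delta a (cpx z))%:E * bergman_abs b h (cpx z) ^+ 2))%E).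
    have K0 p : @disc R p -> 0 <= K (1 - normc (mobius a (cpx p)) ^+ 2).
      move=> dp; apply: (WQ_ge0 hK); rewrite mobius_onem // divr_ge0 ?sqr_ge0 // mulr_ge0 ?ltW ?onem_sqr_gt0 //.
    apply: ge0_le_integral' => p dp; first by rewrite lee_fin mulr_ge0 ?sqr_ge0 // K0.
    rewrite cderive_psum //.
    have d1 := normc_comb_deriv b0 v (dp : normc (cpx p) < 1).
    have w0 : 0 <= wt K delta a (cpx p) by exact: (wt_ge0 hK).
    have km := K_mobius_le KL a1 (dp : normc (cpx p) < 1).
    have S0 : (0 <= bergman_abs b (step v) (cpx p))%E.
      by apply: integral_ge0 => w _; rewrite lee_fin !mulr_ge0 ?powR_ge0 ?step_ge0.
    set x := normc (psum _ _) in d1 *; have x0 : 0 <= x by exact: normc_ge0.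
    (* The Bergman integral may be infinite at p; strict positivity of [wt] and [k] then makes the
       right-hand side infinite as well. *)
    have wp : 0 < wt K delta a (cpx p).
      have p1 : normc (cpx p) < 1 := dp.
      rewrite /wt; apply: mulr_gt0; first by rewrite powR_gt0 // divr_gt0 ?onem_sqr_gt0 ?normc1B_gt0 // ltW.
      by apply: (WQ_gt0 hK); exact: wt_arg_gt0.
    have kp : 0 < k by rewrite mulr_gt0 ?ltr_wpDl // sqrtr_gt0 mulr_gt0 ?powR_gt0 // (lt_le_trans _ C21).
    rewrite hE; move: d1 S0; case: (bergman_abs b (step v) (cpx p)) => [S||] //.
      rewrite -!EFinM !lee_fin => d1 S0.
      suff : x ^+ 2 * K (1 - normc (mobius a (cpx p)) ^+ 2) <= wt K delta a (cpx p) * (k * S) ^+ 2 by [].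
      have -> : wt K delta a (cpx p) * (k * S) ^+ 2 = ((b + 1) * S) ^+ 2 * (C2 * 2 `^ delta * wt K delta a (cpx p)).
        by rewrite exprMn kk exprMn; move: (_ `^ _) (wt _ _ _ _) (b + 1) => y y' y''; ring.
      apply: ler_pM => //; [exact: sqr_ge0|exact: K0|].
      by rewrite ler_sqr ?nnegrE // (le_trans x0).
    by move=> _ _; rewrite gt0_muley ?lte_fin // expe2 mulyy gt0_muley ?lte_fin // leey.
  apply: le_trans (HS a h a1 mh h0) _.
  rewrite /C -mulrA EFinM; apply: lee_wpmul2l; first by rewrite lee_fin.
  rewrite -mulrA; apply: le_trans _ (HC a N (fun i => k ^+ 2 * normc (v i) ^+ 2) (k ^+ 2 * s) a1 _ _).
  - apply: ge0_le_integral' => p dp.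
      by rewrite lee_fin; exact: (sqr_wt_ge0 hK).
    rewrite lee_fin; apply: ler_wpM2r; first exact: (wt_ge0 hK).
    rewrite /h exprMn; apply: le_trans (ler_wpM2l (sqr_ge0 _) (step_sqr_le v p)) _.
    by rewrite mulr_sumr; apply: ler_sum => i _; rewrite mulrA.
  - by move=> i; rewrite mulr_ge0 ?sqr_ge0.
  - move=> I; under eq_bigr do rewrite -mulrA.
    by rewrite -mulr_sumr ler_wpM2l ?sqr_ge0.
have f0 : normc (psum (comb_coef b v) 0) = 0 by rewrite comb_at0 normc0.
have nE : QK_norm K (psum (comb_coef b v)) = QK_seminorm K (psum (comb_coef b v)).
  by rewrite /QK_norm f0 add0e.
split; last by rewrite nE.
split; first exact: psum_holomorphic.
rewrite nE ltey; apply/eqP => e; move: main; rewrite e.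
by rewrite expe2 mulyy leye_eq.
Qed.

End PacketsInQK.

(** * Quadratic forms and the capacity *)

Section Duality.
Variables (R : realType) (n : nat) (U : Type) (u0 : U) (A : U -> 'I_n -> R) (B : R).
Hypotheses (A0 : forall u i, 0 <= A u i) (AB : forall u i, A u i <= B).

(** Rounding every coordinate down to a multiple of [eps] leaves finitely many patterns, the entries
    lying between 0 and B; one representative per attained pattern forms the net. *)
Lemma finite_net (eps : R) : 0 < eps -> exists (m : nat) (J : nat -> U),
  forall u, exists2 j, (j < m)%N & forall i, A u i <= A (J j) i + eps.
Proof.
move=> e0; have B0 : 0 <= Num.max B 0 by rewrite le_max lexx orbT.
pose M := (Num.truncn (Num.max B 0 / eps)).+1.
have hM u i : (Num.truncn (A u i / eps) < M)%N.
  rewrite ltnS; apply: le_truncn; rewrite ler_pM2r ?invr_gt0 //.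
  by rewrite le_max AB.
pose cl u : {ffun 'I_n -> 'I_M} := [ffun i => Ordinal (hM u i)].
pose rep (k : {ffun 'I_n -> 'I_M}) : U :=
  if pselect (exists u, cl u = k) is left h then projT1 (cid h) else u0.
have repP u : cl (rep (cl u)) = cl u.
  rewrite /rep; case: pselect => [h|[]]; last by exists u.
  exact: projT2 (cid h).
pose k0 := cl u0.
exists #|{: {ffun 'I_n -> 'I_M}}|, (fun j => rep (nth k0 (enum {: {ffun 'I_n -> 'I_M}}) j)) => u.
exists (index (cl u) (enum {: {ffun 'I_n -> 'I_M}})).
  by rewrite cardE index_mem mem_enum.
move=> i; rewrite nth_index ?mem_enum //.
have := congr1 (fun f : {ffun 'I_n -> 'I_M} => (f i : nat)) (repP u); rewrite !ffunE /= => e.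
have /andP[_ h1] := Num.Theory.truncn_itv (divr_ge0 (A0 u i) (ltW e0)).
have /andP[h2 _] := Num.Theory.truncn_itv (divr_ge0 (A0 (rep (cl u)) i) (ltW e0)).
move: h1; rewrite -e -natr1 ltr_pdivrMr // mulrDl mul1r => h1.
move: h2; rewrite ler_pdivlMr // => h2.
by apply: ltW; apply: lt_le_trans h1 _; rewrite lerD2r.
Qed.

Hypothesis A_null : forall u i, A u0 i = 0 -> A u i = 0.

(** The net is taken with an additive error at most the least nonzero entry of [A u0], so that
    [A u0] itself absorbs the error, and [A_null] settles the coordinates where it vanishes. With
    [u0] added to the net, the best member dominates up to the factor 2. *)
Lemma finite_dominating : exists (m : nat) (J : nat -> U), forall (x : 'I_n -> R), (forall i, 0 <= x i) ->
  exists2 j, (j < m)%N & forall u, \sum_i x i * A u i <= 2 * \sum_i x i * A (J j) i.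
Proof.
pose c : R := \big[Num.min/1]_(i | A u0 i != 0) A u0 i.
have c0 : 0 < c.
  apply: (@big_ind _ (fun x : R => 0 < x)) => // [a b a0 b0|i ai]; first by rewrite lt_min a0.
  by rewrite lt_neqAle eq_sym ai A0.
have cA i : A u0 i != 0 -> c <= A u0 i by move=> ai; rewrite /c (bigD1 i) //= ge_min lexx.
have [m [J HJ]] := finite_net c0.
exists m.+1, (fun j => if j is j'.+1 then J j' else u0) => x x0.
pose F (j : 'I_m.+1) := \sum_i x i * A (if (j : nat) is j'.+1 then J j' else u0) i.
have [j _ jmax] := @arg_maxP _ _ _ ord0 xpredT F isT.
exists j => //= u.
have [j' j'm hj'] := HJ u.
have h1 := jmax (Ordinal (j'm : (j'.+1 < m.+1)%N)) isT.
have h0 := jmax ord0 isT.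
rewrite /F /= in h1 h0.
have : \sum_i x i * A u i <= \sum_i x i * A (J j') i + \sum_i x i * A u0 i.
  rewrite -big_split /=; apply: ler_sum => i _; rewrite -mulrDr ler_wpM2l //.
  have [e|ne] := eqVneq (A u0 i) 0; first by rewrite A_null // addr_ge0.
  by apply: le_trans (hj' i) _; rewrite lerD2l cA.
by rewrite /F in jmax; move: h0 h1; set S := \sum_i x i * A (if _ is _.+1 then _ else _) i; lra.
Qed.

Variables (q : 'rV[R[i]]_n -> R) (C : R).
Hypothesis C0 : 0 <= C.
Hypothesis q_ge0 : forall v, 0 <= q v.
Hypothesis q_par : forall u v, q (u + v) + q (u - v) = 2 * q u + 2 * q v.
Hypothesis q_hom : forall (c : R) v, q (c%:C *: v) = c ^+ 2 * q v.
Hypothesis q_le : forall (v : 'rV[R[i]]_n) (s : R), (forall u, \sum_i normc (v 0 i) ^+ 2 * A u i <= s) -> q v <= C * s.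

(** The supremum over u becomes one weighted sum. Separation is applied to families of vectors,
    where the little Grothendieck inequality provides, for each family, one functional that is
    nonpositive; the conclusion is then read on families with one member. *)
Lemma weights_exist : exists (M : nat) (lam : 'I_M -> R) (I : 'I_M -> U),
  [/\ forall m, 0 <= lam m, \sum_m lam m = 128 * C &
   forall v, q v <= \sum_m lam m * \sum_i normc (v 0 i) ^+ 2 * A (I m) i].
Proof.
have [m [J HJ]] := finite_dominating.
(* 128 = 64 * 2: the little Grothendieck constant times the loss of the finite net. *)
pose L (j : nat) (l : seq 'rV[R[i]]_n) := \sum_(v <- l) q v - 128 * C * \sum_i sqmass l i * A (J j) i.
have sq_cat l l' i : sqmass (l ++ l') i = sqmass l i + sqmass l' i by rewrite /sqmass big_cat.
pose scl (c : R) (l : seq 'rV[R[i]]_n) := [seq (Num.sqrt c)%:C *: v | v <- l].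
have sq_scl c l i : 0 < c -> sqmass (scl c l) i = c * sqmass l i.
  move=> cp; rewrite /sqmass big_map mulr_sumr; apply: eq_bigr => v _.
  by rewrite mxE normcM exprMn normcR ger0_norm ?sqrtr_ge0 // sqr_sqrtr // ltW.
have Lc j : cone_functional cat scl (L j).
  split=> [l l'|c l cp]; rewrite /L.
    rewrite big_cat /= (eq_bigr (fun i => sqmass l i * A (J j) i + sqmass l' i * A (J j) i)); last first.
      by move=> i _; rewrite sq_cat mulrDl.
    by rewrite big_split /=; ring.
  rewrite big_map (eq_bigr (fun v => c * q v)); last first.
    by move=> v _; rewrite q_hom sqr_sqrtr // ltW.
  rewrite -mulr_sumr (eq_bigr (fun i => c * (sqmass l i * A (J j) i))); last first.
    by move=> i _; rewrite sq_scl // mulrA.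
  by rewrite -mulr_sumr; ring.
have q_bnd v : q v <= (C * B) * \sum_i normc (v 0 i) ^+ 2.
  rewrite -mulrA; apply: q_le => u; rewrite mulr_sumr; apply: ler_sum => i _.
  by rewrite mulrC ler_wpM2r ?sqr_ge0.
(* The member of the net that is best for the column masses of [l] bounds q on every vector below
   these masses, and [l] itself is an admissible family for them. *)
have key l : True -> exists2 j, (j < m)%N & L j l <= 0.
  move=> _; have [j jm hj] := HJ (sqmass l) (sqmass_ge0 l); exists j => //.
  pose s := 2 * \sum_i sqmass l i * A (J j) i.
  have hs (u : 'rV[R[i]]_n) : (forall i, normc (u 0 i) ^+ 2 <= sqmass l i) -> q u <= C * s.
    move=> hu; apply: q_le => w; apply: le_trans (hj w).
    by apply: ler_sum => i _; rewrite ler_wpM2r.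
  have := little_grothendieck q_ge0 q_par q_hom q_bnd (sqmass_ge0 l) hs (fun i => lexx _).
  by rewrite /L /s subr_le0 => h; apply: le_trans h _; rewrite le_eqVlt; apply/orP; left; apply/eqP; ring.
have [none|[lam [lam0 Lam0 H]]] := cone_alternative (P := fun=> True) Lc (fun _ _ _ _ => I) (fun _ _ _ _ => I) key.
  by case: (none [::]).
pose S := \sum_(i < m) lam i.
exists m, (fun i => lam i * (128 * C) / S), (fun i => J i); split.
- by move=> i; rewrite divr_ge0 ?mulr_ge0 // ltW.
- by rewrite -!mulr_suml -/S mulrAC divff ?mul1r // gt_eqF.
move=> v; have := H [:: v] I; rewrite /L.
rewrite (eq_bigr (fun i : 'I_m => lam i * q v - (lam i * (128 * C)) * \sum_k normc (v 0 k) ^+ 2 * A (J i) k)); last first.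
  move=> i _; rewrite big_seq1 mulrBr; congr (_ - _); rewrite -[RHS]mulrA; congr (_ * (_ * _)).
  by apply: eq_bigr => k _; rewrite /sqmass big_seq1.
rewrite sumrB -mulr_suml subr_le0 -/S => h.
rewrite (eq_bigr (fun i : 'I_m => S^-1 * (lam i * (128 * C) * \sum_k normc (v 0 k) ^+ 2 * A (J i) k))); last first.
  by move=> i _; rewrite mulrAC [RHS]mulrC.
by rewrite -mulr_sumr mulrC ler_pdivlMr // mulrC.
Qed.

End Duality.

Section QuadraticForms.
Local Open Scope sesquilinear_scope.
Variables (R : realType) (n : nat).
Implicit Types (A : 'M[R[i]]_n) (u v : 'rV[R[i]]_n) (c : R).

Lemma quad_formE A v : (v *m A *m v ^t* ) 0 0 = \sum_i \sum_j v 0 i * A i j * (v 0 j)^*.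
Proof.
rewrite mxE exchange_big /=; apply: eq_bigr => j _.
by rewrite mxE mulr_suml; apply: eq_bigr => i _; rewrite !mxE.
Qed.

Definition quad A v : R := Re ((v *m A *m v ^t* ) 0 0).

Lemma conjCR c : (c%:C : R[i])^* = c%:C.
Proof. by rewrite /= oppr0. Qed.

Lemma quad_par A u v : quad A (u + v) + quad A (u - v) = 2 * quad A u + 2 * quad A v.
Proof.
have E w w' : ((w + w') ^t* ) = w ^t* + w' ^t* by apply/matrixP => i j; rewrite !mxE rmorphD.
have EN w : ((- w) ^t* ) = - (w ^t* ) by apply/matrixP => i j; rewrite !mxE rmorphN.
rewrite /quad -cReD.
have -> : ((u + v) *m A *m (u + v) ^t* ) 0 0 + ((u - v) *m A *m (u - v) ^t* ) 0 0 =
  2 * (u *m A *m u ^t* ) 0 0 + 2 * (v *m A *m v ^t* ) 0 0.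
  rewrite !E !EN !mulmxDl !mulmxDr !mulmxN !mulNmx !opprK !mxE.
  by move: (\sum_j _) (\sum_j _) (\sum_j _) (\sum_j _) => *; ring.
by rewrite !mulr_natl !mulr2n !cReD.
Qed.

Lemma quad_hom A c v : quad A (c%:C *: v) = c ^+ 2 * quad A v.
Proof.
have E : ((c%:C *: v) ^t* ) = c%:C *: (v ^t* ).
  by apply/matrixP => i j; rewrite !mxE rmorphM; congr (_ * _); exact: conjCR.
rewrite /quad E -scalemxAl -scalemxAl -scalemxAr scalerA mxE -rmorphM /= cReM /= mul0r subr0.
by rewrite expr2.
Qed.

Lemma diag_quad (x : 'I_n -> R) v :
  (v *m diag_mx (\row_i (x i)%:C) *m v ^t* ) 0 0 = (\sum_i normc (v 0 i) ^+ 2 * x i)%:C.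
Proof.
rewrite mxE rmorph_sum; apply: eq_bigr => i _.
by rewrite mul_mx_diag !mxE rmorphM /= normc_mulJ mulrAC.
Qed.

Lemma loewner_leP A (x : 'I_n -> R) : A \is hermsymmx ->
  (forall v, (v *m A *m v ^t* ) 0 0 = (quad A v)%:C) ->
  (forall v, quad A v <= \sum_i normc (v 0 i) ^+ 2 * x i) ->
  loewner_le A (diag_mx (\row_i (x i)%:C)).
Proof.
move=> /is_hermitianmxP hA Aq Ax; split.
  rewrite expr0 scale1r in hA; apply/is_hermitianmxP; rewrite expr0 scale1r.
  have hD : diag_mx (\row_i (x i)%:C) = (diag_mx (\row_i (x i)%:C)) ^t* :> 'M[R[i]]_n.
    apply/matrixP => i j; rewrite !mxE.
    rewrite eq_sym; case: eqVneq => [->|_]; last by rewrite !mulr0n rmorph0.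
    by rewrite !mulr1n; symmetry; exact: conjCR.
  rewrite [LHS](_ : _ = (diag_mx (\row_i (x i)%:C)) ^t* - A ^t* ); last by rewrite -hD -hA.
  by apply/matrixP => i j; rewrite !mxE rmorphB.
move=> v; rewrite mulmxBr mulmxBl mxE [in X in _ + X]mxE diag_quad Aq -rmorphB /=.
by rewrite ler0c subr_ge0.
Qed.

Lemma loewner_le_quad A (x : 'I_n -> R) v :
  loewner_le A (diag_mx (\row_i (x i)%:C)) -> quad A v <= \sum_i normc (v 0 i) ^+ 2 * x i.
Proof.
move=> [_ /(_ v)]; rewrite mulmxBr mulmxBl mxE [in X in _ + X]mxE diag_quad lecE /= => /andP[_].
by rewrite cReD cReN /= subr_ge0.
Qed.

End QuadraticForms.

Section GramMatrix.
Local Open Scope sesquilinear_scope.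
Context d (T : measurableType d) (R : realType) (m : {measure set T -> \bar R}).
Variables (D : set T) (n : nat) (F : 'I_n -> T -> R[i]).
Hypothesis mD : measurable D.

Lemma cintble_mulJ (f g : T -> R[i]) : cmeas D f -> cmeas D g ->
  (\int[m]_(p in D) (normc (f p) ^+ 2)%:E < +oo)%E -> (\int[m]_(p in D) (normc (g p) ^+ 2)%:E < +oo)%E ->
  cintble m D (fun p => f p * (g p)^*).
Proof.
move=> mf mg If Ig; apply: cintbleP => //; first by apply: cmeasM => //; exact: cmeasJ.
have msq k : cmeas D k -> measurable_fun D (fun p => (normc (k p) ^+ 2)%:E).
  by move=> mk; apply/measurable_EFinP; apply: measurable_funX; exact: measurable_normc.
apply: (@le_lt_trans _ _ (\int[m]_(p in D) ((normc (f p) ^+ 2)%:E + (normc (g p) ^+ 2)%:E))%E).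
  apply: ge0_le_integral' => p _; first by rewrite lee_fin normc_ge0.
  rewrite -EFinD lee_fin normcM normcJ.
  have := sqr_ge0 (normc (f p) - normc (g p)).
  have := normc_ge0 (f p); have := normc_ge0 (g p).
  by move: (normc _) (normc _) => x y; nra.
rewrite ge0_integralD //; first by rewrite lte_add_pinfty.
- by move=> p _; rewrite lee_fin sqr_ge0.
- exact: msq.
- by move=> p _; rewrite lee_fin sqr_ge0.
- exact: msq.
Qed.

Definition gram : 'M[R[i]]_n := \matrix_(i, j) Cintegral m D (fun p => F i p * (F j p)^*).

Lemma gram_quad (v : 'rV[R[i]]_n) :
  (forall i, cmeas D (fun p => v 0 i * F i p)) ->
  (forall i, (\int[m]_(p in D) (normc (v 0 i * F i p) ^+ 2)%:E < +oo)%E) ->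
  (v *m gram *m v ^t* ) 0 0 = (fine (\int[m]_(p in D) (normc (\sum_i v 0 i * F i p) ^+ 2)%:E)%E)%:C /\
  (\int[m]_(p in D) (normc (\sum_i v 0 i * F i p) ^+ 2)%:E < +oo)%E.
Proof.
move=> mF iF.
have ci i j : cintble m D (fun p => (v 0 i * F i p) * (v 0 j * F j p)^*) by exact: cintble_mulJ.
have E : (v *m gram *m v ^t* ) 0 0 = Cintegral m D (fun p => \sum_i \sum_j (v 0 i * F i p) * (v 0 j * F j p)^*).
  rewrite quad_formE Cintegral_sum //; last by move=> i _; apply: cintble_sum.
  apply: eq_bigr => i _; rewrite Cintegral_sum //; apply: eq_bigr => j _.
  have EF p : (v 0 i * F i p) * (v 0 j * F j p)^* = (v 0 i * (v 0 j)^*) * (F i p * (F j p)^*).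
    by rewrite rmorphM mulrACA.
  (* For a zero coefficient the entry of [gram] may be a default value, which the factor 0 removes.
     Otherwise integrability of the entry follows by dividing by the coefficient. *)
  have [c0|c0] := eqVneq (v 0 i * (v 0 j)^*) 0.
    rewrite mulrAC c0 mul0r (@eq_Cintegral _ _ _ _ _ _ (fun=> 0)) ?Cintegral0 // => p _.
    by rewrite EF c0 mul0r.
  rewrite (@eq_Cintegral _ _ _ _ _ _ (fun p => (v 0 i * (v 0 j)^*) * (F i p * (F j p)^*))) => [|p _]; last exact: EF.
  rewrite CintegralZ //; first by rewrite mxE mulrAC.
  apply: (eq_cintble mD _ (cintbleZ mD (v 0 i * (v 0 j)^*)^-1 (ci i j))) => p _.
  by rewrite EF mulrA mulVf // mul1r.
have EG p : \sum_i \sum_j (v 0 i * F i p) * (v 0 j * F j p)^* = (normc (\sum_i v 0 i * F i p) ^+ 2)%:C.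
  rewrite normc_mulJ rmorph_sum mulr_suml; apply: eq_bigr => i _.
  by rewrite mulr_sumr.
have ci2 : cintble m D (fun p => (normc (\sum_i v 0 i * F i p) ^+ 2)%:C).
  apply: (@eq_cintble _ _ _ _ _ mD) (_ : cintble m D (fun p => \sum_i \sum_j (v 0 i * F i p) * (v 0 j * F j p)^*)).
    by move=> p _; exact: EG.
  by do 2![apply: cintble_sum => // ? _].
split.
  rewrite E (@eq_Cintegral _ _ _ _ _ _ (fun p => (normc (\sum_i v 0 i * F i p) ^+ 2)%:C)); last by move=> p _.
  by apply: eq_cplx; rewrite /Cintegral //= /Rintegral integral0.
have /integrableP[_ h] := ci2.1; apply: le_lt_trans h.
apply: ge0_le_integral' => p _; first by rewrite lee_fin sqr_ge0.
exact: lee_abs.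
Qed.

Lemma gram_herm : (forall i j, cintble m D (fun p => F i p * (F j p)^*)) -> gram \is hermsymmx.
Proof.
move=> ci; apply/is_hermitianmxP; rewrite expr0 scale1r.
apply/matrixP => i j; rewrite !mxE -[RHS]CintegralJ //.
apply: eq_Cintegral => p _; rewrite rmorphM mulrC; congr (_ * _).
by rewrite /= conjcK.
Qed.

End GramMatrix.

Section BoxMatrices.
Variables (R : realType) (K : R -> R).
Hypothesis hK : class_WQ K.

Lemma boxval_le (I : circle_arc R) N (jk : cell_index N) :
  ((boxval K I jk)%:E <= (K 1)%:E * @dA R (cell jk))%E.
Proof.
rewrite (boxvalE hK) -integral_cst; last exact: measurable_cell.
apply: ge0_le_integral_set.
- by move=> p [_ /box_arg /andP[h _]]; rewrite lee_fin (WQ_ge0 hK) //; exact: ltW.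
- by move=> p _; rewrite lee_fin (WQ_ge0 hK).
- by move=> p [].
- by move=> p [_ /box_arg /andP[h1 h2]]; rewrite lee_fin (WQ_nondecreasing hK) //; exact: ltW.
Qed.

Lemma boxval_bound (I : circle_arc R) N (jk : cell_index N) :
  boxval K I jk <= K 1 * fine (@dA R (@disc R)).
Proof.
rewrite -lee_fin; apply: le_trans (boxval_le I jk) _.
rewrite EFinM fineK; last by rewrite ge0_fin_numE //; exact: dA_disc_fin.
apply: lee_wpmul2l; first by rewrite lee_fin (WQ_ge0 hK).
apply: le_measure; rewrite ?inE; [exact: measurable_cell|exact: measurable_disc|exact: cell_disc].
Qed.

(** [K] is positive inside the disc, so a cell without full-circle mass is a null set and has mass
    in no box. This supplies [A_null] without computing the area of a cell. *)
Lemma boxval_null (I : circle_arc R) N (jk : cell_index N) :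
  boxval K (full_circle R) jk = 0 -> boxval K I jk = 0.
Proof.
move=> b0; have mc := @measurable_cell R N jk.
have cE : cell jk `&` carleson_box (full_circle R) = @cell R N jk.
  by rewrite full_circle_box; apply/setIidPl; exact: cell_disc.
have mf : measurable_fun (cell jk) (fun p => (K ((1 - normc (cpx p)) / arc_len (full_circle R)))%:E).
  apply/measurable_EFinP; apply: (measurable_box_weight hK) => //.
  by rewrite full_circle_box; exact: cell_disc.
have := boxvalE hK (full_circle R) jk; rewrite b0 cE => e.
have pos p : cell jk p -> 0 < K ((1 - normc (cpx p)) / arc_len (full_circle R)).
  by move=> /cell_disc dp; apply: (WQ_gt0 hK); rewrite divr_gt0 ?arc_len_gt0 // subr_gt0.
have h : (\int[@dA R]_(p in cell jk) `|(K ((1 - normc (cpx p)) / arc_len (full_circle R)))%:E| = 0)%E.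
  apply: etrans (esym e); apply: eq_integral => p; rewrite inE => cp.
  by rewrite gee0_abs // lee_fin ltW // pos.
have [Z [mZ Z0 sub]] := (ae_eq_integral_abs (@dA R) mc mf).1 h.
have c0 : @dA R (cell jk) = 0%E.
  apply/eqP; rewrite eq_le measure_ge0 andbT -Z0; apply: le_measure; rewrite ?inE // => p cp.
  apply: sub => /= H; have := H cp; rewrite /cst => -[k0]; have := pos p cp.
  by rewrite k0 ltxx.
apply/eqP; rewrite eq_le (boxval_ge0 hK) andbT -lee_fin.
by apply: le_trans (boxval_le I jk) _; rewrite c0 mule0.
Qed.

Lemma box_matrixE (I : circle_arc R) N :
  box_matrix K I N = diag_mx (\row_i (boxval K I (enum_val i))%:C).
Proof. by []. Qed.

Lemma sum_box_matrix N M (lam : 'I_M -> R) (I : 'I_M -> circle_arc R) :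
  \sum_(m < M) (lam m)%:C *: box_matrix K (I m) N =
  diag_mx (\row_i (\sum_(m < M) lam m * boxval K (I m) (enum_val i))%:C).
Proof.
apply/matrixP => i j; rewrite summxE !mxE rmorph_sum -sumrMnl.
by apply: eq_bigr => m _; rewrite box_matrixE !mxE mulrnAr rmorphM.
Qed.

End BoxMatrices.

(** * From the embedding to the capacity *)

Section ForwardDirection.
Variables (R : realType) (K : R -> R).
Hypothesis hK : class_WQ K.
Variables (b C : R).
Hypotheses (b0 : 0 <= b) (C0 : 0 <= C).
Hypothesis packQK : forall N (v : cell_index N -> R[i]) (s : R),
  (forall I, \sum_i normc (v i) ^+ 2 * boxval K I i <= s) ->
  in_QK K (psum (comb_coef b v)) /\ (QK_norm K (psum (comb_coef b v)) ^+ 2 <= (C * s)%:E)%E.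
Variable mu : {measure set (plane R) -> \bar R}.
Hypothesis emb : bounded_embedding K mu.

Lemma cdiff_cst (c z : R[i]) : cdiff (fun=> c) z 0.
Proof. by move=> e e0; exists 1 => // h _; rewrite subrr mul0r subrr normc0 mulr_ge0 ?normc_ge0 // ltW. Qed.

(** The constant function 1 has norm 1 in Q_K. *)
Lemma embedding_finite : (mu (@disc R) < +oo)%E.
Proof.
have [C' HC] := emb.
pose f := (fun=> 1) : R[i] -> R[i].
have df z := cdiff_derivable (cdiff_cst 1 z).
have sn : QK_seminorm K f = 0%E.
  have : (QK_seminorm K f ^+ 2 <= 0%:E)%E.
    apply: (QK_seminorm_sqr_le hK) => // a a1; rewrite integral0_eq // => p _.
    by rewrite (df _).2 normc0 expr0n mul0r.
  have : (0 <= QK_seminorm K f)%E by exact: sqrte_ge0.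
  case: (QK_seminorm K f) => [x||] //=.
  rewrite -EFinM !lee_fin -expr2 => x0 x2; congr EFin.
  by apply/eqP; rewrite -sqrf_eq0 eq_le x2 sqr_ge0.
have nE : QK_norm K f = 1%E by rewrite /QK_norm sn adde0 normc1.
have fQ : in_QK K f by split; [move=> z _; exact: (df z).1|rewrite nE ltry].
have := HC f fQ; rewrite nE expe2 !mule1.
rewrite /f normc1 expr1n integral_cst ?mul1e; last exact: measurable_disc.
by move/le_lt_trans; apply; exact: ltry.
Qed.

Lemma comb_L2 : exists2 C' : R, 0 <= C' & forall N (v : cell_index N -> R[i]) (s : R),
  (forall I, \sum_i normc (v i) ^+ 2 * boxval K I i <= s) ->
  (\int[mu]_(p in @disc R) (normc (\sum_i v i * packet b i (cpx p)) ^+ 2)%:E <= (C' * s)%:E)%E.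
Proof.
(* The embedding constant comes without a sign, hence the maximum with 0. *)
have [C' HC] := emb; exists (Num.max C' 0 * C).
  by rewrite mulr_ge0 // le_max lexx orbT.
move=> N v s hs; have [fQ fn] := packQK hs.
have := HC _ fQ => h.
rewrite (_ : (\int[mu]_(p in @disc R) _)%E = (\int[mu]_(p in @disc R) (normc (psum (comb_coef b v) (cpx p)) ^+ 2)%:E)%E).
  apply: le_trans h _; rewrite -mulrA EFinM.
  apply: (@le_trans _ _ ((Num.max C' 0)%:E * QK_norm K (psum (comb_coef b v)) ^+ 2)%E).
    by apply: lee_wpmul2r; [exact: sqre_ge0|rewrite lee_fin le_max lexx].
  by apply: lee_wpmul2l => //; rewrite lee_fin le_max lexx orbT.
by apply: eq_integral => p; rewrite inE => dp; rewrite comb_psum.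
Qed.

Lemma cmeas_psum_disc (a : nat -> R[i]) : subexp a -> cmeas (@disc R) (fun p => psum a (cpx p)).
Proof.
move=> ha; apply: (@cmeas_cvg _ _ _ _ (fun N p => \sum_(n < N) a n * cpx p ^+ n)).
  move=> N; apply: cmeas_sum => n; apply: cmeasM; first exact: cmeas_cst.
  by apply: cmeasX; exact: cmeas_cpx.
by move=> p dp e e0; apply: psum_cseries.
Qed.

Lemma cmeas_packet N (jk : cell_index N) : cmeas (@disc R) (fun p => packet b jk (cpx p)).
Proof.
apply: (@eq_cmeas _ _ _ _ (fun p => psum (packet_coef b jk) (cpx p))).
  by move=> p dp; rewrite packet_psum.
by apply: cmeas_psum_disc; exact: subexp_packet_coef.
Qed.

Lemma capacity_finite : (capacity K b mu < +oo)%E.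
Proof.
have [C' C'0 HL2] := comb_L2.
apply: (@le_lt_trans _ _ (128 * C')%:E); last exact: ltry.
apply: ge_ereal_sup => _ [N _ <-].
have mdisc := @measurable_disc R.
pose n := #|{: cell_index N}|.
pose F (i : 'I_n) (p : plane R) := packet b (enum_val i) (cpx p).
have mF i : cmeas (@disc R) (F i) by exact: cmeas_packet.
pose B := K 1 * fine (@dA R (@disc R)).
have sumE (v : 'rV[R[i]]_n) (G : R[i] -> cell_index N -> R[i]) :
    \sum_jk G (v 0 (enum_rank jk)) jk = \sum_i G (v 0 i) (enum_val i).
  rewrite (reindex _ (onW_bij _ (enum_val_bij _))).
  by apply: eq_bigr => i _; rewrite enum_valK.
have sumER (v : 'rV[R[i]]_n) (G : R[i] -> cell_index N -> R) :
    \sum_jk G (v 0 (enum_rank jk)) jk = \sum_i G (v 0 i) (enum_val i).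
  rewrite (reindex _ (onW_bij _ (enum_val_bij _))).
  by apply: eq_bigr => i _; rewrite enum_valK.
have L2 (v : 'rV[R[i]]_n) s : (forall I, \sum_i normc (v 0 i) ^+ 2 * boxval K I (enum_val i) <= s) ->
    (\int[mu]_(p in @disc R) (normc (\sum_i v 0 i * F i p) ^+ 2)%:E <= (C' * s)%:E)%E.
  move=> hs.
  have hs' I : \sum_jk normc (v 0 (enum_rank jk)) ^+ 2 * boxval K I jk <= s.
    by rewrite (sumER v (fun x jk => normc x ^+ 2 * boxval K I jk)).
  have := HL2 N (fun jk => v 0 (enum_rank jk)) s hs'.
  by under eq_integral do rewrite (sumE v (fun x jk => x * packet b jk _)).
have L2i (v : 'rV[R[i]]_n) : (\int[mu]_(p in @disc R) (normc (\sum_i v 0 i * F i p) ^+ 2)%:E < +oo)%E.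
  apply: le_lt_trans (L2 v (\sum_i normc (v 0 i) ^+ 2 * B) _) (ltry _) => I.
  by apply: ler_sum => i _; rewrite ler_wpM2l ?sqr_ge0 // boxval_bound.
(* A multiple of a coordinate vector isolates one packet, so each packet is square integrable and
   the entries of the packet matrix are genuine integrals. *)
have single (v : 'rV[R[i]]_n) i : (\int[mu]_(p in @disc R) (normc (v 0 i * F i p) ^+ 2)%:E < +oo)%E.
  have := L2i (v 0 i *: delta_mx 0 i).
  congr (_ < _)%E; apply: eq_integral => p _; congr ((normc _ ^+ 2)%:E).
  rewrite (bigD1 i) //= big1; first by rewrite !mxE !eqxx mulr1 addr0.
  by move=> j ji; rewrite !mxE eqxx (negbTE ji) mulr0 mul0r.
have mvF (v : 'rV[R[i]]_n) i : cmeas (@disc R) (fun p => v 0 i * F i p).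
  by apply: cmeasM => //; exact: cmeas_cst.
have gq (v : 'rV[R[i]]_n) := gram_quad mdisc (mvF v) (single v).
have PM : packet_matrix b mu N = gram mu (@disc R) F by [].
pose q v := quad (packet_matrix b mu N) v.
have qE v : q v = fine (\int[mu]_(p in @disc R) (normc (\sum_i v 0 i * F i p) ^+ 2)%:E).
  by rewrite /q /quad PM (gq v).1.
have q0 v : 0 <= q v.
  by rewrite qE fine_ge0 // integral_ge0 // => p _; rewrite lee_fin sqr_ge0.
have qle (v : 'rV[R[i]]_n) s : (forall I, \sum_i normc (v 0 i) ^+ 2 * boxval K I (enum_val i) <= s) -> q v <= C' * s.
  move=> hs; rewrite qE -lee_fin fineK; first exact: L2.
  by rewrite ge0_fin_numE // integral_ge0 // => p _; rewrite lee_fin sqr_ge0.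
have [M [lam [I [lam0 lamS H]]]] := weights_exist (u0 := full_circle R)
  (fun I i => boxval_ge0 hK I (enum_val i)) (fun I i => boxval_bound hK I (enum_val i))
  (fun I i => @boxval_null _ _ hK I _ (enum_val i)) C'0 q0 (quad_par _) (quad_hom _) qle.
apply: ereal_inf_lbound; exists M, lam, I; split=> //; last by rewrite lamS.
rewrite sum_box_matrix; apply: loewner_leP.
- rewrite PM; apply: gram_herm => // i j.
  have F2 k : (\int[mu]_(p in @disc R) (normc (F k p) ^+ 2)%:E < +oo)%E.
    have := single (const_mx 1) k; congr (_ < _)%E; apply: eq_integral => p _.
    by rewrite mxE mul1r.
  exact: cintble_mulJ.
- by move=> v; rewrite -/(q v) qE PM (gq v).1.
- move=> v; apply: le_trans (H v) _.
  rewrite le_eqVlt; apply/orP; left; apply/eqP.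
  under eq_bigr do rewrite mulr_sumr.
  rewrite exchange_big /=; apply: eq_bigr => i _; rewrite mulr_sumr.
  by apply: eq_bigr => m _; rewrite mulrCA.
Qed.

End ForwardDirection.

(** * Cauchy's formula and Taylor series *)

Section FourSection.
Variables (R : realType) (J : R -> R -> R -> R -> R[i]) (a b c d : R).
Hypotheses (ab : a <= b) (cd : c <= d).
Hypothesis addS : forall s1 s2 s3 t1 t2 : R, a <= s1 -> s1 <= s2 -> s2 <= s3 -> s3 <= b ->
  c <= t1 -> t1 <= t2 -> t2 <= d -> J s1 s3 t1 t2 = J s1 s2 t1 t2 + J s2 s3 t1 t2.
Hypothesis addT : forall s1 s2 t1 t2 t3 : R, a <= s1 -> s1 <= s2 -> s2 <= b ->
  c <= t1 -> t1 <= t2 -> t2 <= t3 -> t3 <= d -> J s1 s2 t1 t3 = J s1 s2 t1 t2 + J s1 s2 t2 t3.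
Hypothesis loc : forall s t : R, a <= s -> s <= b -> c <= t -> t <= d -> forall e : R, 0 < e ->
  exists2 r, 0 < r & forall s1 s2 t1 t2 : R, a <= s1 -> s1 <= s -> s <= s2 -> s2 <= b ->
    c <= t1 -> t1 <= t -> t <= t2 -> t2 <= d -> s2 - s1 < r -> t2 - t1 < r ->
    normc (J s1 s2 t1 t2) <= e * ((s2 - s1) + (t2 - t1)) ^+ 2.

Let h n : R := (b - a) / 2 ^+ n.
Let l n : R := (d - c) / 2 ^+ n.
Let m n (p : R * R) : R := normc (J p.1 (p.1 + h n) p.2 (p.2 + l n)).

Let h0 n : 0 <= h n. Proof. by rewrite divr_ge0 ?subr_ge0 // exprn_ge0. Qed.
Let l0 n : 0 <= l n. Proof. by rewrite divr_ge0 ?subr_ge0 // exprn_ge0. Qed.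
Let hS n : h n = h n.+1 + h n.+1.
Proof. by rewrite /h exprS; field; rewrite expf_neq0. Qed.
Let lS n : l n = l n.+1 + l n.+1.
Proof. by rewrite /l exprS; field; rewrite expf_neq0. Qed.

Let next n (p : R * R) : R * R :=
  if m n p <= 4 * m n.+1 p then p
  else if m n p <= 4 * m n.+1 (p.1 + h n.+1, p.2) then (p.1 + h n.+1, p.2)
  else if m n p <= 4 * m n.+1 (p.1, p.2 + l n.+1) then (p.1, p.2 + l n.+1)
  else (p.1 + h n.+1, p.2 + l n.+1).

Let pos := fix pos n := if n is n'.+1 then next n' (pos n') else (a, c).

Let inside n (p : R * R) := [/\ a <= p.1, p.1 + h n <= b, c <= p.2 & p.2 + l n <= d].

Let nextP n p : inside n p -> [/\ inside n.+1 (next n p), m n p <= 4 * m n.+1 (next n p),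
  p.1 <= (next n p).1 <= p.1 + h n.+1 & p.2 <= (next n p).2 <= p.2 + l n.+1].
Proof.
move=> [p1 p2 p3 p4]; have hn := h0 n.+1; have ln := l0 n.+1.
rewrite hS in p2; rewrite lS in p4.
have tri : m n p <= m n.+1 p + m n.+1 (p.1 + h n.+1, p.2) + m n.+1 (p.1, p.2 + l n.+1)
   + m n.+1 (p.1 + h n.+1, p.2 + l n.+1).
  rewrite /m /= hS lS !addrA; set x := p.1 + h n.+1; set y := p.2 + l n.+1.
  have -> : J p.1 (x + h n.+1) p.2 (y + l n.+1) =
      J p.1 x p.2 y + J x (x + h n.+1) p.2 y + J p.1 x y (y + l n.+1) + J x (x + h n.+1) y (y + l n.+1).
    have E1 : J p.1 (x + h n.+1) p.2 (y + l n.+1) = J p.1 x p.2 (y + l n.+1) + J x (x + h n.+1) p.2 (y + l n.+1).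
      by apply: addS; rewrite /x /y; lra.
    have E2 : J p.1 x p.2 (y + l n.+1) = J p.1 x p.2 y + J p.1 x y (y + l n.+1).
      by apply: addT; rewrite /x /y; lra.
    have E3 : J x (x + h n.+1) p.2 (y + l n.+1) = J x (x + h n.+1) p.2 y + J x (x + h n.+1) y (y + l n.+1).
      by apply: addT; rewrite /x /y; lra.
    by rewrite E1 E2 E3 addrACA addrA.
  do 2![apply: le_trans (normcD _ _) _; rewrite lerD2r]; exact: normcD.
by rewrite /next /inside; case: ifPn => [c1|/negbTE c1]; [|case: ifPn => [c2|/negbTE c2]; [|case: ifPn => [c3|/negbTE c3]]];
  split=> //=; try (split; lra); try (apply/andP; split; lra);
  move/negbT: c1; move/negbT: c2; move/negbT: c3; rewrite -!ltNge; lra.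
Qed.

Let posP n : inside n (pos n) /\ normc (J a b c d) <= 4 ^+ n * m n (pos n).
Proof.
elim: n => [|n [IH1 IH2]].
  rewrite /inside /m /h /l /= expr0 !divr1 mul1r ![_ + (_ - _)]addrC !subrK; split=> //.
have [n1 n2 _ _] := nextP IH1; split=> //=.
by apply: le_trans IH2 _; rewrite exprSr -mulrA ler_wpM2l ?exprn_ge0.
Qed.

Let mono (u : nat -> R) (w : nat -> R) : (forall n, 0 <= w n) -> (forall n, u n <= u n.+1) ->
  (forall n, u n.+1 + w n.+1 <= u n + w n) -> forall n, u n <= sup (range u) <= u n + w n.
Proof.
move=> w0 uS uwS n.
have inc k : forall i, u i <= u (i + k)%N.
  elim: k => [|k IH] i; first by rewrite addn0.
  by rewrite addnS; apply: le_trans (IH i) (uS _).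
have dec k : forall i, u (i + k)%N + w (i + k)%N <= u i + w i.
  elim: k => [|k IH] i; first by rewrite addn0.
  by rewrite addnS; apply: le_trans (uwS _) (IH i).
have ub : ubound (range u) (u n + w n).
  move=> _ [i _ <-].
  have [ni|ni] := leqP n i.
    by rewrite -(subnKC ni); apply: le_trans (dec (i - n)%N n); rewrite lerDl.
  by apply: (@le_trans _ _ (u n)); [rewrite -(subnKC (ltnW ni))|rewrite lerDl].
apply/andP; split; last by apply: ge_sup => //; exists (u 0%N); exists 0%N.
by apply: ub_le_sup; [exists (u n + w n)|exists n].
Qed.

(** Goursat's argument for an additive rectangle function: one of the four quarters keeps at least a
    quarter of the modulus. The nested rectangles shrink to a point, where [loc] bounds the modulus
    by a small multiple of the squared size. *)
Lemma four_section : J a b c d = 0.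
Proof.
apply: eq0_normc; apply/eqP; rewrite eq_le normc_ge0 andbT.
have nP n := nextP (posP n).1.
pose s := sup (range (fun n => (pos n).1)); pose t := sup (range (fun n => (pos n).2)).
have sP n : (pos n).1 <= s <= (pos n).1 + h n.
  apply: (mono h0) => k; have [_ _ /andP[h1 h2] _] := nP k => //=.
  by rewrite [h k]hS; move: h2; set y := next _ _; lra.
have tP n : (pos n).2 <= t <= (pos n).2 + l n.
  apply: (mono l0) => k; have [_ _ _ /andP[h1 h2]] := nP k => //=.
  by rewrite [l k]lS; move: h2; set y := next _ _; lra.
have [as_ sb ct td] : [/\ a <= s, s <= b, c <= t & t <= d].
  have := sP 0%N; have := tP 0%N; rewrite /= /h /l expr0 !divr1.
  by move=> /andP[? ?] /andP[? ?]; split; lra.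
apply/ler_addgt0Pl => e e0; rewrite addr0.
pose L := (b - a) + (d - c).
have L0 : 0 <= L by rewrite addr_ge0 // subr_ge0.
(* After n steps the half-perimeter is L / 2^n; its square cancels the accumulated 4^n and leaves
   the factor L^2 / (L^2 + 1). *)
have e1 : 0 < e / (L ^+ 2 + 1) by rewrite divr_gt0 // ltr_wpDl ?sqr_ge0.
have [r r0 H] := loc as_ sb ct td e1.
have [n Hn] : exists n, (L + 1) / 2 ^+ n < r.
  pose n := (Num.truncn ((L + 1) / r)).+1; exists n.
  have L1 : 0 < L + 1 by lra.
  have /andP[_ hn] := Num.Theory.truncn_itv (ltW (divr_gt0 L1 r0)).
  rewrite ltr_pdivrMr ?exprn_gt0 // mulrC -ltr_pdivrMr //; apply: (lt_trans hn).
  by rewrite -natrX ltr_nat ltn_expl.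
have pn : 0 < 2 ^+ n :> R by rewrite exprn_gt0.
have hL : h n <= (L + 1) / 2 ^+ n by rewrite ler_pM2r ?invr_gt0 // /L; lra.
have lL : l n <= (L + 1) / 2 ^+ n by rewrite ler_pM2r ?invr_gt0 // /L; lra.
have [[q1 q2 q3 q4] q5] := posP n.
have /andP[s1 s2] := sP n; have /andP[t1 t2] := tP n.
have B : m n (pos n) <= e / (L ^+ 2 + 1) * (h n + l n) ^+ 2.
  have := H _ _ _ _ q1 s1 s2 q2 q3 t1 t2 q4; rewrite ![_ + _ - _]addrAC !subrr !add0r; apply; lra.
apply: le_trans q5 _; apply: le_trans (ler_wpM2l _ B) _; first by rewrite exprn_ge0.
have -> : h n + l n = L / 2 ^+ n by rewrite /h /l -mulrDl.
have -> : 4 ^+ n * (e / (L ^+ 2 + 1) * (L / 2 ^+ n) ^+ 2) = e * (L ^+ 2 / (L ^+ 2 + 1)).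
  have -> : (4 : R) ^+ n = 2 ^+ n ^+ 2 by rewrite exprAC; congr (_ ^+ _); ring.
  by field; rewrite !gt_eqF // ltr_wpDl ?sqr_ge0.
by rewrite ler_piMr ?(ltW e0) // ler_pdivrMr ?mul1r ?lerDl // ltr_wpDl ?sqr_ge0.
Qed.

End FourSection.

(** * Integrals of continuous complex functions over intervals *)

Section IntervalIntegral.
Variable R : realType.
Implicit Types (f g : R -> R[i]) (a b c t : R).

Definition ccont g := continuous (fun t => Re (g t)) /\ continuous (fun t => Im (g t)).

Lemma ccont_eps g : (forall t e, 0 < e -> exists2 r, 0 < r & forall h, `|h| < r -> normc (g (t + h) - g t) <= e) ->
  ccont g.
Proof.
move=> H; split=> t; apply/cvgrPdist_le => /= e e0; have [r r0 Hr] := H t e e0.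
  exists r => // x /= xt; have xt' : `|x - t| < r by rewrite distrC; exact: xt.
  have := Hr (x - t) xt'; rewrite (_ : t + (x - t) = x); last by ring.
  by move=> h; rewrite distrC; apply: le_trans h; apply: le_trans (normc_Re _); rewrite cReD cReN.
exists r => // x /= xt; have xt' : `|x - t| < r by rewrite distrC; exact: xt.
have := Hr (x - t) xt'; rewrite (_ : t + (x - t) = x); last by ring.
by move=> h; rewrite distrC; apply: le_trans h; apply: le_trans (normc_Im _); rewrite cImD cImN.
Qed.

Lemma ccont_cst (x : R[i]) : ccont (fun=> x).
Proof. by split=> t; exact: cvg_cst. Qed.

Lemma ccontD f g : ccont f -> ccont g -> ccont (fun t => f t + g t).
Proof.
move=> [f1 f2] [g1 g2]; split=> t.
  by under eq_fun do rewrite cReD; apply: cvgD; [exact: f1|exact: g1].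
by under eq_fun do rewrite cImD; apply: cvgD; [exact: f2|exact: g2].
Qed.

Lemma ccontM f g : ccont f -> ccont g -> ccont (fun t => f t * g t).
Proof.
move=> [f1 f2] [g1 g2]; split=> t.
  under eq_fun do rewrite cReM; apply: cvgB; apply: cvgM; [exact: f1|exact: g1|exact: f2|exact: g2].
under eq_fun do rewrite cImM; apply: cvgD; apply: cvgM; [exact: f1|exact: g2|exact: f2|exact: g1].
Qed.

Lemma ccontN f : ccont f -> ccont (fun t => - f t).
Proof.
move=> [f1 f2]; split=> t.
  by under eq_fun do rewrite cReN; apply: cvgN; exact: f1.
by under eq_fun do rewrite cImN; apply: cvgN; exact: f2.
Qed.

Lemma ccontB f g : ccont f -> ccont g -> ccont (fun t => f t - g t).
Proof. by move=> cf /ccontN; exact: ccontD. Qed.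

Lemma ccontV f : ccont f -> (forall t, f t != 0) -> ccont (fun t => (f t)^-1).
Proof.
move=> [f1 f2] f0.
have cn : continuous (fun t => (normc (f t) ^+ 2)^-1).
  move=> t; apply: cvgV; first by rewrite expf_neq0 // gt_eqF // normc_gt0.
  rewrite (_ : (fun t => normc (f t) ^+ 2) = (fun t => Re (f t) * Re (f t) + Im (f t) * Im (f t))); last first.
    by apply/funext => u; rewrite normc_sqr !expr2.
  by rewrite normc_sqr !expr2; apply: cvgD; apply: cvgM; [exact: f1|exact: f1|exact: f2|exact: f2].
split=> t.
  under eq_fun do rewrite invcE cReM /= mul0r subr0 -/(normc _) cReJ.
  by apply: cvgM; [exact: cn|exact: f1].
under eq_fun do rewrite invcE cImM /= mul0r addr0 -/(normc _) cImJ.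
by apply: cvgM; [exact: cn|apply: cvgN; exact: f2].
Qed.

Definition ci g a b := Cintegral (@lebesgue_measure R) `[a, b] g.

Let mitv a b : @measurable _ (measurableTypeR R) `[a, b]. Proof. exact: measurable_itv. Qed.

Lemma ccont_cintble g a b : ccont g -> cintble (@lebesgue_measure R) `[a, b] g.
Proof.
move=> [g1 g2]; split; apply: continuous_compact_integrable; try exact: segment_compact;
  by apply: continuous_subspaceT.
Qed.

Lemma ci_D f g a b : ccont f -> ccont g -> ci (fun t => f t + g t) a b = ci f a b + ci g a b.
Proof. by move=> cf cg; apply: (CintegralD (mitv a b)); exact: ccont_cintble. Qed.

Lemma ci_B f g a b : ccont f -> ccont g -> ci (fun t => f t - g t) a b = ci f a b - ci g a b.
Proof. by move=> cf cg; apply: (CintegralB (mitv a b)); exact: ccont_cintble. Qed.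

Lemma ci_Z (x : R[i]) g a b : ccont g -> ci (fun t => x * g t) a b = x * ci g a b.
Proof. by move=> cg; apply: (CintegralZ (mitv a b)); exact: ccont_cintble. Qed.

Lemma eq_ci f g a b : (forall t, a <= t <= b -> f t = g t) -> ci f a b = ci g a b.
Proof. by move=> e; apply: eq_Cintegral => t /=; rewrite in_itv /= => /e. Qed.

Lemma ci_split g a c b : ccont g -> a <= c -> c <= b -> ci g a b = ci g a c + ci g c b.
Proof.
move=> cg ac cb; have [i1 i2] := ccont_cintble a b cg.
have spl (h : R -> R) : (@lebesgue_measure R).-integrable `[a, b] (EFin \o h) ->
    Rintegral (@lebesgue_measure R) `[a, b] h =
    Rintegral (@lebesgue_measure R) `[a, c] h + Rintegral (@lebesgue_measure R) `[c, b] h.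
  move=> ih; have h1 : (BLeft a <= BRight c)%O by rewrite bnd_simp.
  have h2 : (BRight c <= BRight b)%O by rewrite bnd_simp.
  have := Rintegral_itvB ih h1 h2; rewrite Rintegral_itv_obnd_cbnd; last first.
    apply: integrableS ih => //.
    by move=> x /=; rewrite !in_itv /= => /andP[cx ->]; rewrite andbT (le_trans ac) // ltW.
  by move=> <-; rewrite addrC subrK.
by apply: eq_cplx; rewrite ?cReD ?cImD /=; exact: spl.
Qed.

Lemma lebesgue_itv_fin a b : (@lebesgue_measure R `[a, b] < +oo)%E.
Proof. by rewrite lebesgue_measure_itv /=; case: ifP => _; rewrite ?ltry // -EFinB ltry. Qed.

Lemma ci_bound g a b (M : R) : ccont g -> a <= b -> 0 <= M -> (forall t, a <= t <= b -> normc (g t) <= M) ->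
  normc (ci g a b) <= M * (b - a).
Proof.
move=> cg ab M0 gM.
have -> : b - a = fine (@lebesgue_measure R `[a, b]).
  rewrite lebesgue_measure_itv /= lte_fin; case: ltP => [//|ba].
  by rewrite (@le_anti _ _ a b) ?ab ?ba // subrr.
apply: (normc_Cintegral_bound (mitv a b)) => //.
- exact: cintble_cmeas (ccont_cintble a b cg).
- exact: lebesgue_itv_fin.
Qed.

Lemma ccont_bounded g a b : ccont g -> a <= b -> exists M : R, forall t, a <= t <= b -> normc (g t) <= M.
Proof.
move=> [c1 c2] ab; pose h t := Re (g t) * Re (g t) + Im (g t) * Im (g t).
have ch : {within `[a, b], continuous h}.
  apply: continuous_subspaceT => t.
  by apply: cvgD; apply: cvgM; [exact: c1|exact: c1|exact: c2|exact: c2].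
have [c _ H] := EVT_max ab ch; exists (h c + 1) => t tab.
have := H t; rewrite in_itv /= => /(_ tab).
rewrite {1}/h -!expr2 -normc_sqr => H1; have := normc_ge0 (g t); nra.
Qed.

Lemma ci_FTC (g g' : R -> R[i]) a b : a <= b -> ccont g' -> (forall t, rdiff g t (g' t)) ->
  ci g' a b = g b - g a.
Proof.
move=> ab [c1 c2] dg.
have key (h h' : R -> R) : continuous h' -> (forall t, is_derive t 1 h (h' t)) ->
    Rintegral (@lebesgue_measure R) `[a, b] h' = h b - h a.
  move=> ch' dh; have ch : continuous h.
    by move=> t; apply: differentiable_continuous; apply/derivable1_diffP; case: (dh t).
  move: ab; rewrite le_eqVlt => /predU1P[->|ab].
    by rewrite subrr set_itv1 Rintegral_set1.
  rewrite /Rintegral (@continuous_FTC2 R h' h a b ab) //.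
  - by apply: continuous_subspaceT.
  - split=> [t _||]; first by case: (dh t).
      by apply: cvg_at_right_filter; exact: ch.
    by apply: cvg_at_left_filter; exact: ch.
  - by move=> t _; rewrite derive1E; case: (dh t).
apply: eq_cplx; rewrite ?cReD ?cImD ?cReN ?cImN /=.
  by apply: (key (fun t => Re (g t))) => // t; case: (dg t).
by apply: (key (fun t => Im (g t))) => // t; case: (dg t).
Qed.

End IntervalIntegral.

Section CauchyFormula.
Variables (R : realType) (f : R[i] -> R[i]) (z : R[i]) (r : R).
Hypothesis fhol : holomorphic_on (@cdisc R) f.
Hypotheses (zr : normc z < r) (r1 : r < 1).
Implicit Types (s t th : R).

Let r0 : 0 < r. Proof. exact: le_lt_trans (normc_ge0 z) zr. Qed.

(** The radial parameter e^s, frozen at 1 for s > 0: [hG] then stays in the closed disc of radius r,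
    and the integrands on all sides are continuous on the whole line. *)
Definition hE s : R := expR (Num.min s 0).

Let E01 s : 0 <= hE s <= 1.
Proof. by rewrite /hE expR_ge0 -(@expR0 R) ler_expR ge_min lexx orbT. Qed.

Let expR_lip (x y : R) : x <= y -> y <= 0 -> expR y - expR x <= y - x.
Proof.
move=> xy y0; have -> : expR x = expR y * expR (x - y) by rewrite -expRD addrCA subrr addr0.
have h := expR_ge1Dx (x - y); have e0 := expR_ge0 y.
have e1 : expR y <= 1 by rewrite -(@expR0 R) ler_expR.
have xy0 : 0 <= y - x by rewrite subr_ge0.
nra.
Qed.

Let E_lip s s' : `|hE s - hE s'| <= `|s - s'|.
Proof.
have mono (x y : R) : x <= y -> hE x <= hE y.
  by move=> xy; rewrite /hE ler_expR le_min !ge_min xy lexx !orbT.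
have one (x y : R) : x <= y -> hE y - hE x <= y - x.
  move=> xy; apply: le_trans (expR_lip _ _) _.
  - by rewrite le_min !ge_min xy lexx !orbT.
  - by rewrite ge_min lexx orbT.
  - by rewrite /Num.min; case: ifP; case: ifP; move=> /negP/negP h1 /negP/negP h2; rewrite -?leNgt in h1 h2; lra.
have [ss|ss] := leP s s'.
  by rewrite ler0_norm ?subr_le0 ?mono // ler0_norm ?subr_le0 // !opprB one.
have ss' := ltW ss.
by rewrite ger0_norm ?subr_ge0 ?mono // ger0_norm ?subr_ge0 //; exact: one.
Qed.

(** s = 0 gives the circle and s -> -oo shrinks it to z. These logarithmic coordinates push the
    singularity at z to infinity, so Goursat's argument runs on ordinary rectangles. *)
Definition hG s th : R[i] := z + (hE s)%:C * (r%:C * cis th - z).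

Let G_in s th : normc (hG s th) <= r.
Proof.
have /andP[e0 e1] := E01 s; rewrite /hG.
have -> : z + (hE s)%:C * (r%:C * cis th - z) = (1 - hE s)%:C * z + (hE s)%:C * (r%:C * cis th).
  by rewrite rmorphB /=; ring.
apply: le_trans (normcD _ _) _; rewrite !normcM normc_cis mulr1 !normcR (ger0_norm (ltW r0)) !ger0_norm ?subr_ge0 //.
have := ltW zr; nra.
Qed.

Lemma cis_lip (t t' : R) : normc (cis t - cis t') <= `|t - t'|.
Proof.
have -> : cis t - cis t' = - (cis t' * (1 - cis (t - t'))).
  by rewrite mulrBr -cisD mulr1 addrCA subrr addr0 opprB.
by rewrite normcN normcM normc_cis mul1r normc_1Bcis_le.
Qed.

Let G_lip s th s' th' : normc (hG s th - hG s' th') <= 2 * `|s - s'| + `|th - th'|.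
Proof.
have -> : hG s th - hG s' th' = (hE s - hE s')%:C * (r%:C * cis th - z) + (hE s')%:C * (r%:C * (cis th - cis th')).
  by rewrite /hG rmorphB /=; ring.
have /andP[e0 e1] := E01 s'.
apply: le_trans (normcD _ _) _; apply: lerD.
  rewrite normcM normcR mulrC; apply: ler_pM; rewrite ?normc_ge0 ?E_lip //.
  apply: le_trans (normcB _ _) _; rewrite normcM normc_cis mulr1 normcR ger0_norm ?(ltW r0) //.
  by have := ltW zr; have := ltW r1; lra.
rewrite !normcM !normcR (ger0_norm (ltW r0)) (ger0_norm e0).
have := cis_lip th th'; have n0 := normc_ge0 (cis th - cis th') => h.
have : hE s' * r <= 1 by have := ltW r1; have := ltW r0; nra.
rewrite mulrA; have : 0 <= hE s' * r by rewrite mulr_ge0 // ltW.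
by move: (hE s' * r) => y; nra.
Qed.

Let rcz th : r - normc z <= normc (r%:C * cis th - z).
Proof.
apply: le_trans (ler_normcB _ _); rewrite normcM normc_cis mulr1 normcR ger0_norm // ltW //.
Qed.

Let rcz0 th : r%:C * cis th - z != 0.
Proof. by rewrite -normc_gt0; apply: lt_le_trans (rcz th); rewrite subr_gt0. Qed.

Definition hk th : R[i] := 'i * (r%:C * cis th) / (r%:C * cis th - z).

Let kM : R := r / (r - normc z).

Let k_bound th : normc (hk th) <= kM.
Proof.
have i1 : normc ('i : R[i]) = 1 by rewrite /= expr0n expr1n add0r sqrtr1.
rewrite /hk normc_div !normcM i1 mul1r normc_cis mulr1 normcR ger0_norm ?(ltW r0) //.
by rewrite ler_pM2l // lef_pV2 ?posrE ?rcz ?subr_gt0 // normc_gt0.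
Qed.

Let kM0 : 0 <= kM. Proof. by rewrite divr_ge0 ?(ltW r0) // subr_ge0 ltW. Qed.

Let cis_cont : ccont (@cis R).
Proof.
apply: ccont_eps => t e e0; exists e => // h he.
by apply: le_trans (cis_lip _ _) _; rewrite addrAC subrr add0r ltW.
Qed.

Let k_cont : ccont hk.
Proof.
have c1 : ccont (fun t => r%:C * cis t) by apply: ccontM => //; exact: ccont_cst.
apply: ccontM; first by apply: ccontM => //; exact: ccont_cst.
by apply: ccontV => //; apply: ccontB => //; exact: ccont_cst.
Qed.

Let f_cont w : normc w < 1 -> forall e, 0 < e -> exists2 rho, 0 < rho &
  forall h, normc h < rho -> normc (f (w + h) - f w) <= e.
Proof.
move=> w1 e e0; have [rho rho0 H] := derivable_cdiff (fhol (w1 : @cdisc R w)) ltr01.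
pose B := normc (cderive f w) + 1; have B0 : 0 < B by rewrite ltr_wpDl ?normc_ge0.
exists (Num.min rho (e / B)); first by rewrite lt_min rho0 divr_gt0.
move=> h; rewrite lt_min => /andP[h1 h2].
have -> : f (w + h) - f w = (f (w + h) - f w - cderive f w * h) + cderive f w * h by ring.
apply: le_trans (normcD _ _) _; apply: le_trans (lerD (H h h1) (lexx _)) _.
rewrite normcM -mulrDl addrC -/B mulrC -ler_pdivlMr //; exact: ltW.
Qed.

Definition hF s th : R[i] := f (hG s th).

Let G1 s th : normc (hG s th) < 1. Proof. exact: le_lt_trans (G_in s th) r1. Qed.

Let F_eps s th e : 0 < e -> exists2 d, 0 < d & forall s' th', 2 * `|s' - s| + `|th' - th| < d ->
  normc (hF s' th' - hF s th) <= e.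
Proof.
move=> e0; have [rho rho0 H] := f_cont (G1 s th) e0; exists rho => // s' th' h.
rewrite /hF (_ : hG s' th' = hG s th + (hG s' th' - hG s th)); last by rewrite addrC subrK.
by apply: H; apply: le_lt_trans h; exact: G_lip.
Qed.

Let F_cont_th s : ccont (hF s).
Proof.
apply: ccont_eps => t e e0; have [d d0 H] := F_eps s t e0; exists d => // h hd.
by apply: H; rewrite subrr normr0 mulr0 add0r addrAC subrr add0r.
Qed.

Let F_cont_s th : ccont (hF ^~ th).
Proof.
apply: ccont_eps => t e e0; have [d d0 H] := F_eps t th e0; exists (d / 2); first by rewrite divr_gt0.
move=> h hd; apply: H; rewrite subrr normr0 addr0 addrAC subrr add0r.
by rewrite mulrC -ltr_pdivlMr.
Qed.

(* The integral of f(zeta) d zeta / (zeta - z) along the boundary of a rectangle,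
   for zeta = hG s th: then d zeta / (zeta - z) = ds + hk th dth when s <= 0. *)
Definition hJ s1 s2 t1 t2 : R[i] :=
  ci (fun th => (hF s2 th - hF s1 th) * hk th) t1 t2 - ci (fun s => hF s t2 - hF s t1) s1 s2.

Let c1 s1 s2 : ccont (fun th => (hF s2 th - hF s1 th) * hk th).
Proof. by apply: ccontM => //; exact: ccontB. Qed.

Let c2 t1 t2 : ccont (fun s => hF s t2 - hF s t1).
Proof. exact: (ccontB (F_cont_s t2) (F_cont_s t1)). Qed.

Lemma hJ_addS s1 s2 s3 t1 t2 : s1 <= s2 -> s2 <= s3 -> hJ s1 s3 t1 t2 = hJ s1 s2 t1 t2 + hJ s2 s3 t1 t2.
Proof.
move=> h12 h23; rewrite /hJ (ci_split (c2 t1 t2) h12 h23).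
rewrite (_ : ci (fun th => (hF s3 th - hF s1 th) * hk th) t1 t2 =
  ci (fun th => (hF s2 th - hF s1 th) * hk th) t1 t2 + ci (fun th => (hF s3 th - hF s2 th) * hk th) t1 t2).
  by rewrite opprD addrACA.
rewrite -ci_D //; apply: eq_ci => t _; rewrite -mulrDl; congr (_ * _).
by move: (hF _ _) (hF _ _) (hF _ _) => x y w; ring.
Qed.

Lemma hJ_addT s1 s2 t1 t2 t3 : t1 <= t2 -> t2 <= t3 -> hJ s1 s2 t1 t3 = hJ s1 s2 t1 t2 + hJ s1 s2 t2 t3.
Proof.
move=> h12 h23; rewrite /hJ (ci_split (c1 s1 s2) h12 h23).
rewrite (_ : ci (fun s => hF s t3 - hF s t1) s1 s2 =
  ci (fun s => hF s t2 - hF s t1) s1 s2 + ci (fun s => hF s t3 - hF s t2) s1 s2).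
  by rewrite opprD addrACA.
rewrite -ci_D //; apply: eq_ci => t _.
by move: (hF _ _) (hF _ _) (hF _ _) => x y w; ring.
Qed.

Let G_cont_th s : ccont (hG s).
Proof.
apply: ccont_eps => t e e0; exists e => // h hd; apply: le_trans (G_lip _ _ _ _) _.
by rewrite subrr normr0 mulr0 add0r addrAC subrr add0r ltW.
Qed.

Let G_cont_s th : ccont (hG ^~ th).
Proof.
apply: ccont_eps => t e e0; exists (e / 2); first by rewrite divr_gt0.
move=> h hd; apply: le_trans (G_lip _ _ _ _) _; rewrite subrr normr0 addr0 addrAC subrr add0r.
by rewrite mulrC -ler_pdivlMr // ltW.
Qed.

Let E_cont : ccont (fun s => (hE s)%:C).
Proof.
apply: ccont_eps => t e e0; exists e => // h hd; rewrite -rmorphB normcR.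
by apply: le_trans (E_lip _ _) _; rewrite addrAC subrr add0r ltW.
Qed.

Let G_ths (s1 s2 t1 t2 : R) : t1 <= t2 ->
  ci (fun th => (hG s2 th - hG s1 th) * hk th) t1 t2 =
  (hE s2 - hE s1)%:C * (r%:C * cis t2 - r%:C * cis t1).
Proof.
move=> t12; pose g' th := (hE s2 - hE s1)%:C * (r%:C * ('i * cis th)).
transitivity (ci g' t1 t2).
  apply: eq_ci => t _; rewrite /g' /hG /hk rmorphB /=; field; exact: rcz0.
have cg : ccont (fun th => r%:C * ('i * cis th)).
  by apply: ccontM; [exact: ccont_cst|apply: ccontM => //; exact: ccont_cst].
rewrite /g' ci_Z // (ci_FTC (g := fun th => r%:C * cis th)) // => t.
have dc : rdiff (@cis R) t ('i * cis t).
  split => /=; rewrite ?mul0r ?mul1r ?sub0r ?add0r; first exact: is_derive_cos.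
  exact: is_derive_sin.
have d0 : rdiff (fun=> r%:C : R[i]) t 0 by split; exact: is_derive_cst.
by have := rdiffM d0 dc; rewrite mul0r add0r.
Qed.

Let G_ss (s1 s2 t1 t2 : R) : s1 <= s2 -> s2 <= 0 ->
  ci (fun s => hG s t2 - hG s t1) s1 s2 = (hE s2 - hE s1)%:C * (r%:C * cis t2 - r%:C * cis t1).
Proof.
move=> s12 s20; have s10 := le_trans s12 s20.
have Es s : s <= 0 -> hE s = expR s by rewrite /hE => /min_idPl ->.
have ex_cont : ccont (fun s : R => (expR s)%:C).
  by split=> t; [exact: continuous_expR|exact: cvg_cst].
transitivity (ci (fun s => (r%:C * cis t2 - r%:C * cis t1) * (expR s)%:C) s1 s2).
  apply: eq_ci => s /andP[_ ss]; rewrite /hG Es ?(le_trans ss) //; ring.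
rewrite ci_Z // (ci_FTC (g := fun s : R => (expR s)%:C)) //.
  by rewrite !Es // rmorphB /= mulrC.
by move=> t; split=> /=; [exact: is_derive_expR|exact: is_derive_cst].
Qed.

(** [hJ] does not see the affine part of f: constants cancel, and [G_ths] and [G_ss] show that [hG]
    itself contributes the same on both pairs of sides. What remains is the first-order remainder,
    small compared with the rectangle, integrated over sides of the same size. *)
Let loc s t : s <= 0 -> forall e : R, 0 < e ->
  exists2 q, 0 < q & forall s1 s2 t1 t2 : R, s1 <= s -> s <= s2 -> s2 <= 0 ->
    t1 <= t -> t <= t2 -> s2 - s1 < q -> t2 - t1 < q ->
    normc (hJ s1 s2 t1 t2) <= e * ((s2 - s1) + (t2 - t1)) ^+ 2.
Proof.
move=> s0 e e0; pose w := hG s t; pose B := cderive f w.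
have kM1 : 0 < 4 * (kM + 1) by have := kM0; lra.
have e1 : 0 < e / (4 * (kM + 1)) by rewrite divr_gt0.
have [rho rho0 H] := derivable_cdiff (fhol (G1 s t : @cdisc R w)) e1.
exists (rho / 4); first by rewrite divr_gt0.
move=> s1 s2 t1 t2 s1s ss2 s20 t1t tt2 sq tq.
pose d := (s2 - s1) + (t2 - t1).
have d0 : 0 <= d by rewrite /d; lra.
pose q s t : R[i] := hF s t - f w - B * (hG s t - w).
have qb s' t' : s1 <= s' <= s2 -> t1 <= t' <= t2 -> normc (q s' t') <= e / (4 * (kM + 1)) * (2 * d).
  move=> /andP[a1 a2] /andP[b1 b2].
  have as' : `|s' - s| <= s2 - s1 by rewrite ler_norml; lra.
  have bt' : `|t' - t| <= t2 - t1 by rewrite ler_norml; lra.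
  have Gd : normc (hG s' t' - w) <= 2 * `|s' - s| + `|t' - t| by exact: G_lip.
  have := H (hG s' t' - w); rewrite (_ : w + (hG s' t' - w) = hG s' t'); last by rewrite addrC subrK.
  move=> H1; apply: le_trans (H1 _) _; first by apply: le_lt_trans Gd _; lra.
  by rewrite ler_pM2l //; apply: le_trans Gd _; rewrite /d; lra.
have q_th s' : ccont (q s').
  by apply: ccontB; [apply: ccontB => //; exact: ccont_cst|apply: ccontM; [exact: ccont_cst|apply: ccontB => //; exact: ccont_cst]].
have q_s t' : ccont (q ^~ t').
  apply: ccontB; first by apply: (ccontB (F_cont_s t')); exact: ccont_cst.
  by apply: ccontM; [exact: ccont_cst|apply: (ccontB (G_cont_s t')); exact: ccont_cst].
have cG1 : ccont (fun th => (hG s2 th - hG s1 th) * hk th) by apply: ccontM => //; exact: ccontB.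
have cG2 : ccont (fun s => hG s t2 - hG s t1) by exact: (ccontB (G_cont_s t2) (G_cont_s t1)).
have cq1 : ccont (fun th => (q s2 th - q s1 th) * hk th) by apply: ccontM => //; exact: ccontB.
have cq2 : ccont (fun s => q s t2 - q s t1) by exact: (ccontB (q_s t2) (q_s t1)).
have s12 : s1 <= s2 by lra.
have t12 : t1 <= t2 by lra.
have -> : hJ s1 s2 t1 t2 = ci (fun th => (q s2 th - q s1 th) * hk th) t1 t2 - ci (fun s => q s t2 - q s t1) s1 s2.
  rewrite /hJ.
  have -> : ci (fun th => (hF s2 th - hF s1 th) * hk th) t1 t2 =
      ci (fun th => (q s2 th - q s1 th) * hk th) t1 t2 + B * ci (fun th => (hG s2 th - hG s1 th) * hk th) t1 t2.
    rewrite -ci_Z // -ci_D //; last by apply: ccontM => //; exact: ccont_cst.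
    apply: eq_ci => th _; rewrite /q; move: (hF _ _) (hF _ _) (hG _ _) (hG _ _) (hk _) => x1 x2 x3 x4 x5; ring.
  have -> : ci (fun s => hF s t2 - hF s t1) s1 s2 =
      ci (fun s => q s t2 - q s t1) s1 s2 + B * ci (fun s => hG s t2 - hG s t1) s1 s2.
    rewrite -ci_Z // -ci_D //; last by apply: ccontM => //; exact: ccont_cst.
    apply: eq_ci => th _; rewrite /q; move: (hF _ _) (hF _ _) (hG _ _) (hG _ _) => x1 x2 x3 x4; ring.
  by rewrite G_ths // G_ss // opprD addrACA subrr addr0.
pose M := e / (4 * (kM + 1)) * (2 * d).
have M0 : 0 <= M by exact: mulr_ge0 (ltW e1) (mulr_ge0 (ler0n _ 2) d0).
have M2 : 0 <= 2 * M by exact: mulr_ge0 (ler0n _ 2) M0.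
have i1 : normc (ci (fun th => (q s2 th - q s1 th) * hk th) t1 t2) <= 2 * M * kM * (t2 - t1).
  apply: ci_bound => //; first exact: mulr_ge0 M2 kM0.
  move=> th th12; rewrite normcM; apply: ler_pM; rewrite ?normc_ge0 //.
  apply: le_trans (normcB _ _) _; rewrite mulr_natl mulr2n.
  by apply: lerD; apply: qb => //; rewrite lexx ?andbT.
have i2 : normc (ci (fun s => q s t2 - q s t1) s1 s2) <= 2 * M * (s2 - s1).
  apply: ci_bound => //.
  move=> s' s12'; apply: le_trans (normcB _ _) _; rewrite mulr_natl mulr2n.
  by apply: lerD; apply: qb => //; rewrite lexx ?andbT.
apply: le_trans (normcB _ _) _; apply: le_trans (lerD i1 i2) _.
have eM : e * d ^+ 2 = 2 * M * ((kM + 1) * d).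
  by rewrite /M; field; have := kM0; lra.
rewrite -/d eM -[2 * M * kM * _]mulrA -mulrDr; apply: ler_wpM2l; first exact: M2.
have := kM0; have : 0 <= t2 - t1 by lra.
have : 0 <= s2 - s1 by lra.
rewrite /d; move: (s2 - s1) (t2 - t1) kM => x y k x0 y0 k0; nra.
Qed.

Lemma hJ0 (a : R) : a <= 0 -> hJ a 0 0 (2 * pi) = 0.
Proof.
move=> a0; have pi0 : 0 <= 2 * pi :> R by rewrite mulr_ge0 // pi_ge0.
apply: (four_section a0 pi0).
- by move=> s1 s2 s3 t1 t2 _ h1 h2 _ _ _ _; exact: hJ_addS.
- by move=> s1 s2 t1 t2 t3 _ _ _ _ h1 h2 _; exact: hJ_addT.
- move=> s t _ s0 _ _ e e0; have [q q0 H] := loc t s0 e0; exists q => //.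
  by move=> s1 s2 t1 t2 _ ? ? ? _ ? ? _ ? ?; exact: H.
Qed.

Lemma ccont_circle : ccont (fun th => f (r%:C * cis th)).
Proof.
have := F_cont_th 0; rewrite /hF /hG /hE minxx expR0.
by congr ccont; apply/funext => th; rewrite mul1r addrC subrK.
Qed.

(** The rectangle [a, 0] x [0, 2 pi] gives no contribution, its sides at 0 and 2 pi cancel by
    periodicity, and for a far to the left f is nearly f(z) on the inner curve. The integral of [hk]
    stays in place of 2 pi i and is evaluated by the geometric series later. *)
Lemma cauchy_formula : ci (fun th => f (r%:C * cis th) * hk th) 0 (2 * pi) = f z * ci hk 0 (2 * pi).
Proof.
have pi0 : 0 < 2 * pi :> R by rewrite mulr_gt0 // pi_gt0.
have cF0 := ccont_circle.
apply/eqP; rewrite -subr_eq0 -ci_Z // -ci_B //; [|by apply: ccontM|by apply: ccontM => //; exact: ccont_cst].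
apply/eqP/eq0_normc/le_anti; rewrite normc_ge0 andbT.
apply/ler_addgt0Pl => e e0; rewrite addr0.
have kp : 0 < kM * (2 * pi) + 1 by have := mulr_ge0 kM0 (ltW pi0); lra.
have e1 : 0 < e / (kM * (2 * pi) + 1) by rewrite divr_gt0.
have z1 : normc z < 1 by exact: lt_trans zr r1.
have [rho rho0 H] := f_cont z1 e1.
(* The inner curve is at distance at most 2 e^a <= rho / 2 from z, within the range of continuity
   [rho]; the minimum with 1 keeps a <= 0. *)
pose a := ln (Num.min (rho / 4) 1).
have m0 : 0 < Num.min (rho / 4) 1 by rewrite lt_min ltr01 andbT divr_gt0.
have a0 : a <= 0 by rewrite /a ln_le0 // ge_min lexx orbT.
have Ea : hE a <= rho / 4 by rewrite /hE (min_idPl a0) lnK ?posrE // ge_min lexx.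
have := hJ0 a0; rewrite /hJ.
have -> : ci (fun s => hF s (2 * pi) - hF s 0) a 0 = 0.
  rewrite -[RHS](mul0r (ci (fun=> 0) a 0)) -ci_Z; last exact: ccont_cst.
  apply: eq_ci => s _; rewrite mul0r /hF /hG.
  by rewrite (_ : cis (2 * pi) = cis 0) ?subrr // /cis mulr_natl cos2pi sin2pi cos0 sin0.
move/eqP; rewrite subr0 => /eqP J0.
have -> : ci (fun th => f (r%:C * cis th) * hk th - f z * hk th) 0 (2 * pi) =
    ci (fun th => (hF a th - f z) * hk th) 0 (2 * pi).
  apply/eqP; rewrite -subr_eq0 -ci_B; first last.
  - by apply: ccontM => //; apply: ccontB => //; exact: ccont_cst.
  - by apply: ccontB; apply: ccontM => //; exact: ccont_cst.
  rewrite -[X in _ == X]J0; apply/eqP; apply: eq_ci => th _.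
  have -> : hF 0 th = f (r%:C * cis th) by rewrite /hF /hG /hE minxx expR0 mul1r addrC subrK.
  by move: (hF _ _) (hk _) (f _) (f _) => x1 x2 x3 x4; ring.
apply: (@le_trans _ _ (e / (kM * (2 * pi) + 1) * kM * (2 * pi - 0))).
  apply: ci_bound; rewrite ?(ltW pi0) //.
  - by apply: ccontM => //; apply: ccontB => //; exact: ccont_cst.
  - by apply: mulr_ge0 => //; exact: ltW.
  move=> th _; rewrite normcM; apply: ler_pM; rewrite ?normc_ge0 //.
  rewrite /hF /hG; apply: H; rewrite normcM normcR ger0_norm ?expR_ge0 //.
  have l2 : normc (r%:C * cis th - z) <= 2.
    apply: le_trans (normcB _ _) _; rewrite normcM normc_cis mulr1 normcR (ger0_norm (ltW r0)).
    by have := r1; lra.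
  have Ea0 : 0 <= hE a by rewrite expR_ge0.
  have := normc_ge0 (r%:C * cis th - z); move: (normc _) l2 (hE a) Ea Ea0 => y y2 x x1 x2 y0.
  by have := rho0; nra.
rewrite subr0 -mulrA mulrAC ler_pdivrMr //; apply: ler_wpM2l; first exact: ltW.
by rewrite lerDl.
Qed.

End CauchyFormula.

Section PsumUniqueness.
Variable R : realType.
Implicit Types (a : nat -> R[i]) (z : R[i]).

Lemma cdiff_local (f g : R[i] -> R[i]) z d (rho : R) : 0 < rho ->
  (forall h, normc h < rho -> f (z + h) = g (z + h)) -> cdiff f z d -> cdiff g z d.
Proof.
move=> rho0 fg fd e e0; have [r r0 H] := fd e e0; exists (Num.min rho r); first by rewrite lt_min rho0.
have fg0 : f z = g z by have := fg 0; rewrite addr0 normc0; apply.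
by move=> h; rewrite lt_min => /andP[h1 h2]; rewrite -fg // -fg0; exact: H.
Qed.

(** The value at 0 gives the first coefficient, and the derivatives coincide on the same disc, which
    gives the next ones by induction. *)
Lemma psum_inj a1 a2 (rho : R) : 0 < rho -> rho <= 1 -> subexp a1 -> subexp a2 ->
  (forall z, normc z < rho -> psum a1 z = psum a2 z) -> a1 =1 a2.
Proof.
move=> rho0 rho1 s1 s2 H n; elim: n a1 a2 s1 s2 H => [|n IH] a1 a2 s1 s2 H.
  by rewrite -!psum_at0 H // normc0.
have : pderiv a1 n = pderiv a2 n.
  apply: (IH _ _ (subexp_pderiv s1) (subexp_pderiv s2)) => z zrho.
  have z1 : normc z < 1 by exact: lt_le_trans rho1.
  have d1 : cdiff (psum a2) z (psum (pderiv a1) z).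
    apply: (@cdiff_local (psum a1) _ _ _ (rho - normc z)); first by rewrite subr_gt0.
      by move=> h hz; apply: H; apply: le_lt_trans (normcD _ _) _; lra.
    exact: psum_cdiff.
  by rewrite -(cdiff_derivable d1).2 -(cdiff_derivable (psum_cdiff s2 z1)).2.
by rewrite /pderiv => /mulfI; apply; rewrite pnatr_eq0.
Qed.

Lemma psum_scale a (c : R[i]) z : psum (fun n => a n * c ^+ n) z = psum a (c * z).
Proof.
rewrite /psum (_ : (fun n => a n * c ^+ n * z ^+ n) = (fun n => a n * (c * z) ^+ n)) //.
by apply/funext => n; rewrite -mulrA -exprMn.
Qed.

Lemma eq_subexp a1 a2 : a1 =1 a2 -> subexp a1 -> subexp a2.
Proof. by move=> /funext ->. Qed.

Lemma psum_one z : normc z < 1 -> psum (fun=> 1) z = (1 - z)^-1.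
Proof.
move=> z1; have s1 : subexp (fun=> 1 : R[i]) by apply: (@subexp_cst _ 1) => n; rewrite normc1.
have n0 : 1 - z != 0.
  by rewrite subr_eq0; apply: contraTneq z1 => <-; rewrite normc1 ltxx.
apply: (mulfI n0); rewrite divff // mulrBl mul1r -psum_pshift //.
rewrite (_ : psum (fun=> 1) z - psum (pshift (fun=> 1)) z =
   psum (fun n => 1 + (-1) * pshift (fun=> 1) n) z); last first.
  have s2 := subexp_pshift s1; have s3 := subexpZ (-1) s2.
  by rewrite psumD // psumZ // mulN1r.
apply: psum_unique => e e0; exists 1%N => -[//|N] _.
rewrite big_ord_recl /= mulr0 addr0 expr0 mulr1 big1 ?addr0 ?subrr ?normc0 ?ltW //.
by move=> i _; rewrite mulr1 subrr mul0r.
Qed.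

End PsumUniqueness.

Section Taylor.
Variables (R : realType) (f : R[i] -> R[i]).
Hypothesis fhol : holomorphic_on (@cdisc R) f.

Let mI : @measurable _ (measurableTypeR R) `[0%R, 2 * pi]. Proof. exact: measurable_itv. Qed.
Let finI : (@lebesgue_measure R `[0%R, (2 * pi)%R] < +oo)%E. Proof. exact: lebesgue_itv_fin. Qed.

Let pi0 : 0 < 2 * pi :> R. Proof. by rewrite mulr_gt0 // pi_gt0. Qed.

(** The n-th Fourier coefficient on the circle of radius r, that is r^n times the n-th Taylor
    coefficient. Leaving r^n inside makes the sequence bounded. *)
Definition circle_coef (r : R) n : R[i] :=
  ci (fun th => cis (- th) ^+ n * f (r%:C * cis th)) 0 (2 * pi) / (2 * pi)%:C.

Let ccis : ccont (fun th : R => cis (- th)).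
Proof.
split=> t /=; first by apply: continuous_comp; [exact: opp_continuous|exact: continuous_cos].
by apply: continuous_comp; [exact: opp_continuous|exact: continuous_sin].
Qed.

Let circle_cont (r : R) : 0 < r -> r < 1 -> ccont (fun th => f (r%:C * cis th)).
Proof.
move=> r0 r1; apply: (ccont_circle (z := 0) fhol _ r1); by rewrite normc0.
Qed.

Let ci_cisX n : ci (fun th : R => cis (- th) ^+ n.+1 * 1) 0 (2 * pi) = 0.
Proof.
pose c : R[i] := ('i / n.+1%:R).
pose g (th : R) := c * cis (- (n.+1%:R * th)).
have dg t : rdiff g t (cis (- t) ^+ n.+1 * 1).
  have d0 : rdiff (fun=> c) t 0 by split; exact: is_derive_cst.
  have dc : rdiff (fun th : R => cis (- (n.+1%:R * th))) t (- 'i * n.+1%:R * cis (- (n.+1%:R * t))).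
    have dl : is_derive t 1 (fun th : R => - (n.+1%:R * th)) (- n.+1%:R).
      have := is_deriveN (is_deriveZ n.+1%:R (is_derive_id t (1 : R))).
      by rewrite /GRing.scale /= mulr1.
    have e1 : - 'i * n.+1%:R = (0 +i* (- n.+1%:R)) :> R[i].
      by rewrite -(rmorph_nat (real_complex R)); apply: eq_cplx; rewrite ?cReM ?cImM /=; ring.
    rewrite e1; split => /=; apply: (is_derive_eq (is_derive1_comp _ dl)).
    - by rewrite /GRing.scale /=; ring.
    - by rewrite /GRing.scale /=; ring.
  have := rdiffM d0 dc; rewrite mul0r add0r mulr1 cisX mulrN /c.
  congr rdiff; rewrite !mulrA.
  have -> : 'i / n.+1%:R * - 'i * n.+1%:R = 1 :> R[i]; last by rewrite mul1r.
  have n0 : n.+1%:R != 0 :> R[i] by rewrite pnatr_eq0.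
  by rewrite mulrN mulNr [_ / _ * 'i]mulrAC -expr2 sqr_i mulN1r mulNr opprK mulVf.
rewrite (ci_FTC (g := g)) ?(ltW pi0) //.
  have c2 : cis (2 * pi) = 1 :> R[i] by rewrite -[2 * pi]add0r cis2pi cis0.
  by rewrite /g mulr0 oppr0 !cisN -cisX c2 expr1n cis0 rmorph1 subrr.
apply: ccontM; last exact: ccont_cst.
have := ccis; elim: n.+1 => [|k IH] cc; first by under eq_fun do rewrite expr0; exact: ccont_cst.
by under eq_fun do rewrite exprS; apply: ccontM => //; exact: IH.
Qed.

Lemma circle_coef_bounded (r : R) : 0 < r -> r < 1 -> exists M : R, forall n, normc (circle_coef r n) <= M.
Proof.
move=> r0 r1; have cF := circle_cont r0 r1; have [M HM'] := ccont_bounded cF (ltW pi0).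
have HM (th : R) : ([set` `[0%R, (2 * pi)%R]] : set R) th -> normc (f (r%:C * cis th)) <= M.
  by rewrite /= in_itv /=; exact: HM'.
have mg : @cmeas _ (measurableTypeR R) R `[0%R, 2 * pi] (fun th => cis (- th)).
  exact: cintble_cmeas (ccont_cintble _ _ ccis).
have g1 (th : R) : ([set` `[0%R, (2 * pi)%R]] : set R) th -> normc (cis (- th)) <= 1 by rewrite normc_cis.
have mF : @cmeas _ (measurableTypeR R) R `[0%R, 2 * pi] (fun th => f (r%:C * cis th)).
  exact: cintble_cmeas (ccont_cintble _ _ cF).
exists (Num.max M 0 * fine (@lebesgue_measure R `[0%R, (2 * pi)%R]) / (2 * pi)) => n.
rewrite normc_div normcR (ger0_norm (ltW pi0)) ler_pM2r ?invr_gt0 //.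
exact: (moment_bound mI finI mg g1 mF HM).
Qed.

(** For z = r u the Cauchy kernel is 'i times the geometric series in u e^(-i th), so Cauchy's
    formula integrates term by term; with f = 1 the same expansion evaluates the integral of the
    kernel. *)
Lemma circle_coef_psum (r : R) u : 0 < r -> r < 1 -> normc u < 1 ->
  subexp (circle_coef r) /\ f (r%:C * u) = psum (circle_coef r) u.
Proof.
move=> r0 r1 w1; have cF := circle_cont r0 r1.
have rC : r%:C != 0 :> R[i] by apply: contra_ltN r0 => /eqP[->].
have pC : (2 * pi)%:C != 0 :> R[i] by apply: contra_ltN pi0 => /eqP[->].
have zr : normc (r%:C * u) < r by rewrite normcM normcR ger0_norm ?(ltW r0) // gtr_pMr.
have s1 : subexp (fun=> 1 : R[i]) by apply: (@subexp_cst _ 1) => n; rewrite normc1.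
have mg : @cmeas _ (measurableTypeR R) R `[0%R, 2 * pi] (fun th => cis (- th)).
  exact: cintble_cmeas (ccont_cintble _ _ ccis).
have g1 (th : R) : ([set` `[0%R, (2 * pi)%R]] : set R) th -> normc (cis (- th)) <= 1 by rewrite normc_cis.
have mF : @cmeas _ (measurableTypeR R) R `[0%R, 2 * pi] (fun th => f (r%:C * cis th)).
  exact: cintble_cmeas (ccont_cintble _ _ cF).
have [M HM'] := ccont_bounded cF (ltW pi0).
have HM (th : R) : ([set` `[0%R, (2 * pi)%R]] : set R) th -> normc (f (r%:C * cis th)) <= M.
  by rewrite /= in_itv /=; exact: HM'.
have hkE (th : R) : hk (r%:C * u) r th = 'i * psum (fun=> 1) (u * cis (- th)).
  rewrite /hk psum_one ?normcM ?normc_cis ?mulr1 -?normcM // -mulrA; congr (_ * _).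
  have c0 := cis_neq0 th.
  have -> : cis (- th) = (cis th)^-1 by rewrite cisV.
  have h0 : r%:C * cis th - r%:C * u != 0.
    rewrite subr_eq0; apply: contraTneq zr => <-.
    by rewrite normcM normc_cis mulr1 normcR ger0_norm ?ltxx // ltW.
  have h1 : cis th - u != 0 by move: h0; rewrite -mulrBr mulf_eq0 negb_or => /andP[].
  by rewrite -mulrBr; field; rewrite h1 rC c0.
have s2 := subexp_moment mI finI mg g1 mF HM s1.
have CF := cauchy_formula fhol zr r1.
have e1 : ci (fun th => f (r%:C * cis th) * hk (r%:C * u) r th) 0 (2 * pi) =
    'i * psum (fun n => 1 * ci (fun th => cis (- th) ^+ n * f (r%:C * cis th)) 0 (2 * pi)) (u).
  rewrite -(Cintegral_psum mI finI mg g1 mF HM s1 w1).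
  rewrite -(CintegralZ mI); last exact: (cintble_psum mI finI mg g1 mF HM s1 w1).
  by apply: eq_ci => th _; rewrite hkE mulrCA [X in _ * X]mulrC.
have m1 : @cmeas _ (measurableTypeR R) R `[0%R, 2 * pi] (fun=> 1) by exact: cmeas_cst.
have M1 (th : R) : ([set` `[0%R, (2 * pi)%R]] : set R) th -> normc (1 : R[i]) <= 1 by rewrite normc1.
have e2 : ci (hk (r%:C * u) r) 0 (2 * pi) = 'i * (2 * pi)%:C.
  transitivity (ci (fun th => 'i * (psum (fun=> 1) (u * cis (- th)) * 1)) 0 (2 * pi)).
    by apply: eq_ci => th _; rewrite mulr1; exact: hkE.
  rewrite /ci (CintegralZ mI); last exact: (cintble_psum mI finI mg g1 m1 M1 s1 w1).
  rewrite (Cintegral_psum mI finI mg g1 m1 M1 s1 w1); congr (_ * _).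
  apply: psum_unique => e e0; exists 1%N => -[//|N] _.
  rewrite big_ord_recl big1 => [|i _]; last by rewrite lift0 mul1r -/(ci _ _ _) ci_cisX mul0r.
  rewrite addr0 mul1r expr0 mulr1 -/(ci _ _ _).
  have -> : ci (fun th : R => cis (- th) ^+ 0 * 1) 0 (2 * pi) = (2 * pi)%:C.
    transitivity (ci (fun=> 1 : R[i]) 0 (2 * pi)).
      by apply: eq_ci => th _; rewrite expr0 mulr1.
    rewrite (ci_FTC (g := fun th : R => th%:C)) ?(ltW pi0) ?subr0 //; first exact: ccont_cst.
    by move=> t; split=> /=; [exact: is_derive_id|exact: is_derive_cst].
  by rewrite subrr normc0 ltW.
have i0 : 'i != 0 :> R[i] by rewrite eq_complex /= oner_eq0 andbF.
split.
  apply: (eq_subexp (a1 := fun n => (2 * pi)%:C^-1 * (1 * ci (fun th => cis (- th) ^+ n * f (r%:C * cis th)) 0 (2 * pi)))).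
    by move=> n; rewrite /circle_coef mul1r mulrC.
  exact: subexpZ.
rewrite (@eq_psum _ _ (fun n => (2 * pi)%:C^-1 * (1 * ci (fun th => cis (- th) ^+ n * f (r%:C * cis th)) 0 (2 * pi)))); last first.
  by move=> n; rewrite /circle_coef mul1r mulrC.
rewrite psumZ //; apply: (mulfI pC); rewrite mulrA divff // mul1r.
by have := CF; rewrite e1 e2 [X in _ = X]mulrCA => /(mulfI i0) ->; rewrite mulrC.
Qed.

(** Coefficients defined on the circle of radius 1/2 represent f a priori near 0 only. The whole
    disc is reached by showing that every larger circle yields the same coefficients. *)
Lemma taylor : exists2 a, subexp a & forall z, normc z < 1 -> f z = psum a z.
Proof.
have [h h0 h1] : exists2 h : R, 0 < h & h < 1 by exists 2^-1; [rewrite invr_gt0|rewrite invf_lt1 ?ltr1n].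
have n01 : normc (0 : R[i]) < 1 by rewrite normc0.
pose a n := circle_coef h n * (h%:C)^-1 ^+ n.
(* Both circles give power series for u -> f(h u), so uniqueness makes the rescaled coefficients
   independent of the radius. *)
have aE (r : R) n : h <= r -> r < 1 -> a n = circle_coef r n * r%:C^-1 ^+ n.
  move=> hr r1; have r0 := lt_le_trans h0 hr.
  have rC : r%:C != 0 :> R[i] by apply: contra_ltN r0 => /eqP[->].
  have hC : h%:C != 0 :> R[i] by apply: contra_ltN h0 => /eqP[->].
  have [sr _] := circle_coef_psum r0 r1 n01.
  have [sh _] := circle_coef_psum h0 h1 n01.
  have c1 : normc (h%:C / r%:C) <= 1.
    by rewrite normc_div !normcR !ger0_norm ?(ltW h0) ?(ltW r0) // ler_pdivrMr // mul1r.
  have sr' : subexp (fun n => circle_coef r n * (h%:C / r%:C) ^+ n).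
    by apply: (@subexpM _ _ _ 1) => // k; rewrite normcX exprn_ile1 // normc_ge0.
  rewrite /a (@psum_inj _ (circle_coef h) _ 1 ltr01 (lexx _) sh sr' _ n).
    rewrite -mulrA -exprMn; congr (_ * _ ^+ _).
    by rewrite mulrAC divff // mul1r.
  move=> u u1; rewrite psum_scale -(circle_coef_psum h0 h1 u1).2 -(circle_coef_psum r0 r1 _).2.
    by rewrite [in RHS]mulrA [r%:C * _]mulrC divfK.
  by rewrite normcM; apply: le_lt_trans u1; rewrite ler_piMl ?normc_ge0.
exists a.
  move=> x x0 x1; pose r := Num.max x h.
  have hr : h <= r by rewrite le_max lexx orbT.
  have r0 := lt_le_trans h0 hr.
  have r1 : r < 1 by rewrite gt_max x1 h1.
  have [M HM] := circle_coef_bounded r0 r1.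
  exists M => n; rewrite (aE r) // normcM -mulrA; apply: le_trans (HM n).
  rewrite ler_piMr ?normc_ge0 // normcX -exprMn normcV normcR ger0_norm ?(ltW r0) //.
  apply: exprn_ile1; first by apply: mulr_ge0; rewrite ?invr_ge0 ltW.
  by rewrite mulrC ler_pdivrMr // mul1r le_max lexx.
move=> z z1; pose r := Num.max ((normc z + 1) / 2) h.
have hr : h <= r by rewrite le_max lexx orbT.
have r0 := lt_le_trans h0 hr.
have r1 : r < 1 by rewrite gt_max h1 andbT; lra.
have zr : normc z < r by rewrite lt_max; apply/orP; left; lra.
have rC : r%:C != 0 :> R[i] by apply: contra_ltN r0 => /eqP[->].
have w1 : normc (r%:C^-1 * z) < 1.
  by rewrite normcM normcV normcR ger0_norm ?(ltW r0) // mulrC ltr_pdivrMr // mul1r.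
rewrite (@eq_psum _ a (fun n => circle_coef r n * r%:C^-1 ^+ n)).
  by rewrite psum_scale -(circle_coef_psum r0 r1 w1).2 mulVKf.
by move=> n; exact: aE.
Qed.

End Taylor.

(** * The reproducing formula *)

Section BetaIntegral.
Variables (R : realType) (b : R).
Hypothesis b0 : 0 <= b.
Implicit Types s t : R.

Let b1 : 0 < b + 1. Proof. by have := b0; lra. Qed.

Lemma FTC_itv (F f : R -> R) (u v : R) : u <= v -> (forall s, u <= s <= v -> is_derive s 1 F (f s)) ->
  (forall s, u <= s <= v -> {for s, continuous f}) ->
  Rintegral (@lebesgue_measure R) `[u, v] f = F v - F u.
Proof.
rewrite le_eqVlt => /predU1P[->|uv] dF cf.
  by rewrite subrr set_itv1 Rintegral_set1.
have cF s : u <= s <= v -> {for s, continuous F}.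
  by move=> h; apply: differentiable_continuous; apply/derivable1_diffP; case: (dF s h).
rewrite /Rintegral (@continuous_FTC2 R f F u v uv) //.
- apply: continuous_in_subspaceT => s; rewrite inE /= in_itv /=; exact: cf.
- split=> [s|| ]; first by rewrite in_itv /= => /andP[h1 h2]; case: (dF s) => //; rewrite !ltW.
    by apply: cvg_at_right_filter; apply: cF; rewrite lexx ltW.
  by apply: cvg_at_left_filter; apply: cF; rewrite lexx ltW.
- by move=> s; rewrite in_itv /= => /andP[h1 h2]; rewrite derive1E; case: (dF s) => //; rewrite !ltW.
Qed.

Definition betaw n s : R := s ^+ n * ((b + 1) * (1 - s) `^ b).
Definition betaI n t : R := Rintegral (@lebesgue_measure R) `[0, t] (betaw n).

Let d_onem s : is_derive s 1 (fun x : R => 1 - x) (-1).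
Proof.
have d := is_deriveB (@is_derive_cst R R R 1 s 1) (is_derive_id s (1 : R)).
by rewrite sub0r in d.
Qed.

Let d_pow s : s < 1 -> is_derive s 1 (fun x : R => (1 - x) `^ (b + 1)) (- ((b + 1) * (1 - s) `^ b)).
Proof.
move=> s1; have h : 0 < 1 - s by rewrite subr_gt0.
have d1 := @is_derive1_powR R (b + 1) (1 - s) h.
rewrite addrK in d1.
have := @is_derive1_comp R (fun y => y `^ (b + 1)) (fun x => 1 - x) s _ _ d1 (d_onem s); rewrite mulrN1; exact.
Qed.

Let c_pow s : s < 1 -> {for s, continuous (fun x : R => (1 - x) `^ b)}.
Proof.
move=> s1; have h : 0 < 1 - s by rewrite subr_gt0.
have d1 := @is_derive1_powR R b (1 - s) h.
apply: differentiable_continuous; apply/derivable1_diffP.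
by case: (@is_derive1_comp R (fun y => y `^ b) (fun x => 1 - x) s _ _ d1 (d_onem s)).
Qed.

Let c_betaw n s : s < 1 -> {for s, continuous (betaw n)}.
Proof.
move=> s1; apply: cvgM; first exact: exprn_continuous.
by apply: cvgM; [exact: cvg_cst|exact: c_pow].
Qed.

Lemma measurable_betaw n (D : set R) : @measurable_fun _ _ (measurableTypeR R) R D (betaw n).
Proof.
apply: measurable_funTS; apply: measurable_funM => //.
apply: measurable_funM => //; apply: (measurableT_comp (measurable_powR b)) => //.
exact: measurable_funB.
Qed.

Lemma betaw_ge0 n s : 0 <= s -> 0 <= betaw n s.
Proof.
move=> s0; apply: mulr_ge0; first exact: exprn_ge0.
by apply: mulr_ge0; [exact: ltW|exact: powR_ge0].
Qed.

Lemma betaI_ge0 n t : 0 <= betaI n t.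
Proof.
apply: Rintegral_ge0 => s; rewrite /= in_itv /= => /andP[s0 _]; exact: betaw_ge0.
Qed.

Lemma integrable_betaw n t : 0 <= t -> t < 1 -> (@lebesgue_measure R).-integrable `[0, t] (EFin \o betaw n).
Proof.
move=> t0 t1; apply: continuous_compact_integrable; first exact: segment_compact.
apply: continuous_in_subspaceT => s; rewrite inE /= in_itv /= => /andP[_ st]; apply: c_betaw.
exact: le_lt_trans t1.
Qed.

Let i_Zbetaw c n t : 0 <= t -> t < 1 ->
  (@lebesgue_measure R).-integrable `[0, t] (EFin \o (fun s => c * betaw n s)).
Proof.
move=> t0 t1; apply: continuous_compact_integrable; first exact: segment_compact.
apply: continuous_in_subspaceT => s; rewrite inE /= in_itv /= => /andP[_ st].
by apply: cvgM; [exact: cvg_cst|apply: c_betaw; exact: le_lt_trans t1].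
Qed.

Lemma betaI0 t : 0 <= t -> t < 1 -> betaI 0 t = 1 - (1 - t) `^ (b + 1).
Proof.
move=> t0 t1.
have dF s : 0 <= s <= t -> is_derive s 1 (fun s => - (1 - s) `^ (b + 1)) (betaw 0 s).
  move=> /andP[_ st]; have d := is_deriveN (d_pow (le_lt_trans st t1)).
  by rewrite opprK in d; apply: (is_derive_eq d); rewrite /betaw expr0 mul1r.
have cf s : 0 <= s <= t -> {for s, continuous (betaw 0)}.
  by move=> /andP[_ st]; apply: c_betaw; exact: le_lt_trans t1.
by rewrite /betaI (FTC_itv t0 dF cf) subr0 powR1 opprK addrC.
Qed.

(** Integrate the derivative of (b + 1) s^(n+1) (1 - s)^(b+1) over [0, t]. *)
Lemma betaIS n t : 0 <= t -> t < 1 ->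
  (n.+1%:R + b + 1) * betaI n.+1 t = n.+1%:R * betaI n t - (b + 1) * (t ^+ n.+1 * (1 - t) `^ (b + 1)).
Proof.
move=> t0 t1; pose F s := (b + 1) * (s ^+ n.+1 * (1 - s) `^ (b + 1)).
have mI : @measurable _ (measurableTypeR R) `[0, t] by exact: measurable_itv.
have E : Rintegral (@lebesgue_measure R) `[0, t] (fun s => n.+1%:R * betaw n s - (n.+1%:R + b + 1) * betaw n.+1 s) = F t - F 0.
  apply: (FTC_itv t0) => s /andP[_ st]; have s1 := le_lt_trans st t1.
    have dX : is_derive s 1 (fun x : R => x ^+ n.+1) (n.+1%:R * s ^+ n).
      apply: DeriveDef; first exact: exprn_derivable.
      by rewrite exp_derive scaler1 -mulr_natl.
    have d := is_deriveZ (b + 1) (is_deriveM dX (d_pow s1)).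
    apply: (is_derive_eq d); rewrite /betaw /GRing.scale /= exprS.
    have -> : (1 - s) `^ (b + 1) = (1 - s) * (1 - s) `^ b.
      by rewrite powRDp ?subr_gt0 // powRr1 ?subr_ge0 ?(ltW s1) // mulrC.
    by ring.
  by apply: cvgB; apply: cvgM; [exact: cvg_cst|exact: c_betaw|exact: cvg_cst|exact: c_betaw].
move: E; rewrite RintegralB //; first last.
- exact: i_Zbetaw.
- exact: i_Zbetaw.
rewrite !RintegralZl //; try exact: integrable_betaw.
rewrite -/(betaI n t) -/(betaI n.+1 t) /F expr0n /= mul0r mulr0 subr0 => E.
by rewrite -E subKr.
Qed.

(** A normalised incomplete Beta integral: the binomial coefficient is the inverse of the complete
    integral, so the limit at t = 1 is 1. It is the multiplier that truncation to |w|^2 < t puts on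
    the n-th coefficient of the derivative. *)
Definition betaJ n t : R := binc (b + 2) n * betaI n t.

Lemma betaJ_ge0 n t : 0 <= betaJ n t.
Proof. by rewrite mulr_ge0 ?betaI_ge0 // binc_ge0 // addr_ge0. Qed.

Lemma betaJS n t : 0 <= t -> t < 1 ->
  betaJ n.+1 t = betaJ n t - binc (b + 2) n * (b + 1) / n.+1%:R * (t ^+ n.+1 * (1 - t) `^ (b + 1)).
Proof.
move=> t0 t1; have := betaIS n t0 t1; rewrite /betaJ /=.
have n0 : n.+1%:R != 0 :> R by rewrite pnatr_eq0.
have -> : n%:R + (b + 2) = n.+1%:R + b + 1 by rewrite -natr1; ring.
move=> E; apply: (mulfI n0).
have -> : n.+1%:R * (binc (b + 2) n * (n.+1%:R + b + 1) / n.+1%:R * betaI n.+1 t) =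
   binc (b + 2) n * ((n.+1%:R + b + 1) * betaI n.+1 t) by field.
by rewrite E; field.
Qed.

Lemma betaJ_le1 n t : 0 <= t -> t < 1 -> betaJ n t <= 1.
Proof.
move=> t0 t1; elim: n => [|n IH]; first by rewrite /betaJ mul1r betaI0 // gerBl powR_ge0.
rewrite betaJS //; apply: le_trans IH; rewrite gerBl; apply: mulr_ge0.
  by apply: divr_ge0 => //; apply: mulr_ge0 (ltW b1); rewrite binc_ge0 // addr_ge0.
by apply: mulr_ge0; [exact: exprn_ge0|exact: powR_ge0].
Qed.

Lemma betaJ_ge n : exists2 d : R, 0 <= d & forall t, 0 <= t -> t < 1 -> 1 - betaJ n t <= d * (1 - t).
Proof.
have pw t : 0 <= t -> t < 1 -> (1 - t) `^ (b + 1) <= 1 - t.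
  move=> t0 t1; rewrite powRDp ?subr_gt0 // powRr1 ?subr_ge0 ?(ltW t1) //.
  rewrite ler_piMl ?subr_ge0 ?(ltW t1) // -[leRHS](powRr0 (1 - t)).
  by apply: ger_powR => //; rewrite subr_gt0 t1 gerBl.
elim: n => [|n [d d0 IH]].
  exists 1 => // t t0 t1; have -> : betaJ 0 t = 1 - (1 - t) `^ (b + 1) by rewrite /betaJ /= mul1r betaI0.
  by rewrite subKr mul1r; exact: pw.
have e0 : 0 <= binc (b + 2) n * (b + 1) / n.+1%:R.
  by apply: divr_ge0 => //; apply: mulr_ge0 (ltW b1); rewrite binc_ge0 // addr_ge0.
exists (d + binc (b + 2) n * (b + 1) / n.+1%:R); first exact: addr_ge0.
move=> t t0 t1; rewrite betaJS // opprB addrA mulrDl addrAC; apply: lerD; first by rewrite addrC; have := IH t t0 t1; lra.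
apply: ler_wpM2l => //; apply: le_trans (pw t t0 t1).
by rewrite ler_piMl ?powR_ge0 // exprn_ile1 // ltW.
Qed.

End BetaIntegral.

Section Monomials.
Variables (R : realType) (b : R).
Hypothesis b0 : 0 <= b.

Definition subdisc (t : R) : set (plane R) := [set p | nsq p < t].

Lemma measurable_subdisc t : measurable (subdisc t).
Proof.
rewrite (_ : subdisc t = @nsq R @^-1` `]-oo, t[); first exact: measurable_nsq_set.
by apply/seteqP; split=> p /=; rewrite in_itv.
Qed.

Lemma subdisc_disc t : t <= 1 -> subdisc t `<=` @disc R.
Proof. by move=> t1 p; rewrite disc_nsq /subdisc /= => h; exact: lt_le_trans t1. Qed.

Lemma subdisc_fin t : t <= 1 -> (@dA R (subdisc t) < +oo)%E.
Proof.
move=> t1; apply: le_lt_trans (@dA_disc_fin R); apply: le_measure; rewrite ?inE //.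
- exact: measurable_subdisc.
- exact: measurable_disc.
- exact: subdisc_disc.
Qed.

Lemma Cintegral_rot t th (F : plane R -> R[i]) : 1 + cos th != 0 -> cmeas [set: plane R] F ->
  Cintegral (@dA R) (subdisc t) (fun p => F (rot th p)) = Cintegral (@dA R) (subdisc t) F.
Proof.
move=> cth [m1 m2].
have key (h : plane R -> R) : measurable_fun [set: plane R] h ->
    Rintegral (@dA R) (subdisc t) (fun p => h (rot th p)) = Rintegral (@dA R) (subdisc t) h.
  move=> mh; rewrite /Rintegral; congr fine.
  rewrite [LHS]integral_mkcond [RHS]integral_mkcond.
  pose H := (fun p => (h p)%:E) \_ (subdisc t).
  have mH : measurable_fun [set: plane R] H.
    apply/(measurable_restrictT _ _).1; first exact: measurable_subdisc.
    by apply/measurable_EFinP; exact: measurable_funTS.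
  rewrite (_ : (fun p => (h (rot th p))%:E) \_ (subdisc t) = H \o rot th); last first.
    apply/funext => p; rewrite /H /= !patchE; congr (if _ then _ else _).
    by apply/idP/idP; rewrite !inE /subdisc /= nsq_rot.
  rewrite integralE [RHS]integralE; congr (_ - _)%E.
    rewrite -(ge0_integral_dA_rot cth (F := H ^\+)%E) //; last exact: measurable_funepos.
    by apply: eq_integral => p _; rewrite !funeposE.
  rewrite -(ge0_integral_dA_rot cth (F := H ^\-)%E) //; last exact: measurable_funeneg.
  by apply: eq_integral => p _; rewrite !funenegE.
by apply: eq_cplx; [exact: (key (fun p => Re (F p)))|exact: (key (fun p => Im (F p)))].
Qed.

Let mono m n (p : plane R) : R[i] := cpx p ^+ m * ((cpx p)^* ^+ n * (bweight b p)%:C).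

Let cmeas_mono m n (D : set (plane R)) : cmeas D (mono m n).
Proof.
apply: cmeasM; first by apply: cmeasX; exact: cmeas_cpx.
apply: cmeasM; first by apply: cmeasX; apply: cmeasJ; exact: cmeas_cpx.
by apply: cmeasR; exact: measurable_bweight.
Qed.

Let mono_bound m n p : @disc R p -> normc (mono m n p) <= b + 1.
Proof.
move=> Dp; have p1 : normc (cpx p) <= 1 by exact: ltW.
rewrite /mono !normcM !normcX normcJ normcR (ger0_norm (bweight_ge0 b0 p)) mulrA.
apply: le_trans (bweight_le b0 Dp); apply: ler_piMl; first exact: bweight_ge0.
by apply: mulr_ile1; rewrite ?exprn_ge0 ?exprn_ile1 ?normc_ge0.
Qed.

Let mono_rot m n th p : mono m n (rot th p) = cis (m%:R * th) * cis (- (n%:R * th)) * mono m n p.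
Proof.
have cJ : (cpx (rot th p))^* ^+ n = cis (- (n%:R * th)) * (cpx p)^* ^+ n.
  rewrite -mulrN -cisX -exprMn cpx_rot cisN; congr (_ ^+ n); exact: rmorphM.
rewrite /mono cJ cpx_rot exprMn cisX.
have -> : bweight b (rot th p) = bweight b p by rewrite /bweight -!nsqE nsq_rot.
by move: (cis _) (cis _) (_%:C) (cpx p ^+ m) (_ ^+ n) => x1 x2 x3 x4 x5; ring.
Qed.

Let cintble_mono m n t : t <= 1 -> cintble (@dA R) (subdisc t) (mono m n).
Proof.
move=> t1; apply: (@cintble_bounded _ _ _ _ _ (measurable_subdisc t) _ (b + 1)).
- exact: cmeas_mono.
- exact: subdisc_fin.
- by move=> p /(subdisc_disc t1); exact: mono_bound.
Qed.

(** A rotation leaves the integral unchanged and multiplies the integrand by a unimodular constant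
    that differs from 1 for a suitable angle. *)
Lemma monomial_orthogonal m n t : t <= 1 -> m != n ->
  Cintegral (@dA R) (subdisc t) (fun p => cpx p ^+ m * ((cpx p)^* ^+ n * (bweight b p)%:C)) = 0.
Proof.
move=> t1 mn; rewrite -/(mono m n); set X := Cintegral _ _ _.
(* At most 1, so not a half turn, and |m - n| th < 1 < 2 pi, so the constant is not 1. *)
pose th : R := (m + n).+1%:R^-1.
have th0 : 0 < th by rewrite invr_gt0.
have th1 : th <= 1 by rewrite invf_le1 // ler1n.
have pi2 := @pi_ge2 R.
have cth : 1 + cos th != 0 by apply: cos_gtN1; lra.
pose c : R[i] := cis (m%:R * th) * cis (- (n%:R * th)).
have cX : c * X = X.
  rewrite -[RHS](Cintegral_rot t cth (cmeas_mono m n _)) -(CintegralZ (measurable_subdisc t)); last exact: cintble_mono.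
  by apply: eq_Cintegral => p _; rewrite mono_rot.
have [/eqP|c1] := eqVneq X 0; first by move/eqP.
suff c1' : c != 1.
  have : (c - 1) * X = 0 by rewrite mulrBl mul1r cX subrr.
  by move/eqP; rewrite mulf_eq0 subr_eq0 (negbTE c1') /= (negbTE c1).
have mS k : (k <= m + n)%N -> k%:R * th < 1.
  by move=> h; rewrite /th ltr_pdivrMr ?mul1r ?ltr_nat ?ltnS.
rewrite /c -cisD; apply/eqP => h.
have [mn'|nm] := leqP n m.
  have := cis_eq1 _ _ h; rewrite -mulrBl -natrB // => H.
  have : (m - n)%:R * th = 0.
    apply: H; first exact: mulr_ge0 (ler0n _ _) (ltW th0).
    by apply: lt_trans (mS (m - n)%N _) _; [rewrite (leq_trans (leq_subr _ _)) ?leq_addr|lra].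
  by move/eqP; rewrite mulf_eq0 (gt_eqF th0) orbF pnatr_eq0 subn_eq0 leqNgt ltn_neqAle mn' andbT eq_sym mn.
have h' : cis (n%:R * th - m%:R * th) = 1 :> R[i].
  by rewrite -opprB cisN h rmorph1.
have := cis_eq1 _ _ h'; rewrite -mulrBl -natrB ?(ltnW nm) // => H.
have : (n - m)%:R * th = 0.
  apply: H; first exact: mulr_ge0 (ler0n _ _) (ltW th0).
  by apply: lt_trans (mS (n - m)%N _) _; [rewrite (leq_trans (leq_subr _ _)) ?leq_addl|lra].
by move/eqP; rewrite mulf_eq0 (gt_eqF th0) orbF pnatr_eq0 subn_eq0 leqNgt nm.
Qed.

Lemma monomial_radial n t : 0 <= t -> t < 1 ->
  Cintegral (@dA R) (subdisc t) (fun p => cpx p ^+ n * ((cpx p)^* ^+ n * (bweight b p)%:C)) =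
  (kappa R * betaI b n t)%:C.
Proof.
move=> t0 t1.
have E p : cpx p ^+ n * ((cpx p)^* ^+ n * (bweight b p)%:C) = (betaw b n (nsq p))%:C.
  rewrite mulrA -exprMn -normc_mulJ -nsqE -rmorphXn -rmorphM /betaw /bweight -nsqE //.
transitivity ((Rintegral (@dA R) (subdisc t) (fun p => betaw b n (nsq p)))%:C).
  apply: eq_cplx => /=.
    by rewrite /Rintegral; congr fine; apply: eq_integral => p _; rewrite E.
  by rewrite /Rintegral (eq_integral (cst 0%E)) ?integral0 // => p _; rewrite E.
congr (_%:C); rewrite /Rintegral.
pose h (s : R) : \bar R := if s < t then (betaw b n s)%:E else 0%E.
have mh : @measurable_fun _ _ (measurableTypeR R) _ setT h.
  rewrite (_ : h = (fun s => (betaw b n s)%:E) \_ `]-oo, t[); last first.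
    apply/funext => s; rewrite patchE /h; case: ifPn => st; first by rewrite ifT // inE /= in_itv.
    by rewrite ifF //; apply/negbTE; move: st; rewrite notin_setE /= in_itv /= => /negP.
  apply/(measurable_restrictT _ _).1; first exact: measurable_itv.
  by apply/measurable_EFinP; exact: measurable_betaw.
have h0 s : 0 <= s -> (0 <= h s)%E.
  by move=> s0; rewrite /h; case: ifP => // _; rewrite lee_fin; exact: betaw_ge0.
have -> : (\int[@dA R]_(p in subdisc t) (betaw b n (nsq p))%:E = \int[@dA R]_(p in @disc R) h (nsq p))%E.
  rewrite [LHS]integral_mkcond [RHS]integral_mkcond; apply: eq_integral => p _.
  rewrite !patchE /h; have [pt|pt] := ltP (nsq p) t.
    by rewrite !ifT // inE // disc_nsq /=; exact: lt_trans t1.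
  rewrite ifF; last by apply/negbTE; rewrite notin_setE /subdisc /=; apply/negP; rewrite -leNgt.
  by case: ifP.
rewrite ge0_integral_radial //.
have -> : (\int[@lebesgue_measure R]_(s in `[0%R, 1%R[) h s = \int[@lebesgue_measure R]_(s in `[0%R, t[) (betaw b n s)%:E)%E.
  rewrite [LHS]integral_mkcond [RHS]integral_mkcond; apply: eq_integral => s _.
  rewrite !patchE /h; have [st|st] := ltP s t.
    have -> : (s \in [set` `[0%R, t[]) = (s \in [set` `[0%R, 1%R[]).
      by apply/idP/idP; rewrite !inE /= !in_itv /= => /andP[-> _] //=; exact: lt_trans t1.
    by [].
  rewrite [RHS]ifF; last by apply/negbTE; rewrite notin_setE /= in_itv /= ltNge st andbF.
  by case: ifP.
have fI : (\int[@lebesgue_measure R]_(s in `[0%R, t[) (betaw b n s)%:E)%E = (betaI b n t)%:E.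
  rewrite integral_itv_bndo_bndc; last by apply/measurable_EFinP; exact: measurable_betaw.
  by rewrite /betaI /Rintegral fineK //; apply: integrable_fin_num => //; exact: integrable_betaw.
by rewrite fI -EFinM.
Qed.

End Monomials.

Section PsumConvergence.
Variable R : realType.
Implicit Types (a : nat -> R[i]) (z : R[i]).

Lemma psum_le_sum (u : nat -> R[i]) z (C q : R) : 0 <= C -> 0 <= q -> q < 1 ->
  (forall n, normc (u n * z ^+ n) <= C * q ^+ n) -> forall N,
  normc (psum u z) <= \sum_(n < N) normc (u n * z ^+ n) + C * q ^+ N / (1 - q).
Proof.
move=> C0 q0 q1 H N; have [S HS] := cseries_geometric C0 q0 q1 H.
have -> : psum u z = S.
  apply: psum_unique; apply: (@cseries_of_bound _ _ _ (C / (1 - q)) q) => // k.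
  by rewrite mulrAC.
rewrite -[S](subrK (\sum_(n < N) u n * z ^+ n)) addrC; apply: le_trans (normcD _ _) _.
by apply: lerD (HS N); exact: normc_sum.
Qed.

(** Dominated convergence for series: the multipliers stay in [0, 1] and tend to 1 for each index,
    so finitely many terms are treated by hand and the geometric tail is uniform in m. *)
Lemma psum_dominated a (j : nat -> nat -> R) z : subexp a -> normc z < 1 ->
  (forall m n, 0 <= j m n <= 1) ->
  (forall n e, 0 < e -> exists M, forall m, (M <= m)%N -> 1 - j m n <= e) ->
  forall e, 0 < e -> exists M, forall m, (M <= m)%N ->
    normc (psum a z - psum (fun n => a n * (j m n)%:C) z) <= e.
Proof.
move=> sa z1 j01 jcvg e e0.
have [C [q [C0 q0 q1 H _]]] := psum_unif sa (normc_ge0 z) z1.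
have e2 : 0 < e / 2 by rewrite divr_gt0.
have [N0 HN] := cvg_expr_small (C / (1 - q)) q0 q1 e2.
have tail : C * q ^+ N0 / (1 - q) <= e / 2 by rewrite mulrAC; exact: HN.
have [M HM] : exists M, forall m, (M <= m)%N -> \sum_(n < N0) normc (a n * z ^+ n) * (1 - j m n) <= e / 2.
  pose B : R := N0%:R * C + 1.
  have B0 : 0 < B by have := mulr_ge0 (ler0n R N0) C0; rewrite /B; lra.
  have eB : 0 < e / 2 / B by rewrite divr_gt0.
  have [M HM] : exists M, forall m n, (M <= m)%N -> (n < N0)%N -> 1 - j m n <= e / 2 / B.
    elim: (N0) => [|k [M HM]]; first by exists 0%N.
    have [M' HM'] := jcvg k _ eB; exists (maxn M M') => m n; rewrite geq_max => /andP[h1 h2].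
    by rewrite ltnS leq_eqVlt => /predU1P[->|nk]; [exact: HM'|exact: HM].
  exists M => m mM; apply: (@le_trans _ _ (\sum_(n < N0) C * (e / 2 / B))).
    apply: ler_sum => n _; apply: ler_pM; rewrite ?normc_ge0 ?subr_ge0 //.
    - by have /andP[] := j01 m n.
    - by apply: le_trans (H z n (lexx _)) _; rewrite ler_piMr // exprn_ile1 // ltW.
    - exact: HM.
  have -> : \sum_(n < N0) C * (e / 2 / B) = e / 2 * (N0%:R * C / B).
    by rewrite sumr_const card_ord -mulr_natl; field; exact: lt0r_neq0.
  rewrite ler_piMr //; first exact: ltW.
  by rewrite ler_pdivrMr // mul1r /B; lra.
exists M => m mM.
have sj : subexp (fun n => a n * (j m n)%:C).
  by apply: (@subexpM _ _ _ 1) => // n; have /andP[h0 h1] := j01 m n; rewrite normcR ger0_norm.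
have -> : psum a z - psum (fun n => a n * (j m n)%:C) z = psum (fun n => a n * (1 - j m n)%:C) z.
  have s2 := subexpZ (-1) sj.
  rewrite -mulN1r -psumZ // -psumD //; apply: eq_psum => n.
  by rewrite mulN1r rmorphB /= mulrBr mulr1.
have ud n : normc (a n * (1 - j m n)%:C * z ^+ n) = normc (a n * z ^+ n) * (1 - j m n).
  have /andP[h0 h1] := j01 m n.
  by rewrite mulrAC normcM normcR ger0_norm // subr_ge0.
have ub n : normc (a n * (1 - j m n)%:C * z ^+ n) <= C * q ^+ n.
  have /andP[h0 h1] := j01 m n.
  rewrite ud; apply: le_trans (H z n (lexx _)); rewrite ler_piMr ?normc_ge0 //; lra.
apply: le_trans (psum_le_sum C0 q0 q1 ub N0) _.
rewrite [leRHS](splitr e); apply: lerD tail.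
by under eq_bigr do rewrite ud; exact: HM.
Qed.

End PsumConvergence.

Section Reproduction.
Variables (R : realType) (b : R) (a : nat -> R[i]).
Hypotheses (b0 : 0 <= b) (sa : subexp a).

Let f' (p : plane R) : R[i] := psum (pderiv a) (cpx p).

Lemma subdisc_normc t (p : plane R) : 0 <= t -> subdisc t p -> normc (cpx p) <= Num.sqrt t.
Proof.
move=> t0 h; have h' : normc (cpx p) ^+ 2 <= t by rewrite -nsqE; exact: ltW.
by have := normc_ge0 (cpx p); move: (normc _) h' => x h' x0; rewrite -[x]ger0_norm // -sqrtr_sqr ler_wsqrtr.
Qed.

(** By orthogonality only the n-th term of the series survives. The series is evaluated at sqrt t
    times a point p / sqrt t of modulus at most 1, which is the form that [Cintegral_psum]
    accepts. *)
Lemma moment_subdisc n t : 0 < t -> t < 1 ->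
  moment (subdisc t) (fun p => f' p * (bweight b p)%:C) n = pderiv a n * (kappa R * betaI b n t)%:C.
Proof.
move=> t0 t1; have s0 : 0 < Num.sqrt t by rewrite sqrtr_gt0.
have s1 : Num.sqrt t < 1 by rewrite -sqrtr1 ltr_sqrt.
set s := Num.sqrt t in s0 s1.
have sC : s%:C != 0 :> R[i] by apply: contra_ltN s0 => /eqP[->].
have mD := @measurable_subdisc R t.
have fin := subdisc_fin (ltW t1).
have mg : cmeas (subdisc t) (fun p : plane R => s%:C^-1 * cpx p).
  by apply: cmeasM; [exact: cmeas_cst|exact: cmeas_cpx].
have g1 (p : plane R) : subdisc t p -> normc (s%:C^-1 * cpx p) <= 1.
  move=> /(subdisc_normc (ltW t0)) h; rewrite normcM normcV normcR (ger0_norm (ltW s0)).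
  by rewrite mulrC ler_pdivrMr // mul1r.
pose nu (p : plane R) : R[i] := (cpx p)^* ^+ n * (bweight b p)%:C.
have mnu : cmeas (subdisc t) nu.
  apply: cmeasM; first by apply: cmeasX; apply: cmeasJ; exact: cmeas_cpx.
  by apply: cmeasR; exact: measurable_bweight.
have nuM p : subdisc t p -> normc (nu p) <= b + 1.
  move=> /(subdisc_disc (ltW t1)) Dp; rewrite /nu normcM normcX normcJ normcR (ger0_norm (bweight_ge0 b0 p)).
  apply: le_trans (bweight_le b0 Dp); apply: ler_piMl; first exact: bweight_ge0.
  by rewrite exprn_ile1 ?normc_ge0 //; exact: ltW.
have z1 : normc (s%:C : R[i]) < 1 by rewrite normcR ger0_norm // ltW.
have sp := subexp_pderiv sa.
transitivity (Cintegral (@dA R) (subdisc t) (fun p => psum (pderiv a) (s%:C * (s%:C^-1 * cpx p)) * nu p)).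
  rewrite /moment; apply: eq_Cintegral => p _; rewrite mulVKf // /nu /f'.
  by rewrite mulrCA.
rewrite (Cintegral_psum mD fin mg g1 mnu nuM sp z1).
have cE k : Cintegral (@dA R) (subdisc t) (fun p : plane R => (s%:C^-1 * cpx p) ^+ k * nu p) =
    s%:C^-1 ^+ k * (if k == n then (kappa R * betaI b n t)%:C else 0).
  transitivity (s%:C^-1 ^+ k * Cintegral (@dA R) (subdisc t) (fun p : plane R => cpx p ^+ k * nu p)).
    rewrite -(CintegralZ mD); last first.
      apply: (cintble_bounded mD (M := b + 1)) => //.
        by apply: cmeasM => //; apply: cmeasX; exact: cmeas_cpx.
      move=> p Dp; rewrite normcM normcX; apply: le_trans (nuM p Dp).
      rewrite ler_piMl ?normc_ge0 // exprn_ile1 ?normc_ge0 //.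
      by apply: ltW; exact: (subdisc_disc (ltW t1) Dp).
    by apply: eq_Cintegral => p _; rewrite exprMn -mulrA.
  case: eqVneq => [->|kn]; first by rewrite (monomial_radial b0 n (ltW t0) t1).
  by rewrite (monomial_orthogonal b0 (ltW t1) kn) mulr0.
apply: psum_unique => e e0; exists n.+1 => N nN.
rewrite (bigD1 (Ordinal nN)) //= big1 => [|i].
  rewrite addr0 cE eqxx; have sn : s%:C^-1 ^+ n * s%:C ^+ n = 1 by rewrite -exprMn mulVf // expr1n.
  move: (s%:C^-1 ^+ n) (s%:C ^+ n) sn (pderiv a n) ((_ * _)%:C) => x y xy p k.
  have -> : p * (x * k) * y = p * k * (x * y) by ring.
  by rewrite xy mulr1 subrr normc0 ltW.
by rewrite -val_eqE /= cE => /negbTE ->; rewrite !mulr0 mul0r.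
Qed.

(** On the disc |w|^2 < t the kernel reproduces each coefficient up to [kappa] and a [betaJ]
    multiplier tending to 1. The radii are dyadic so that the cells of a fine level do not straddle
    the boundary. *)
Lemma reproduction z : normc z < 1 -> forall e, 0 < e -> exists M, forall m, (M <= m)%N ->
  normc ((kappa R)%:C * (psum a z - a 0%N) -
    Cintegral (@dA R) (subdisc (1 - (2 ^+ m.+1)^-1)) (fun p => packet_kernel b z (cpx p) * (f' p * (bweight b p)%:C))) <= e.
Proof.
move=> z1; have b2 : 0 <= b + 2 by have := b0; lra.
have T (m : nat) : 0 < 1 - (2 ^+ m.+1)^-1 :> R /\ 1 - (2 ^+ m.+1)^-1 < 1 :> R.
  have h0 : 0 < (2 ^+ m.+1 : R)^-1 by rewrite invr_gt0 exprn_gt0.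
  have h1 : (2 ^+ m.+1 : R)^-1 < 1 by rewrite invf_lt1 ?exprn_gt0 // exprn_egt1 // ltr1n.
  by split; lra.
pose a1 := pshift (fun n => a n.+1).
have sa1 : subexp a1 by apply: subexp_pshift; exact: subexp_shift.
pose j m n : R := if n is k.+1 then betaJ b k (1 - (2 ^+ m.+1)^-1) else 1.
have j01 m n : 0 <= j m n <= 1.
  case: n => [|n]; first by rewrite ler01 lexx.
  by have [t0 t1] := T m; rewrite /j betaJ_ge0 // betaJ_le1 // ltW.
have jc n e : 0 < e -> exists M, forall m, (M <= m)%N -> 1 - j m n <= e.
  case: n => [|n] e0; first by exists 0%N => m _; rewrite subrr ltW.
  have [d d0 H] := betaJ_ge b0 n.
  have h0 : 0 <= 2^-1 :> R by rewrite invr_ge0.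
  have h1 : 2^-1 < 1 :> R by rewrite invf_lt1 ?ltr1n.
  have [M HM] := cvg_expr_small d h0 h1 e0; exists M => m mM.
  have [t0 t1] := T m; apply: le_trans (H _ (ltW t0) t1) _.
  by rewrite subKr -exprVn; apply: HM; exact: leqW.
have aE : psum a z - a 0%N = psum a1 z.
  rewrite /a1 psum_pshift //; last exact: subexp_shift.
  have e2 : psum a z = psum (fun n => a 0%N * (n == 0%N)%:R + a1 n) z.
    by apply: eq_psum => -[|n]; rewrite /a1 /= ?mulr1 ?addr0 ?mulr0 ?add0r.
  have sd : subexp (fun n => a 0%N * (n == 0%N)%:R).
    by apply: (@subexp_cst _ (normc (a 0%N))) => n; rewrite normcM; case: eqP => _; rewrite ?normc1 ?normc0 ?mulr1 ?mulr0 ?normc_ge0.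
  rewrite e2 psumD // -psum_pshift //; last exact: subexp_shift.
  have -> : psum (fun n => a 0%N * (n == 0%N)%:R) z = a 0%N.
    apply: psum_unique => e e0; exists 1%N => -[//|N] _.
    rewrite big_ord_recl /= !mulr1 big1 ?addr0 ?subrr ?normc0 ?ltW // => i _.
    by rewrite mulr0 mul0r.
  by rewrite addrAC subrr add0r.
move=> e e0; have k0 := kappa_gt0 R.
have ek : 0 < e / kappa R by rewrite divr_gt0.
have [M HM] := psum_dominated sa1 z1 j01 jc ek; exists M => m mM.
have [t0 t1] := T m; set t := 1 - _ in t0 t1 *.
have mD := @measurable_subdisc R t.
have sD := @subdisc_disc R t (ltW t1).
have s1 : Num.sqrt t < 1 by rewrite -sqrtr1 ltr_sqrt.
have sp := subexp_pderiv sa.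
have [C [q [C0 q0 q1 _ H]]] := psum_unif sp (sqrtr_ge0 t) s1.
have GM p : subdisc t p -> normc (f' p * (bweight b p)%:C) <= C * (b + 1).
  move=> Dp; have := H (cpx p) 0%N (subdisc_normc (ltW t0) Dp).
  rewrite big_ord0 subr0 expr0 mulr1 => fC.
  rewrite normcM normcR (ger0_norm (bweight_ge0 b0 p)); apply: ler_pM => //.
  - exact: normc_ge0.
  - exact: bweight_ge0.
  - by apply: bweight_le => //; exact: sD.
have mG : cmeas (subdisc t) (fun p => f' p * (bweight b p)%:C).
  apply: cmeasM; last by apply: cmeasR; exact: measurable_bweight.
  have [c1 c2] := cmeas_psum_disc sp.
  split; [apply: measurable_funS c1|apply: measurable_funS c2] => //; exact: measurable_disc.
rewrite (Cintegral_packet_kernel b0 mD sD mG GM z1) aE.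
have -> : psum (pshift (fun n => ecoef b n * moment (subdisc t) (fun p => f' p * (bweight b p)%:C) n)) z =
    (kappa R)%:C * psum (fun n => a1 n * (j m n)%:C) z.
  rewrite -psumZ //; last first.
    by apply: (@subexpM _ _ _ 1) => // n; have /andP[h0 h1] := j01 m n; rewrite normcR ger0_norm.
  apply: eq_psum => -[|n]; first by rewrite /= mul0r mulr0.
  rewrite /= moment_subdisc // /ecoef /pderiv /betaJ /bincC -/t !rmorphM /=.
  have n0 : n.+1%:R != 0 :> R[i] by rewrite pnatr_eq0.
  by field.
rewrite -mulrBr normcM normcR (ger0_norm (ltW k0)) mulrC -ler_pdivlMr //.
exact: HM.
Qed.

End Reproduction.

(** * Sampling on cells *)

Section Estimates.
Variable R : realType.

Lemma normc_packet_kernel_le (b r : R) : 0 <= b -> 0 <= r -> r < 1 -> exists2 C : R, 0 <= C &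
  forall z w, normc z < 1 -> normc w <= 1 -> normc (z * w^*) <= r -> normc (packet_kernel b z w) <= C.
Proof.
move=> b0 r0 r1; have [C [q [C0 q0 q1 _ H]]] := psum_unif (subexp_ecoef b0) r0 r1.
exists C => // z w z1 w1 zw; rewrite packet_kernel_psum // normcM.
have := H _ 0%N zw; rewrite big_ord0 subr0 expr0 mulr1 => h.
by apply: le_trans h; rewrite ler_piMl ?normc_ge0 // ltW.
Qed.

Lemma normc_subX_le (z w : R[i]) (r : R) n : 0 <= r -> normc z <= r -> normc w <= r ->
  normc (z ^+ n.+1 - w ^+ n.+1) <= normc (z - w) * (n.+1%:R * r ^+ n).
Proof.
move=> r0 zr wr; rewrite subrXX normcM; apply: ler_wpM2l; first exact: normc_ge0.
apply: le_trans (normc_sum _ _ _) _.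
apply: (@le_trans _ _ (\sum_(i < n.+1) r ^+ n)); last by rewrite sumr_const card_ord mulr_natl.
apply: ler_sum => i _; rewrite normcM !normcX /=.
have -> : r ^+ n = r ^+ (n - i) * r ^+ i by rewrite -exprD subnK // -ltnS.
by apply: ler_pM; rewrite ?exprn_ge0 ?normc_ge0 //; apply: lerXn2r; rewrite ?nnegrE ?normc_ge0.
Qed.

Lemma psum_lipschitz (a : nat -> R[i]) (r : R) : subexp a -> 0 <= r -> r < 1 -> exists2 L : R, 0 <= L &
  forall z w, normc z <= r -> normc w <= r -> normc (psum a z - psum a w) <= L * normc (z - w).
Proof.
move=> sa r0 r1; have [C [q [C0 q0 q1 H _]]] := psum_unif (subexp_pderiv sa) r0 r1.
exists (C / (1 - q)); first by rewrite divr_ge0 // subr_ge0 ltW.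
move=> z w zr wr; apply/ler_addgt0Pl => e e0.
have e2 : 0 < e / 2 by rewrite divr_gt0.
have [N1 h1] := psum_cseries sa (le_lt_trans zr r1) e2.
have [N2 h2] := psum_cseries sa (le_lt_trans wr r1) e2.
pose N := (maxn N1 N2).+1.
have {}h1 := h1 N (leqW (leq_maxl _ _)); have {}h2 := h2 N (leqW (leq_maxr _ _)).
have rC : normc (r%:C : R[i]) <= r by rewrite normcR ger0_norm.
have h3 : normc (\sum_(n < N) a n * z ^+ n - \sum_(n < N) a n * w ^+ n) <= C / (1 - q) * normc (z - w).
  rewrite -sumrB big_ord_recl !expr0 subrr add0r; apply: le_trans (normc_sum _ _ _) _.
  apply: (@le_trans _ _ (\sum_(n < maxn N1 N2) C * q ^+ n * normc (z - w))).
    apply: ler_sum => i _; rewrite lift0 -mulrBr normcM.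
    apply: le_trans (ler_wpM2l (normc_ge0 _) (normc_subX_le i r0 zr wr)) _.
    rewrite mulrCA mulrC; apply: ler_wpM2r; first exact: normc_ge0.
    have := H r%:C i rC; rewrite /pderiv !normcM normcX normcR (ger0_norm r0) normc_nat.
    by rewrite mulrCA mulrA.
  rewrite -mulr_suml -mulr_sumr; apply: ler_wpM2r; first exact: normc_ge0.
  apply: ler_wpM2l => //.
  by have := geometric_sum_le 0 (maxn N1 N2) q0 q1; rewrite expr0 div1r big_mkord.
have -> : psum a z - psum a w = (psum a z - \sum_(n < N) a n * z ^+ n) -
  (psum a w - \sum_(n < N) a n * w ^+ n) + (\sum_(n < N) a n * z ^+ n - \sum_(n < N) a n * w ^+ n).
  by move: (psum a z) (psum a w) (\sum_(_ < _) _) (\sum_(_ < _) _) => x1 x2 x3 x4; ring.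
apply: le_trans (normcD _ _) _; apply: lerD h3.
by apply: le_trans (normcB _ _) _; rewrite (splitr e); exact: (lerD h1 h2).
Qed.

Lemma cell_close (d : R) : 0 < d -> exists N0, forall N, (N0 <= N)%N ->
  forall (jk : cell_index N) p q, cell jk p -> cell jk q -> normc (cpx p - cpx q) <= d.
Proof.
move=> d0; have h0 : 0 <= 2^-1 :> R by rewrite invr_ge0.
have h1 : 2^-1 < 1 :> R by rewrite invf_lt1 ?ltr1n.
have e1 : 0 < d ^+ 2 / 4 by rewrite divr_gt0 // exprn_gt0.
have e2 : 0 < d / 2 by rewrite divr_gt0.
have [N1 H1] := cvg_expr_small 1 h0 h1 e1.
have [N2 H2] := cvg_expr_small (2 * pi) h0 h1 e2.
exists (maxn N1 N2) => N; rewrite geq_max => /andP[/H1 k1 /H2 k2] jk p q.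
move=> [r [t [pE r0 /andP[r1 r2] /andP[t1 t2]]]] [s [u [qE s0 /andP[s1 s2] /andP[u1 u2]]]].
have step1 (j : nat) : j.+1%:R / 2 ^+ N = j%:R / 2 ^+ N + 2^-1 ^+ N :> R.
  by rewrite -natr1 mulrDl mul1r exprVn.
have step2 (j : nat) : 2 * pi * j.+1%:R / 2 ^+ N = 2 * pi * j%:R / 2 ^+ N + 2 * pi * 2^-1 ^+ N :> R.
  by rewrite -!mulrA step1 !mulrDr.
rewrite step1 in r2 s2; rewrite step2 in t2 u2.
have rs : `|r - s| <= d / 2.
  rewrite -ler_sqr ?nnegrE ?(ltW e2) // real_normK ?num_real //.
  rewrite mul1r in k1.
  (* Cells are cut in the variable r^2, and (r - s)^2 <= |r^2 - s^2|: the radial width is only of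
     order 2^(-N/2), whence the square in [e1]. *)
  have : (r - s) ^+ 2 <= 2^-1 ^+ N.
    have [rs|rs] := leP r s; nra.
  by move=> h; apply: le_trans h _; apply: le_trans k1 _; rewrite expr_div_n; lra.
have tu : `|t - u| <= d / 2 by apply: le_trans k2; rewrite ler_norml; apply/andP; split; lra.
have s11 : s <= 1.
  have j2 : (jk.1 : nat).+1%:R / 2 ^+ N <= 1 :> R.
    rewrite ler_pdivrMr ?exprn_gt0 // mul1r -natrX ler_nat; exact: ltn_ord.
  by rewrite step1 in j2; nra.
rewrite pE qE.
have -> : r%:C * cis t - s%:C * cis u = (r - s)%:C * cis t + s%:C * (cis t - cis u).
  by rewrite rmorphB /=; ring.
apply: le_trans (normcD _ _) _; rewrite !normcM !normcR normc_cis mulr1 (ger0_norm s0) (splitr d).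
apply: lerD rs _; apply: le_trans tu; apply: le_trans (cis_lip t u).
by rewrite ler_piMl ?normc_ge0.
Qed.

(** 1 - 2^-m is a multiple of 2^-N for m <= N, so a cell lies entirely on one side of that
    circle. *)
Lemma cell_subdisc m N (jk : cell_index N) (p q : plane R) : (m <= N)%N -> cell jk p -> cell jk q ->
  subdisc (1 - (2 ^+ m)^-1) p -> subdisc (1 - (2 ^+ m)^-1) q.
Proof.
move=> mN; rewrite !cellE => -[/= /andP[p1 _] _] [/= /andP[_ q2] _]; rewrite /subdisc /= => pt.
have N0 : 0 < 2 ^+ N :> R by rewrite exprn_gt0.
have mN2 : (2 ^ (N - m) <= 2 ^ N)%N by rewrite leq_exp2l // leq_subr.
have tE : 1 - (2 ^+ m)^-1 = (2 ^ N - 2 ^ (N - m))%:R / 2 ^+ N :> R.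
  rewrite natrB // !natrX mulrBl divff ?gt_eqF //; congr (_ - _).
  by rewrite -[in X in _ / X](subnK mN) exprD invfM mulrA divff ?mul1r // gt_eqF // exprn_gt0.
apply: lt_le_trans q2 _; rewrite tE ler_pM2r ?invr_gt0 // ler_nat.
by have := le_lt_trans p1 pt; rewrite tE ltr_pM2r ?invr_gt0 // ltr_nat.
Qed.

End Estimates.

Section Sampling.
Variables (R : realType) (b : R) (a : nat -> R[i]).
Hypotheses (b0 : 0 <= b) (sa : subexp a).

Let f' (p : plane R) : R[i] := psum a (cpx p).

Definition cell_point N (jk : cell_index N) : plane R := xget (0, 0) (cell jk).

(** The cut-off at [t] gives coefficient 0 to the cells that reach the unit circle, so that only
    packets known to be bounded enter. *)
Definition sample t N (jk : cell_index N) : R[i] :=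
  if nsq (cell_point jk) < t then f' (cell_point jk) else 0.

Lemma cell_pointP N (jk : cell_index N) (p : plane R) : cell jk p -> cell jk (cell_point jk).
Proof. by move=> h; exact: (xgetI _ h). Qed.

Let tm m : R := 1 - (2 ^+ m.+1)^-1.

Let tm01 m : 0 < tm m /\ tm m < 1.
Proof.
have h0 : 0 < (2 ^+ m.+1 : R)^-1 by rewrite invr_gt0 exprn_gt0.
have h1 : (2 ^+ m.+1 : R)^-1 < 1 by rewrite invf_lt1 ?exprn_gt0 // exprn_egt1 // ltr1n.
by rewrite /tm; split; rewrite ?subr_gt0 ?gtrBl.
Qed.

(** A power series is Lipschitz on a smaller disc and fine cells are small; N > m ensures that a
    cell and its sampling point are on the same side of the cut. *)
Lemma sample_approx m (e : R) : 0 < e -> exists2 N, (m < N)%N & forall (jk : cell_index N) p,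
  cell jk p -> normc (sample (tm m) jk - (if nsq p < tm m then f' p else 0)) <= e /\
    (sample (tm m) jk != 0 -> subdisc (tm m) p).
Proof.
move=> e0; have [t0 t1] := tm01 m.
have s1 : Num.sqrt (tm m) < 1 by rewrite -sqrtr1 ltr_sqrt.
have [L L0 HL] := psum_lipschitz sa (sqrtr_ge0 (tm m)) s1.
have d0 : 0 < e / (L + 1) by rewrite divr_gt0 // ltr_wpDl.
have [N0 HN] := cell_close d0.
exists (maxn m.+1 N0); first exact: leq_maxl.
move=> jk p jp; have jq := cell_pointP jp.
have pq : (nsq p < tm m) = (nsq (cell_point jk) < tm m).
  by apply/idP/idP; [exact: (cell_subdisc (leq_maxl _ _) jp jq)|exact: (cell_subdisc (leq_maxl _ _) jq jp)].
move: t0 t1 s1 HL pq; move: (tm m) => t t0 t1 s1 HL pq.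
have sE : sample t jk = if nsq (cell_point jk) < t then f' (cell_point jk) else 0 by [].
have [qt|qt] := boolP (nsq (cell_point jk) < t); last first.
  rewrite sE pq (negbTE qt) subrr normc0 eqxx; split; [exact: ltW|by []].
have pt : subdisc t p by rewrite -pq in qt.
rewrite sE pq qt; split; last by [].
apply: le_trans (HL _ _ _ _) _.
- exact: (subdisc_normc (ltW t0)).
- exact: (subdisc_normc (ltW t0)).
apply: le_trans (ler_wpM2l L0 (HN _ (leq_maxr _ _) jk _ _ jq jp)) _.
by rewrite mulrCA ler_piMr ?(ltW e0) // ler_pdivrMr ?ltr_wpDl // mul1r lerDl.
Qed.

Lemma Cintegral_indic (A D : set (plane R)) (F : plane R -> R[i]) : A `<=` D ->
  Cintegral (@dA R) A F = Cintegral (@dA R) D (fun p => (\1_A p)%:C * F p).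
Proof.
move=> AD.
have key (h : plane R -> R) : Rintegral (@dA R) A h = Rintegral (@dA R) D (fun p => \1_A p * h p).
  rewrite /Rintegral; congr fine; rewrite [LHS]integral_mkcond [RHS]integral_mkcond.
  apply: eq_integral => p _; rewrite !patchE indicE; case: ifPn => pA.
    by rewrite mul1r ifT //; move: pA; rewrite !inE; exact: AD.
  by rewrite mul0r; case: ifP.
by apply: eq_cplx => /=; rewrite key /Rintegral; congr fine; apply: eq_integral => p _;
  rewrite ?cReM ?cImM /= mul0r ?subr0 ?addr0.
Qed.

Lemma packet_kernel_cmeas z : normc z < 1 -> cmeas (@disc R) (fun p => packet_kernel b z (cpx p)).
Proof.
move=> z1; apply: (@eq_cmeas _ _ _ _ (fun p => z * psum (ecoef b) (z * (cpx p)^*))).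
  by move=> p dp; rewrite packet_kernel_psum //; exact: ltW.
apply: cmeasM; first exact: cmeas_cst.
have mg : cmeas (@disc R) (fun p => (cpx p)^*) by apply: cmeasJ; exact: cmeas_cpx.
have g1 p : @disc R p -> normc (cpx p)^* <= 1 by rewrite normcJ => /ltW.
exact: (cmeas_psum mg g1 (subexp_ecoef b0) z1).
Qed.

Lemma sample_packet_approx z : normc z < 1 -> exists2 C : R, 0 <= C & forall N (v : cell_index N -> R[i]) t e,
  0 <= e -> t < 1 ->
  (forall jk p, cell jk p -> normc (v jk - (if nsq p < t then f' p else 0)) <= e) ->
  normc (\sum_jk v jk * packet b jk z -
    Cintegral (@dA R) (subdisc t) (fun p => packet_kernel b z (cpx p) * (f' p * (bweight b p)%:C))) <= C * e.
Proof.
move=> z1; have [Ck Ck0 HK] := normc_packet_kernel_le b0 (normc_ge0 z) z1.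
have mdisc := @measurable_disc R; have find := @dA_disc_fin R.
exists (Ck * (b + 1) * fine (@dA R (@disc R))).
  by apply: mulr_ge0; [apply: mulr_ge0 => //; have := b0; lra|exact: fine_ge0].
move=> N v t e e0 t1 H.
pose W p := packet_kernel b z (cpx p) * (bweight b p)%:C.
have mW : cmeas (@disc R) W.
  by apply: cmeasM; [exact: packet_kernel_cmeas|apply: cmeasR; exact: measurable_bweight].
have WM p : @disc R p -> normc (W p) <= Ck * (b + 1).
  move=> dp; rewrite /W normcM normcR (ger0_norm (bweight_ge0 b0 p)).
  apply: ler_pM; [exact: normc_ge0|exact: bweight_ge0| |exact: bweight_le].
  have p1 : normc (cpx p) <= 1 by exact: ltW.
  by apply: HK => //; rewrite normcM normcJ ler_piMr ?normc_ge0.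
pose D (p : plane R) : R[i] := \sum_jk v jk * (\1_(cell jk) p)%:C - (\1_(subdisc t) p)%:C * f' p.
have mI (A : set (plane R)) : measurable A -> cmeas (@disc R) (fun p => (\1_A p)%:C).
  by move=> mA; apply: cmeasR; apply: measurable_funTS; exact: measurable_indic.
have mt := @measurable_subdisc R t.
have mf' : cmeas (@disc R) f' by exact: cmeas_psum_disc.
have mft : cmeas (@disc R) (fun p => (\1_(subdisc t) p)%:C * f' p) by apply: cmeasM => //; exact: mI.
have [Mf [qf [Mf0 _ _ _ HMf]]] : exists Mf q : R, [/\ 0 <= Mf, 0 <= q, q < 1, True &
    forall p, subdisc t p -> normc (f' p) <= Mf].
  have st : Num.sqrt (Num.max t 0) < 1 by rewrite -sqrtr1 ltr_sqrt // gt_max t1 ltr01.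
  have [C [q [C0 q0 q1 _ HC]]] := psum_unif sa (sqrtr_ge0 (Num.max t 0)) st.
  exists C, q; split=> // p pt.
  have pt' : subdisc (Num.max t 0) p by rewrite /subdisc /= lt_max pt.
  have m0 : 0 <= Num.max t 0 by rewrite le_max lexx orbT.
  by have := HC (cpx p) 0%N (subdisc_normc m0 pt'); rewrite big_ord0 subr0 expr0 mulr1.
have iv jk : cintble (@dA R) (@disc R) (fun p => v jk * ((\1_(cell jk) p)%:C * W p)).
  apply: (cintble_bounded mdisc (M := normc (v jk) * (Ck * (b + 1)))) => //.
    by apply: cmeasM; [exact: cmeas_cst|apply: cmeasM => //; apply: mI; exact: measurable_cell].
  move=> p dp; rewrite normcM; apply: ler_wpM2l; first exact: normc_ge0.
  rewrite normcM normcR indicE; case: (p \in cell jk); rewrite ?normr1 ?mul1r; first exact: WM.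
  by rewrite normr0 mul0r; apply: mulr_ge0 => //; have := b0; lra.
have it : cintble (@dA R) (@disc R) (fun p => (\1_(subdisc t) p)%:C * (f' p * W p)).
  apply: (cintble_bounded mdisc (M := Mf * (Ck * (b + 1)))) => //.
    by apply: cmeasM; [exact: mI|exact: cmeasM].
  move=> p dp; rewrite normcM normcR indicE; have [pt|pt] := boolP (p \in subdisc t).
    rewrite normr1 mul1r normcM; apply: ler_pM; rewrite ?normc_ge0 //; last exact: WM.
    by apply: HMf; move: pt; rewrite inE.
  by rewrite normr0 mul0r; apply: mulr_ge0 => //; apply: mulr_ge0 => //; have := b0; lra.
have -> : \sum_jk v jk * packet b jk z - Cintegral (@dA R) (subdisc t)
      (fun p => packet_kernel b z (cpx p) * (f' p * (bweight b p)%:C)) =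
    Cintegral (@dA R) (@disc R) (fun p => D p * W p).
  have -> : \sum_jk v jk * packet b jk z =
      Cintegral (@dA R) (@disc R) (fun p => \sum_jk v jk * ((\1_(cell jk) p)%:C * W p)).
    rewrite (Cintegral_sum mdisc) => [|jk _]; last exact: iv.
    apply: eq_bigr => jk _; rewrite /packet (Cintegral_indic _ (@cell_disc R N jk)).
    rewrite -(CintegralZ mdisc) //.
    apply: (cintble_bounded mdisc (M := Ck * (b + 1))) => //.
      by apply: cmeasM => //; apply: mI; exact: measurable_cell.
    move=> p dp; rewrite normcM normcR indicE; case: (p \in cell jk); rewrite ?normr1 ?mul1r; first exact: WM.
    by rewrite normr0 mul0r; apply: mulr_ge0 => //; have := b0; lra.
  rewrite (Cintegral_indic _ (subdisc_disc (ltW t1))).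
  transitivity (Cintegral (@dA R) (@disc R) (fun p => \sum_jk v jk * ((\1_(cell jk) p)%:C * W p)) -
    Cintegral (@dA R) (@disc R) (fun p => (\1_(subdisc t) p)%:C * (f' p * W p))).
    congr (_ - _); apply: eq_Cintegral => p _; congr (_ * _); rewrite /W; exact: mulrCA.
  rewrite -(CintegralB mdisc) //; last by apply: (cintble_sum mdisc) => jk _; exact: iv.
  apply: eq_Cintegral => p _; rewrite /D mulrBl mulr_suml; congr (_ - _); last by rewrite mulrA.
  by apply: eq_bigr => jk _; rewrite mulrA.
have DW : cintble (@dA R) (@disc R) (fun p => D p * W p).
  have h := cintbleB mdisc (cintble_sum mdisc (index_enum _) (P := xpredT) (fun jk _ => iv jk)) it.
  move: h; apply: (eq_cintble mdisc) => p _; rewrite /D mulrBl mulr_suml; congr (_ - _); last by rewrite mulrA.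
  by apply: eq_bigr => jk _; rewrite mulrA.
(* Away from the origin exactly one cell contains p, so [D p] is the sampling error of that cell. *)
have De p : @disc R p -> nsq p != 0 -> normc (D p) <= e.
  move=> dp p0; have [jk jp] := cell_cover N dp.
  have z0 : cpx p != 0 by rewrite -normc_gt0 lt_neqAle normc_ge0 andbT eq_sym -sqrf_eq0 -nsqE.
  rewrite /D (bigD1 jk) //= big1 ?addr0.
    rewrite !indicE (mem_set jp) mulr1; apply: le_trans (H jk p jp).
    rewrite le_eqVlt; apply/orP; left; apply/eqP; congr (normc (_ - _)).
    have [pt|pt] := boolP (p \in subdisc t); move: pt; rewrite ?inE ?notin_setE /subdisc /=.
      by move=> ->; rewrite mul1r.
    by move=> /negP/negbTE ->; rewrite mul0r.
  move=> i ij; rewrite indicE memNset ?mulr0 // => ip.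
  by move: ij; rewrite (cell_uniq z0 ip jp) eqxx.
rewrite -lee_fin; apply: le_trans (normc_Cintegral_le mdisc DW) _.
rewrite ge0_integral_off_origin; first last.
- by move=> p _; rewrite lee_fin normc_ge0.
- by apply/measurable_EFinP; apply: measurable_normc; exact: (cintble_cmeas DW).
apply: (@le_trans _ _ (\int[@dA R]_(p in @disc R) (cst ((Ck * (b + 1) * e)%:E) p))%E).
  apply: ge0_le_integral' => p dp; case: eqP => [_|/eqP p0]; rewrite ?lee_fin ?normc_ge0 //.
    by apply: mulr_ge0 => //; apply: mulr_ge0 => //; have := b0; lra.
  by rewrite normcM mulrC; apply: ler_pM; rewrite ?normc_ge0 ?WM ?De.
rewrite integral_cst // -[X in (_ * X)%E](@fineK _ (@dA R (@disc R))) ?ge0_fin_numE //.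
by rewrite -EFinM lee_fin mulrAC.
Qed.

(** For w in a smaller disc z conj w stays away from the singularity 1 whatever z is. Together with
    finiteness of [mu] this makes the packet square integrable. *)
Lemma packet_bounded N (jk : cell_index N) t : 0 <= t -> t < 1 -> (forall p : plane R, cell jk p -> subdisc t p) ->
  exists2 M : R, 0 <= M & forall z, normc z < 1 -> normc (packet b jk z) <= M.
Proof.
move=> t0 t1 ct; have s1 : Num.sqrt t < 1 by rewrite -sqrtr1 ltr_sqrt.
have [C C0 HC] := normc_packet_kernel_le b0 (sqrtr_ge0 t) s1.
have fc : (@dA R (cell jk) < +oo)%E.
  apply: le_lt_trans (@dA_disc_fin R); apply: le_measure; rewrite ?inE //.
  - exact: measurable_cell.
  - exact: measurable_disc.
  - exact: cell_disc.
have M0 : 0 <= C * (b + 1) by apply: mulr_ge0 => //; have := b0; lra.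
exists (C * (b + 1) * fine (@dA R (cell jk))); first by apply: mulr_ge0 => //; exact: fine_ge0.
move=> z z1; rewrite /packet; apply: (normc_Cintegral_bound (measurable_cell jk)) => //.
  apply: cmeasM; last by apply: cmeasR; exact: measurable_bweight.
  have [c1 c2] := packet_kernel_cmeas z1.
  split; [apply: measurable_funS c1|apply: measurable_funS c2] => //; try exact: measurable_disc; exact: cell_disc.
move=> p jp; have dp := cell_disc jp; have p1 : normc (cpx p) <= 1 by exact: ltW.
rewrite normcM normcR (ger0_norm (bweight_ge0 b0 p)).
apply: ler_pM; [exact: normc_ge0|exact: bweight_ge0| |exact: bweight_le].
apply: HC => //; rewrite normcM normcJ; apply: le_trans (subdisc_normc t0 (ct p jp)).
by rewrite ler_piMl ?normc_ge0 // ltW.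
Qed.

End Sampling.

(** * From the capacity to the embedding *)

Section Fatou.
Variables (d : measure_display) (T : measurableType d) (R : realType).
Variables (m : {measure set T -> \bar R}) (D : set T).
Hypothesis mD : measurable D.

Lemma fatou_le (f : nat -> T -> \bar R) (g : T -> \bar R) (B : \bar R) :
  (forall n, measurable_fun D (f n)) -> (forall n x, D x -> (0 <= f n x)%E) ->
  (forall x, D x -> f n x @[n --> \oo] --> g x) ->
  (forall n, (\int[m]_(x in D) f n x <= B)%E) -> (\int[m]_(x in D) g x <= B)%E.
Proof.
move=> mf f0 fg fB.
have -> : (\int[m]_(x in D) g x = \int[m]_(x in D) limn_einf (f^~ x))%E.
  apply: eq_integral => x; rewrite inE => Dx.
  by have [-> _] := cvg_limn_einf_sup (fg x Dx).
apply: le_trans (fatou _ mD mf f0) _.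
rewrite limn_einf_lim; apply: lime_le; first exact: is_cvg_einfs.
apply: nearW => n; apply: le_trans (fB n).
by apply: ereal_inf_lbound; exists n => /=.
Qed.

Lemma fatou_normc (f : nat -> T -> R[i]) (g : T -> R[i]) (B : \bar R) :
  (forall n, cmeas D (f n)) ->
  (forall x, D x -> forall e : R, 0 < e -> exists N0, forall N, (N0 <= N)%N -> normc (g x - f N x) <= e) ->
  (forall n, (\int[m]_(x in D) (normc (f n x) ^+ 2)%:E <= B)%E) ->
  (\int[m]_(x in D) (normc (g x) ^+ 2)%:E <= B)%E.
Proof.
move=> mf fg; apply: (fatou_le (f := fun n x => (normc (f n x) ^+ 2)%:E)).
- move=> n; apply/measurable_EFinP.
  by under eq_fun do rewrite expr2; apply: measurable_funM; exact: measurable_normc.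
- by move=> n x _; rewrite lee_fin sqr_ge0.
move=> x Dx; apply: cvg_EFin; first by apply: nearW => n.
have c : normc (f n x) @[n --> \oo] --> normc (g x).
  apply/cvgrPdist_le => e e0; have [N0 H] := fg x Dx e e0; exists N0 => // n /= nN.
  apply: le_trans (H n nN); rewrite ler_norml lerNl opprB; apply/andP; split; last exact: ler_normcB.
  by rewrite normc_sub; exact: ler_normcB.
by rewrite /comp /= expr2; under eq_fun do rewrite expr2; exact: cvgM.
Qed.

End Fatou.

Section BoxSums.
Variables (R : realType) (K : R -> R).
Hypothesis hK : class_WQ K.

(** Off the origin one cell contains each point, so the sum is the integral of a function constant
    on cells, which lies below [h]. *)
Lemma box_sum_le (I : circle_arc R) N (x : cell_index N -> R) (h : plane R -> R) :
  (forall i, 0 <= x i) -> (forall i p, cell i p -> x i <= h p) ->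
  ((\sum_i x i * boxval K I i)%:E <= \int[@dA R]_(p in carleson_box I)
     (h p * K ((1 - normc (cpx p)) / arc_len I))%:E)%E.
Proof.
move=> x0 xh; have mdisc := @measurable_disc R.
have mI k : measurable (cell (N := N) k `&` carleson_box I).
  by apply: measurableI; [exact: measurable_cell|exact: measurable_carleson_box].
pose Kw (p : plane R) := K ((1 - normc (cpx p)) / arc_len I).
pose g (k : cell_index N) (p : plane R) : R := \1_(cell k `&` carleson_box I) p * Kw p.
have Kw0 p : @disc R p -> 0 <= Kw p.
  by move=> dp; apply: (WQ_ge0 hK); rewrite divr_ge0 ?(ltW (arc_len_gt0 _)) // subr_ge0 ltW.
have g0 k p : @disc R p -> 0 <= g k p.
  by move=> dp; apply: mulr_ge0; [rewrite indicE ler0n|exact: Kw0].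
have mg k : measurable_fun (@disc R) (g k).
  rewrite (_ : g k = Kw \_ (cell k `&` carleson_box I)).
    apply: measurable_funTS; apply/(measurable_restrictT _ _).1 => //.
    by apply: measurable_box_weight => // p [].
  by apply/funext => p; rewrite patchE /g indicE; case: ifP; rewrite ?mul1r ?mul0r.
have gint k : (\int[@dA R]_(p in @disc R) (x k * g k p)%:E = (x k * boxval K I k)%:E)%E.
  rewrite EFinM (boxvalE hK); under eq_integral do rewrite EFinM.
  rewrite ge0_integralZl_EFin //; first last.
  - by apply/measurable_EFinP; exact: mg.
  - by move=> p dp; rewrite lee_fin g0.
  congr (_ * _)%E; rewrite integral_mkcond [RHS]integral_mkcond.
  apply: eq_integral => p _; rewrite !patchE /g indicE.
  have [bp|bp] := boolP (p \in cell k `&` carleson_box I).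
    by rewrite mul1r mem_set //; move: bp; rewrite inE => -[/cell_disc].
  by rewrite mul0r; case: ifP.
pose F (p : plane R) : \bar R := (\sum_i x i * g i p)%:E.
have -> : (\sum_i x i * boxval K I i)%:E = (\int[@dA R]_(p in @disc R) F p)%E.
  rewrite /F; under eq_integral do rewrite -sumEFin.
  rewrite ge0_integral_sum //.
  - by rewrite -sumEFin; apply: eq_bigr => i _; rewrite gint.
  - by move=> i; apply/measurable_EFinP; apply: measurable_funM => //; exact: mg.
  - by move=> i p dp; rewrite lee_fin; apply: mulr_ge0 => //; exact: g0.
rewrite ge0_integral_off_origin; first last.
- by move=> p dp; rewrite lee_fin; apply: sumr_ge0 => i _; apply: mulr_ge0 => //; exact: g0.
- apply/measurable_EFinP; apply: measurable_sum => i.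
  by apply: measurable_funM => //; exact: mg.
rewrite [leLHS]integral_mkcond [leRHS]integral_mkcond.
apply: ge0_le_integral' => p _.
  rewrite patchE; case: ifP => // /set_mem dp; case: ifP => // _; rewrite lee_fin.
  by apply: sumr_ge0 => i _; apply: mulr_ge0 => //; exact: g0.
have h0 : carleson_box I p -> (0 <= (h p * Kw p)%:E)%E.
  move=> bp; have dp := carleson_box_disc bp; have [jk jp] := cell_cover N dp.
  by rewrite lee_fin; apply: mulr_ge0; [exact: le_trans (x0 jk) (xh jk p jp)|exact: Kw0].
rewrite !patchE; have [dp|_] := boolP (p \in @disc R); last by case: ifP => // /set_mem /h0.
case: eqP => [_|/eqP p0]; first by case: ifP => // /set_mem /h0.
have {}dp := set_mem dp; have [jk jp] := cell_cover N dp.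
have z0 : cpx p != 0 by rewrite -normc_gt0 lt_neqAle normc_ge0 andbT eq_sym -sqrf_eq0 -nsqE.
rewrite /F (bigD1 jk) //= big1 ?addr0; last first.
  move=> i ij; rewrite /g indicE memNset ?mul0r ?mulr0 // => -[ip _].
  by move: ij; rewrite (cell_uniq z0 ip jp) eqxx.
rewrite /g indicE; have [bp|bp] := boolP (p \in carleson_box I).
  rewrite mem_set; last by split=> //; exact: set_mem.
  by rewrite mul1r lee_fin; apply: ler_wpM2r; [exact: Kw0|exact: xh].
by rewrite memNset ?mul0r ?mulr0 // => -[_ /mem_set]; rewrite (negbTE bp).
Qed.

Lemma measurable_K_mobius (a : R[i]) : normc a < 1 ->
  measurable_fun (@disc R) (fun p => K (1 - normc (mobius a (cpx p)) ^+ 2)).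
Proof.
move=> a1; have mdisc := @measurable_disc R.
pose u (p : plane R) := (1 - normc a ^+ 2) * (1 - nsq p) * ((normc (1 - a^* * cpx p))^-1 * (normc (1 - a^* * cpx p))^-1).
apply: (@eq_measurable_fun _ _ _ _ (@disc R) (fun p => K (Num.max (u p) 0))).
  move=> p; rewrite inE => dp; rewrite mobius_onem // /u nsqE.
  have -> : (normc (1 - a^* * cpx p))^-1 * (normc (1 - a^* * cpx p))^-1 = (normc (1 - a^* * cpx p) ^+ 2)^-1.
    by rewrite expr2 invfM.
  congr K; apply/max_idPl; apply: divr_ge0; last exact: sqr_ge0.
  by apply: mulr_ge0; apply/ltW; apply: onem_sqr_gt0.
apply: (measurableT_comp (measurable_WQ hK)).
have md : measurable_fun (@disc R) (fun p => (normc (1 - a^* * cpx p))^-1).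
  by apply: measurable_inv_ge0; [move=> x; exact: normc_ge0|exact: measurable_normc1B].
apply: measurable_funM; last exact: measurable_funM.
apply: measurable_funM => //; apply: measurable_funB => //.
by apply: measurable_funTS; exact: measurable_nsq.
Qed.

Variables (sigma C1 : R).
Hypotheses (sigma0 : 0 < sigma) (C11 : 1 <= C1).
Hypothesis KU : forall s t : R, 1 <= s -> 0 < t -> t <= 1 -> K (s * t) <= C1 * s `^ sigma * K t.

(** The Moebius weight of the point attached to the box dominates the box weight. The bound on the
    x_i is the one satisfied by squared samples with error e, as (|f| + e)^2 <= 2 |f|^2 + 2 e^2. *)
Lemma box_energy_le : exists2 C : R, 0 <= C & forall (f : plane R -> R[i]) (S e : R),
  cmeas (@disc R) f ->
  (forall a, normc a < 1 -> (\int[@dA R]_(p in @disc R)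
    (normc (f p) ^+ 2 * K (1 - normc (mobius a (cpx p)) ^+ 2))%:E <= S%:E)%E) ->
  forall N (x : cell_index N -> R) (I : circle_arc R), (forall i, 0 <= x i) ->
  (forall i p, cell i p -> x i <= 2 * normc (f p) ^+ 2 + 2 * e ^+ 2) ->
  \sum_i x i * boxval K I i <= 2 * C * S + 2 * K 1 * fine (@dA R (@disc R)) * e ^+ 2.
Proof.
have [C C0 HC] := box_weight_le hK C11 KU.
exists C => // f S e mf HS N x I x0 xf; have mdisc := @measurable_disc R.
have [a [a1 Ha]] := HC I.
rewrite -lee_fin; apply: le_trans (box_sum_le I x0 xf) _.
pose h1 (p : plane R) : R := 2 * C * (normc (f p) ^+ 2 * K (1 - normc (mobius a (cpx p)) ^+ 2)).
have Km0 p : @disc R p -> 0 <= K (1 - normc (mobius a (cpx p)) ^+ 2).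
  move=> dp; apply: (WQ_ge0 hK); rewrite mobius_onem //; apply: divr_ge0; last exact: sqr_ge0.
  by apply: mulr_ge0; apply/ltW; apply: onem_sqr_gt0.
have h10 p : @disc R p -> 0 <= h1 p.
  by move=> dp; apply: mulr_ge0; [exact: mulr_ge0|apply: mulr_ge0; [exact: sqr_ge0|exact: Km0]].
have K10 : 0 <= K 1 by exact: (WQ_ge0 hK).
pose h2 : R := 2 * e ^+ 2 * K 1.
have h20 : 0 <= h2 by apply: mulr_ge0 => //; apply: mulr_ge0 => //; exact: sqr_ge0.
have mh1 : measurable_fun (@disc R) (fun p => normc (f p) ^+ 2 * K (1 - normc (mobius a (cpx p)) ^+ 2)).
  apply: measurable_funM; last exact: measurable_K_mobius.
  by under eq_fun do rewrite expr2; apply: measurable_funM; exact: measurable_normc.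
apply: (@le_trans _ _ (\int[@dA R]_(p in @disc R) ((h1 p)%:E + cst h2%:E p))%E).
  apply: ge0_le_integral_set; first last.
  - move=> p bp; have dp := carleson_box_disc bp; rewrite -EFinD lee_fin.
    have /andP[w0 w1] := box_arg bp.
    rewrite mulrDl; apply: lerD.
      have -> : h1 p = 2 * normc (f p) ^+ 2 * (C * K (1 - normc (mobius a (cpx p)) ^+ 2)) by rewrite /h1; ring.
      apply: ler_wpM2l; first by apply: mulr_ge0 => //; exact: sqr_ge0.
      exact: Ha.
    rewrite /h2; apply: ler_wpM2l; first by apply: mulr_ge0 => //; exact: sqr_ge0.
    by apply: (WQ_nondecreasing hK) => //; exact: ltW.
  - exact: carleson_box_disc.
  - by move=> p dp; rewrite -EFinD lee_fin addr_ge0 // h10.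
  - move=> p bp; have /andP[w0 w1] := box_arg bp; rewrite lee_fin; apply: mulr_ge0.
      by apply: addr_ge0; apply: mulr_ge0 => //; exact: sqr_ge0.
    by apply: (WQ_ge0 hK); exact: ltW.
rewrite ge0_integralD //; last by apply/measurable_EFinP; apply: measurable_funM.
rewrite integral_cst // EFinD; apply: leeD.
  rewrite /h1; under eq_integral do rewrite EFinM.
  rewrite ge0_integralZl_EFin //; last 3 first.
  - by move=> p dp; rewrite lee_fin; apply: mulr_ge0; [exact: sqr_ge0|exact: Km0].
  - exact/measurable_EFinP.
  - exact: mulr_ge0.
  by rewrite [leRHS]EFinM; apply: lee_wpmul2l; [rewrite lee_fin mulr_ge0|exact: HS].
rewrite -[X in (_ * X)%E](@fineK _ (@dA R (@disc R))) ?ge0_fin_numE ?dA_disc_fin // -EFinM lee_fin /h2.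
by rewrite le_eqVlt; apply/orP; left; apply/eqP; ring.
Qed.

End BoxSums.

Section BackwardDirection.
Variables (R : realType) (K : R -> R).
Hypothesis hK : class_WQ K.
Variables (sigma C1 b : R).
Hypotheses (sigma0 : 0 < sigma) (C11 : 1 <= C1) (b0 : 0 <= b).
Hypothesis KU : forall s t : R, 1 <= s -> 0 < t -> t <= 1 -> K (s * t) <= C1 * s `^ sigma * K t.
Variable mu : {measure set (plane R) -> \bar R}.
Hypotheses (mufin : (mu (@disc R) < +oo)%E) (cap : (capacity K b mu < +oo)%E).

Lemma capacity_quad_le : exists2 c : R, 0 <= c & forall N (v : cell_index N -> R[i]) (s : R),
  (forall I, \sum_i normc (v i) ^+ 2 * boxval K I i <= s) ->
  (forall i, v i != 0 -> exists M : R, forall z, normc z < 1 -> normc (packet b i z) <= M) ->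
  (\int[mu]_(p in @disc R) (normc (\sum_i v i * packet b i (cpx p)) ^+ 2)%:E <= (c * s)%:E)%E.
Proof.
have [c c0 capc] : exists2 c : R, 0 <= c & (capacity K b mu < c%:E)%E.
  exists (`|fine (capacity K b mu)| + 1); first exact: addr_ge0.
  move: cap; case: (capacity K b mu) => [x||] //= _; last exact: ltNyr.
  by rewrite lte_fin; have := ler_norm x; lra.
exists c => // N v s hs hv.
have mdisc := @measurable_disc R.
have s0 : 0 <= s.
  apply: le_trans (hs (full_circle R)); apply: sumr_ge0 => i _; apply: mulr_ge0; [exact: sqr_ge0|exact: boxval_ge0].
have : (capacity_at K b mu N < c%:E)%E.
  by apply: le_lt_trans capc; apply: ereal_sup_ubound; exists N.
move=> /ereal_inf_lt[_ [M [lam [I [lam0 L ->]]]]]; rewrite lte_fin => lamc.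
pose n := #|{: cell_index N}|.
pose F (i : 'I_n) (p : plane R) := packet b (enum_val i) (cpx p).
pose w : 'rV[R[i]]_n := \row_i v (enum_val i).
have mF i : cmeas (@disc R) (fun p => w 0 i * F i p).
  by apply: cmeasM; [exact: cmeas_cst|exact: cmeas_packet].
have iF i : (\int[mu]_(p in @disc R) (normc (w 0 i * F i p) ^+ 2)%:E < +oo)%E.
  have [vi|vi] := eqVneq (v (enum_val i)) 0.
    by rewrite integral0_eq // => p _; rewrite mxE vi mul0r normc0 expr0n.
  have [B HB] := hv _ vi.
  apply: (@le_lt_trans _ _ (\int[mu]_(p in @disc R) (cst ((normc (w 0 i) * B) ^+ 2)%:E p))%E).
    apply: ge0_le_integral' => p dp; first by rewrite lee_fin sqr_ge0.
    have h := HB _ dp.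
    rewrite lee_fin ler_sqr ?nnegrE ?normc_ge0 //.
      by rewrite normcM; apply: ler_wpM2l => //; exact: normc_ge0.
    by apply: mulr_ge0; [exact: normc_ge0|exact: le_trans (normc_ge0 _) h].
  by rewrite integral_cst //; apply: lte_mul_pinfty => //; rewrite lee_fin sqr_ge0.
have [gq gfin] := gram_quad mdisc mF iF.
have sE p : \sum_i w 0 i * F i p = \sum_jk v jk * packet b jk (cpx p).
  rewrite [RHS](reindex _ (onW_bij _ (enum_val_bij _))).
  by apply: eq_bigr => i _; rewrite mxE.
have PM : packet_matrix b mu N = gram mu (@disc R) F by [].
rewrite sum_box_matrix in L; have := loewner_le_quad w L.
rewrite /quad PM gq /= => Q.
under eq_integral do rewrite -sE.
rewrite -[leLHS]fineK; last by rewrite ge0_fin_numE // integral_ge0 // => p _; rewrite lee_fin sqr_ge0.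
rewrite lee_fin; apply: le_trans Q _.
apply: (@le_trans _ _ (\sum_(m < M) lam m * s)); last by rewrite -mulr_suml; apply: ler_wpM2r => //; exact: ltW.
under eq_bigr do rewrite mulr_sumr.
rewrite exchange_big /=; apply: ler_sum => m _.
under eq_bigr do rewrite mulrCA.
rewrite -mulr_sumr; apply: ler_wpM2l; first exact: lam0.
apply: le_trans (hs (I m)); rewrite le_eqVlt; apply/orP; left; apply/eqP.
rewrite [RHS](reindex _ (onW_bij _ (enum_val_bij _))).
by apply: eq_bigr => i _; rewrite mxE.
Qed.

(** The samples satisfy the box bound up to a term in eta^2, so the capacity bounds their packet
    combinations in L^2(mu). Fatou's lemma passes to [kappa] times f - f(0), and [kappa] is divided
    out. *)
Lemma psum_L2_le : exists2 C : R, 0 <= C & forall (a : nat -> R[i]) (S : R), subexp a ->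
  (forall w, normc w < 1 -> (\int[@dA R]_(p in @disc R)
    (normc (psum (pderiv a) (cpx p)) ^+ 2 * K (1 - normc (mobius w (cpx p)) ^+ 2))%:E <= S%:E)%E) ->
  (\int[mu]_(p in @disc R) (normc (psum a (cpx p) - a 0%N) ^+ 2)%:E <= (C * S)%:E)%E.
Proof.
have [c c0 Hc] := capacity_quad_le.
have [C C0 HC] := box_energy_le hK C11 KU.
have k0 := kappa_gt0 R.
exists (c * (2 * C) / kappa R ^+ 2).
  by apply: divr_ge0; [apply: mulr_ge0 => //; exact: mulr_ge0|exact: sqr_ge0].
move=> a S sa HS; have sp := subexp_pderiv sa; have mdisc := @measurable_disc R.
have mf : cmeas (@disc R) (fun p => psum (pderiv a) (cpx p)) by exact: cmeas_psum_disc.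
have ma : cmeas (@disc R) (fun p => psum a (cpx p) - a 0%N).
  by apply: cmeasB; [exact: cmeas_psum_disc|exact: cmeas_cst].
pose B := 2 * K 1 * fine (@dA R (@disc R)).
have K10 : 0 <= K 1 by exact: (WQ_ge0 hK).
have B0 : 0 <= B by apply: mulr_ge0; [exact: mulr_ge0|exact: fine_ge0].
(* The m-th sampling error is eta 2^-m: it tends to 0 for the pointwise limit, and it stays below
   [eta], so it costs at most B eta^2 at every m. Then [eta] is sent to 0. *)
have main (eta : R) : 0 < eta -> (\int[mu]_(p in @disc R)
    (normc ((kappa R)%:C * (psum a (cpx p) - a 0%N)) ^+ 2)%:E <= (c * (2 * C * S + B * eta ^+ 2))%:E)%E.
  move=> eta0.
  have h0 : 0 < 2^-1 :> R by rewrite invr_gt0.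
  have h1 : 2^-1 < 1 :> R by rewrite invf_lt1 ?ltr1n.
  have em m : 0 < eta * 2^-1 ^+ m by rewrite mulr_gt0 // exprn_gt0.
  pose tm m : R := 1 - (2 ^+ m.+1)^-1.
  have tm01 m : 0 < tm m /\ tm m < 1.
    have g0 : 0 < (2 ^+ m.+1 : R)^-1 by rewrite invr_gt0 exprn_gt0.
    have g1 : (2 ^+ m.+1 : R)^-1 < 1 by rewrite invf_lt1 ?exprn_gt0 // exprn_egt1 // ltr1n.
    by rewrite /tm; split; rewrite ?subr_gt0 ?gtrBl.
  have ex m : exists N, forall (jk : cell_index N) p,
      cell jk p -> normc (sample (pderiv a) (tm m) jk - (if nsq p < tm m then psum (pderiv a) (cpx p) else 0)) <= eta * 2^-1 ^+ m /\
      (sample (pderiv a) (tm m) jk != 0 -> subdisc (tm m) p).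
    by have [N _ H] := sample_approx sp m (em m); exists N.
  pose N m := projT1 (cid (ex m)).
  have HN m := projT2 (cid (ex m)).
  pose v m (jk : cell_index (N m)) := sample (pderiv a) (tm m) jk.
  pose g m (p : plane R) := \sum_jk v m jk * packet b jk (cpx p).
  apply: (fatou_normc mdisc (f := g)).
  - move=> m; apply: cmeas_sum => jk; apply: cmeasM; [exact: cmeas_cst|exact: cmeas_packet].
  - move=> p dp e e0; have e2 : 0 < e / 2 by rewrite divr_gt0.
    have [M1 H1] := reproduction b0 sa (dp : normc (cpx p) < 1) e2.
    have [Cz Cz0 HCz] := sample_packet_approx b0 sp (dp : normc (cpx p) < 1).
    have [M2 H2] := cvg_expr_small (Cz * eta) (ltW h0) h1 e2.
    exists (maxn M1 M2) => m; rewrite geq_max => /andP[m1 m2].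
    have A1 := H1 m m1.
    have [t0 t1] := tm01 m.
    have A2 := HCz (N m) (v m) (tm m) _ (ltW (em m)) t1 (fun jk q jq => (HN m jk q jq).1).
    have A3 := H2 m m2; rewrite -mulrA in A3.
    rewrite -/(tm m) in A1.
    move: A1 A2; rewrite -/(g m p); set X := Cintegral _ _ _ => A1 A2.
    have -> : (kappa R)%:C * (psum a (cpx p) - a 0%N) - g m p =
      ((kappa R)%:C * (psum a (cpx p) - a 0%N) - X) - (g m p - X) by rewrite opprB addrA subrK.
    apply: le_trans (normcB _ _) _; rewrite (splitr e); apply: lerD A1 _.
    exact: le_trans A2 A3.
  - move=> m; apply: (Hc (N m) (v m)).
      move=> I; apply: le_trans (HC _ S (eta * 2^-1 ^+ m) mf HS _ _ I _ _) _.
      + by move=> i; exact: sqr_ge0.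
      + move=> i p ip; have [A _] := HN m i p ip.
        have : normc (v m i) <= normc (psum (pderiv a) (cpx p)) + eta * 2^-1 ^+ m.
          rewrite -[v m i](subrK (if nsq p < tm m then psum (pderiv a) (cpx p) else 0)) addrC.
          apply: le_trans (normcD _ _) _; apply: lerD A.
          by case: ifP => // _; rewrite normc0 normc_ge0.
        have := normc_ge0 (v m i); have := em m; have := normc_ge0 (psum (pderiv a) (cpx p)).
        move: (normc (psum (pderiv a) (cpx p))) (normc (v m i)) (eta * 2^-1 ^+ m) => x y z x0 z0 y0 xyz.
        have : y ^+ 2 <= (x + z) ^+ 2 by rewrite ler_sqr ?nnegrE // addr_ge0 // ltW.
        by have := sqr_ge0 (x - z); nra.
      rewrite lerD2l; apply: ler_wpM2l => //.
      rewrite ler_sqr ?nnegrE ?(ltW (em m)) ?(ltW eta0) // ler_piMr ?(ltW eta0) //.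
      by rewrite exprn_ile1 // ltW.
    move=> i vi; have [t0 t1] := tm01 m.
    have [M _ HM] := packet_bounded b0 (ltW t0) t1 (fun p ip => (HN m i p ip).2 vi).
    by exists M.
have fin : (\int[mu]_(p in @disc R) (normc ((kappa R)%:C * (psum a (cpx p) - a 0%N)) ^+ 2)%:E <= (c * (2 * C * S))%:E)%E.
  apply/lee_addgt0Pr => e e0.
  have d0 : 0 < c * B + 1 by have := mulr_ge0 c0 B0; lra.
  have q0 : 0 < e / (c * B + 1) by rewrite divr_gt0.
  have s0 : 0 < Num.sqrt (e / (c * B + 1)) by rewrite sqrtr_gt0.
  apply: le_trans (main _ s0) _; rewrite sqr_sqrtr ?(ltW q0) // -EFinD lee_fin mulrDr lerD2l.
  by rewrite mulrA mulrCA ler_piMr ?(ltW e0) // ler_pdivrMr // mul1r lerDl.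
have mn : measurable_fun (@disc R) (fun p => (normc (psum a (cpx p) - a 0%N) ^+ 2)%:E).
  apply/measurable_EFinP; under eq_fun do rewrite expr2.
  by apply: measurable_funM; exact: measurable_normc.
have kE : (\int[mu]_(p in @disc R) (normc ((kappa R)%:C * (psum a (cpx p) - a 0%N)) ^+ 2)%:E =
    (kappa R ^+ 2)%:E * \int[mu]_(p in @disc R) (normc (psum a (cpx p) - a 0%N) ^+ 2)%:E)%E.
  rewrite -ge0_integralZl_EFin ?sqr_ge0 //; last by move=> p _; rewrite lee_fin sqr_ge0.
  by apply: eq_integral => p _; rewrite -EFinM normcM exprMn normcR (ger0_norm (ltW k0)).
have k2 : 0 < kappa R ^+ 2 by rewrite exprn_gt0.
rewrite kE in fin.
have -> : c * (2 * C) / kappa R ^+ 2 * S = (kappa R ^+ 2)^-1 * (c * (2 * C * S)) by ring.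
rewrite EFinM -lee_pdivrMl ?invr_gt0 // invrK //.
Qed.

Lemma embedding_of_capacity : bounded_embedding K mu.
Proof.
have [C C0 HC] := psum_L2_le; have mdisc := @measurable_disc R.
pose A := fine (mu (@disc R)).
have A0 : 0 <= A by exact: fine_ge0.
(* From |f|^2 <= 2 |f - f(0)|^2 + 2 |f(0)|^2, the constant part being integrated against the finite
   mass [A]. *)
exists (2 * C + 2 * A) => f [fhol]; rewrite /QK_norm.
have : (0 <= QK_seminorm K f)%E by exact: sqrte_ge0.
case E : (QK_seminorm K f) => [q||] //=; rewrite ?addey // lee_fin => q0 _.
have [a sa fa] := taylor fhol.
have HS w : normc w < 1 -> (\int[@dA R]_(p in @disc R)
    (normc (psum (pderiv a) (cpx p)) ^+ 2 * K (1 - normc (mobius w (cpx p)) ^+ 2))%:E <= (q ^+ 2)%:E)%E.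
  move=> w1; move: E; rewrite /QK_seminorm; set S := ereal_sup _ => E.
  have I0 : (0 <= S)%E.
    have h0 : @cdisc R 0 by rewrite /cdisc /mkset normc0 ltr01.
    apply: le_trans (ereal_sup_ubound (ex_intro2 _ _ (0 : R[i]) h0 erefl)).
    apply: integral_ge0 => p dp; rewrite lee_fin; apply: mulr_ge0; first exact: sqr_ge0.
    apply: (WQ_ge0 hK); rewrite mobius_onem ?normc0 ?ltr01 //; apply: divr_ge0; last exact: sqr_ge0.
    by apply: mulr_ge0; [rewrite expr0n subr0|apply/ltW; exact: onem_sqr_gt0].
  have -> : (q ^+ 2)%:E = S by rewrite -(sqr_sqrte I0) E.
  apply: ereal_sup_ubound; exists w => //.
  apply: eq_integral => p; rewrite inE => dp; congr ((normc _ ^+ 2 * _)%:E).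
  have p1 : normc (cpx p) < 1 := dp.
  have d1 : cdiff f (cpx p) (psum (pderiv a) (cpx p)).
    apply: (@cdiff_local _ (psum a) _ _ _ (1 - normc (cpx p))); first by rewrite subr_gt0.
      by move=> h hz; rewrite fa //; apply: le_lt_trans (normcD _ _) _; lra.
    exact: psum_cdiff.
  by rewrite (cdiff_derivable d1).2.
have main := HC a (q ^+ 2) sa HS.
have f0 : f 0 = a 0%N by rewrite fa ?normc0 // psum_at0.
have ma : measurable_fun (@disc R) (fun p => (2 * normc (psum a (cpx p) - a 0%N) ^+ 2)%:E).
  apply/measurable_EFinP; apply: measurable_funM => //; under eq_fun do rewrite expr2.
  by apply: measurable_funM; apply: measurable_normc; apply: cmeasB; try exact: cmeas_psum_disc; exact: cmeas_cst.
pose cc : R := 2 * normc (a 0%N) ^+ 2.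
have cc0 : 0 <= cc by apply: mulr_ge0 => //; exact: sqr_ge0.
apply: (@le_trans _ _ (\int[mu]_(p in @disc R) ((2 * normc (psum a (cpx p) - a 0%N) ^+ 2)%:E + cst cc%:E p))%E).
  apply: ge0_le_integral' => p dp; first by rewrite lee_fin sqr_ge0.
  rewrite -EFinD lee_fin (fa _ dp) /cc.
  have := normcD (psum a (cpx p) - a 0%N) (a 0%N); rewrite subrK.
  have := normc_ge0 (psum a (cpx p)); have := normc_ge0 (a 0%N); have := normc_ge0 (psum a (cpx p) - a 0%N).
  move: (normc (psum a (cpx p) - a 0%N)) (normc (a 0%N)) (normc (psum a (cpx p))) => x y z x0 y0 z0 h.
  have -> : 2 * x ^+ 2 + 2 * y ^+ 2 = (x + y) ^+ 2 + (x - y) ^+ 2 by ring.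
  by apply: ler_wpDr; rewrite ?sqr_ge0 // ler_sqr ?nnegrE // addr_ge0.
rewrite ge0_integralD //; last by move=> p _; rewrite lee_fin; apply: mulr_ge0 => //; exact: sqr_ge0.
rewrite integral_cst //; under eq_integral do rewrite EFinM.
rewrite ge0_integralZl_EFin //; first last.
- apply/measurable_EFinP; under eq_fun do rewrite expr2.
  by apply: measurable_funM; apply: measurable_normc; apply: cmeasB; try exact: cmeas_psum_disc; exact: cmeas_cst.
- by move=> p _; rewrite lee_fin sqr_ge0.
rewrite f0 -EFinD -[X in (_ + _ * X)%E](@fineK _ (mu (@disc R))) ?ge0_fin_numE // -/A.
apply: (@le_trans _ _ (2%:E * (C * q ^+ 2)%:E + cc%:E * A%:E)%E).
  by apply: leeD => //; apply: lee_wpmul2l.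
rewrite -!EFinM -EFinD lee_fin /cc.
have := normc_ge0 (a 0%N); move: (normc _) => y y0.
have h : 0 <= 2 * C * (y ^+ 2 + 2 * (y * q)) + 2 * A * (q ^+ 2 + 2 * (y * q)).
  by apply: addr_ge0; apply: mulr_ge0; rewrite ?mulr_ge0 //; apply: addr_ge0; rewrite ?sqr_ge0 // !mulr_ge0.
rewrite -subr_ge0; apply: le_trans h _; rewrite le_eqVlt; apply/orP; left; apply/eqP; ring.
Qed.

End BackwardDirection.

Theorem theorem5p4 (R : realType) (K : R -> R) (hK : class_WQ K) :
  exists b0 : R, forall b : R, b0 <= b ->
    forall mu : {measure set (plane R) -> \bar R},
      bounded_embedding K mu <->
      (mu (@disc R) < +oo)%E /\ (capacity K b mu < +oo)%E.
Proof.
have [sigma [C1 [sigma0 C11 KU]]] := WQ_upper hK.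
have [delta [C2 [delta0 delta1 C21 KL]]] := WQ_lower hK.
(* This threshold puts the exponents of both Forelli-Rudin integrals of the Schur test in their
   admissible ranges, and makes b nonnegative. *)
exists (sigma + 1) => b hb mu.
have b0 : 0 <= b by lra.
split=> [emb|[fin cap]]; last exact: (embedding_of_capacity hK C11 b0 KU fin cap).
have [C C0 packQK] := packets_in_QK hK sigma0 C11 KU delta0 delta1 C21 KL hb.
by split; [exact: (embedding_finite hK emb)|exact: (capacity_finite hK b0 C0 packQK emb)].
Qed.
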